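(* Let $m\in\frac52+\mathbb Z_{\geq0}$, let $\Gamma$ be a discrete subgroup of finite covolume in $\mathrm{SL}_2(\mathbb R)^\sim$ such that $\infty$ is a cusp of $P(\Gamma)$, and let $\chi:\Gamma\to\mathbb C^\times$ be a character of finite order such that $\eta_\gamma^{-2m}=\chi(\gamma)$ for all $\gamma\in\Gamma_\infty$. Let $h\in\mathbb R_{>0}$ be such that $Z(\mathrm{SL}_2(\mathbb R)^\sim)\Gamma_\infty=Z(\mathrm{SL}_2(\mathbb R)^\sim)\langle n_h\rangle$. Let $f\in S_m(\Gamma,\chi)$. Then the function $$\ell(\,\cdot\,,f):\left\{s\in\mathbb C:\Re(s)>\tfrac m2+1\right\}\cup\left\{s\in\mathbb C:\tfrac m2<\Re(s)<m-1\right\}\to\mathbb C,$$ $$\ell(s,f):=\frac{\varepsilon_\Gamma(4\pi)^{m-1}}{h^m\,\Gamma(m-1)}\left\langle f,\Psi_{\Gamma,m,\chi,m-\overline s}\right\rangle_{S_m(\Gamma,\chi)},$$ is well-defined and holomorphic. If $m>4$, then $\ell(\,\cdot\,,f)$ is an analytic continuation of $L(\,\cdot\,,f)$ to the half-plane $\{s\in\mathbb C:\Re(s)>\frac m2\}$.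
   Context: $\mathcal H=\{z\in\mathbb C:\Im(z)>0\}$, and $\mathrm{SL}_2(\mathbb R)$ acts on $\mathbb C\cup\{\infty\}$ by $g.z=\frac{az+b}{cz+d}$. The metaplectic cover $\mathrm{SL}_2(\mathbb R)^\sim$ is the group of pairs $\sigma=(g_\sigma,\eta_\sigma)$ with $g_\sigma=\begin{pmatrix}a_\sigma&b_\sigma\\c_\sigma&d_\sigma\end{pmatrix}\in\mathrm{SL}_2(\mathbb R)$ and $\eta_\sigma:\mathcal H\to\mathbb C$ holomorphic with $\eta_\sigma(z)^2=c_\sigma z+d_\sigma$; multiplication is $\sigma_1\sigma_2=(g_{\sigma_1}g_{\sigma_2},\eta_{\sigma_1}(g_{\sigma_2}.z)\eta_{\sigma_2}(z))$. It is a connected Lie group for which $P:\sigma\mapsto g_\sigma$ is a smooth covering homomorphism of degree 2 onto $\mathrm{SL}_2(\mathbb R)$; it acts through $P$, $\sigma.z:=g_\sigma.z$. $Z(\mathrm{SL}_2(\mathbb R)^\sim)=P^{-1}(\{\pm I_2\})$ is its center, $Z(\Gamma):=\Gamma\cap Z(\mathrm{SL}_2(\mathbb R)^\sim)$, $\varepsilon_\Gamma:=|Z(\Gamma)|$. For $x\in\mathbb R$, $n_x:=\left(\begin{pmatrix}1&x\\0&1\end{pmatrix},1\right)$. A cusp of $P(\Gamma)$ is a point of $\mathbb R\cup\{\infty\}$ fixed by a parabolic element of $P(\Gamma)$; $\Gamma_\infty:=\{\gamma\in\Gamma:\gamma.\infty=\infty\}$. The condition $\eta_\gamma^{-2m}=\chi(\gamma)$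 means that $\eta_\gamma^{-2m}$ is the constant function $\chi(\gamma)$. For $f:\mathcal H\to\mathbb C$, $(f|_m\sigma)(z):=f(g_\sigma.z)\eta_\sigma(z)^{-2m}$. $S_m(\Gamma,\chi)$ is the space of holomorphic $f:\mathcal H\to\mathbb C$ with $f|_m\gamma=\chi(\gamma)f$ for all $\gamma\in\Gamma$ that vanish at every cusp of $P(\Gamma)$: for every cusp $x$ and $\sigma\in\mathrm{SL}_2(\mathbb R)^\sim$ with $\sigma.\infty=x$, the function $f|_m\sigma$ has a Fourier expansion $\sum_{n\in\mathbb Z}a_ne^{2\pi inz/h'}$ (for some $h'>0$) with $a_n=0$ for all $n\leq0$. It is a finite-dimensional Hilbert space under $$\langle f_1,f_2\rangle_{S_m(\Gamma,\chi)}:=\varepsilon_\Gamma^{-1}\int_{\Gamma\backslash\mathcal H}f_1(z)\overline{f_2(z)}\Im(z)^m\,dv(z),\qquad dv(x+iy)=y^{-2}dx\,dy,$$ where the integral is over a fundamental domain for $\Gamma$ in $\mathcal H$. Every $f\in S_m(\Gamma,\chi)$ has a Fourier expansion $f(z)=\sum_{n=1}^\infty a_n(f)e^{2\pi inz/h}$, and its $L$-function is $L(s,f):=\sum_{n=1}^\infty a_n(f)n^{-s}$ for $\Re(s)>\frac m2+1$ (the series converges absolutely there). For $z\in\mathcal H$, $s\in\mathbb C$, let $F(z,s):=\sum_{n=1}^\infty n^{s-1}e^{2\pi inz/h}$. For $s\in\mathbb C$ with $\Re(s)<\frac m2-1$ or $1<\Re(s)<\frac m2$, $$\Psi_{\Gamma,m,\chi,s}:=\sum_{\gamma\in\Gamma_\infty\backslash\Gamma}\overline{\chi(\gamma)}\,F(\,\cdot\,,s)\big|_m\gamma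 .$$ $\Gamma(\cdot)$ applied to a number denotes the gamma function. *)

(* Defs.v *)
From HB Require Import structures.
From mathcomp Require Import all_boot all_order all_algebra.
From mathcomp Require Import finmap complex ring lra.
From mathcomp Require Import all_classical all_reals all_analysis.
From mathcomp.analysis.showcase Require Import summability.
Import Order.TTheory GRing.Theory Num.Theory.
Import numFieldNormedType.Exports.

Set Implicit Arguments.
Unset Strict Implicit.
Unset Printing Implicit Defensive.

Local Open Scope classical_set_scope.
Local Open Scope complex_scope.
Local Open Scope ring_scope.

(* [R[i]] seen through its numClosedFieldType structure, which is what carries
   the topology and the norm in MathComp-Analysis. *)
Definition Cx (R : realType) : numClosedFieldType := R[i].

Section Derivable.
Context {K : numFieldType}.

Lemma derivable_comp1 (f g : K -> K) (z : K) :
  derivable g z 1 -> derivable f (g z) 1 -> derivable (f \o g) z 1.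
Proof.
move=> /derivable1_diffP dg /derivable1_diffP df; apply/derivable1_diffP.
exact: differentiable_comp.
Qed.

Lemma derivable_near_eq (f g : K -> K) (z : K) :
  (\forall w \near z, f w = g w) -> derivable f z 1 -> derivable g z 1.
Proof.
move=> fg; have fgz := nbhs_singleton fg; rewrite /derivable => /cvg_ex[l dl].
apply/cvg_ex; exists l; apply: cvg_trans dl; apply: near_eq_cvg.
have : \forall h \near (0 : K), f (h + z) = g (h + z).
  by have /nbhs0P := fg; apply: filterS => e; rewrite addrC.
move=> /nbhs_dnbhs fgh; near=> h.
have := near fgh h; rewrite /= fgz /GRing.scale /= mulr1 => -> //.
Unshelve. all: by end_near. Qed.

Lemma derivable_mul (f g : K -> K) (z : K) :
  derivable f z 1 -> derivable g z 1 -> derivable (fun w => f w * g w) z 1.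
Proof. exact: derivableM. Qed.

Lemma derivable_inv (f : K -> K) (z : K) :
  f z != 0 -> derivable f z 1 -> derivable (fun w => (f w)^-1) z 1.
Proof. exact: derivableV. Qed.

Lemma derivable_affine (a b z : K) : derivable (fun w => a * w + b) z 1.
Proof.
have h : derivable (fun w => a * w) z 1.
  by apply: derivable_mul; [exact: derivable_cst|exact: derivable_id].
exact: derivableD h (derivable_cst b z 1).
Qed.

Lemma near_lt_dist (z e : K) : 0 < e -> \forall w \near z, `|z - w| < e.
Proof.
move=> e0.
exact: (@cvgr_dist_lt _ _ _ (nbhs z) _ id z (@cvg_id _ (nbhs z)) _ e0).
Qed.

End Derivable.

Section Complex.
Context {R : realType}.
Local Notation C := (Cx R).

Definition toC (x : R) : C := x%:C.

HB.instance Definition _ := GRing.RMorphism.copy toC (real_complex R).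

Definition cexp (z : C) : C :=
  toC (expR (complex.Re z)) * (cos (complex.Im z) +i* sin (complex.Im z)).

(* n ^ s for n >= 1 *)
Definition npow (n : nat) (s : C) : C := cexp (s * toC (ln n%:R)).

Definition cabs (z : C) : R := complex.Re `|z|.

Definition abs_summable (I : choiceType) (D : set I) (a : I -> C) : Prop :=
  esum.summable D (fun i => (cabs (a i))%:E).

(* Unordered sums: limits of finite partial sums along the directed set of
   finite subsets of [I]. *)
Definition has_csum (I : choiceType) (a : I -> C) (l : C) : Prop :=
  partial_sum a @ totally --> l.

Definition csum (I : choiceType) (D : set I) (a : I -> C) : C :=
  summability.sum (a \_ D).

Definition holomorphic_on (D : set C) (f : C -> C) : Prop :=
  forall s, D s -> derivable f s 1.

Definition analytic_continuation (U V : set C) (f g : C -> C) : Prop :=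
  [/\ U `<=` V, holomorphic_on V g & forall s, U s -> g s = f s].

Definition gamma_fun (x : R) : R :=
  \int[lebesgue_measure]_(t in `]0, +oo[) (t `^ (x - 1) * expR (- t)).

End Complex.

Section UpperHalfPlane.
Context {R : realType}.
Local Notation C := (Cx R).

Record uhp := UHP { uval :> C ; uval_gt0 : 0 < complex.Im uval }.

HB.instance Definition _ := [isSub for uval].
HB.instance Definition _ := [Choice of uhp by <:].

Definition uext (f : uhp -> C) (z : C) : C := oapp f 0 (insub z).

Definition holomorphic (f : uhp -> C) : Prop :=
  forall z : uhp, derivable (uext f) (uval z) 1.

Lemma uhp_inj (z w : uhp) : uval z = uval w -> z = w.
Proof. exact: val_inj. Qed.

Lemma uextE f (z : uhp) : uext f (uval z) = f z.
Proof. by rewrite /uext valK. Qed.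

Definition mob_num (g : 'M[R]_2) (z : C) : C := toC (g 0 0) * z + toC (g 0 1).
Definition mob_den (g : 'M[R]_2) (z : C) : C := toC (g 1 0) * z + toC (g 1 1).
Definition mob (g : 'M[R]_2) (z : C) : C := mob_num g z / mob_den g z.

Lemma det22 (g : 'M[R]_2) : \det g = g 0 0 * g 1 1 - g 0 1 * g 1 0.
Proof.
rewrite (expand_det_row _ 0) !big_ord_recl big_ord0 /cofactor !det_mx11 !mxE.
transitivity (g 0 0 * (1 * g 1 1) + (g 0 1 * (-1 * g 1 0) + 0)); last by ring.
by congr (_ * (_ * _) + (_ * (_ * _) + _)); rewrite ?expr0 ?expr1 //;
  congr (g _ _); exact/val_inj.
Qed.

Lemma mob_den_neq0 (g : 'M[R]_2) (z : C) :
  \det g = 1 -> 0 < complex.Im z -> mob_den g z != 0.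
Proof.
rewrite det22; case: z => x y /= dg y0; apply/negP => /eqP.
rewrite /mob_den; simpc => -[h1] /eqP.
rewrite mulf_eq0 (gt_eqF y0) orbF => /eqP h2.
have h3 : g 1 1 = 0 by rewrite -h1 h2 mul0r add0r.
by move: dg; rewrite h2 h3 !mulr0 subr0 => /eqP; rewrite eq_sym oner_eq0.
Qed.

Lemma mob_Im (g : 'M[R]_2) (z : C) : \det g = 1 -> 0 < complex.Im z ->
  0 < complex.Im (mob g z).
Proof.
move=> dg y0; have := mob_den_neq0 dg y0; move: dg y0.
rewrite det22 /mob /mob_num /mob_den; case: z => x y /= dg y0.
simpc => /= n0.
set D := (X in _ / X); have D0 : 0 < D.
  rewrite lt0r addr_ge0 ?sqr_ge0 // andbT; apply: contra n0.
  by rewrite paddr_eq0 ?sqr_ge0 // !sqrf_eq0 => /andP[/eqP -> /eqP ->].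
rewrite (_ : _ + _ = (g 0 0 * g 1 1 - g 0 1 * g 1 0) * y / D); last ring.
by rewrite dg mul1r divr_gt0.
Qed.

Lemma mulmx22 (g1 g2 : 'M[R]_2) i j :
  (g1 *m g2) i j = g1 i 0 * g2 0 j + g1 i 1 * g2 1 j.
Proof.
rewrite mxE !big_ord_recl big_ord0 addr0.
by rewrite (_ : lift ord0 ord0 = 1); last exact/val_inj.
Qed.

Lemma mob_denM (g1 g2 : 'M[R]_2) z : mob_den g2 z != 0 ->
  mob_den (g1 *m g2) z = mob_den g1 (mob g2 z) * mob_den g2 z.
Proof.
move=> d0; rewrite [RHS]mulrDl -mulrA /mob divfK //.
rewrite /mob_den /mob_num !mulmx22 !rmorphD !rmorphM /=; ring.
Qed.

Lemma mob_numM (g1 g2 : 'M[R]_2) z : mob_den g2 z != 0 ->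
  mob_num (g1 *m g2) z = mob_num g1 (mob g2 z) * mob_den g2 z.
Proof.
move=> d0; rewrite [RHS]mulrDl -mulrA /mob divfK //.
rewrite /mob_den /mob_num !mulmx22 !rmorphD !rmorphM /=; ring.
Qed.

Lemma mobM (g1 g2 : 'M[R]_2) z : mob_den g2 z != 0 ->
  mob (g1 *m g2) z = mob g1 (mob g2 z).
Proof.
move=> d0; rewrite {1}/mob mob_numM // mob_denM // invfM.
by rewrite mulrACA divff // mulr1.
Qed.

Lemma mob_den1 z : mob_den 1%:M z = 1.
Proof. by rewrite /mob_den !mxE /= mul0r add0r. Qed.

Lemma mob1 z : mob 1%:M z = z.
Proof. by rewrite /mob mob_den1 /mob_num !mxE /= mul1r addr0 divr1. Qed.

Lemma near_uhp (z : uhp) : \forall w \near (uval z), 0 < complex.Im w.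
Proof.
have z0 : 0 < (complex.Im (uval z))%:C by rewrite ltcR uval_gt0.
have zd := near_lt_dist (uval z) z0.
apply: (filterS _ zd) => w; rewrite /= normc_def ltcR => h.
have : complex.Im (uval z - w) < complex.Im (uval z).
  apply: le_lt_trans h; apply: le_trans (ler_norm _) _.
  by rewrite -sqrtr_sqr ler_wsqrtr // lerDr sqr_ge0.
by rewrite raddfB /= ltrBlDr ltrDl.
Qed.

Lemma holomorphic_near (f : uhp -> C) (g : C -> C) (z : uhp) :
  (forall w : uhp, f w = g (uval w)) -> derivable g (uval z) 1 ->
  derivable (uext f) (uval z) 1.
Proof.
move=> fg; apply: derivable_near_eq; apply: filterS (near_uhp z) => w w0.
by rewrite -[w]/(uval (UHP w0)) uextE fg.
Qed.

Lemma derivable_mob (g : 'M[R]_2) (z : uhp) :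
  \det g = 1 -> derivable (mob g) (uval z) 1.
Proof.
move=> dg; apply: derivable_mul; first exact: derivable_affine.
apply: derivable_inv; last exact: derivable_affine.
exact: mob_den_neq0 dg (uval_gt0 z).
Qed.

Definition mobu (g : 'M[R]_2) (dg : \det g = 1) (z : uhp) : uhp :=
  UHP (mob_Im dg (uval_gt0 z)).

Record metap := Metap {
  mat : 'M[R]_2 ;
  eta : uhp -> C ;
  mat_det : \det mat = 1 ;
  eta_holo : holomorphic eta ;
  eta_sqr : forall z : uhp, eta z ^+ 2 = mob_den mat (uval z) }.

Definition act (s : metap) (z : uhp) : uhp := mobu (mat_det s) z.

Lemma metap_ext (s t : metap) : mat s = mat t -> eta s =1 eta t -> s = t.
Proof.
case: s => g e dg he se; case: t => g' e' dg' he' se' /= eg /funext ee.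
subst g' e'; congr Metap; exact: Prop_irrelevance.
Qed.

Lemma mob_den_uneq0 (s : metap) (z : uhp) : mob_den (mat s) (uval z) != 0.
Proof. exact: mob_den_neq0 (mat_det s) (uval_gt0 z). Qed.

Lemma eta_neq0 (s : metap) (z : uhp) : eta s z != 0.
Proof. by rewrite -sqrf_eq0 eta_sqr mob_den_uneq0. Qed.

Lemma mul_det (s t : metap) : \det (mat s *m mat t) = 1.
Proof. by rewrite det_mulmx !mat_det mulr1. Qed.

Lemma holo_mobu (f : uhp -> C) (g : 'M[R]_2) (dg : \det g = 1) :
  holomorphic f -> holomorphic (f \o mobu dg).
Proof.
move=> hf z; apply: (@holomorphic_near _ (uext f \o mob g)).
  by move=> w; rewrite /= -(uextE f).
exact: (@derivable_comp1 _ (uext f) (mob g) (uval z)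
  (@derivable_mob g z dg) (hf (mobu dg z))).
Qed.

Lemma mul_holo (s t : metap) : holomorphic (fun z => eta s (act t z) * eta t z).
Proof.
move=> z.
apply: (@holomorphic_near _ 
    (fun w => uext (eta s \o act t) w * uext (eta t) w)).
  by move=> w; rewrite !uextE.
apply: derivable_mul; last exact: eta_holo.
exact: (@holo_mobu _ _ (mat_det t) (@eta_holo s) z).
Qed.

Lemma mul_sqr (s t : metap) (z : uhp) :
  (eta s (act t z) * eta t z) ^+ 2 = mob_den (mat s *m mat t) (uval z).
Proof. by rewrite exprMn !eta_sqr mob_denM ?mob_den_uneq0. Qed.

Definition metap_mul (s t : metap) : metap :=
  Metap (mul_det s t) (@mul_holo s t) (mul_sqr s t).

Lemma cst_holo (a : C) : holomorphic (fun=> a).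
Proof.
by move=> z; apply: (@holomorphic_near _ (cst a)) => //; exact: derivable_cst.
Qed.

Lemma one_sqr (z : uhp) : (1 : C) ^+ 2 = mob_den 1%:M (uval z).
Proof. by rewrite expr1n mob_den1. Qed.

Definition metap_one : metap :=
  Metap (det1 R 2) (@cst_holo 1) one_sqr.

Lemma inv_det (s : metap) : \det (invmx (mat s)) = 1.
Proof. by rewrite det_inv mat_det invr1. Qed.

Lemma mat_unit (s : metap) : mat s \in unitmx.
Proof. by rewrite unitmxE mat_det unitr1. Qed.

Lemma inv_holo (s : metap) :
  holomorphic (fun z => (eta s (mobu (inv_det s) z))^-1).
Proof.
move=> z.
apply: (@holomorphic_near _ (fun w => (uext (eta s \o mobu (inv_det s)) w)^-1)).
  by move=> w; rewrite uextE.
apply: derivable_inv; first by rewrite uextE eta_neq0.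
exact: (@holo_mobu _ _ (inv_det s) (@eta_holo s) z).
Qed.

Lemma inv_sqr (s : metap) (z : uhp) :
  (eta s (mobu (inv_det s) z))^-1 ^+ 2 = mob_den (invmx (mat s)) (uval z).
Proof.
have d0 := mob_den_neq0 (inv_det s) (uval_gt0 z).
have := mob_denM (mat s) d0; rewrite mulmxV ?mat_unit // mob_den1 => e1.
rewrite exprVn eta_sqr -[LHS]mulr1 [X in _ * X]e1 mulKf //.
exact: mob_den_uneq0.
Qed.

Definition metap_inv (s : metap) : metap :=
  Metap (inv_det s) (@inv_holo s) (inv_sqr s).

HB.instance Definition _ := gen_eqMixin metap.
HB.instance Definition _ := gen_choiceMixin metap.

Lemma actM (s t : metap) (z : uhp) : act (metap_mul s t) z = act s (act t z).
Proof. by apply: uhp_inj; rewrite /= mobM // mob_den_uneq0. Qed.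

Lemma metap_mulA : associative metap_mul.
Proof.
by move=> s t u; apply: metap_ext => [|z] /=; rewrite ?mulmxA // actM mulrA.
Qed.

Lemma metap_mul1 : left_id metap_one metap_mul.
Proof.
by move=> s; apply: metap_ext => [|z] /=; rewrite ?mul1mx ?mul1r.
Qed.

Lemma act1 (z : uhp) : act metap_one z = z.
Proof. by apply: uhp_inj; rewrite /= mob1. Qed.

Lemma metap_mulr1 : right_id metap_one metap_mul.
Proof.
by move=> s; apply: metap_ext => [|z] /=; rewrite ?mulmx1 // act1 mulr1.
Qed.

Lemma metap_mulV : left_inverse metap_one metap_inv metap_mul.
Proof.
move=> s; apply: metap_ext => [|z] /=; first by rewrite mulVmx ?mat_unit.
rewrite (_ : mobu _ _ = z) ?mulVf ?eta_neq0 //; apply: uhp_inj => /=.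
by rewrite -mobM ?mob_den_uneq0 // mulVmx ?mat_unit // mob1.
Qed.

Lemma metap_mulrV : right_inverse metap_one metap_inv metap_mul.
Proof.
move=> s; apply: metap_ext => [|z] /=; first by rewrite mulmxV ?mat_unit.
by rewrite (_ : mobu _ _ = act (metap_inv s) z) ?divff ?eta_neq0.
Qed.

HB.instance Definition _ := isGroup.Build metap
  metap_mulA metap_mul1 metap_mulr1 metap_mulV metap_mulrV.


Fact uhp_i_gt0 : 0 < complex.Im (0 +i* 1 : R[i]).
Proof. exact: ltr01. Qed.

Definition uhp_i : uhp := @UHP (0 +i* 1) uhp_i_gt0.

(* Since H is connected, eta is determined by g and eta(i), so this is a
   bijection onto {(g, w) | \det g = 1, w ^ 2 = c i + d}, a closed double cover
   of SL_2(R); it induces the Lie group topology of the metaplectic group. *)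
Definition metap_emb (s : metap) : 'M[R]_2 * C := (mat s, eta s uhp_i).

HB.instance Definition _ :=
  Topological.copy metap (initial_topology metap_emb).

End UpperHalfPlane.

Arguments uhp R : clear implicits.
Arguments metap R : clear implicits.

Section Groups.
Context {R : realType}.
Local Notation C := (Cx R).
Implicit Types (G : set (metap R)) (F : set (uhp R)).

Definition mx22 (a b c d : R) : 'M[R]_2 :=
  \matrix_(i, j) if i == 0 then if j == 0 then a else b
                 else if j == 0 then c else d.

Fact nx_det (x : R) : \det (mx22 1 x 0 1) = 1.
Proof. by rewrite det22 !mxE /= mulr0 subr0 mulr1. Qed.

Fact nx_sqr (x : R) (z : uhp R) : (1 : C) ^+ 2 = mob_den (mx22 1 x 0 1) (uval z).
Proof. by rewrite /mob_den !mxE /= expr1n /toC mul0r add0r. Qed.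

Definition nx (x : R) : metap R := Metap (nx_det x) (@cst_holo R 1) (nx_sqr x).

Definition metap_center : set (metap R) :=
  [set s | mat s = 1%:M \/ mat s = - 1%:M].

Definition is_subgroup G : Prop :=
  [/\ G 1%g, forall s t, G s -> G t -> G (s * t)%g & forall s, G s -> G (s^-1)%g].

Definition discrete_set G : Prop := G `<=` isolated G.

Definition setmul (A B : set (metap R)) : set (metap R) :=
  [set (s * t)%g | s in A & t in B].

Definition cyclic_gen (s : metap R) : set (metap R) :=
  [set t | exists n : nat, t = (s ^+ n)%g \/ t = (s ^- n)%g].

(* The real projective line; [None] is the point at infinity. *)
Definition bact (g : 'M[R]_2) (x : option R) : option R :=
  match x with
  | None => if g 1 0 == 0 then None else Some (g 0 0 / g 1 0)
  | Some x => if g 1 0 * x + g 1 1 == 0 then None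
              else Some ((g 0 0 * x + g 0 1) / (g 1 0 * x + g 1 1))
  end.

Definition parabolic (g : 'M[R]_2) : Prop :=
  [/\ `|\tr g| = 2, g <> 1%:M & g <> - 1%:M].

Definition is_cusp G (x : option R) : Prop :=
  exists s, [/\ G s, parabolic (mat s) & bact (mat s) x = x].

Definition stab_oo G : set (metap R) :=
  [set s | G s /\ bact (mat s) None = None].

Definition eps_card G : nat := #|` fset_set (G `&` metap_center)|%fset.

Definition is_character G (chi : metap R -> C) : Prop :=
  (forall s, G s -> chi s != 0) /\
  (forall s t, G s -> G t -> chi (s * t)%g = chi s * chi t).

Definition finite_order G (chi : metap R -> C) : Prop :=
  exists2 N : nat, (0 < N)%N & forall s, G s -> chi s ^+ N = 1.

Definition leb2 := ((@lebesgue_measure R) \x (@lebesgue_measure R))%E.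

Definition plane F : set (R * R) :=
  [set p | exists2 z, F z & uval z = p.1 +i* p.2].

Definition hyp_area F : \bar R :=
  (\int[leb2]_(p in plane F) (p.2 ^- 2)%:E)%E.

(* The integrands of \int_F phi dv, dv = y^-2 dx dy. *)
Definition hyp_re (phi : uhp R -> C) (p : R * R) : R :=
  complex.Re (uext phi (p.1 +i* p.2)) * p.2 ^- 2.
Definition hyp_im (phi : uhp R -> C) (p : R * R) : R :=
  complex.Im (uext phi (p.1 +i* p.2)) * p.2 ^- 2.

Definition hyp_integrable F (phi : uhp R -> C) : Prop :=
  leb2.-integrable (plane F) (EFin \o hyp_re phi) /\
  leb2.-integrable (plane F) (EFin \o hyp_im phi).

Definition hyp_integral F (phi : uhp R -> C) : C :=
  (\int[leb2]_(p in plane F) hyp_re phi p) +i*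
  (\int[leb2]_(p in plane F) hyp_im phi p).

(* Lebesgue-null and v-null sets are the same. *)
Definition fundamental_domain G F : Prop :=
  [/\ measurable (plane F),
      forall z, exists2 s, G s & F (act s z)
    & forall s, G s -> ~ metap_center s ->
        leb2.-negligible (plane (F `&` act s @` F))].

Definition finite_covolume G : Prop :=
  exists2 F, fundamental_domain G F & (hyp_area F < +oo)%E.

End Groups.

Section CuspForms.
Context {R : realType}.
Local Notation C := (Cx R).
Implicit Types (G : set (metap R)) (F : set (uhp R)) (chi : metap R -> C).
Implicit Types (m h : R) (f : uhp R -> C).

(* eta(z) ^ (- 2 m); the weights m are half-integral, so 2 m is an integer. *)
Definition eta_pow m (s : metap R) (z : uhp R) : C :=
  eta s z ^ (- Num.floor (2 * m)).

Definition slash m f (s : metap R) (z : uhp R) : C :=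
  f (act s z) * eta_pow m s z.

Definition efun h (n : int) (z : uhp R) : C :=
  cexp ((0 +i* (2 * pi * n%:~R / h)) * uval z).

Definition fourier_expansion h f (a : int -> C) : Prop :=
  forall z, has_csum (fun n => a n * efun h n z) (f z).

Definition cusp_form G chi m f : Prop :=
  [/\ holomorphic f,
      forall s, G s -> forall z, slash m f s z = chi s * f z
    & forall x s, is_cusp G x -> bact (mat s) None = x ->
        exists h' (a : int -> C),
          [/\ 0 < h', fourier_expansion h' (slash m f s) a
            & forall n, n <= 0 -> a n = 0]].

Definition petersson_fun m (f1 f2 : uhp R -> C) (z : uhp R) : C :=
  f1 z * (f2 z)^* * toC (complex.Im (uval z) `^ m).

Definition petersson G m F (f1 f2 : uhp R -> C) : C :=
  ((eps_card G)%:R)^-1 * hyp_integral F (petersson_fun m f1 f2).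

Definition fcoef h f : int -> C := xget (fun=> 0) (fourier_expansion h f).

Definition Lseries h f (s : C) : C :=
  csum [set n : nat | (0 < n)%N] (fun n => fcoef h f n%:Z * npow n (- s)).

Definition Fser h (s : C) (z : uhp R) : C :=
  csum [set n : nat | (0 < n)%N] (fun n => npow n (s - 1) * efun h n%:Z z).

Definition right_coset (A : set (metap R)) (s : metap R) : set (metap R) :=
  [set (t * s)%g | t in A].

Definition stab_cosets G : set (set (metap R)) :=
  [set right_coset (stab_oo G) s | s in G].

Definition Psi_term m chi h (s : C) (z : uhp R) (g : metap R) : C :=
  (chi g)^* * slash m (Fser h s) g z.

(* Each coset is represented by an arbitrarily chosen element. *)
Definition Psi G m chi h (s : C) (z : uhp R) : C :=
  csum (stab_cosets G) (fun c => Psi_term m chi h s z (xget 1%g c)).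

Definition ell_dom m : set C :=
  [set s | m / 2 + 1 < complex.Re s \/ m / 2 < complex.Re s < m - 1].

Definition ell_form G m chi h (s : C) : uhp R -> C :=
  Psi G m chi h (toC m - s^*).

Definition ell G m chi h F f (s : C) : C :=
  toC ((eps_card G)%:R * (4 * pi) `^ (m - 1) / (h `^ m * gamma_fun (m - 1))) *
  petersson G m F f (ell_form G m chi h s).

(* The series defining Psi has terms depending on cosets only, converges
   absolutely and is a cusp form; the integral defining the inner product
   converges and does not depend on the fundamental domain. *)
Definition ell_well_defined G m chi h f (s : C) : Prop :=
  [/\ forall z t g, stab_oo G t -> G g ->
        Psi_term m chi h (toC m - s^*) z (t * g)%g =
        Psi_term m chi h (toC m - s^*) z g,
      forall z, abs_summable (stab_cosets G) (fun c =>
        Psi_term m chi h (toC m - s^*) z (xget 1%g c)),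
      cusp_form G chi m (ell_form G m chi h s),
      forall F, fundamental_domain G F ->
        hyp_integrable F (petersson_fun m f (ell_form G m chi h s))
    & forall F F', fundamental_domain G F -> fundamental_domain G F' ->
        ell G m chi h F f s = ell G m chi h F' f s].

End CuspForms.

(* Main.v *)
From HB Require Import structures.
Require Import Defs.
From mathcomp Require Import all_boot all_order all_algebra.
From mathcomp Require Import finmap complex ring lra zify.
From mathcomp Require Import all_classical all_reals all_analysis.
From mathcomp Require Import measurable_realfun.
From mathcomp.analysis.showcase Require Import summability.
Import Order.TTheory GRing.Theory Num.Theory.
Import numFieldNormedType.Exports.

Set Implicit Arguments.
Unset Strict Implicit.
Unset Printing Implicit Defensive.

Local Open Scope classical_set_scope.
Local Open Scope ring_scope.

(* Unfolding turns <f, Psi> into the integral of f conj(F(., m - conj s)) y^m over the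
   strip 0 < x < h for the hyperbolic measure.  It is dominated by the integral of
   Phi = min(1, y)^(m/2) (1 + 1/|1 - q|)^tau, q = e^(2 pi i z/h), which converges for
   1 <= tau < m/2; a Harnack inequality for Phi together with a count of the elements
   of small displacement gives the convergence of the Poincare series and its decay at
   the cusps.  Differentiating under the integral in s gives holomorphy, and integrating
   the expansion of F term by term gives L(s, f). *)

(** Two obstacles shape the argument. [F] is unbounded near the real points h * k, where 1 - q
    vanishes and [F] can grow like a power of 1/|1 - q|; a majorant depending on Im z alone is too
    weak, so part of the singularity must be integrated in x and part in y. Secondly, the growth at
    the cusps is controlled without reduction theory: a fundamental domain is an arbitrary
    measurable set, used only through its finite area. The substitute is the displacement [nz z g]
    of a group element at a point. Commutators of elements of small displacement are displaced still
    less, so in a discrete group such elements are pairwise proportional. Points where no noncentral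
    element has small displacement are covered, modulo the group, by finitely many balls, because
    disjoint balls use up area; every other point is moved to one of these along an element of least
    displacement. Fourier expansions come from averages over 2^j equally spaced points, which turn
    uniqueness, orthogonality and inversion into finite identities. The bound m > 4 enters through
    the series of n^(m/2) (n + k)^(1 - m) over n, which must converge before the sum and the
    integral can be exchanged. *)

Local Notation Re := complex.Re.
Local Notation Im := complex.Im.
Local Notation RxR R := (measurableTypeR R * measurableTypeR R)%type.
Local Notation Zmp := metap_center.
Local Notation mcomp := measurableT_comp.
Local Notation cusp_width G h :=
  (setmul Zmp (stab_oo G) = setmul Zmp (cyclic_gen (nx h))).
Local Notation mfT := (measurable_fun setT).
Local Notation stab_char G chi m := (forall g, stab_oo G g -> forall z, eta_pow m g z = chi g).
Ltac ext := apply: funext.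
Implicit Type I : choiceType.

#[local] Hint Extern 0 (is_true (@Order.le _ _ _ (_ `^ _))) => exact: powR_ge0 : core.
#[local] Hint Extern 0 (is_true (@Order.le _ _ _ (expR _))) => exact: expR_ge0 : core.
#[local] Hint Extern 0 (is_true (@Order.lt _ _ _ (Im (uval _)))) => exact: uval_gt0 : core.

(** * Modulus, real and imaginary parts of complex numbers *)

Section Modulus.
Context {R : realType}.
Local Notation C := (Cx R).
Implicit Types (z w : C) (x y : R).

Lemma toC_cabs z : toC (cabs z) = `|z|.
Proof. by rewrite /cabs /toC normc_def. Qed.
Lemma cabsE z : cabs z = Num.sqrt (Re z ^+ 2 + Im z ^+ 2).
Proof. by rewrite /cabs normc_def. Qed.
Lemma toC_inj : injective (@toC R).
Proof. exact: complexI. Qed.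
Lemma toC_ltE x y : (toC x < toC y) = (x < y).
Proof. exact: ltcR. Qed.
Lemma toC_leE x y : (toC x <= toC y) = (x <= y).
Proof. exact: lecR. Qed.
Lemma cabs_ge0 z : 0 <= cabs z.
Proof. by rewrite cabsE sqrtr_ge0. Qed.
#[local] Hint Extern 0 (is_true (@Order.le _ _ _ (cabs _))) => exact: cabs_ge0 : core.

Lemma cabsM z w : cabs (z * w) = cabs z * cabs w.
Proof. by apply: toC_inj; rewrite rmorphM /= !toC_cabs normrM. Qed.
Lemma cabsD z w : cabs (z + w) <= cabs z + cabs w.
Proof. by rewrite -toC_leE rmorphD /= !toC_cabs ler_normD. Qed.
Lemma cabsN z : cabs (- z) = cabs z.
Proof. by apply: toC_inj; rewrite !toC_cabs normrN. Qed.
Lemma cabsB z w : cabs (z - w) <= cabs z + cabs w.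
Proof. by rewrite -(cabsN w) cabsD. Qed.
Lemma cabsBC z w : cabs (z - w) = cabs (w - z).
Proof. by rewrite -cabsN opprB. Qed.
Lemma cabs0 : cabs (0 : C) = 0.
Proof. by apply: toC_inj; rewrite toC_cabs normr0 rmorph0. Qed.
Lemma cabs1 : cabs (1 : C) = 1.
Proof. by apply: toC_inj; rewrite toC_cabs normr1 rmorph1. Qed.
Lemma cabs_eq0 z : (cabs z == 0) = (z == 0).
Proof. by rewrite -(inj_eq toC_inj) toC_cabs rmorph0 normr_eq0. Qed.
Lemma cabs_gt0 z : (0 < cabs z) = (z != 0).
Proof. by rewrite lt_neqAle cabs_ge0 andbT eq_sym cabs_eq0. Qed.
Lemma cabsV z : cabs z^-1 = (cabs z)^-1.
Proof. by apply: toC_inj; rewrite fmorphV /= !toC_cabs normfV. Qed.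
Lemma cabsf z w : cabs (z / w) = cabs z / cabs w.
Proof. by rewrite cabsM cabsV. Qed.
Lemma cabsX z n : cabs (z ^+ n) = cabs z ^+ n.
Proof. by apply: toC_inj; rewrite rmorphXn /= !toC_cabs normrX. Qed.
Lemma cabs_toC x : cabs (toC x) = `|x|.
Proof. by rewrite cabsE /= expr0n /= addr0 sqrtr_sqr. Qed.
Lemma cabs_sqr z : cabs z ^+ 2 = Re z ^+ 2 + Im z ^+ 2.
Proof. by rewrite cabsE sqr_sqrtr // addr_ge0 // sqr_ge0. Qed.
Lemma cabs_conj z : cabs z^* = cabs z.
Proof. by apply: toC_inj; rewrite !toC_cabs norm_conjC. Qed.
Lemma ReD z w : Re (z + w) = Re z + Re w.
Proof. exact: raddfD. Qed.
Lemma ImD z w : Im (z + w) = Im z + Im w.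
Proof. exact: raddfD. Qed.
Lemma ReN z : Re (- z) = - Re z.
Proof. exact: raddfN. Qed.
Lemma ImN z : Im (- z) = - Im z.
Proof. exact: raddfN. Qed.
Lemma ReM z w : Re (z * w) =
 Re z * Re w - Im z * Im w.
Proof. by case: z w => [a b] [c d]. Qed.
Lemma ImM z w : Im (z * w) =
 Re z * Im w + Im z * Re w.
Proof. by case: z w => [a b] [c d]. Qed.
Lemma Re_conj z : Re z^* = Re z.
Proof. by case: z. Qed.
Lemma Im_conj z : Im z^* = - Im z.
Proof. by case: z. Qed.
Lemma cx_eq z w : Re z = Re w -> Im z = Im w ->
 z = w.
Proof. by case: z w => [a b] [c d] /= -> ->. Qed.
Lemma Re_le_cabs z : `|Re z| <= cabs z.
Proof.
by rewrite -(@ler_pXn2r _ 2) ?nnegrE // cabs_sqr real_normK ?num_real //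
 lerDl sqr_ge0.
Qed.

Lemma Im_le_cabs z : `|Im z| <= cabs z.
Proof.
by rewrite -(@ler_pXn2r _ 2) ?nnegrE // cabs_sqr real_normK ?num_real //
 lerDr sqr_ge0.
Qed.

Lemma cabs_le_ReIm z : cabs z <= `|Re z| + `|Im z|.
Proof.
rewrite -(@ler_pXn2r _ 2) ?nnegrE ?addr_ge0 // cabs_sqr sqrrD.
by rewrite !real_normK ?num_real // lerD2r lerDl mulrn_wge0 // mulr_ge0.
Qed.

Lemma cabs_sum (I : Type) (r : seq I) (P : pred I) (F : I -> C) :
 cabs (\sum_(i <- r | P i) F i) <= \sum_(i <- r | P i) cabs (F i).
Proof.
elim/big_ind2 : _ => [|x1 x2 y1 y2 h1 h2|//]; first by rewrite cabs0.
exact: le_trans (cabsD _ _) (lerD h1 h2).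
Qed.

Lemma conjC_toC x : (toC x)^* = toC x.
Proof. by apply: cx_eq; rewrite ?Re_conj ?Im_conj /= ?oppr0. Qed.
End Modulus.

#[local] Hint Extern 0 (is_true (@Order.le _ _ _ (cabs _))) => exact: cabs_ge0 : core.

Lemma fsum_split I (V : zmodType) (A B : {fset I}) (u : I -> V) :
 (A `<=` B)%fset ->
 \sum_(i <- B) u i = \sum_(i <- A) u i + \sum_(i <- (B `\` A)%fset) u i.
Proof.
move=> AB; rewrite [LHS](big_fsetID _ (fun i => i \in A)) /=.
congr (_ + _); apply: eq_fbigl => i.
 by rewrite !inE /= andbC andb_idr // => /(fsubsetP AB).
by rewrite !inE /= andbC.
Qed.

Lemma fsum_mono I (R : numDomainType) (A B : {fset I}) (p : I -> R) :
 (forall i, 0 <= p i) -> (A `<=` B)%fset ->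
 \sum_(i <- A) p i <= \sum_(i <- B) p i.
Proof. by move=> p0 AB; rewrite (fsum_split _ AB) lerDl sumr_ge0. Qed.

(** * Unordered sums of real and complex families *)

Section UnorderedSums.
Context {R : realType}.
Local Notation C := (Cx R).

(** Unordered convergence with real tolerances, for real ([hcr]) and complex ([hcs]) families.
    [has_csumE] identifies [hcs] with [has_csum], whose tolerances are positive elements of the
    complex field. *)
Definition hcr I (p : I -> R) (l : R) : Prop :=
 forall e, 0 < e -> exists A : {fset I}, forall B : {fset I}, (A `<=` B)%fset ->
  `|l - \sum_(i <- B) p i| < e.

Definition hcs I (a : I -> C) (l : C) : Prop :=
 forall e, 0 < e -> exists A : {fset I}, forall B : {fset I}, (A `<=` B)%fset ->
  cabs (l - \sum_(i <- B) a i) < e.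

(** Meant for nonnegative families: a finite extended sum is then absolute convergence, and the
    comparison test is monotonicity of [esum]. *)
Definition summ I (p : I -> R) : Prop :=
 (\esum_(i in setT) (p i)%:E < +oo)%E.

Definition bsum I (p : I -> R) : R :=
 fine (\esum_(i in setT) (p i)%:E).

Section Real.
Variables (I : choiceType) (p : I -> R).
Hypothesis p0 : forall i, 0 <= p i.

Lemma fsum_le_esum (B : {fset I}) :
 ((\sum_(i <- B) p i)%:E <= \esum_(i in setT) (p i)%:E)%E.
Proof.
apply: esum_ge; exists [set` B]; first by split => //; exact: finite_fset.
by rewrite fsbig_finite ?finite_fset //= set_fsetK sumEFin.
Qed.

Lemma esum_le_ub (M : \bar R) :
 (forall B : {fset I}, ((\sum_(i <- B) p i)%:E <= M)%E) ->
 (\esum_(i in setT) (p i)%:E <= M)%E.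
Proof.
move=> h; apply: ge_ereal_sup => _ [A [fA _] <-].
by rewrite fsbig_finite //= sumEFin.
Qed.

Hypothesis ps : summ p.

Lemma bsumE : \esum_(i in setT) (p i)%:E = (bsum p)%:E.
Proof.
rewrite /bsum fineK // ge0_fin_numE //; apply: esum_ge0 => i _.
by rewrite lee_fin.
Qed.

Lemma fsum_le_bsum (B : {fset I}) : \sum_(i <- B) p i <= bsum p.
Proof. by rewrite -lee_fin -bsumE fsum_le_esum. Qed.
Lemma hcr_bsum : hcr p (bsum p).
Proof.
move=> e e0.
have [[A hA]|/forallNP h] := pselect (exists A : {fset I}, bsum p - e < \sum_(i <- A) p i).
 exists A => B AB; rewrite ger0_norm ?subr_ge0 ?fsum_le_bsum //.
 rewrite ltrBlDr -ltrBlDl; apply: lt_le_trans hA _.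
 exact: fsum_mono.
have : ((bsum p)%:E <= (bsum p - e)%:E)%E.
 by rewrite -bsumE; apply: esum_le_ub => B; rewrite lee_fin leNgt; apply/negP/h.
by rewrite lee_fin lerBrDr gerDl leNgt e0.
Qed.
End Real.

Lemma hcr_lin I (a b : I -> R) la lb (c : R) :
 hcr a la -> hcr b lb -> hcr (fun i => a i + c * b i) (la + c * lb).
Proof.
move=> ha hb e e0; have e2 : 0 < e / 2 by rewrite divr_gt0.
have c0 : 0 < `|c| + 1 by rewrite ltr_wpDl.
have [A hA] := ha _ e2; have [B hB] := hb _ (divr_gt0 e2 c0).
exists (A `|` B)%fset => D; rewrite fsubUset => /andP[/hA h1 /hB h2].
rewrite big_split /= -mulr_sumr.
rewrite (_ : _ - _ = (la - \sum_(i <- D) a i) + c * (lb - \sum_(i <- D) b i)); last ring.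
rewrite (splitr e) (le_lt_trans (ler_normD _ _)) // ltr_leD //.
rewrite normrM (le_trans (ler_wpM2l (normr_ge0 c) (ltW h2))) //.
by rewrite mulrCA ler_piMr ?(ltW e2) // ler_pdivrMr // mul1r lerDl.
Qed.

Lemma hcs_ReIm I (a : I -> C) l m :
 hcr (fun i => Re (a i)) l -> hcr (fun i => Im (a i)) m ->
 hcs a (l +i* m)%C.
Proof.
move=> hl hm e e0; have e2 : 0 < e / 2 by rewrite divr_gt0.
have [A hA] := hl _ e2; have [B hB] := hm _ e2.
exists (A `|` B)%fset => D; rewrite fsubUset => /andP[/hA h1 /hB h2].
apply: le_lt_trans (cabs_le_ReIm _) _; rewrite (splitr e) ltrD //.
 by rewrite ReD ReN /= raddf_sum.
by rewrite ImD ImN /= raddf_sum.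
Qed.

Lemma summ_le I (p q : I -> R) :
 (forall i, p i <= q i) -> summ q -> summ p.
Proof.
by move=> pq; apply: le_lt_trans; apply: le_esum => i _; rewrite lee_fin.
Qed.

Lemma bsum_ge0 I (p : I -> R) : (forall i, 0 <= p i) -> 0 <= bsum p.
Proof. by move=> p0; rewrite fine_ge0 // esum_ge0 // => i _; rewrite lee_fin. Qed.
Lemma summ_ub I (p : I -> R) M : (forall i, 0 <= p i) ->
 (forall B : {fset I}, \sum_(i <- B) p i <= M) -> summ p /\ bsum p <= M.
Proof.
move=> p0 h; have h1 : (\esum_(i in setT) (p i)%:E <= M%:E)%E.
 by apply: esum_le_ub => // B; rewrite lee_fin.
have ps : summ p by apply: le_lt_trans h1 (ltry _).
by split => //; rewrite -lee_fin -bsumE.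
Qed.

Lemma summZ I (p : I -> R) c : 0 <= c -> (forall i, 0 <= p i) ->
 summ p -> summ (fun i => c * p i).
Proof.
move=> c0 p0 ps; apply: (proj1 (@summ_ub _ _ (c * bsum p) _ _)) => [i|B].
 by rewrite mulr_ge0.
by rewrite -mulr_sumr ler_wpM2l // fsum_le_bsum.
Qed.

(** With u = (|p| + p) / 2, the family p = 2 u - |p| is a difference of two nonnegative families
    dominated by multiples of q, to which [hcr_bsum] applies. *)
Lemma hcr_abs I (p q : I -> R) : (forall i, `|p i| <= q i) ->
 summ q -> exists l, hcr p l.
Proof.
move=> pq sq; pose u i := (`|p i| + p i) / 2.
have u0 i : 0 <= u i by have := ler_norm (- p i); rewrite normrN /u; lra.
have uq i : u i <= q i.
 rewrite ler_pdivrMr // mulr_natr mulr2n lerD //.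
 by apply: le_trans (pq i); exact: ler_norm.
have su := summ_le uq sq.
have sp := summ_le pq sq.
exists (bsum u * 2 - bsum (fun i => `|p i|)).
have h : hcr (fun i : I => 0 : R) 0.
 by move=> e e0; exists fset0 => B _; rewrite big1 // subrr normr0.
have h1 := hcr_lin 2 h (hcr_bsum u0 su).
have := hcr_lin (-1) h1 (hcr_bsum (fun i => normr_ge0 _) sp).
rewrite add0r mulN1r mulrC; congr hcr; ext => i.
by rewrite /u; lra.
Qed.

Lemma hcsP I (a : I -> C) : summ (fun i => cabs (a i)) ->
 exists l, hcs a l.
Proof.
move=> sa.
have [l hl] := hcr_abs (fun i => Re_le_cabs (a i)) sa.
have [m hm] := hcr_abs (fun i => Im_le_cabs (a i)) sa.
by exists (l +i* m)%C; exact: hcs_ReIm.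
Qed.

Lemma has_csumE I (a : I -> C) l : has_csum a l <-> hcs a l.
Proof.
have E (B : {fset I}) : partial_sum a B = \sum_(i <- B) a i.
 by rewrite /partial_sum big_seq_fsetE.
split=> [/cvgrPdist_lt - /(_ totally_filter) h e e0|h].
 have e0' : 0 < toC e by rewrite -[0](rmorph0 (@toC R)) toC_ltE.
 have [A _ hA] := h _ e0'.
 exists A => B AB; have := hA B AB => /=.
 by rewrite E -toC_cabs toC_ltE.
apply/(@cvgrPdist_lt _ _ _ _ totally_filter) => e e0.
have [x x0 ->] : exists2 x : R, 0 < x & e = toC x.
 exists (Re e); first by move: e0; rewrite ltcE /= => /andP[].
 by move: e0; case: (e) => a0 b0; rewrite ltcE /= => /andP[/eqP -> _].
have [A hA] := h _ x0; exists A => // B AB /=.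
by rewrite E -toC_cabs toC_ltE; exact: hA.
Qed.

Lemma hcs_unique I (a : I -> C) l m : hcs a l -> hcs a m -> l = m.
Proof.
move=> hl hm; apply/eqP; rewrite -subr_eq0 -cabs_eq0 eq_le cabs_ge0 andbT.
apply/ler_addgt0Pr => e e0; rewrite add0r.
have e2 : 0 < e / 2 by rewrite divr_gt0.
have [A hA] := hl _ e2; have [B hB] := hm _ e2.
have h1 := hA _ (fsubsetUl A B); have h2 := hB _ (fsubsetUr A B).
rewrite (_ : l - m = (l - \sum_(i <- (A `|` B)%fset) a i) -
  (m - \sum_(i <- (A `|` B)%fset) a i)); last ring.
by rewrite (splitr e) (le_trans (cabsB _ _)) // ltW // ltrD.
Qed.

Lemma csumE I (D : set I) (a : I -> C) l :
 hcs (a \_ D) l -> csum D a = l.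
Proof.
move=> h; rewrite /csum /summability.sum; apply: cvg_lim; last exact/has_csumE.
 exact: norm_hausdorff.
exact: totally_filter.
Qed.

Lemma abs_summableE I (D : set I) (a : I -> C) :
 abs_summable D a <-> summ (fun i => cabs ((a \_ D) i)).
Proof.
rewrite /abs_summable /esum.summable /summ esum_mkcond.
rewrite (_ : (fun i => _) = (fun i => (cabs ((a \_ D) i))%:E)) //.
ext => i; rewrite /patch; case: ifP => _; last by rewrite cabs0.
by rewrite /= ger0_norm // cabs_ge0.
Qed.

Lemma hcs_csum I (D : set I) (a : I -> C) :
 abs_summable D a -> hcs (a \_ D) (csum D a).
Proof. by move=> /abs_summableE/hcsP[l hl]; rewrite (csumE hl). Qed.
Lemma cabs_hcs I (a : I -> C) (p : I -> R) l :
 (forall i, cabs (a i) <= p i) -> summ p -> hcs a l -> cabs l <= bsum p.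
Proof.
move=> ap sp h; apply/ler_addgt0Pr => e e0; have [A hA] := h _ e0.
have {}hA := hA _ (fsubset_refl A).
have p0 i : 0 <= p i by apply: le_trans (ap i); exact: cabs_ge0.
rewrite (_ : l = (l - \sum_(i <- A) a i) + \sum_(i <- A) a i); last ring.
rewrite (le_trans (cabsD _ _)) // addrC lerD ?(ltW hA) //.
rewrite (le_trans (cabs_sum _ _ _)) // (le_trans _ (fsum_le_bsum p0 sp A)) //.
exact: ler_sum.
Qed.

Lemma hcs_lin I (a b : I -> C) la lb (c : C) :
 hcs a la -> hcs b lb -> hcs (fun i => a i + c * b i) (la + c * lb).
Proof.
move=> ha hb e e0; have e2 : 0 < e / 2 by rewrite divr_gt0.
have c0 : 0 < cabs c + 1 by rewrite ltr_wpDl // cabs_ge0.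
have [A hA] := ha _ e2; have [B hB] := hb _ (divr_gt0 e2 c0).
exists (A `|` B)%fset => D; rewrite fsubUset => /andP[/hA h1 /hB h2].
rewrite big_split /= -mulr_sumr.
rewrite (_ : _ - _ = (la - \sum_(i <- D) a i) + c * (lb - \sum_(i <- D) b i)); last ring.
rewrite (splitr e) (le_lt_trans (cabsD _ _)) // ltr_leD //.
rewrite cabsM (le_trans (ler_wpM2l (cabs_ge0 c) (ltW h2))) //.
by rewrite mulrCA ler_piMr ?(ltW e2) // ler_pdivrMr // mul1r lerDl.
Qed.

Lemma hcs0 I : hcs (fun i : I => 0 : C) 0.
Proof. by move=> e e0; exists fset0 => B _; rewrite big1 // subrr cabs0. Qed.
Lemma hcsZ I (a : I -> C) l (c : C) :
 hcs a l -> hcs (fun i => c * a i) (c * l).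
Proof.
move=> h; have := hcs_lin c (@hcs0 I) h; rewrite add0r; congr hcs.
by ext => i; rewrite add0r.
Qed.

Lemma hcs_conj I (a : I -> C) l :
 hcs a l -> hcs (fun i => (a i)^*) l^*.
Proof.
move=> h e e0; have [A hA] := h _ e0; exists A => B /hA.
by rewrite -rmorph_sum -rmorphB /= cabs_conj.
Qed.

(** The error of a partial sum is controlled by the tail of the majorant alone; this is the form of
    dominated convergence that serves for termwise differentiation and integration. *)
Lemma hcs_tail I (a : I -> C) (p : I -> R) l (A : {fset I}) :
 (forall i, cabs (a i) <= p i) -> summ p -> hcs a l ->
 cabs (l - \sum_(i <- A) a i) <= bsum p - \sum_(i <- A) p i.
Proof.
move=> ap sp h; have p0 i : 0 <= p i by apply: le_trans (ap i); exact: cabs_ge0.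
apply/ler_addgt0Pr => e e0; have [B hB] := h _ e0.
have {}hB := hB _ (fsubsetUr A B).
set D := (A `|` B)%fset in hB; have AD : (A `<=` D)%fset by exact: fsubsetUl.
rewrite (_ : l - _ = (l - \sum_(i <- D) a i) + \sum_(i <- (D `\` A)%fset) a i); last first.
 by rewrite (fsum_split _ AD); ring.
rewrite (le_trans (cabsD _ _)) // addrC lerD ?(ltW hB) //.
rewrite (le_trans (cabs_sum _ _ _)) // (le_trans (ler_sum _ (fun i _ => ap i))) //.
by rewrite lerBrDl -(fsum_split _ AD) fsum_le_bsum.
Qed.

(* Unordered convergence forces absolute convergence: outside a finite set all
  finite sums are at most 2 in modulus, so those of each sign of the real and
  imaginary parts are bounded. *)
Lemma hcs_summable I (a : I -> C) l :
 hcs a l -> summ (fun i => cabs (a i)).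
Proof.
move=> h; have [A hA] := h 1 ltr01.
have bnd (B : {fset I}) : [disjoint A & B]%fset -> cabs (\sum_(i <- B) a i) <= 2.
 move=> AB; have h1 := hA _ (fsubset_refl A); have h2 := hA _ (fsubsetUl A B).
 have e : \sum_(i <- (A `|` B)%fset) a i = \sum_(i <- A) a i + \sum_(i <- B) a i.
  rewrite (fsum_split _ (fsubsetUl A B)); congr (_ + _); apply: eq_fbigl => i.
  rewrite !inE /=; case iA : (i \in A) => //=.
  by move/fdisjointP : AB => /(_ _ iA) /negbTE ->.
 rewrite e in h2.
 rewrite (_ : \sum_(i <- B) a i =  (l - \sum_(i <- A) a i) -
   (l - (\sum_(i <- A) a i + \sum_(i <- B) a i))); last ring.
 by rewrite (le_trans (cabsB _ _)) // (_ : 2 = 1 + 1) // ltW // ltrD.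
have abs (pr : C -> R) (prs : forall B : {fset I}, `|\sum_(i <- B) pr (a i)| <=
  cabs (\sum_(i <- B) a i)) (B : {fset I}) : [disjoint A & B]%fset ->
  \sum_(i <- B) `|pr (a i)| <= 4.
 move=> AB; rewrite (bigID (fun i => 0 <= pr (a i))) /= (_ : 4 = 2 + 2); last first.
  by rewrite -natrD.
 have half (P : pred I) : `|\sum_(i <- B | P i) pr (a i)| <= 2.
  rewrite big_fset_condE; apply: le_trans (prs _) _; apply: bnd.
  apply/fdisjointP => i iA; rewrite !inE /= negb_and.
  by move/fdisjointP : AB => /(_ _ iA) ->.
 apply: lerD.
  apply: le_trans (half (fun i => 0 <= pr (a i))).
  rewrite (le_trans _ (ler_norm _)) // ler_sum // => i i0.
  by rewrite ger0_norm.
 apply: le_trans (half (fun i => ~~ (0 <= pr (a i)))).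
 rewrite -normrN (le_trans _ (ler_norm _)) // -sumrN ler_sum // => i.
 by rewrite -ltNge => i0; rewrite ltr0_norm.
apply: (proj1 (@summ_ub _ _ (\sum_(i <- A) cabs (a i) + (4 + 4)) _ _)).
 by move=> i; exact: cabs_ge0.
move=> B; rewrite (big_fsetID _ (fun i => i \in A)) /= lerD //.
 apply: fsum_mono => [i|]; first exact: cabs_ge0.
 by apply/fsubsetP => i; rewrite !inE /= => /andP[].
set D := [fset _ | _ in _ & _]%fset.
have AD : [disjoint A & D]%fset.
 by apply/fdisjointP => i iA; rewrite !inE /= iA /= andbF.
rewrite (le_trans (ler_sum _ (fun i _ => cabs_le_ReIm (a i)))) // big_split /=.
apply: lerD; apply: abs => // D'.
 by rewrite -raddf_sum; exact: Re_le_cabs.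
by rewrite -raddf_sum; exact: Im_le_cabs.
Qed.

Lemma summ_inj (I J : choiceType) (g : J -> I) (p : I -> R) :
 injective g -> (forall i, 0 <= p i) -> summ p -> summ (p \o g).
Proof.
move=> gi p0 ps; apply: (proj1 (@summ_ub _ _ (bsum p) _ _)) => [j|B]; first exact: p0.
rewrite (_ : \sum_(i <- B) _ = \sum_(i <- [fset g j | j in B]%fset) p i).
 exact: fsum_le_bsum.
by rewrite big_imfset //= => x y _ _ /gi.
Qed.

Lemma hcs_reindex (I J : choiceType) (g : J -> I) (g' : I -> J) (a : I -> C) l :
 cancel g g' -> cancel g' g -> hcs a l -> hcs (a \o g) l.
Proof.
move=> gK g'K h e e0; have [A hA] := h _ e0.
exists [fset g' i | i in A]%fset => B AB.
have -> : \sum_(i <- B) (a \o g) i = \sum_(i <- [fset g j | j in B]%fset) a i.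
 by rewrite big_imfset //= => x y _ _ /(can_inj gK).
apply: hA; apply/fsubsetP => i iA; apply/imfsetP; exists (g' i) => //=.
by apply: (fsubsetP AB); exact: in_imfset.
Qed.
End UnorderedSums.

(** * Derivatives of complex functions of a real or complex variable, mean value inequalities,
    termwise differentiation *)

Section Derivatives.
Context {R : realType}.
Local Notation C := (Cx R).

(* Derivative of [f] at [x], for a complex ([e] the identity) or a real
  ([e = toC]) variable. *)
Definition gder (T : zmodType) (e : T -> C) (f : T -> C) (x : T) (l : C) : Prop :=
 forall eps, 0 < eps -> exists2 d : R, 0 < d & forall h : T, cabs (e h) < d ->
  cabs (f (x + h) - f x - l * e h) <= eps * cabs (e h).

Definition cder := @gder C id.
Definition rder := @gder R (@toC R).

Section Rules.
Variables (T : zmodType) (e : T -> C).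
Implicit Types (f g : T -> C) (x : T) (l k : C).

Lemma gder_cst (c : C) x : gder e (fun=> c) x 0.
Proof.
move=> eps e0; exists 1 => // h _; rewrite subrr mul0r subrr cabs0.
by rewrite mulr_ge0 // ltW.
Qed.

Lemma gder_emb x : {morph e : a b / a + b} -> gder e e x 1.
Proof.
move=> eM eps e0; exists 1 => // h _; rewrite eM mul1r addrAC addrK subrr cabs0.
by rewrite mulr_ge0 // ltW.
Qed.

Lemma gder_bound f x l : gder e f x l -> exists2 d : R, 0 < d & forall h,
 cabs (e h) < d -> cabs (f (x + h) - f x) <= (cabs l + 1) * cabs (e h).
Proof.
move=> /(_ _ ltr01)[d d0 hd]; exists d => // h /hd hh.
rewrite (_ : f _ - f _ = (f (x + h) - f x - l * e h) + l * e h); last ring.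
rewrite (le_trans (cabsD _ _)) // cabsM mulrDl addrC lerD2l.
by rewrite mul1r; rewrite mul1r in hh.
Qed.

Lemma gder_cont f x l eps : gder e f x l -> 0 < eps -> exists2 d : R, 0 < d & forall h,
 cabs (e h) < d -> cabs (f (x + h) - f x) < eps.
Proof.
move=> /gder_bound[d d0 hd] e0; have l0 : 0 < cabs l + 1 by rewrite ltr_wpDl.
exists (Num.min d (eps / (cabs l + 1))); first by rewrite lt_min d0 divr_gt0.
move=> h; rewrite lt_min => /andP[/hd h1]; rewrite ltr_pdivlMr // mulrC.
exact: le_lt_trans.
Qed.

Lemma gderD f g x l k : gder e f x l -> gder e g x k ->
 gder e (fun y => f y + g y) x (l + k).
Proof.
move=> hf hg eps e0; have e2 : 0 < eps / 2 by rewrite divr_gt0.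
have [d d0 hd] := hf _ e2; have [d' d0' hd'] := hg _ e2.
exists (Num.min d d'); first by rewrite lt_min d0.
move=> h; rewrite lt_min => /andP[/hd h1 /hd' h2].
rewrite (_ : _ - _ = (f (x + h) - f x - l * e h) + (g (x + h) - g x - k * e h)); last ring.
by rewrite (le_trans (cabsD _ _)) // (splitr eps) mulrDl lerD.
Qed.

Lemma gderM f g x l k : gder e f x l -> gder e g x k ->
 gder e (fun y => f y * g y) x (l * g x + f x * k).
Proof.
move=> hf hg eps e0.
pose K := cabs (g x) + cabs (f x) + (cabs l + 1).
have [l0 f0 g0] : [/\ 0 <= cabs l, 0 <= cabs (f x) & 0 <= cabs (g x)].
 by split; exact: cabs_ge0.
have K0 : 0 < K by rewrite /K; lra.
have [q eK qE] : exists2 q, 0 < q & eps = q * K.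
 by exists (eps / K); rewrite ?divr_gt0 // divfK // gt_eqF.
have [d d0 hd] := hf _ eK.
have [d' d0' hd'] := hg _ eK.
have [d1 d10 hd1] := gder_cont hg eK.
have [d2 d20 hd2] := gder_bound hf.
exists (Num.min (Num.min d d2) (Num.min d' d1)); first by rewrite !lt_min d0 d0' d20.
move=> h; rewrite !lt_min => /andP[/andP[/hd h1 /hd2 h4] /andP[/hd' h2 /hd1 h3]].
rewrite (_ : _ - _ = (f (x + h) - f x - l * e h) * g x +
  f x * (g (x + h) - g x - k * e h) + (f (x + h) - f x) * (g (x + h) - g x)); last ring.
have E0 := cabs_ge0 (e h).
apply: le_trans (cabsD _ _) _; rewrite qE.
rewrite (_ : q * K * _ = (q * cabs (e h) * cabs (g x) + cabs (f x) * (q * cabs (e h)))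
  + ((cabs l + 1) * cabs (e h)) * q); last by rewrite /K; ring.
apply: lerD.
 apply: le_trans (cabsD _ _) _; apply: lerD; rewrite cabsM.
  by rewrite ler_wpM2r.
 by rewrite ler_wpM2l.
by rewrite cabsM; apply: ler_pM => //; rewrite // ltW.
Qed.

Lemma gderZ f x l (c : C) : gder e f x l -> gder e (fun y => c * f y) x (c * l).
Proof. by move=> h; have := gderM (gder_cst c x) h; rewrite mul0r add0r. Qed.
Lemma gderN f x l : gder e f x l -> gder e (fun y => - f y) x (- l).
Proof.
move=> h; rewrite -mulN1r (_ : (fun y => _) = fun y => -1 * f y); first exact: gderZ.
by ext => y; rewrite mulN1r.
Qed.

Lemma gderB f g x l k : gder e f x l -> gder e g x k ->
 gder e (fun y => f y - g y) x (l - k).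
Proof. by move=> hf hg; exact: gderD hf (gderN hg). Qed.
Lemma gder_comp (f : C -> C) g x l k : cder f (g x) l -> gder e g x k ->
 gder e (fun y => f (g y)) x (l * k).
Proof.
move=> hf hg eps e0.
have [l0 k0] : 0 <= cabs l /\ 0 <= cabs k by split; exact: cabs_ge0.
have K0 : 0 < cabs k + 1 by lra.
have L0 : 0 < cabs l + 1 by lra.
have e2 : 0 < eps / 2 by rewrite divr_gt0.
have [d d0 hd] := hf _ (divr_gt0 e2 K0).
have [d1 d10 hd1] := hg _ (divr_gt0 e2 L0).
have [d2 d20 hd2] := gder_bound hg.
have [d3 d30 hd3] := gder_cont hg d0.
exists (Num.min d1 (Num.min d2 d3)); first by rewrite !lt_min d10 d20.
move=> h; rewrite !lt_min => /andP[/hd1 h1 /andP[/hd2 h2 /hd3 /hd]] /=.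
rewrite (_ : g x + (g (x + h) - g x) = g (x + h)); last ring.
move=> h3.
rewrite (_ : _ - _ = (f (g (x + h)) - f (g x) - l * (g (x + h) - g x)) +
 l * (g (x + h) - g x - k * e h)); last ring.
have E0 := cabs_ge0 (e h).
apply: le_trans (cabsD _ _) _; rewrite (splitr eps) mulrDl; apply: lerD.
 apply: le_trans h3 _; rewrite -mulrA ler_wpM2l ?(ltW e2) // mulrC ler_pdivrMr //.
 by rewrite (mulrC (cabs (e h))).
rewrite cabsM; apply: le_trans (ler_wpM2l l0 h1) _.
rewrite mulrA ler_wpM2r // mulrCA ler_piMr ?(ltW e2) // ler_pdivrMr // mul1r; lra.
Qed.

Lemma gder_near f g x l (d : R) : 0 < d -> (forall h, cabs (e h) < d -> f (x + h) = g (x + h)) ->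
 f x = g x -> gder e f x l -> gder e g x l.
Proof.
move=> d0 fg fgx hf eps e0; have [d1 d10 hd1] := hf _ e0.
exists (Num.min d d1); first by rewrite lt_min d0.
by move=> h; rewrite lt_min => /andP[/fg <- /hd1]; rewrite fgx.
Qed.

Lemma gder_ext f g x l : f =1 g -> gder e f x l -> gder e g x l.
Proof. by move=> /funext ->. Qed.
Lemma gder_sum (I : Type) (r : seq I) (F : I -> T -> C) (L : I -> C) x :
 (forall i, gder e (F i) x (L i)) ->
 gder e (fun y => \sum_(i <- r) F i y) x (\sum_(i <- r) L i).
Proof.
move=> h; elim: r => [|i r IH].
 rewrite big_nil; apply: gder_ext (gder_cst 0 x) => y; by rewrite big_nil.
rewrite big_cons; apply: gder_ext (gderD (h i) IH) => y; by rewrite big_cons.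
Qed.
End Rules.

Lemma cder_id (z : C) : cder id z 1.
Proof. exact: gder_emb. Qed.
Lemma rder_toC (x : R) : rder (@toC R) x 1.
Proof. by apply: gder_emb => a b; rewrite rmorphD. Qed.
Lemma cder_inv (z : C) : z != 0 -> cder (fun w => w^-1) z (- (z ^+ 2)^-1).
Proof.
move=> z0 eps e0; have a0 : 0 < cabs z by rewrite cabs_gt0.
exists (Num.min (cabs z / 2) (eps * cabs z ^+ 3 / 2)).
 by rewrite lt_min !divr_gt0 // mulr_gt0 // exprn_gt0.
move=> h /=; rewrite lt_min => /andP[h1 h2].
have h3 : cabs z / 2 <= cabs (z + h).
 have := cabsB (z + h) h; rewrite addrK => h4; lra.
have zh0 : z + h != 0 by rewrite -cabs_gt0; apply: lt_le_trans h3; rewrite divr_gt0.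
rewrite (_ : _ - _ = h * h / (z ^+ 2 * (z + h))); last by field; rewrite ?z0 ?zh0.
rewrite !cabsM cabsV cabsM cabsX mulrAC ler_wpM2r // ler_pdivrMr; last first.
 by rewrite mulr_gt0 ?exprn_gt0 ?cabs_gt0.
apply: le_trans (ltW h2) _; rewrite exprSr -!mulrA ler_pM2l // ler_pM2l //.
by rewrite ler_pM2l.
Qed.

Lemma cderX n (z : C) : cder (fun w => w ^+ n) z (n%:R * z ^+ n.-1).
Proof.
elim: n => [|n IH].
 rewrite mul0r; exact: gder_cst.
have h := gderM (cder_id z) IH.
rewrite (_ : _ * _ = 1 * z ^+ n + id z * (n%:R * z ^+ n.-1)); last first.
 case: n {IH h} => [|n]; first by rewrite /= mul0r mulr0 addr0.
 by rewrite /= -natr1 (exprS z n); ring.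
by apply: gder_ext h => w; rewrite exprS.
Qed.

Lemma cder_derivable (f : C -> C) z l : cder f z l -> derivable f z 1.
Proof.
move=> hf; apply/cvg_ex; exists l; apply/cvgrPdist_le => eps e0.
have [x x0 ->] : exists2 x : R, 0 < x & eps = toC x.
 exists (Re eps); first by move: e0; rewrite ltcE /= => /andP[].
 by move: e0; case: (eps) => a0 b0; rewrite ltcE /= => /andP[/eqP -> _].
have [d d0 hd] := hf _ x0; near=> h.
have h0 : h != 0 by near: h; exact: nbhs_dnbhs_neq.
have hb : cabs h < d.
 rewrite -toC_ltE toC_cabs -normrN -[- h]add0r; near: h; apply: nbhs_dnbhs.
 by apply: near_lt_dist; rewrite -[0](rmorph0 (@toC R)) toC_ltE.
rewrite -toC_cabs toC_leE /GRing.scale /= mulr1.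
have := hd h hb; rewrite /= addrC.
rewrite (_ : l - _ = - ((f (h + z) - f z - l * h) / h)); last by field.
rewrite cabsN cabsf ler_pdivrMr ?cabs_gt0 //.
by rewrite (addrC z h) addrC.
Unshelve. all: by end_near. Qed.

Lemma derivable_cder (f : C -> C) z : derivable f z 1 -> exists l, cder f z l.
Proof.
move=> /cvg_ex[l hl]; exists l => eps e0.
have e0' : 0 < toC eps by rewrite -[0](rmorph0 (@toC R)) toC_ltE.
move/cvgrPdist_le : hl => /(_ _ e0') /nbhs_ballP[/= x x0 hx].
have [d d0 dx] : exists2 d : R, 0 < d & x = toC d.
 exists (Re x); first by move: x0; rewrite ltcE /= => /andP[].
 by move: x0; case: (x) => a0 b0; rewrite ltcE /= => /andP[/eqP -> _].
exists d => // h hd; have [->|h0] := eqVneq h 0.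
 by rewrite addr0 subrr mulr0 subrr cabs0 mulr0.
have := hx h; rewrite /ball /= sub0r normrN -toC_cabs dx toC_ltE => /(_ hd h0).
rewrite /GRing.scale /= mulr1 -toC_cabs toC_leE addrC => h1.
rewrite -ler_pdivrMr ?cabs_gt0 // -cabsf -cabsN (addrC z h).
by rewrite (_ : - _ = l - h^-1 * (f (h + z) - f z)) 1?addrC //; field.
Qed.

Lemma rder_Re (f : R -> C) x l : rder f x l ->
 is_derive x 1 (fun y => Re (f y)) (Re l).
Proof.
move=> hf; have hl : (h^-1 *: (Re (f (h *: 1 + x)) - Re (f x)))
  @[h --> (0 : R)^'] --> Re l.
 apply/cvgrPdist_le => eps e0; have [d d0 hd] := hf _ e0; near=> h.
 have h0 : h != 0 by near: h; exact: nbhs_dnbhs_neq.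
 have hb : cabs (toC h) < d.
  rewrite cabs_toC -normrN -[- h]add0r; near: h; apply: nbhs_dnbhs.
  exact: near_lt_dist.
 have := hd h hb; rewrite cabs_toC => h1.
 have := le_trans (Re_le_cabs _) h1.
 rewrite !(ReD, ReN) ReM /= mulr0 subr0 /GRing.scale /= mulr1 (addrC h).
 set u := Re (f _) => h2.
 rewrite (_ : _ - _ = - ((u - Re (f x) - Re l * h) / h)); last by field.
 by rewrite normrN normrM normfV ler_pdivrMr ?normr_gt0.
by apply: DeriveDef; [exact: cvgP hl|exact: cvg_lim hl].
Unshelve. all: by end_near. Qed.

(** With u the conjugate of f b - f a, the real function Re (u f) increases by |u|^2 over the
    interval; the real mean value theorem bounds this increase by |u| M (b - a), and one factor |u|
    cancels. *)
Lemma mean_value_ineq (f f' : R -> C) (a b M : R) : a <= b ->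
 (forall x, a <= x <= b -> rder f x (f' x)) ->
 (forall x, a <= x <= b -> cabs (f' x) <= M) -> cabs (f b - f a) <= M * (b - a).
Proof.
move=> ab df fM; pose u := (f b - f a)^*.
have [u0|u0] := eqVneq u 0.
 have -> : cabs (f b - f a) = 0 by rewrite -cabs_conj -/u u0 cabs0.
 rewrite mulr_ge0 ?subr_ge0 // (le_trans _ (fM a _)) ?lexx //.
have dg x : a <= x <= b -> is_derive x 1 (fun y => Re (u * f y)) (Re (u * f' x)).
 by move=> /df h; exact: rder_Re (gderZ u h).
have [c cab] : exists2 c, c \in `[a, b] &
  Re (u * f b) - Re (u * f a) = Re (u * f' c) * (b - a).
 apply: (@MVT_segment _ (fun y => Re (u * f y)) (fun x => Re (u * f' x))) => //.
  by move=> x; rewrite in_itv /= => /andP[xa xb]; apply: dg; rewrite !ltW.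
 apply: derivable_within_continuous => x; rewrite in_itv /= => /dg h.
 exact: @ex_derive.
rewrite -ReN -ReD -mulrN -mulrDr => h.
have h1 : cabs u ^+ 2 <= cabs u * M * (b - a).
 have -> : cabs u ^+ 2 = Re (u * (f b - f a)).
  by rewrite cabs_sqr ReM /u Re_conj Im_conj; ring.
 rewrite h ler_wpM2r ?subr_ge0 // (le_trans (ler_norm _)) // (le_trans (Re_le_cabs _)) //.
 by rewrite cabsM ler_wpM2l // fM // -in_itv.
rewrite -(cabs_conj (f b - f a)) -/u -(@ler_pM2l _ (cabs u)) ?cabs_gt0 //.
by rewrite -expr2 mulrA.
Qed.

Lemma rder_line (f : C -> C) z w t l : cder f (z + toC t * w) l ->
 rder (fun t => f (z + toC t * w)) t (l * w).
Proof.
move=> h; apply: gder_comp => //.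
rewrite -[w in gder _ _ _ w]mul1r.
have := gderD (gder_cst (@toC R) z t) (gderM (rder_toC t) (gder_cst (@toC R) w t)).
by rewrite mulr0 add0r addr0.
Qed.

Lemma cmean_value_ineq (f f' : C -> C) (z w : C) (M : R) :
 (forall t, 0 <= t <= 1 -> cder f (z + toC t * w) (f' (z + toC t * w))) ->
 (forall t, 0 <= t <= 1 -> cabs (f' (z + toC t * w)) <= M) ->
 cabs (f (z + w) - f z) <= M * cabs w.
Proof.
move=> df fM.
have := @mean_value_ineq (fun t => f (z + toC t * w)) (fun t => f' (z + toC t * w) * w) 0 1
 (M * cabs w) ler01 (fun t ht => rder_line (df t ht)).
rewrite rmorph1 rmorph0 mul1r mul0r addr0 subr0 mulr1; apply => t ht.
by rewrite cabsM ler_wpM2r // fM.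
Qed.

(* Splitting off a finite subsum, the mean value inequality controls the
  difference quotients of the tail by the tail of the majorant. *)
Lemma hcs_gder I (u u' : I -> C -> C) (S : C -> C) (S' z0 : C) (M : I -> R) (r : R) :
 0 < r ->
 (forall i z, cabs (z - z0) < r -> cder (u i) z (u' i z)) ->
 (forall i z, cabs (z - z0) < r -> cabs (u' i z) <= M i) ->
 summ M ->
 (forall z, cabs (z - z0) < r -> hcs (fun i => u i z) (S z)) ->
 hcs (fun i => u' i z0) S' -> cder S z0 S'.
Proof.
move=> r0 du uM sM hS hS' eps e0.
have z00 : cabs (z0 - z0) < r by rewrite subrr cabs0.
have M0 i : 0 <= M i by apply: le_trans (uM i z0 z00); exact: cabs_ge0.
have [A hA] := hcr_bsum M0 sM (divr_gt0 e0 (ltr0n R 4)).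
have {}hA := hA _ (fsubset_refl A); rewrite ger0_norm in hA; last first.
 by rewrite subr_ge0 fsum_le_bsum.
have dA := gder_sum A (fun i => du i z0 z00).
have [d d0 hd] := dA _ (divr_gt0 e0 (ltr0n R 2)).
exists (Num.min r d); first by rewrite lt_min r0.
move=> h /=; rewrite lt_min => /andP[hr /hd h1].
have zh : cabs (z0 + h - z0) < r by rewrite addrAC subrr add0r.
pose q i := u i (z0 + h) - u i z0 - u' i z0 * h.
have qs : hcs q (S (z0 + h) - S z0 - S' * h).
 have := hcs_lin (- h) (hcs_lin (-1) (hS _ zh) (hS _ z00)) hS'.
 rewrite !mulNr mul1r mulrC; congr hcs; ext => i; rewrite /q; ring.
have qM i : cabs (q i) <= 2 * cabs h * M i.
 rewrite (le_trans (cabsB _ _)) // (_ : 2 * _ * _ = M i * cabs h + M i * cabs h); last ring.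
 apply: lerD; last by rewrite cabsM ler_wpM2r // uM.
 apply: (@cmean_value_ineq (u i) (u' i)) => t /andP[t0 t1];
  have ht : cabs (z0 + toC t * h - z0) < r by
   (rewrite addrAC subrr add0r; rewrite cabsM cabs_toC ger0_norm //;
   apply: le_lt_trans hr; rewrite ler_piMl ?cabs_ge0).
  exact: du.
 exact: uM.
have h20 : 0 <= 2 * cabs h by rewrite mulr_ge0.
have := hcs_tail A qM (summZ h20 M0 sM) qs.
have := proj2 (@summ_ub _ _ (fun i => 2 * cabs h * M i) (2 * cabs h * bsum M) _ _).
move=> /(_ (fun i => mulr_ge0 h20 (M0 i))) h3 h4.
have {}h3 : bsum (fun i => 2 * cabs h * M i) <= 2 * cabs h * bsum M.
 by apply: h3 => B; rewrite -mulr_sumr ler_wpM2l // fsum_le_bsum.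
rewrite (_ : S _ - _ - _ = (S (z0 + h) - S z0 - S' * h - \sum_(i <- A) q i) +
  \sum_(i <- A) q i); last ring.
apply: le_trans (cabsD _ _) _; rewrite (splitr eps) mulrDl; apply: lerD.
 apply: le_trans h4 _; rewrite -mulr_sumr; apply: le_trans (lerB h3 (lexx _)) _.
 rewrite -mulrBr (_ : eps / 2 * cabs h = 2 * cabs h * (eps / 4)); last by field.
 by rewrite ler_wpM2l // ltW.
by rewrite /q !big_split /= !sumrN -mulr_suml.
Qed.
End Derivatives.

(** * The complex exponential, the functions x^w (ln x)^p, power series and summation by parts *)

Section Exponential.
Context {R : realType}.
Local Notation C := (Cx R).

Lemma is_derive_rder (g : R -> R) (x l : R) :
 is_derive x 1 g l -> rder (fun y => toC (g y)) x (toC l).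
Proof.
move=> dg eps e0.
have hl : (h^-1 *: (g (h *: 1 + x) - g x)) @[h --> (0 : R)^'] --> l.
 have := @ex_derive _ _ _ _ _ _ _ dg; have /= := @derive_val _ _ _ _ _ _ _ dg.
 by rewrite /derive => <- /cvg_ex[k hk]; rewrite (cvg_lim _ hk).
move/cvgrPdist_le : hl => /(_ _ e0) /nbhs_ballP[/= d d0 hd].
exists d => // h; rewrite cabs_toC => hb; have [->|h0] := eqVneq h 0.
 by rewrite addr0 subrr rmorph0 mulr0 subrr cabs0 normr0 mulr0.
have := hd h; rewrite /ball /= sub0r normrN => /(_ hb h0).
rewrite /GRing.scale /= mulr1 => h1.
rewrite -!rmorphB -rmorphM -rmorphB cabs_toC -ler_pdivrMr ?normr_gt0 //.
rewrite -normfV -normrM -normrN; rewrite (addrC h) in h1.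
by rewrite (_ : - _ = l - h^-1 * (g (x + h) - g x)) //; field.
Qed.

Lemma cexp0 : cexp (0 : C) = 1.
Proof. by rewrite /cexp /= expR0 cos0 sin0 mul1r. Qed.
Lemma cexpD (z w : C) : cexp (z + w) = cexp z * cexp w.
Proof.
rewrite /cexp ReD ImD expRD cosD sinD rmorphM /=.
apply: cx_eq; rewrite !(ReM, ImM) /=; ring.
Qed.

Lemma cabs_cexp (z : C) : cabs (cexp z) = expR (Re z).
Proof.
rewrite /cexp cabsM cabs_toC ger0_norm //.
by rewrite cabsE /= cos2Dsin2 sqrtr1 mulr1.
Qed.

Lemma cexp_neq0 (z : C) : cexp z != 0.
Proof. by rewrite -cabs_gt0 cabs_cexp expR_gt0. Qed.
Lemma cexpN (z : C) : cexp (- z) = (cexp z)^-1.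
Proof.
by apply: (mulfI (cexp_neq0 z)); rewrite -cexpD subrr cexp0 divff ?cexp_neq0.
Qed.

Lemma cexpMn (z : C) n : cexp (z *+ n) = cexp z ^+ n.
Proof. by elim: n => [|n IH]; rewrite ?cexp0 // mulrS cexpD IH exprS. Qed.
Lemma cexp_toC (x : R) : cexp (toC x) = toC (expR x).
Proof. by rewrite /cexp /= cos0 sin0 mulr1. Qed.
Lemma conj_cexp (z : C) : (cexp z)^* = cexp z^*.
Proof.
apply: cx_eq; rewrite !(Re_conj, Im_conj) /cexp !(ReM, ImM) /= !(Re_conj, Im_conj).
 by rewrite cosN; ring.
by rewrite sinN; ring.
Qed.

Lemma cder_cexp0 : cder (@cexp R) 0 1.
Proof.
(* Each of exp, cos and sin is approximated to first order within eps / 10. With |exp a| <= 3 and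
   |exp a - 1| <= 2 |h|, the real part of the error costs 4 eps / 10 and the imaginary part 5 eps /
   10, both times |h|. *)
move=> eps e0; have e1 : 0 < Num.min 1 (eps / 10) by rewrite lt_min ltr01 divr_gt0.
have [d1 d10 h1] := is_derive_rder (is_derive_expR 0) e1.
have [d2 d20 h2] := is_derive_rder (is_derive_cos 0) e1.
have [d3 d30 h3] := is_derive_rder (is_derive_sin 0) e1.
exists (Num.min (Num.min 1 (eps / 10)) (Num.min d1 (Num.min d2 d3))).
 by rewrite !lt_min ltr01 d10 d20 d30 divr_gt0.
case=> a b; rewrite /= !lt_min => /andP[/andP[k1 k8] /andP[k2 /andP[k3 k4]]].
set h := (a +i* b)%C in k1 k2 k3 k4 k8 *.
have ha : `|a| <= cabs h by exact: (Re_le_cabs h).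
have hb : `|b| <= cabs h by exact: (Im_le_cabs h).
have := h1 a; rewrite !add0r expR0 !cabs_toC => /(_ (le_lt_trans ha k2)).
have := h2 b; rewrite !add0r cos0 sin0 oppr0 !cabs_toC => /(_ (le_lt_trans hb k3)).
have := h3 b; rewrite !add0r cos0 sin0 !cabs_toC => /(_ (le_lt_trans hb k4)).
rewrite -!rmorphB -!rmorphM -!rmorphB !cabs_toC mul0r !subr0 !mul1r.
set m := Num.min 1 (eps / 10).
have m1 : m <= 1 by rewrite ge_min lexx.
have m8 : m <= eps / 10 by rewrite ge_min lexx orbT.
move=> s1 c1 x1.
rewrite cexp0 ?mul1r; apply: le_trans (cabs_le_ReIm _) _.
have H0 := cabs_ge0 h.
have P0 : 0 <= eps * cabs h by rewrite mulr_ge0 // ltW.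
have A0 := normr_ge0 a; have B0 := normr_ge0 b.
have sm : `|sin b - b| <= eps / 10 * cabs h.
 by apply: le_trans s1 _; apply: ler_pM => //; exact: ltW.
have cm : `|cos b - 1| <= eps / 10 * cabs h.
 by apply: le_trans c1 _; apply: ler_pM => //; exact: ltW.
have xm : `|expR a - 1 - a| <= eps / 10 * cabs h.
 by apply: le_trans x1 _; apply: ler_pM => //; exact: ltW.
have x2 : `|expR a - 1| <= 2 * cabs h.
 rewrite (_ : expR a - 1 = (expR a - 1 - a) + a); last ring.
 apply: le_trans (ler_normD _ _) _; have : m * `|a| <= cabs h by apply: le_trans ha; rewrite ler_piMl.
 lra.
have x3 : `|expR a| <= 3.
 have := ler_normD (expR a - 1) 1; rewrite subrK normr1; lra.
have m3 (u v w : R) : `|u| <= 3 -> `|v| <= w -> `|u * v| <= 3 * w.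
 by move=> hu hv; rewrite normrM; apply: ler_pM.
rewrite (splitr eps) mulrDl; apply: lerD.
 rewrite !(ReD, ReN) /cexp ReM /= mul0r subr0.
 rewrite (_ : _ - _ = (expR a - 1 - a) + expR a * (cos b - 1)); last ring.
 have := m3 _ _ _ x3 cm; have := ler_normD (expR a - 1 - a) (expR a * (cos b - 1)); lra.
rewrite !(ImD, ImN) /cexp ImM /= mul0r addr0 oppr0 addr0.
rewrite (_ : _ - _ = expR a * (sin b - b) + (expR a - 1) * b); last ring.
have : `|(expR a - 1) * b| <= 2 * (eps / 10) * cabs h.
 rewrite normrM -mulrA [X in _ <= _ * X]mulrC mulrA; apply: ler_pM => //.
 by apply: le_trans hb _; exact: ltW.
have := m3 _ _ _ x3 sm.
have := ler_normD (expR a * (sin b - b)) ((expR a - 1) * b); lra.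
Qed.

Lemma cder_cexp (z : C) : cder (@cexp R) z (cexp z).
Proof.
have h : cder (fun w => w - z) z 1.
 by have := gderB (cder_id z) (gder_cst id z z); rewrite subr0.
have h1 : cder (@cexp R) (z - z) 1 by rewrite subrr; exact: cder_cexp0.
have := gderZ (cexp z) (@gder_comp _ _ _ _ (fun w => w - z) _ _ _ h1 h); rewrite !mulr1; apply: gder_ext => w.
by rewrite -cexpD addrC subrK.
Qed.

Lemma cder_cexpZ (c z : C) : cder (fun w => cexp (c * w)) z (c * cexp (c * z)).
Proof.
have := gder_comp (cder_cexp (c * z)) (gderZ c (cder_id z)).
by rewrite mulr1 mulrC.
Qed.

Lemma cexp_ln (x : R) : 0 < x -> toC x = cexp (toC (ln x)).
Proof. by move=> x0; rewrite cexp_toC lnK. Qed.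
Lemma cabs_cexp_ln (w : C) (x : R) : 0 < x ->
 cabs (cexp (w * toC (ln x))) = x `^ Re w.
Proof.
by move=> x0; rewrite cabs_cexp ReM /= mulr0 subr0 /powR gt_eqF.
Qed.

(* [symb w p j] is the [j]-th derivative of [x ^ w * (ln x) ^ p]; [symc w p j i]
  is its coefficient as a function of [ln x], differentiated [i] times. *)
Fixpoint symc (w : C) (p j i : nat) (L : C) : C :=
 if j is k.+1 then (w - k%:R) * symc w p k i L + symc w p k i.+1 L
 else (p ^_ i)%:R * L ^+ (p - i).

Definition symb (w : C) (p j : nat) (x : R) : C :=
 symc w p j 0 (toC (ln x)) * cexp ((w - j%:R) * toC (ln x)).

Lemma cder_symc w p j i (L : C) : cder (symc w p j i) L (symc w p j i.+1 L).
Proof.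
elim: j i => [|j IH] i /=; last exact: gderD (gderZ _ (IH i)) (IH i.+1).
have := gderZ (p ^_ i)%:R (cderX (p - i) L).
by rewrite mulrA -natrM -ffactnSr -subnS.
Qed.

Lemma rder_symb w p j x : 0 < x -> rder (symb w p j) x (symb w p j.+1 x).
Proof.
move=> x0; have dl := is_derive_rder (is_derive1_ln x0).
have cl f l := @gder_comp _ _ (@toC R) f (fun y => toC (ln y)) x l (toC x^-1).
have := gderM (cl _ _ (cder_symc w p j 0 (toC (ln x))) dl)
 (cl _ _ (cder_cexpZ (w - j%:R) (toC (ln x))) dl).
congr gder; rewrite /symb /=.
have -> : w - j.+1%:R = w - j%:R + (-1) by rewrite -natr1; ring.
have E : cexp ((w - j%:R + -1) * toC (ln x)) =
  cexp ((w - j%:R) * toC (ln x)) * toC x^-1.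
 rewrite mulrDl cexpD mulN1r cexpN -cexp_ln //; congr (_ * _).
 by rewrite fmorphV.
rewrite E; ring.
Qed.

(** The bound is uniform in i, so each step of the recursion multiplies it by at most |w - k| + 1 <=
    B + k + 1. The factorial p! dominates all the falling factorials that come from differentiating
    L^p. *)
Lemma symc_le (w : C) p (B : R) j i (L : C) : cabs w <= B ->
 cabs (symc w p j i L) <= p`!%:R * (\prod_(k < j) (B + k%:R + 1)) * (1 + cabs L) ^+ p.
Proof.
move=> wB; have B0 : 0 <= B := le_trans (cabs_ge0 _) wB.
have L0 := cabs_ge0 L.
elim: j i => [|j IH] i /=.
 rewrite big_ord0 mulr1 cabsM (_ : (p ^_ i)%:R = toC (p ^_ i)%:R :> C); last by rewrite rmorph_nat.
 rewrite cabs_toC ger0_norm // cabsX; have [ip|ip] := leqP i p; last first.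
  by rewrite ffact_small // mul0r mulr_ge0 // exprn_ge0 // addr_ge0.
 apply: ler_pM; rewrite ?exprn_ge0 // ?ler_nat.
  by rewrite -(ffact_fact ip) leq_pmulr // fact_gt0.
 apply: (@le_trans _ _ ((1 + cabs L) ^+ (p - i))).
  by rewrite lerXn2r ?nnegrE ?addr_ge0 // lerDr.
 by rewrite ler_weXn2l ?leq_subr // lerDl.
rewrite big_ord_recr /=; set P := \prod_(_ < _) _; set X := (1 + _) ^+ p.
apply: le_trans (cabsD _ _) _; rewrite cabsM.
have X0 : 0 <= p`!%:R * P * X.
 rewrite mulr_ge0 ?exprn_ge0 ?addr_ge0 // mulr_ge0 // prodr_ge0 // => k _.
 by rewrite !addr_ge0.
rewrite (_ : _ * (P * _) * X = (B + j%:R) * (p`!%:R * P * X) + p`!%:R * P * X); last ring.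
apply: lerD => //; apply: ler_pM; rewrite //.
apply: le_trans (cabsB _ _) _; apply: lerD => //.
by rewrite (_ : j%:R = toC j%:R :> C) ?cabs_toC ?ger0_norm // rmorph_nat.
Qed.

(** Used to absorb every power of ln x, hence every derivative in s, into an arbitrarily small power
    of x. *)
Lemma ln_powR_le (d x : R) : 0 < d -> 1 <= x -> 1 + ln x <= (1 + d^-1) * x `^ d.
Proof.
move=> d0 x1; have x0 : 0 < x by apply: lt_le_trans x1.
have h1 : 1 <= x `^ d.
 have := @ge0_ler_powR _ d (ltW d0) 1 x; rewrite powR1 !nnegrE; apply => //.
 exact: ltW.
rewrite mulrDl mul1r lerD // mulrC ler_pdivlMr // mulrC -ln_powR.
by rewrite ltW // ln_sublinear // powR_gt0.
Qed.



Lemma fsum_iota (V : zmodType) (p : nat -> V) N :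
 \sum_(i <- [fset i | i in iota 0 N]%fset) p i = \sum_(i < N) p i.
Proof.
rewrite -(big_mkord xpredT p) /index_iota subn0; apply: perm_big.
by apply: uniq_perm; rewrite ?fset_uniq ?iota_uniq // => i; rewrite in_fset.
Qed.

Lemma summ_nat (p : nat -> R) M : (forall n, 0 <= p n) ->
 (forall N, \sum_(n < N) p n <= M) -> summ p /\ bsum p <= M.
Proof.
move=> p0 h; apply: summ_ub => // B.
pose N := (\max_(i <- B) i).+1.
have BN : (B `<=` [fset i | i in iota 0 N])%fset.
 apply/fsubsetP => i iB; rewrite in_fset mem_iota add0n ltnS /=.
 exact: (@leq_bigmax_seq _ _ xpredT id i iB isT).
apply: le_trans (fsum_mono p0 BN) _.
by rewrite fsum_iota.
Qed.

Lemma summ_geo (r : R) : 0 <= r < 1 -> summ (fun n : nat => r ^+ n).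
Proof.
move=> /andP[r0 r1]; apply: (proj1 (@summ_nat _ (1 - r)^-1 _ _)) => [n|N].
 exact: exprn_ge0.
have r1' : 0 < 1 - r by rewrite subr_gt0.
rewrite -[leRHS]mul1r ler_pdivlMr // mulrC.
by have := subrX1 r N => /(congr1 -%R); rewrite opprB -mulNr opprB => <-; rewrite gerBl exprn_ge0.
Qed.

Lemma natX_le_expR (u : R) k (n : nat) : 0 < u ->
 n%:R ^+ k <= (k%:R / u) ^+ k * expR (u * n%:R).
Proof.
move=> u0; case: k => [|k].
 by rewrite !expr0 mul1r -expR0 ler_expR mulr_ge0 // ltW.
have k0 : 0 < k.+1%:R :> R by rewrite ltr0n.
have -> : expR (u * n%:R) = expR (u * n%:R / k.+1%:R) ^+ k.+1.
 by rewrite -expRM_natr divfK // gt_eqF.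
have h : n%:R <= k.+1%:R / u * expR (u * n%:R / k.+1%:R).
 rewrite -ler_pdivrMl ?divr_gt0 // invf_div mulrAC.
 by apply: le_trans (expR_ge1Dx _); rewrite lerDr.
by rewrite -exprMn lerXn2r ?nnegrE // (le_trans _ h).
Qed.

Lemma summ_natX_geo k (r : R) : 0 <= r < 1 ->
 summ (fun n : nat => n.+1%:R ^+ k * r ^+ n).
Proof.
move=> /andP[r0 r1]; have [->|rn0] := eqVneq r 0.
 apply: (proj1 (@summ_nat _ 1 _ _)) => [n|N]; first by rewrite mulr_ge0 ?exprn_ge0.
 case: N => [|N]; first by rewrite big_ord0.
 rewrite big_ord_recl /= expr0 mulr1 expr1n big1 ?addr0 // => i _.
 by rewrite expr0n mulr0.
have r00 : 0 < r by rewrite lt_neqAle eq_sym rn0.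
(* So r = exp (-u)^2: one factor exp (-u n) absorbs the power of n by [natX_le_expR], the other
   leaves a geometric series. *)
pose u := - ln r / 2.
have u0 : 0 < u by rewrite divr_gt0 // oppr_gt0 ln_lt0 // r00.
have rE : r = expR (- u) * expR (- u).
 by rewrite -expRD /u -opprD -splitr opprK lnK.
pose s := expR (- u); have s01 : 0 <= s < 1 by rewrite expR_ge0 expR_lt1 oppr_lt0.
apply: (@summ_le _ _ _ (fun n => ((k%:R / u) ^+ k * expR u) * s ^+ n)).
 move=> n; rewrite rE exprMn mulrA ler_wpM2r ?exprn_ge0 //.
 apply: le_trans (ler_wpM2r _ (natX_le_expR k n.+1 u0)) _; first by rewrite exprn_ge0.
 have ku : 0 <= k%:R / u by rewrite mulr_ge0 // invr_ge0 ltW.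
 rewrite -mulrA ler_wpM2l ?exprn_ge0 //.
 by rewrite -expRM_natl -expRD -natr1 mulrDr mulr1 mulrN mulrC addrAC subrr add0r.
have ku : 0 <= k%:R / u by rewrite mulr_ge0 // invr_ge0 ltW.
apply: summZ; rewrite ?mulr_ge0 ?exprn_ge0 //.
 by move=> n; rewrite exprn_ge0 ?expR_ge0.
exact: summ_geo.
Qed.

Lemma hcs_shift (a : nat -> C) l : hcs a l -> hcs (fun n => a n.+1) (l - a 0%N).
Proof.
move=> h e e0; have [A hA] := h _ e0.
exists [fset n.-1 | n in A]%fset => B AB.
have := hA (0%N |` [fset n.+1 | n in B])%fset.
rewrite big_fsetU1 /=; last by apply/negP => /imfsetP[].
rewrite big_imfset /=; last by move=> x y _ _ [].
rewrite opprD addrA; apply; apply/fsubsetP => -[|n] nA; rewrite !inE //=.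
by rewrite in_imfset //=; apply: (fsubsetP AB); apply/imfsetP; exists n.+1.
Qed.

Lemma hcs_unshift (a : nat -> C) l : hcs (fun n => a n.+1) l -> hcs a (l + a 0%N).
Proof.
move=> h; have [l' hl'] : exists l, hcs a l.
 apply: hcsP; have := hcs_summable h => hs.
 have h0 n : 0 <= cabs (a n.+1) by exact: cabs_ge0.
 apply: (proj1 (@summ_nat _ (cabs (a 0%N) + bsum (fun n => cabs (a n.+1))) _ _)).
  by move=> n; exact: cabs_ge0.
 case=> [|N]; first by rewrite big_ord0 addr_ge0 ?bsum_ge0.
 rewrite big_ord_recl /= lerD2l -(@fsum_iota _ (fun n => cabs (a n.+1))).
 exact: fsum_le_bsum.
by have := hcs_shift hl' => h2; rewrite (hcs_unique h h2) subrK.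
Qed.

Lemma hcs_drop (a : nat -> C) l N : hcs a l ->
 hcs (fun n => a (N + n)%N) (l - \sum_(n < N) a n).
Proof.
elim: N => [|N IH] h; first by rewrite big_ord0 subr0.
have := hcs_shift (IH h); rewrite addn0 big_ord_recr /= opprD addrA.
by congr hcs; ext => n; rewrite addnS.
Qed.

Definition poly_growth (a : nat -> C) : Prop :=
 exists K k, forall n, cabs (a n) <= K * n.+1%:R ^+ k.

Definition sdiff (a : nat -> C) (n : nat) : C := a n.+1 - a n.

Lemma poly_growth_sdiff a : poly_growth a -> poly_growth (sdiff a).
Proof.
move=> [K [k hK]]; exists (K * 2 ^+ k + K), k => n.
have K0 : 0 <= K by have := hK 0%N; rewrite expr1n mulr1; apply: le_trans; exact: cabs_ge0.
apply: le_trans (cabsB _ _) _; rewrite mulrDl; apply: lerD => //.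
apply: le_trans (hK _) _; rewrite -mulrA ler_wpM2l // -exprMn.
rewrite lerXn2r ?nnegrE ?mulr_ge0 // -natrM ler_nat; lia.
Qed.

Lemma poly_growth_summable a (q : C) : poly_growth a -> cabs q < 1 ->
 summ (fun n => cabs (a n * q ^+ n)).
Proof.
move=> [K [k hK]] q1.
have K0 : 0 <= K by have := hK 0%N; rewrite expr1n mulr1; apply: le_trans; exact: cabs_ge0.
apply: (@summ_le _ _ _ (fun n => K * (n.+1%:R ^+ k * cabs q ^+ n))).
 by move=> n; rewrite cabsM cabsX mulrA ler_wpM2r // exprn_ge0 // cabs_ge0.
apply: summZ => //; last by apply: summ_natX_geo; rewrite cabs_ge0.
by move=> n; rewrite mulr_ge0 ?exprn_ge0.
Qed.

(* Repeated summation by parts: [(1 - q) \sum a_n q^n = a_0 + q \sum (a_(n+1) - a_n) q^n]. *)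
Lemma abel_bound (J : nat) (a : nat -> C) (q l : C) (gam : nat -> R) :
 poly_growth a -> cabs q < 1 -> hcs (fun n => a n * q ^+ n) l ->
 (forall n, cabs (iter J sdiff a n) <= gam n) -> summ gam ->
 cabs l <= \sum_(j < J) cabs (iter j sdiff a 0%N) * (cabs (1 - q))^-1 ^+ j.+1
      + (cabs (1 - q))^-1 ^+ J * bsum gam.
Proof.
move=> + q1; elim: J a l => [|J IH] a l pa ha hg sg.
 rewrite big_ord0 add0r mul1r; apply: cabs_hcs sg ha => n.
 rewrite cabsM cabsX; apply: le_trans (hg n).
 by rewrite ler_piMr // exprn_ile1 // ltW.
have pd := poly_growth_sdiff pa.
have [l' hl'] := hcsP (poly_growth_summable pd q1).
have E : (1 - q) * l = a 0%N + q * l'.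
 have h1 := hcs_lin (- q) (hcs_shift ha) ha.
 have h2 := hcsZ q hl'.
 have : q * l' = l - a 0%N * q ^+ 0 + - q * l.
  apply: hcs_unique h2 _; move: h1; congr hcs; ext => n.
  by rewrite /sdiff exprS; ring.
 by rewrite expr0 mulr1 => ->; ring.
have d0 : 0 < cabs (1 - q).
 by rewrite cabs_gt0 subr_eq0; apply: contraTneq q1 => <-; rewrite cabs1 ltxx.
have El : l = (a 0%N + q * l') / (1 - q).
 by rewrite -E mulrC mulKf // -cabs_gt0.
set D := (cabs (1 - q))^-1.
have D0 : 0 <= D by rewrite invr_ge0 cabs_ge0.
have hg' n : cabs (iter J sdiff (sdiff a) n) <= gam n by rewrite -iterSr; exact: hg.
have {}IH := IH _ _ pd hl' hg' sg.
rewrite El cabsf -/D mulrC big_ord_recl /= expr1 [cabs (a 0%N) * D]mulrC -addrA.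
apply: (@le_trans _ _ (D * (cabs (a 0%N) + cabs l'))).
 rewrite ler_wpM2l // (le_trans (cabsD _ _)) // lerD2l cabsM ler_piMl //.
 exact: ltW.
rewrite mulrDr lerD2l exprS -mulrA; apply: le_trans (ler_wpM2l D0 IH) _.
rewrite -/D mulrDr; apply: lerD => //; rewrite mulr_sumr; apply: ler_sum => j _.
by rewrite -iterS iterSr [_ ^+ (bump _ _).+1]exprS /bump /= add1n mulrCA.
Qed.

Lemma iter_sdiff_shift j (a : nat -> C) n m :
 iter j sdiff (fun k => a (n + k)%N) m = iter j sdiff a (n + m)%N.
Proof. by elim: j m => [//|j IH] m /=; rewrite /sdiff !IH addnS. Qed.
(** Finite differences are controlled by derivatives: the induction replaces each [fs i] by its
    increment over a unit step, whose derivative is the increment of [fs i.+1], and the mean value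
    inequality is applied once, at the end. *)
Lemma iter_sdiff_le j (fs : nat -> R -> C) (x M : R) :
 (forall i y, x <= y -> rder (fs i) y (fs i.+1 y)) ->
 (forall y, x <= y <= x + j%:R -> cabs (fs j y) <= M) ->
 cabs (iter j sdiff (fun n => fs 0%N (x + n%:R)) 0%N) <= M.
Proof.
elim: j fs => [|j IH] fs df hM /=.
 by apply: hM; rewrite !addr0 lexx.
rewrite -iterS iterSr.
pose gs i y := fs i (y + 1) - fs i y.
rewrite (_ : sdiff _ = (fun n => gs 0%N (x + n%:R))); last first.
 by ext => n; rewrite /sdiff /gs -natr1 addrA.
apply: IH => [i y xy|y /andP[xy yx]].
 apply: gderB; last exact: df.
 have h : rder (fs i) (y + 1) (fs i.+1 (y + 1)) by apply: df; rewrite ler_wpDr.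
 by move=> e /h[d d0 hd]; exists d => // t /hd; rewrite (addrAC y 1 t).
rewrite /gs; have := @mean_value_ineq _ (fs j) (fs j.+1) y (y + 1) M.
rewrite addrAC subrr add0r mulr1; apply; first by rewrite lerDl.
 by move=> z /andP[yz _]; apply: df; apply: le_trans yz.
move=> z /andP[yz zy]; apply: hM; rewrite (le_trans xy) //= -natr1 addrA.
by apply: le_trans zy _; rewrite lerD2r.
Qed.
End Exponential.

(** * Growth of the sum of n^w (ln n)^p q^n as q approaches 1 *)

Section SymbolSeries.
Context {R : realType}.
Local Notation C := (Cx R).

Lemma powR_ge1 (x a : R) : 1 <= x -> 0 <= a -> 1 <= x `^ a.
Proof. by move=> x1 a0; rewrite -(powRr0 x) ler_powR. Qed.
Lemma powR_le_neg (x y a : R) : 0 < x -> x <= y -> a <= 0 -> y `^ a <= x `^ a.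
Proof.
move=> x0 xy a0; have y0 : 0 < y := lt_le_trans x0 xy.
rewrite -[a]opprK (powRN _ (- a)) (powRN _ (- a)) lef_pV2 ?posrE ?powR_gt0 //.
by apply: ge0_ler_powR; rewrite ?nnegrE ?oppr_ge0 // ltW.
Qed.

Lemma symb_le p j (B d : R) : 0 <= B -> 0 < d -> exists2 K : R, 0 <= K &
 forall w x, cabs w <= B -> 1 <= x ->
  cabs (@symb R w p j x) <= K * x `^ (Re w + d - j%:R).
Proof.
(* Each of the p logarithms costs x^(d / (p + 1)), hence less than x^d altogether; p + 1 instead of
   p covers p = 0. *)
move=> B0 d0; pose d' := d / p.+1%:R; have d'0 : 0 < d' by rewrite divr_gt0.
pose K := p`!%:R * (\prod_(k < j) (B + k%:R + 1)) * (1 + d'^-1) ^+ p.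
have P0 : 0 <= p`!%:R * (\prod_(k < j) (B + k%:R + 1)).
 by rewrite mulr_ge0 // prodr_ge0 // => k _; rewrite !addr_ge0.
have k0 : 0 <= 1 + d'^-1 by rewrite addr_ge0 // invr_ge0 ltW.
exists K => [|w x wB x1]; first by rewrite mulr_ge0 // exprn_ge0.
have x0 : 0 < x by apply: lt_le_trans x1.
rewrite /symb cabsM cabs_cexp_ln // ReD ReN.
have -> : Re (j%:R : C) = j%:R by rewrite (_ : j%:R = toC j%:R :> C) // rmorph_nat.
have h1 := symc_le p j 0 (toC (ln x)) wB.
rewrite cabs_toC ger0_norm ?ln_ge0 // in h1.
rewrite addrAC [X in _ <= K * X]powRD; last by rewrite (gt_eqF x0) implybT.
rewrite [X in _ <= K * X]mulrC mulrA ler_wpM2r //.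
apply: le_trans h1 _; rewrite /K -[leRHS]mulrA ler_wpM2l //.
apply: (@le_trans _ _ (((1 + d'^-1) * x `^ d') ^+ p)).
 rewrite lerXn2r ?nnegrE ?addr_ge0 ?ln_ge0 ?mulr_ge0 //.
 exact: ln_powR_le.
rewrite exprMn ler_wpM2l ?exprn_ge0 // -powR_mulrn // -powRrM.
rewrite ler_powR // /d' -mulrA ler_piMr ?(ltW d0) // mulrC ler_pdivrMr // mul1r ler_nat.
exact: leqnSn.
Qed.

(** Telescoping, from 1 / y^2 <= 2 (1 / y - 1 / (y + 1)) for y >= 1. *)
Lemma sum_inv_sqr_le (x : R) N : 1 <= x ->
 \sum_(n < N) ((x + n%:R) ^+ 2)^-1 <= 2 / x.
Proof.
move=> x1; have x0 n : 0 < x + n%:R by rewrite ltr_pwDl // (lt_le_trans _ x1).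
apply: (@le_trans _ _ (2 * (x^-1 - (x + N%:R)^-1))); last first.
 by rewrite ler_pM2l // gerBl invr_ge0 ltW.
elim: N => [|N IH]; first by rewrite big_ord0 addr0 subrr mulr0.
rewrite big_ord_recr /=.
have xN := x0 N; have xN1 := x0 N.+1; set y := x + N%:R in xN IH *.
have -> : x + N.+1%:R = y + 1 by rewrite -natr1 addrA.
have y1 : 1 <= y by rewrite ler_wpDr.
have y10 : 0 < y + 1 by lra.
have : (y ^+ 2)^-1 <= 2 * (y^-1 - (y + 1)^-1).
 rewrite (_ : 2 * _ = 2 / (y * (y + 1))); last by field; rewrite !gt_eqF.
 rewrite ler_pdivlMr ?mulr_gt0 // mulrC ler_pdivrMr ?exprn_gt0 //; nra.
by move: IH; lra.
Qed.

Lemma symb_poly_growth p (w : C) : poly_growth (fun n => symb w p 0 n.+1%:R).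
Proof.
have [K K0 hK] := symb_le p 0 (cabs_ge0 w) ltr01.
have [k hk] : exists k : nat, Re w + 1 <= k%:R.
 exists (Num.truncn (`|Re w| + 1)).+1.
 apply: le_trans (ltW (truncnS_gt _)); by rewrite lerD2r ler_norm.
exists K, k => n; apply: le_trans (hK w _ (lexx _) _) _; first by rewrite ler1n.
by rewrite ler_wpM2l // subr0 -powR_mulrn // ler_powR // ler1n.
Qed.

(** The j-th derivative is O(y^(rho - j)) on [x, x + j]. For a nonnegative exponent one uses y <= (1
    + j) x, for a negative one monotonicity; the factor (1 + j)^rho serves both cases. *)
Lemma symb_diff_le p j (B d : R) : 0 <= B -> 0 < d -> exists2 K : R, 0 <= K &
 forall w rho x, cabs w <= B -> 0 <= rho -> Re w + d <= rho -> 1 <= x ->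
  cabs (iter j sdiff (fun n => @symb R w p 0 (x + n%:R)) 0%N)
   <= K * (1 + j%:R) `^ rho * x `^ (rho - j%:R).
Proof.
move=> B0 d0; have [K K0 hK] := symb_le p j B0 d0; exists K => // w rho x wB r0 wr x1.
have x0 : 0 < x by apply: lt_le_trans x1.
have j1 : 1 <= 1 + j%:R :> R by rewrite lerDl.
apply: (@iter_sdiff_le _ j (symb w p)) => [i y xy|y /andP[xy yx]].
 by apply: rder_symb; apply: lt_le_trans xy.
have y1 : 1 <= y by apply: le_trans xy.
apply: le_trans (hK w y wB y1) _; rewrite -mulrA ler_wpM2l //.
apply: (@le_trans _ _ (y `^ (rho - j%:R))); first by rewrite ler_powR // lerD2r.
have yx' : y <= (1 + j%:R) * x.
 by apply: le_trans yx _; rewrite mulrDl mul1r lerD2l ler_peMr.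
have [rj|rj] := leP 0 (rho - j%:R).
 apply: le_trans (ge0_ler_powR rj _ _ yx') _; rewrite ?nnegrE ?mulr_ge0 ?(le_trans ler01) ?(ltW x0) //.
 rewrite powRM ?(le_trans ler01) ?(ltW x0) // ler_wpM2r // ler_powR //.
 by rewrite gerBl.
apply: (@le_trans _ _ (x `^ (rho - j%:R))).
 by apply: powR_le_neg => //; exact: ltW.
by rewrite ler_peMl // powR_ge1.
Qed.

(** The series is cut at N of the order of u = 1/|1 - q|. The head has N terms of size at most
    N^rho, with rho = tau - 1. The tail is summed by parts J times: the j-th boundary term is x^(rho
    - j) u^(j + 1) with x = N + 1, again O(x^tau), and the remaining sum converges. The constant
    depends on w only through B and d, which allows w to vary later. *)
Lemma symb_series_bound p (B d tau : R) : 0 <= B -> 0 < d -> 1 <= tau ->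
 exists2 K : R, 0 <= K & forall (w q l : C), cabs w <= B ->
  Re w + d <= tau - 1 -> cabs q < 1 ->
  hcs (fun n => symb w p 0 n.+1%:R * q ^+ n.+1) l ->
  cabs l <= K * cabs q * (1 + (cabs (1 - q))^-1) `^ tau.
Proof.
move=> B0 d0 t1; pose rho := tau - 1; have r0 : 0 <= rho by rewrite subr_ge0.
have tau0 : 0 <= tau by apply: le_trans t1.
have tE : tau = rho + 1 by rewrite /rho subrK.
(* The choice rho + 2 <= J makes the J-th differences O(n^-2). *)
pose J := (Num.truncn rho).+3.
have rJ : rho + 2 <= J%:R.
 have /ltW := truncnS_gt rho; rewrite /J -addn2 natrD; lra.
have [K0 K00 hK0] := symb_le p 0 B0 d0.
pose Kj j := s2val (cid2 (symb_diff_le p j B0 d0)).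
have Kj0 j : 0 <= Kj j by exact: (s2valP (cid2 (symb_diff_le p j B0 d0))).
have hKj j := s2valP' (cid2 (symb_diff_le p j B0 d0)).
pose Mj j := Kj j * (1 + j%:R) `^ rho.
have Mj0 j : 0 <= Mj j by rewrite mulr_ge0.
pose K := K0 + (\sum_(j < J) Mj j + Mj J * 2) * 2 `^ tau.
have KK : 0 <= (\sum_(j < J) Mj j + Mj J * 2) * 2 `^ tau.
 by rewrite mulr_ge0 // addr_ge0 ?mulr_ge0 // sumr_ge0.
exists K => [|w q l wB wt q1 hl]; first by rewrite addr_ge0.
have q0 := cabs_ge0 q.
have u0 : 0 < cabs (1 - q).
 by rewrite cabs_gt0 subr_eq0; apply: contraTneq q1 => <-; rewrite cabs1 ltxx.
set u := (cabs (1 - q))^-1; have u00 : 0 <= u by rewrite invr_ge0 ltW.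
(* The cut is at least u, so that powers of u are bounded by powers of x = N + 1, and at most 1 + u,
   so that powers of x return to powers of 1 + u. *)
have [N Nu NX] : exists2 N : nat, u <= N%:R & N%:R <= 1 + u.
 exists (Num.truncn u).+1; first exact: ltW (truncnS_gt _).
 by rewrite -natr1 addrC lerD2l truncn_le.
pose x : R := N.+1%:R.
have xX : x <= 2 * (1 + u) by rewrite /x -natr1; lra.
have x1 : 1 <= x by rewrite ler1n.
have x0 : 0 < x by apply: lt_le_trans x1.
have ux : u <= x by apply: le_trans Nu _; rewrite ler_nat.
pose a n : C := symb w p 0 n.+1%:R.
have hd := hcs_drop N hl.
pose b n := a (N + n)%N.
have pa : poly_growth b.
 have [L [k hL]] := symb_poly_growth p w.
 exists (L * (N.+1)%:R ^+ k), k => n; apply: le_trans (hL _) _.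
 have L0 : 0 <= L by have := hL 0%N; rewrite expr1n mulr1; apply: le_trans; exact: cabs_ge0.
 rewrite -mulrA ler_wpM2l // -exprMn lerXn2r ?nnegrE ?mulr_ge0 // -natrM ler_nat.
 by rewrite mulSn mulnS addSn ltnS addnA (addnC n) leq_addr.
have [S hS] := hcsP (poly_growth_summable pa q1).
have E : l - \sum_(n < N) a n * q ^+ n.+1 = q ^+ N.+1 * S.
 apply: hcs_unique hd _; have := hcsZ (q ^+ N.+1) hS; congr hcs; ext => n.
 by rewrite mulrCA -exprD addSn.
have bE m : (fun n => b (m + n)%N) = (fun n => symb w p 0 ((x + m%:R) + n%:R)).
 ext => n; rewrite /b /a /x -!natrD; congr (symb _ _ _ _%:R).
 by rewrite addnA.
have dj j m : cabs (iter j sdiff b m) <= Mj j * (x + m%:R) `^ (rho - j%:R).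
 have := hKj j w rho (x + m%:R) wB r0 wt.
 by rewrite -bE iter_sdiff_shift addn0; apply; rewrite ler_wpDr.
pose gam n := Mj J * x `^ (rho + 2 - J%:R) * ((x + n%:R) ^+ 2)^-1.
have gJ n : cabs (iter J sdiff b n) <= gam n.
 apply: le_trans (dj J n) _; rewrite /gam -mulrA ler_wpM2l //.
 have xn : 0 < x + n%:R by rewrite ltr_wpDr.
 rewrite (_ : rho - J%:R = (rho + 2 - J%:R) + (- 2%:R)); last ring.
 rewrite powRD ?(gt_eqF xn) ?implybT // [X in _ * X <= _]powRN powR_mulrn ?(ltW xn) //.
 rewrite ler_wpM2r ?invr_ge0 ?exprn_ge0 ?(ltW xn) //.
 by apply: powR_le_neg => //; rewrite ?lerDl // subr_le0.
have [sg bg] : summ gam /\ bsum gam <= Mj J * x `^ (rho + 2 - J%:R) * (2 / x).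
 apply: summ_nat => [n|M].
  by rewrite mulr_ge0 ?invr_ge0 ?exprn_ge0 ?mulr_ge0 // addr_ge0 // ltW.
 by rewrite -mulr_sumr ler_wpM2l ?mulr_ge0 // sum_inv_sqr_le.
have HS := abel_bound pa q1 hS gJ sg; rewrite -/u in HS.
have uX j : u ^+ j <= x ^+ j by rewrite lerXn2r ?nnegrE ?(ltW x0).
have xtau : x `^ tau <= 2 `^ tau * (1 + u) `^ tau.
 by rewrite -powRM ?addr_ge0 // ge0_ler_powR ?nnegrE ?mulr_ge0 ?addr_ge0 ?(ltW x0).
have {}HS : cabs S <= (\sum_(j < J) Mj j + Mj J * 2) * (2 `^ tau * (1 + u) `^ tau).
 apply: le_trans HS _; apply: (@le_trans _ _ ((\sum_(j < J) Mj j + Mj J * 2) * x `^ tau)); last first.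
  by rewrite ler_wpM2l // addr_ge0 ?mulr_ge0 // sumr_ge0.
 rewrite mulrDl; apply: lerD.
  rewrite mulr_suml; apply: ler_sum => j _.
  have := dj j 0%N; rewrite addr0 => h.
  apply: (@le_trans _ _ (Mj j * x `^ (rho - j%:R) * x ^+ j.+1)).
   by apply: ler_pM; rewrite ?cabs_ge0 ?exprn_ge0.
  rewrite -mulrA ler_wpM2l // -powR_mulrn ?(ltW x0) // -powRD ?(gt_eqF x0) ?implybT //.
  rewrite ler_powR // tE -natr1; lra.
 apply: (@le_trans _ _ (x ^+ J * (Mj J * x `^ (rho + 2 - J%:R) * (2 / x)))).
  by apply: ler_pM; rewrite ?exprn_ge0 ?bsum_ge0 // => n; apply: le_trans (gJ n); exact: cabs_ge0.
 rewrite -powR_mulrn ?(ltW x0) // -(powR_inv1 (ltW x0)).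
 rewrite (_ : _ * (_ * _) = Mj J * 2 * (x `^ J%:R * x `^ (rho + 2 - J%:R) * x `^ (-1))); last ring.
 rewrite ler_wpM2l ?mulr_ge0 // -!powRD ?(gt_eqF x0) ?implybT //.
 rewrite ler_powR // tE; lra.
have X1 : 1 <= 1 + u by rewrite lerDl.
rewrite -(subrK (\sum_(n < N) a n * q ^+ n.+1) l) E (le_trans (cabsD _ _)) //.
rewrite /K; set Q := _ * 2 `^ tau; rewrite 2!mulrDl addrC; apply: lerD.
 apply: le_trans (cabs_sum _ _ _) _.
 apply: (@le_trans _ _ (\sum_(n < N) K0 * N%:R `^ rho * cabs q)).
  apply: ler_sum => n _; rewrite cabsM cabsX exprS mulrA.
  rewrite (@le_trans _ _ (cabs (a n) * cabs q)) //.
   by rewrite ler_piMr ?mulr_ge0 // exprn_ile1 // ltW.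
  rewrite ler_wpM2r //; apply: le_trans (hK0 w _ wB _) _; first by rewrite ler1n.
  rewrite ler_wpM2l // subr0 (le_trans (ler_powR _ wt)) ?ler1n //.
  by rewrite ge0_ler_powR ?nnegrE // ler_nat.
 rewrite sumr_const card_ord -[_ *+ N]mulr_natl.
 rewrite (_ : _ * _ = K0 * cabs q * (N%:R `^ rho * N%:R)); last ring.
 rewrite ler_wpM2l ?mulr_ge0 // -[X in _ * X](powRr1 (ler0n _ N)) -powRD; last first.
  by rewrite -tE (gt_eqF (lt_le_trans ltr01 t1)).
 by rewrite -tE ge0_ler_powR ?nnegrE ?addr_ge0.
rewrite cabsM cabsX exprS -mulrA (_ : Q * _ * _ = cabs q * (Q * (1 + u) `^ tau)); last ring.
rewrite ler_wpM2l //; apply: (@le_trans _ _ (cabs S)); last by rewrite /Q -mulrA.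
by rewrite ler_piMl // exprn_ile1 // ltW.
Qed.
End SymbolSeries.

(** * The q-series behind [Fser], its derivatives in both variables, and the majorant [Phi] *)

Section QSeries.
Context {R : realType}.
Local Notation C := (Cx R).
Variable h : R.
Hypothesis h0 : 0 < h.

Definition qc : R := 2 * pi / h.
Definition qx (z : C) : C := cexp ((0 +i* qc)%C * z).

Lemma qc_gt0 : 0 < qc.
Proof. by rewrite divr_gt0 // mulr_gt0 // pi_gt0. Qed.
Lemma cabs_qx (z : C) : cabs (qx z) = expR (- (qc * Im z)).
Proof. by rewrite cabs_cexp ReM /= mul0r sub0r. Qed.
Lemma cabs_qx_lt1 (z : C) : 0 < Im z -> cabs (qx z) < 1.
Proof. by move=> y0; rewrite cabs_qx expR_lt1 oppr_lt0 mulr_gt0 // qc_gt0. Qed.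
Lemma efun_qx (n : nat) (z : uhp R) : efun h n%:Z z = qx (uval z) ^+ n.
Proof.
rewrite /efun; transitivity (cexp (((0 +i* qc)%C : C) * uval z *+ n)); last exact: cexpMn.
congr (cexp _); rewrite -mulrnAl; congr (_ * _).
apply: cx_eq; first by rewrite raddfMn /= mul0rn.
by rewrite raddfMn /= /qc -[RHS]mulr_natr [RHS]mulrAC -pmulrn.
Qed.

Lemma cder_qxX n (z : C) : cder (fun z => qx z ^+ n) z ((0 +i* qc)%C * n%:R * qx z ^+ n).
Proof.
have := gder_comp (cderX n (qx z)) (cder_cexpZ (0 +i* qc)%C z).
congr gder; case: n => [|n]; first by rewrite !(mul0r, mulr0).
by rewrite /= exprS /qx; ring.
Qed.

(** This is the sum over n >= 1 of n^w (ln n)^p q^n. Up to a constant, d/dz raises w by one, and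
    d/dw raises p by one, so the family is closed under both derivatives; [Fser] at s is the case p
    = 0, w = s - 1. *)
Definition Dser p (w z : C) : C :=
 csum setT (fun n : nat => symb w p 0 n.+1%:R * qx z ^+ n.+1).

Lemma Dser_summable p (w z : C) : 0 < Im z ->
 summ (fun n : nat => cabs (symb w p 0 n.+1%:R * qx z ^+ n.+1)).
Proof.
move=> y0; have h1 := poly_growth_summable (symb_poly_growth p w) (cabs_qx_lt1 y0).
apply: summ_le h1 => n; rewrite [leLHS]cabsM [leRHS]cabsM ler_wpM2l //.
rewrite exprS cabsM.
by rewrite ler_piMl // ltW // cabs_qx_lt1.
Qed.

Lemma hcs_Dser p (w z : C) : 0 < Im z ->
 hcs (fun n : nat => symb w p 0 n.+1%:R * qx z ^+ n.+1) (Dser p w z).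
Proof.
move=> y0; have := @hcs_csum _ _ setT (fun n : nat => symb w p 0 n.+1%:R * qx z ^+ n.+1).
by rewrite patch_setT; apply; apply/abs_summableE; rewrite patch_setT; exact: Dser_summable.
Qed.

Lemma symbS (w : C) p (x : R) : 0 < x -> symb w p 0 x * toC x = symb (w + 1) p 0 x.
Proof.
move=> x0; rewrite /symb /= -mulrA [in LHS](cexp_ln x0) -cexpD; congr (_ * cexp _).
by ring.
Qed.

Lemma Im_near (z w : C) : cabs (w - z) < Im z / 2 -> Im z / 2 < Im w.
Proof.
move=> hw; have := le_lt_trans (Im_le_cabs (w - z)) hw.
by rewrite ImD ImN ltr_norml => /andP[]; lra.
Qed.

Lemma cder_Dser_z p (w z : C) : 0 < Im z ->
 cder (Dser p w) z ((0 +i* qc)%C * Dser p (w + 1) z).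
Proof.
move=> y0; set c := (0 +i* qc)%C.
have y2 : 0 < Im z / 2 by rewrite divr_gt0.
(* Points within Im z / 2 of z stay above height Im z / 2, so the terms at [z1] dominate those of
   the differentiated series on the whole disc. *)
pose z1 : C := (0 +i* (Im z / 2))%C.
pose M n := cabs c * cabs (symb (w + 1) p 0 n.+1%:R * qx z1 ^+ n.+1).
have sM : summ M.
 apply: summZ; [exact: cabs_ge0|by move=> n; exact: cabs_ge0|exact: Dser_summable].
pose u' n z := c * (symb (w + 1) p 0 n.+1%:R * qx z ^+ n.+1).
apply: (@hcs_gder _ _ (fun n z => symb w p 0 n.+1%:R * qx z ^+ n.+1) u' _ _ _ M _ y2) => //.
- move=> n v _; have := gderZ (symb w p 0 n.+1%:R) (cder_qxX n.+1 v).
 congr gder; rewrite /u' -symbS ?ltr0n //.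
 by rewrite (_ : toC n.+1%:R = n.+1%:R) ?rmorph_nat // /c; ring.
- move=> n v hv; rewrite /u' cabsM ler_wpM2l // [leLHS]cabsM [leRHS]cabsM ler_wpM2l //.
 rewrite !cabsX lerXn2r ?nnegrE // !cabs_qx ler_expR lerN2 /=.
 by rewrite ler_wpM2l ?(ltW qc_gt0) // ltW // Im_near.
- by move=> v hv; apply: hcs_Dser; apply: lt_trans y2 (Im_near hv).
- by apply: hcsZ; exact: hcs_Dser.
Qed.

Lemma cder_symb_w p (w : C) (x : R) :
 cder (fun w => symb w p 0 x) w (symb w p.+1 0 x).
Proof.
have h1 : cder (fun w : C => (w - 0%:R) * toC (ln x)) w (toC (ln x)).
 have := gderM (gderB (cder_id w) (gder_cst id (0%:R : C) w)) (gder_cst id (toC (ln x)) w).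
 by rewrite subr0 mul1r mulr0 addr0.
have := gderZ (symc w p 0 0 (toC (ln x)))
 (@gder_comp _ _ _ _ (fun w : C => (w - 0%:R) * toC (ln x)) _ _ _ (cder_cexp _) h1).
by congr gder; rewrite /symb /= !subn0 !ffactn0 exprS; ring.
Qed.

Lemma cder_Dser_w p (w z : C) : 0 < Im z ->
 cder (fun w => Dser p w z) w (Dser p.+1 w z).
Proof.
move=> y0; have B0 : 0 <= cabs w + 1 by rewrite addr_ge0.
have [K K0 hK] := symb_le p.+1 0 B0 (@ltr01 R).
have [k hk] : exists k : nat, Re w + 2 <= k%:R.
 exists (Num.truncn (`|Re w| + 2)).+1.
 apply: le_trans (ltW (truncnS_gt _)); by rewrite lerD2r ler_norm.
have q1 := cabs_qx_lt1 y0.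
pose M n := K * (n.+1%:R ^+ k * cabs (qx z) ^+ n).
have sM : summ M.
 apply: summZ => // [n|]; first by rewrite mulr_ge0 ?exprn_ge0.
 by apply: summ_natX_geo; rewrite cabs_ge0 q1.
apply: (@hcs_gder _ _ (fun n w => symb w p 0 n.+1%:R * qx z ^+ n.+1)
  (fun n w => symb w p.+1 0 n.+1%:R * qx z ^+ n.+1) _ _ _ M 1) => //.
- move=> n v _; have := gderM (cder_symb_w p v n.+1%:R) (gder_cst id (qx z ^+ n.+1) v).
 by rewrite mulr0 addr0.
- move=> n v hv; rewrite /M mulrA cabsM cabsX; apply: ler_pM; rewrite ?exprn_ge0 //.
  apply: le_trans (hK v _ _ _) _; rewrite ?ler1n //.
   by rewrite -(subrK w v) addrC (le_trans (cabsD _ _)) // lerD2l ltW.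
  rewrite ler_wpM2l // subr0 -powR_mulrn // ler_powR ?ler1n //.
  have := le_lt_trans (Re_le_cabs _) hv; rewrite ReD ReN ltr_norml => /andP[_].
  by lra.
 by rewrite exprS ler_piMl ?exprn_ge0 // ltW.
- by move=> v _; exact: hcs_Dser.
- exact: hcs_Dser.
Qed.

(** Two applications of the mean value inequality. A remainder quadratic in u with an explicit
    constant is what differentiation under the strip integral requires. *)
Lemma Dser_taylor (w u z : C) (M : R) : 0 < Im z ->
 (forall t, 0 <= t <= 1 -> cabs (Dser 2 (w + toC t * u) z) <= M) ->
 cabs (Dser 0 (w + u) z - Dser 0 w z - u * Dser 1 w z) <= M * cabs u ^+ 2.
Proof.
move=> y0 hM; pose g v := Dser 0 v z - v * Dser 1 w z.
have M0 : 0 <= M by apply: le_trans (hM 0 _); rewrite // lexx ler01.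
have dg v : cder g v (Dser 1 v z - Dser 1 w z).
 apply: gderB; first exact: cder_Dser_w.
 by have := gderM (cder_id v) (gder_cst id (Dser 1 w z) v); rewrite mul1r mulr0 addr0.
rewrite (_ : _ - _ - _ = g (w + u) - g w); last by rewrite /g; ring.
rewrite expr2 mulrA; apply: (@cmean_value_ineq _ g (fun v => Dser 1 v z - Dser 1 w z)) => // t /andP[t0 t1].
apply: (@le_trans _ _ (M * cabs (toC t * u))).
 apply: (@cmean_value_ineq _ (fun v => Dser 1 v z) (fun v => Dser 2 v z)) => s /andP[s0 s1].
  exact: cder_Dser_w.
 by rewrite mulrA -rmorphM; apply: hM; rewrite mulr_ge0 //= mulr_ile1.
by rewrite ler_wpM2l // cabsM cabs_toC ger0_norm // ler_piMl.
Qed.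

Lemma Fser_Dser (s : C) (z : uhp R) : Fser h s z = Dser 0 (s - 1) (uval z).
Proof.
have hy := uval_gt0 z; apply: csumE.
set a := _ \_ _; have a0 : a 0%N = 0 by rewrite /a /patch memNset.
rewrite -[Dser _ _ _]addr0 -[in X in _ + X]a0; apply: hcs_unshift.
have := hcs_Dser 0 (s - 1) hy; congr hcs; ext => n.
rewrite /a /patch mem_set // efun_qx; congr (_ * _).
by rewrite /symb /npow /= ffactn0 subn0 expr0 !mulr1 mul1r subr0.
Qed.

Definition Phi (a tau : R) (z : C) : R :=
 Num.min 1 (Im z) `^ a * (1 + (cabs (1 - qx z))^-1) `^ tau.

Lemma Phi_ge0 a tau z : 0 <= Phi a tau z.
Proof. by rewrite mulr_ge0. Qed.
(** |1 - q| >= 1 - exp (-t) >= t / (1 + t), since 1 + t <= exp t. *)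
Lemma one_sub_qx_ge (z : C) : 0 < Im z ->
 qc * Im z / (1 + qc * Im z) <= cabs (1 - qx z).
Proof.
move=> y0; set t := qc * _; have t0 : 0 < t by rewrite mulr_gt0 ?qc_gt0.
apply: (@le_trans _ _ (1 - cabs (qx z))); last first.
 have := cabsD (1 - qx z) (qx z); rewrite subrK cabs1; lra.
rewrite cabs_qx -/t expRN ler_pdivrMr; last by lra.
have e0 : 0 < expR t := expR_gt0 t.
have : (1 + t) / expR t <= 1 by rewrite ler_pdivrMr // mul1r expR_ge1Dx.
lra.
Qed.

(** Each of the k extra powers of n costs a factor 1 + 1/|1 - q|, paid by one factor y = Im z
    because y (1 + 1/|1 - q|) <= 2 y + 1 / qc. For y > 1 the decay of q absorbs all powers of y,
    which is why [Phi] contains min (1, y) and not y. *)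
Lemma Dser_Phi (p k : nat) (B d a tau : R) : 0 <= B -> 0 < d -> 0 < a -> 1 <= tau ->
 exists2 K : R, 0 <= K & forall w z : C, cabs w <= B -> Re w + d <= tau - 1 ->
  0 < Im z ->
  Im z `^ a * Im z ^+ k * cabs (Dser p (w + k%:R) z) <= K * Phi a tau z.
Proof.
move=> B0 d0 a0 t1; have c0 := qc_gt0.
have Bk : 0 <= B + k%:R by rewrite addr_ge0.
have tk : 1 <= tau + k%:R by rewrite ler_wpDr.
have [K K0 hK] := symb_series_bound p Bk d0 tk.
have [A hA] : exists A : nat, a + k%:R <= A%:R.
 by exists (Num.truncn (a + k%:R)).+1; exact: ltW (truncnS_gt _).
pose L := (2 + qc^-1) ^+ k * (1 + (A%:R / qc) ^+ A).
have q1 : 0 <= 2 + qc^-1 by rewrite addr_ge0 // invr_ge0 ltW.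
have A0 : 0 <= (A%:R / qc) ^+ A by rewrite exprn_ge0 // divr_ge0 // ltW.
have L0 : 0 <= L by rewrite mulr_ge0 ?exprn_ge0 // addr_ge0.
exists (K * L) => [|w z wB wt y0]; first by rewrite mulr_ge0.
set y := Im z in y0 *; set u := (cabs (1 - qx z))^-1.
have u0 : 0 <= u by rewrite invr_ge0 cabs_ge0.
have X0 : 0 < 1 + u by rewrite ltr_pwDl.
have kC : (k%:R : C) = toC k%:R by rewrite rmorph_nat.
have hD : cabs (Dser p (w + k%:R) z) <= K * cabs (qx z) * (1 + u) `^ (tau + k%:R).
 apply: hK (cabs_qx_lt1 y0) (hcs_Dser _ _ y0).
  by rewrite (le_trans (cabsD _ _)) // lerD // kC cabs_toC ger0_norm.
 by rewrite ReD kC /=; lra.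
have yu : y * (1 + u) <= 2 * y + qc^-1.
 have := one_sub_qx_ge y0; rewrite -/y => hq.
 have cy : 0 < qc * y by rewrite mulr_gt0.
 have : u <= ((qc * y) / (1 + qc * y))^-1.
  rewrite lef_pV2 ?posrE //; last by rewrite divr_gt0 // ltr_pwDl // ltW.
  by apply: lt_le_trans hq; rewrite divr_gt0 // ltr_pwDl // ltW.
 rewrite invf_div => hu; rewrite mulrDr mulr1 (_ : 2 * y + _ = y + y * ((1 + qc * y) / (qc * y))).
  by rewrite lerD2l ler_wpM2l // ltW.
 by field; rewrite !gt_eqF.
have key : y `^ a * cabs (qx z) * (y * (1 + u)) ^+ k <= L * Num.min 1 y `^ a.
 apply: (@le_trans _ _ (y `^ a * cabs (qx z) * (2 * y + qc^-1) ^+ k)).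
  rewrite ler_wpM2l ?mulr_ge0 // lerXn2r ?nnegrE ?mulr_ge0 ?(ltW X0) ?(ltW y0) //.
  by rewrite addr_ge0 ?mulr_ge0 ?invr_ge0 ?(ltW c0) ?(ltW y0).
 have [y1|y1] := leP y 1.
  rewrite -mulrA (mulrC L) ler_wpM2l //.
  apply: (@le_trans _ _ ((2 + qc^-1) ^+ k)).
   rewrite -[leRHS]mul1r; apply: ler_pM; rewrite ?exprn_ge0 //.
   - by rewrite addr_ge0 ?mulr_ge0 ?invr_ge0 ?(ltW c0) ?(ltW y0).
   - exact: ltW (cabs_qx_lt1 y0).
   - rewrite lerXn2r ?nnegrE // ?addr_ge0 ?mulr_ge0 ?invr_ge0 ?(ltW c0) ?(ltW y0) //.
    by rewrite lerD2r; lra.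
  by rewrite ler_peMr ?exprn_ge0 // lerDl.
 rewrite powR1 mulr1.
 apply: (@le_trans _ _ (y `^ a * cabs (qx z) * (y ^+ k * (2 + qc^-1) ^+ k))).
  rewrite ler_wpM2l ?mulr_ge0 // -exprMn lerXn2r ?nnegrE ?mulr_ge0 ?(ltW y0) //.
   by rewrite addr_ge0 ?mulr_ge0 ?invr_ge0 ?(ltW c0) ?(ltW y0).
  rewrite mulrDr (mulrC y 2) lerD2l ler_peMl ?invr_ge0 ?(ltW c0) //; exact: ltW.
 rewrite (_ : _ * _ * (_ * _) = (2 + qc^-1) ^+ k * (y `^ a * y ^+ k * cabs (qx z))); last ring.
 rewrite /L ler_wpM2l ?exprn_ge0 //.
 apply: (@le_trans _ _ (y ^+ A * cabs (qx z))).
  rewrite ler_wpM2r // -!powR_mulrn ?(ltW y0) // -powRD ?(gt_eqF y0) ?implybT //.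
  by rewrite ler_powR // ltW.
 rewrite cabs_qx -/y; case: (A) A0 hA => [|A'] A0 hA.
  rewrite expr0 mul1r (le_trans _ (_ : 1 <= _)) ?lerDl //.
  by rewrite expR_le1 oppr_le0 mulr_ge0 ?(ltW c0) ?(ltW y0).
 apply: (@le_trans _ _ ((A'.+1%:R / qc) ^+ A'.+1)); last by rewrite lerDr.
 rewrite expRN ler_pdivrMr ?expR_gt0 //.
 have -> : expR (qc * y) = expR (qc * y / A'.+1%:R) ^+ A'.+1.
  by rewrite -expRM_natr divfK // gt_eqF.
 have hy : y <= A'.+1%:R / qc * expR (qc * y / A'.+1%:R).
  have kc : 0 < A'.+1%:R / qc by rewrite mulr_gt0 // invr_gt0.
  rewrite -ler_pdivrMl // invfM invrK (_ : _ * _ * y = qc * y / A'.+1%:R); last ring.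
  by apply: le_trans (expR_ge1Dx _); rewrite lerDr.
 by rewrite -exprMn lerXn2r ?nnegrE ?(ltW y0) // (le_trans (ltW y0) hy).
apply: le_trans (ler_wpM2l _ hD) _; first by rewrite mulr_ge0 // exprn_ge0 ?(ltW y0).
rewrite /Phi -/y -/u powRD ?(gt_eqF X0) ?implybT // powR_mulrn ?(ltW X0) //.
rewrite [leLHS](_ : _ = K * (y `^ a * cabs (qx z) * (y * (1 + u)) ^+ k) * (1 + u) `^ tau).
 rewrite (_ : K * L * (_ * _) = K * (L * Num.min 1 y `^ a) * (1 + u) `^ tau); last ring.
 by rewrite ler_wpM2r //; exact: ler_wpM2l.
by rewrite exprMn; ring.
Qed.

(** Put s = qc y with y = Im z. Moving z by at most y / 4 changes q by at most (s / 4) exp (-3 s /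
    4), which is at most half of s / (1 + s), hence half of |1 - q|. So |1 - q| drops at most by a
    factor 2, and the height grows by less than that. *)
Lemma Phi_harnack a tau (z w : C) : 0 <= a -> 0 <= tau -> 0 < Im z ->
 cabs (w - z) <= Im z / 4 -> Phi a tau w <= 2 `^ a * 2 `^ tau * Phi a tau z.
Proof.
move=> a0 t0 y0 wz; have c0 := qc_gt0; set y := Im z in y0 wz *.
have := le_trans (Im_le_cabs (w - z)) wz; rewrite ImD ImN -/y ler_norml => /andP[w1 w2].
have yw : 0 < Im w by lra.
have h1 : cabs (1 - qx z) <= 2 * cabs (1 - qx w).
 have h2 : cabs (qx w - qx z) <= qc * expR (- (qc * (3 / 4 * y))) * cabs (w - z).
  have -> : qx w = qx (z + (w - z)) by rewrite addrC subrK.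
  apply: (@cmean_value_ineq _ qx (fun v => (0 +i* qc)%C * qx v)) => t /andP[ht0 ht1].
   exact: cder_cexpZ.
  rewrite cabsM cabsE /= expr0n add0r sqrtr_sqr ger0_norm ?(ltW c0) //.
  rewrite ler_wpM2l ?(ltW c0) // cabs_qx ler_expR lerN2 ler_wpM2l ?(ltW c0) //.
  rewrite ImD ImM /= mul0r addr0 -/y.
  have : - (y / 4) <= t * Im (w - z).
   rewrite ImD ImN -/y; have : t * - (Im w - y) <= y / 4.
    apply: (@le_trans _ _ (t * (y / 4))); last by rewrite ler_piMl // divr_ge0 // ltW.
    by rewrite ler_wpM2l //; lra.
   by rewrite mulrN; lra.
  lra.
 have h3 := one_sub_qx_ge y0; rewrite -/y in h3; set s := qc * y in h3.
 have s0 : 0 < s by rewrite mulr_gt0.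
 have h4 : cabs (qx w - qx z) <= s / (1 + s) / 2.
  apply: le_trans h2 _.
  apply: (@le_trans _ _ (qc * expR (- (qc * (3 / 4 * y))) * (y / 4))).
   by rewrite ler_wpM2l // mulr_ge0 // ltW.
  rewrite (_ : _ * _ * _ = s / 4 * expR (- (3 / 4 * s))); last first.
   by rewrite /s (_ : qc * (3 / 4 * y) = 3 / 4 * (qc * y)); ring.
  rewrite expRN ler_pdivrMr ?expR_gt0 //.
  have e1 := expR_ge1Dx (3 / 4 * s).
  rewrite (_ : s / (1 + s) / 2 * _ = s / 4 * (2 * expR (3 / 4 * s) / (1 + s))); last first.
   by field; rewrite gt_eqF //; lra.
  by rewrite ler_peMr ?ler_pdivlMr; lra.
 have := cabsD (1 - qx w) (qx w - qx z); rewrite (_ : 1 - qx w + (qx w - qx z) = 1 - qx z); last ring.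
 lra.
have q0 : 0 < cabs (1 - qx z).
 rewrite cabs_gt0 subr_eq0; apply: contraTneq (cabs_qx_lt1 y0) => <-; by rewrite cabs1 ltxx.
have qw0 : 0 < cabs (1 - qx w) by lra.
rewrite /Phi -/y mulrACA; apply: ler_pM; rewrite //.
 rewrite -powRM // ?le_min ?ler01 ?(ltW y0) // ge0_ler_powR ?nnegrE //.
 - by rewrite le_min ler01 ltW.
 - by rewrite mulr_ge0 // le_min ler01 ltW.
 - have [y1|y1] := leP y 1; first by rewrite ge_min; apply/orP; right; lra.
  by rewrite ge_min; apply/orP; left; lra.
rewrite -powRM // ?addr_ge0 ?invr_ge0 ?(ltW q0) // ge0_ler_powR ?nnegrE ?mulr_ge0 ?addr_ge0 ?invr_ge0 ?(ltW q0) ?(ltW qw0) //.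
have : (cabs (1 - qx w))^-1 <= 2 * (cabs (1 - qx z))^-1.
 rewrite -[2]invrK -invfM lef_pV2 ?posrE ?mulr_gt0 ?invr_gt0 //; lra.
lra.
Qed.
End QSeries.

(** * Continuous functions on the half-plane are measurable for the product sigma-algebra *)

Section PlaneMeasurability.
Context {R : realType}.

Definition UH : set (R * R) := [set p | 0 < p.2].

Lemma measurable_UH : measurable (UH : set (RxR R)).
Proof.
rewrite (_ : UH = setT `*` `]0, +oo[%classic); last first.
 apply/seteqP; split => -[x y] /=; rewrite in_itv /= andbT //.
 by case.
by apply: measurableX.
Qed.

(** An open set is the union of the boxes with rational corners that it contains, and these are
    countably many. *)
Lemma measurable_locally_box (A : set (R * R)) :
 (forall p, A p -> exists2 d : R, 0 < d & forall q, `|q.1 - p.1| < d -> `|q.2 - p.2| < d -> A q) ->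
 measurable (A : set (RxR R)).
Proof.
move=> hA; pose B (a b c d : rat) : set (R * R) :=
 [set q | [/\ ratr a < q.1, q.1 < ratr b, ratr c < q.2 & q.2 < ratr d]].
pose A' := \bigcup_a \bigcup_b \bigcup_c \bigcup_d
 (if `[< B a b c d `<=` A >] then B a b c d else set0).
have -> : A = A'.
 apply/seteqP; split=> [p Ap|p [a _ [b _ [c _ [d _]]]]]; last by case: asboolP => // h /h.
 have [e e0 he] := hA _ Ap.
 have [a] := @rat_in_itvoo R (p.1 - e) p.1 (ltac:(rewrite ltrBlDr ltrDl //)).
 rewrite in_itv /= => /andP[a1 a2].
 have [b] := @rat_in_itvoo R p.1 (p.1 + e) (ltac:(rewrite ltrDl //)).
 rewrite in_itv /= => /andP[b1 b2].
 have [c] := @rat_in_itvoo R (p.2 - e) p.2 (ltac:(rewrite ltrBlDr ltrDl //)).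
 rewrite in_itv /= => /andP[c1 c2].
 have [d] := @rat_in_itvoo R p.2 (p.2 + e) (ltac:(rewrite ltrDl //)).
 rewrite in_itv /= => /andP[d1 d2].
 exists a => //; exists b => //; exists c => //; exists d => //.
 case: asboolP => [_|[]]; first by split.
 by move=> q [q1 q2 q3 q4]; apply: he; rewrite ltr_norml; apply/andP; split; lra.
apply: bigcupT_measurable_rat => a; apply: bigcupT_measurable_rat => b.
apply: bigcupT_measurable_rat => c; apply: bigcupT_measurable_rat => d.
case: ifP => // _.
rewrite (_ : B a b c d = `]ratr a, ratr b[%classic `*` `]ratr c, ratr d[%classic).
 by apply: measurableX.
apply/seteqP; split => -[x y]; rewrite /B /= !in_itv /=; first by case=> h1 h2 h3 h4; split; apply/andP.
by case=> /andP[h1 h2] /andP[h3 h4].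
Qed.

Definition continuous_box (g : R * R -> R) : Prop := forall p, UH p -> forall e, 0 < e ->
 exists2 d : R, 0 < d & forall q, `|q.1 - p.1| < d -> `|q.2 - p.2| < d -> `|g q - g p| < e.

Lemma continuous_box_measurable (g : R * R -> R) : continuous_box g ->
 measurable_fun (UH : set (RxR R)) g.
Proof.
move=> hg mD; apply: (measurability _ (RGenOInfty.measurableE R)) => //.
move=> _ [_ [a ->] <-]; apply: measurable_locally_box => p [p0 pa].
have ga : a < g p by move: pa; rewrite /= in_itv /= andbT.
have [d d0 hd] := hg p p0 (g p - a) (ltac:(rewrite subr_gt0 //)).
exists (Num.min d p.2) => [|q]; first by rewrite lt_min d0.
rewrite !lt_min => /andP[q1 _] /andP[q2 q3]; split.
 by move: q3; rewrite /UH /= ltr_norml => /andP[]; lra.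
by rewrite /= in_itv /= andbT; have := hd q q1 q2; rewrite ltr_norml => /andP[]; lra.
Qed.
End PlaneMeasurability.

(** * Changes of variable on the line and the multiplicative Haar integral *)

Section LineChanges.
Context {R : realType}.
Local Notation mu := (@lebesgue_measure R).
Local Open Scope ereal_scope.

Definition affine_map (a b : R) : measurableTypeR R -> measurableTypeR R :=
 fun x => (a * x + b)%R.

Lemma measurable_affine (a b : R) : mfT (affine_map a b).
Proof. by apply: measurable_funD => //; apply: measurable_funM. Qed.
(** The image of Lebesgue measure under the affine map, scaled by a, agrees with Lebesgue measure on
    half-open intervals, hence everywhere by uniqueness. *)
Lemma integral_affine (a b : R) (f : R -> \bar R) : (0 < a)%R ->
 mfT f -> (forall x, 0 <= f x) ->
 \int[mu]_x (f (a * x + b)%R * a%:E) = \int[mu]_x f x.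
Proof.
move=> a0 mf f0; have ma := measurable_affine a b; set aff := affine_map a b in ma.
pose k : {nonneg R} := NngNum (ltW a0).
pose nu0 : {measure set (measurableTypeR R) -> \bar R} := mscale k (pushforward mu (affine_map a b)).
pose nu : {measure set (measurableTypeR R) -> \bar R} := nu0 ma.
have nuE A : measurable A -> mu A = nu A.
 apply: lebesgue_measure_unique => _ [[c d] _ <-] /=.
 rewrite /nu /mscale /= /pushforward.
 rewrite (_ : aff @^-1` _ = `]((c - b) / a), ((d - b) / a)]%classic)%R; last first.
  by apply/seteqP; split => x /=; rewrite !in_itv /= /aff /affine_map ltr_pdivrMr // ler_pdivlMr //
   ltrBlDr lerBrDr (mulrC x).
 rewrite !lebesgue_measure_itv /= !lte_fin ltr_pM2r ?invr_gt0 // ltrD2r.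
 case: ifP => _; last by rewrite mule0.
 by rewrite -EFinB -EFinM -mulrBl mulrC opprB addrA subrK divfK // gt_eqF.
rewrite [RHS](@eq_measure_integral _ _ _ _ nu); last by move=> A mA _; exact: nuE.
rewrite ge0_integral_mscale // ge0_integral_pushforward // preimage_setT.
rewrite ge0_integralZr //; last by rewrite lee_fin ltW.
 by rewrite muleC.
exact: mcomp mf ma.
Qed.

Lemma integral_reflect (f : R -> \bar R) : mfT f -> (forall x, 0 <= f x) ->
 \int[mu]_x f (- x)%R = \int[mu]_x f x.
Proof.
move=> mf f0.
rewrite [RHS](@eq_measure_integral _ _ _ _ (pushforward mu (-%R : measurableTypeR R -> measurableTypeR R))).
 by rewrite ge0_integral_pushforward.
by move=> A mA _; exact/esym/lebesgue_measureN.
Qed.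

(* The multiplicative Haar measure of the positive half-line. *)
Definition wt (y : R) : R := if (0 < y)%R then (y `^ (-1))%R else 0%R.

Lemma wtE (y : R) : (0 < y)%R -> wt y = y^-1%R.
Proof. by move=> y0; rewrite /wt y0 powR_inv1 // ltW. Qed.
Lemma wt_ge0 y : (0 <= wt y)%R.
Proof. by rewrite /wt; case: ifP => // _; rewrite powR_ge0. Qed.
Lemma measurable_wt : mfT wt.
Proof.
by apply: measurable_fun_ifT; [exact: measurable_fun_ltr|exact: measurable_powR|].
Qed.

Definition mint (g : R -> \bar R) : \bar R := \int[mu]_y (g y * (wt y)%:E).

Let rinv (y : R) : R := (y `^ (-1))%R.

Let measurable_rinv : mfT rinv.
Proof. exact: measurable_powR. Qed.

Let mgw g : mfT g -> mfT (fun y : R => g y * (wt y)%:E).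
Proof.
by move=> mg; apply: emeasurable_funM => //; apply/measurable_EFinP; exact: measurable_wt.
Qed.

Let gw0 (g : R -> \bar R) : (forall y, 0 <= g y) -> forall y, 0 <= g y * (wt y)%:E.
Proof. by move=> g0 y; rewrite mule_ge0 // lee_fin wt_ge0. Qed.

Let wt0 (y : R) : 0 <= (wt y)%:E.
Proof. by rewrite lee_fin wt_ge0. Qed.

Lemma mint_scale (a : R) (g : R -> \bar R) : (0 < a)%R -> mfT g ->
 (forall y, 0 <= g y) -> mint (fun y => g (a * y)%R) = mint g.
Proof.
move=> a0 mg g0.
rewrite /mint -(@integral_affine a 0 (fun y => g y * (wt y)%:E)) //; [|exact: mgw|exact: gw0].
apply: eq_integral => y _; rewrite addr0 -muleA; congr (_ * _).
rewrite /wt pmulr_rgt0 //; case: ifP => y0; last by rewrite mul0e.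
rewrite -EFinM; congr (_%:E); rewrite !powR_inv1 ?mulr_ge0 ?(ltW y0) ?(ltW a0) //.
by field; rewrite !gt_eqF.
Qed.

Lemma eq_mint (g g' : R -> \bar R) : (forall y, (0 < y)%R -> g y = g' y) -> mint g = mint g'.
Proof.
move=> h; apply: eq_integral => y _; rewrite /wt; case: ifP => y0; last by rewrite !mule0.
by rewrite h.
Qed.

(* Uniqueness of Haar measure: both functionals are dilation invariant, and Tonelli
  compares them through a test function of finite nonzero mass. *)
Lemma mint_inv (k : R) (g : R -> \bar R) : (0 < k)%R -> mfT g ->
 (forall y, 0 <= g y) -> mint (fun y => g (k / y)%R) = mint g.
Proof.
move=> k0 mg g0.
have mgi : mfT (fun y => g (rinv y)) by exact: mcomp.
suff H : mint (fun y => g (rinv y)) = mint g.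
 rewrite -H; transitivity (mint (fun y => g (rinv (k^-1 * y)%R))).
  apply: eq_mint => y y0; rewrite /rinv powR_inv1 ?invfM ?invrK //.
  by rewrite mulr_ge0 ?invr_ge0 ?(ltW k0) ?(ltW y0).
 by rewrite (@mint_scale k^-1 (fun y => g (rinv y))) ?invr_gt0.
(* The test function: its inverted integral lies between 1 / 2 and 1, so it can be cancelled. *)
pose w : R -> \bar R := fun y => (\1_(`[1, 2]%classic) (y : R))%:E.
have mw : mfT w by apply/measurable_EFinP; apply: measurable_indic.
have w0 y : 0 <= w y by rewrite lee_fin.
have mwi : mfT (fun y => w (rinv y)) by exact: mcomp.
pose I' (u : R -> \bar R) := mint (fun y => u (rinv y)).
have key (u v : R -> \bar R) : mfT u -> mfT v ->
  (forall y, 0 <= u y) -> (forall y, 0 <= v y) -> mint u * I' v = I' u * I' v.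
 move=> mu' mv u0 v0.
 have mui : mfT (fun y => u (rinv y)) by exact: mcomp.
 have mvi : mfT (fun y => v (rinv y)) by exact: mcomp.
 have I'v0 : 0 <= I' v by apply: integral_ge0 => y _; rewrite mule_ge0 ?wt0.
 have mu0 : 0 <= mint u by apply: integral_ge0 => y _; rewrite mule_ge0 ?wt0.
 have mfst : mfT (fst : RxR R -> _) by exact: measurable_fst.
 have msnd : mfT (snd : RxR R -> _) by exact: measurable_snd.
 have mw1 : mfT (fun p : RxR R => (wt p.1)%:E).
  by apply/measurable_EFinP; exact: (mcomp measurable_wt).
 have mw2 : mfT (fun p : RxR R => (wt p.2)%:E).
  by apply/measurable_EFinP; exact: (mcomp measurable_wt).
 (* Integrated first in the second variable, [f] gives [mint u * I' v] by dilation. For a fixed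
    second variable y, the dilation of the first by y turns [f] into [f2], which integrates to
    [I' u * I' v]. *)
 pose f (p : RxR R) :=
  u (p.2 * rinv p.1)%R * v (rinv p.1) * ((wt p.1)%:E * (wt p.2)%:E).
 pose f2 (p : RxR R) :=
  u (rinv p.1)%R * v (rinv (p.2 * p.1)) * ((wt p.1)%:E * (wt p.2)%:E).
 have mf : mfT f.
  apply: emeasurable_funM; last exact: emeasurable_funM.
  apply: emeasurable_funM; last exact: (mcomp mvi).
  apply: (mcomp mu'); apply: measurable_funM => //.
  exact: (mcomp measurable_rinv).
 have mf2 : mfT f2.
  apply: emeasurable_funM; last exact: emeasurable_funM.
  apply: emeasurable_funM; first exact: (mcomp mui).
  by apply: (mcomp mvi); exact: measurable_funM.
 have w12 p : 0 <= (wt p.1)%:E * (wt p.2)%:E by rewrite mule_ge0 // lee_fin wt_ge0.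
 have f0 p : 0 <= f p by rewrite /f !mule_ge0 // lee_fin wt_ge0.
 have f20 p : 0 <= f2 p by rewrite /f2 !mule_ge0 // lee_fin wt_ge0.
 transitivity (\int[mu]_x \int[mu]_y f (x, y)).
  rewrite /I' {2}/mint -ge0_integralZl //; [|exact: mgw|by move=> y _; rewrite mule_ge0 ?wt0].
  apply: eq_integral => x _; rewrite /f /=.
  have [x0|x0] := ltP 0%R x; last first.
   by rewrite /wt ltNge x0 /= !mule0 integral0_eq // => y _; rewrite mul0e mule0.
  have xi0 : (0 < rinv x)%R by rewrite powR_gt0.
  rewrite -(mint_scale xi0 mu' u0) /mint muleC -ge0_integralZl //.
  - apply: eq_integral => y _; rewrite (mulrC y).
   by rewrite muleCA !muleA.
  - by apply: mgw; apply: (mcomp mu'); exact: measurable_funM.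
  - by move=> y _; rewrite mule_ge0 ?wt0.
  - by rewrite mule_ge0 // lee_fin wt_ge0.
 transitivity (\int[mu]_x \int[mu]_y f2 (x, y)).
  apply: (etrans (@fubini_tonelli _ _ _ _ R mu mu f mf f0)).
  apply: (etrans _ (esym (@fubini_tonelli _ _ _ _ R mu mu f2 mf2 f20))).
  apply: eq_integral => y _; rewrite /f /f2 /=.
  have [y0|y0] := ltP 0%R y; last first.
   by rewrite {2 4}/wt ltNge y0 /=; under eq_integral do rewrite !mule0;
    under [RHS]eq_integral do rewrite !mule0.
  have mA (a b : R -> \bar R) : mfT a -> mfT b ->
    (forall x, 0 <= a x) -> (forall x, 0 <= b x) ->
    \int[mu]_x (a x * b x * ((wt x)%:E * (wt y)%:E)) = mint (fun x => a x * b x) * (wt y)%:E.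
   move=> ma mb a0 b0; rewrite /mint -ge0_integralZr //.
   - by apply: eq_integral => x _; rewrite -!muleA.
   - by apply: mgw; exact: emeasurable_funM.
   - by move=> x _; rewrite !mule_ge0 ?wt0.
  have m1 : mfT (fun x => u (y * rinv x)%R).
   by apply: (mcomp mu'); exact: measurable_funM.
  have m2 : mfT (fun x => v (rinv (y * x))%R).
   by apply: (mcomp mvi); exact: measurable_funM.
  apply: (etrans (mA (fun x => u (y * rinv x)%R) (fun x => v (rinv x)) m1 mvi
   (fun x => u0 _) (fun x => v0 _))).
  apply: (etrans _ (esym (mA (fun x => u (rinv x)) (fun x => v (rinv (y * x)%R)) mui m2
   (fun x => u0 _) (fun x => v0 _)))).
  congr (_ * _).
  rewrite -(@mint_scale y (fun x => u (y * rinv x)%R * v (rinv x))) //.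
  - apply: eq_mint => x x0; congr (u _ * _).
   by rewrite /rinv !powR_inv1 ?mulr_ge0 ?(ltW x0) ?(ltW y0) //; field; rewrite !gt_eqF.
  - exact: emeasurable_funM.
  - by move=> x; rewrite mule_ge0.
 rewrite /I' {1}/mint -ge0_integralZr //; [|exact: mgw|by move=> y _; rewrite mule_ge0 ?wt0].
 apply: eq_integral => x _; rewrite /f2 /=.
 have [x0|x0] := ltP 0%R x; last first.
  rewrite /wt ltNge x0 /= mule0 mul0e integral0_eq // => y _; by rewrite mul0e mule0.
 rewrite -(@mint_scale x (fun y => v (rinv y))) // /mint -ge0_integralZl //.
 - by apply: eq_integral => y _; rewrite (mulrC y) -!muleA; congr (_ * _); rewrite muleCA.
 - by apply: mgw; apply: (mcomp mvi); exact: measurable_funM.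
 - by move=> y _; rewrite mule_ge0 ?wt0.
 - by rewrite mule_ge0 // lee_fin wt_ge0.
pose H : set (measurableTypeR R) := `[2^-1%R, 1%R]%classic.
have mhalf : measurable H by exact: measurable_itv.
have wE y : w (rinv y) * (wt y)%:E = (\1_H y)%:E * (wt y)%:E.
 have [y0|y0] := ltP 0%R y; last by rewrite /wt ltNge y0 /= !mule0.
 have e1 : (1 <= y^-1)%R = (y <= 1)%R by rewrite invf_ge1.
 have e2 : (y^-1 <= 2)%R = (2^-1 <= y)%R.
  by rewrite -[X in (_ <= X)%R]invrK lef_pV2 ?posrE ?invr_gt0.
 congr ((_)%:E * _); rewrite !indicE; congr ((_ : bool)%:R)%R.
 by apply/idP/idP; rewrite !inE /= !in_itv /= /rinv powR_inv1 ?(ltW y0) // e1 e2 => /andP[h1 h2];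
  apply/andP; split.
have wle (y : R) : (y \in `[2^-1%R, 1%R]%R) -> (1 <= wt y <= 2)%R.
 rewrite in_itv /= => /andP[y1 y2]; have y0 : (0 < y)%R by apply: lt_le_trans y1; rewrite invr_gt0.
 by rewrite wtE // invf_ge1 // y2 /= -[leRHS]invrK lef_pV2 ?posrE ?invr_gt0.
have muh : mu H = (2^-1)%:E.
 rewrite /H lebesgue_measure_itv /= lte_fin invf_lt1 // ltr1n /= -EFinB; congr (_%:E); lra.
have ind : \int[mu]_y (\1_H y)%:E = (2^-1)%:E.
 by rewrite integral_indic // setIT.
have m1 : mfT (fun y : measurableTypeR R => (\1_H y)%:E : \bar R).
 by apply/measurable_EFinP; exact: measurable_indic.
have I'E : I' w = \int[mu]_y ((\1_H y)%:E * (wt y)%:E).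
 by apply: eq_integral => y _; exact: wE.
have mH2 : mfT (fun y : measurableTypeR R => (\1_H y)%:E * (wt y)%:E).
 by apply: (emeasurable_funM m1); apply/measurable_EFinP; exact: measurable_wt.
have H0 (y : measurableTypeR R) : 0 <= (\1_H y)%:E :> \bar R by rewrite lee_fin.
have Ilo : (2^-1)%:E <= I' w.
 rewrite -ind I'E; apply: ge0_le_integral => //; try by move=> *; rewrite mule_ge0 ?wt0.
 move=> y _; rewrite indicE; case: (boolP (y \in H)) => yI; last by rewrite mul0e.
 by rewrite mul1e lee_fin; rewrite inE in yI; have /andP[] := wle y yI.
have Ihi : I' w <= 1.
 apply: (@le_trans _ _ (2%:E * \int[mu]_y (\1_H y)%:E)); last first.
  by rewrite ind -EFinM divff.
 rewrite -ge0_integralZl //; rewrite I'E; apply: ge0_le_integral => //; try by move=> *; rewrite mule_ge0 ?wt0 // lee_fin.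
  by apply: emeasurable_funM.
 move=> y _; rewrite indicE; case: (boolP (y \in H)) => yI; last by rewrite mul0e mule0.
 by rewrite mul1e mule1 lee_fin; rewrite inE in yI; have /andP[] := wle y yI.
have [c c0 cE] : exists2 c : R, (0 < c)%R & I' w = c%:E.
 have fin : I' w \is a fin_num.
  by rewrite fin_real // (lt_le_trans _ Ilo) ?ltNyr //= (le_lt_trans Ihi) ?ltry.
 exists (fine (I' w)); last by rewrite fineK.
 by rewrite -lte_fin fineK // (lt_le_trans _ Ilo) // lte_fin invr_gt0.
have := key g w mg mw g0 w0; rewrite cE => /(congr1 (fun z => z * (c^-1)%:E)).
by rewrite -!muleA -EFinM divff ?gt_eqF // !mule1.
Qed.
End LineChanges.

(** * Invariance of the hyperbolic measure under SL_2(R) *)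

Section HyperbolicIntegral.
Context {R : realType}.
Local Notation C := (Cx R).
Local Notation mu := (@lebesgue_measure R).
Local Open Scope ereal_scope.
Implicit Types (phi psi : R * R -> \bar R).

Definition pt (p : R * R) : C := (p.1 +i* p.2)%C.
Definition co (z : C) : R * R := (Re z, Im z).

Lemma ptK p : co (pt p) = p. Proof. by case: p. Qed.
Lemma coK z : pt (co z) = z. Proof. by case: z. Qed.

Definition hw (y : R) : R := (wt y * wt y)%R.

Lemma hw_ge0 y : (0 <= hw y)%R.
Proof. by rewrite mulr_ge0 // wt_ge0. Qed.
Lemma measurable_hw2 : mfT (fun p : RxR R => (hw p.2)%:E).
Proof.
apply/measurable_EFinP.
have h : mfT (fun p : RxR R => wt p.2).
 by apply: (mcomp measurable_wt); exact: measurable_snd.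
exact: measurable_funM.
Qed.

Definition mj phi : Prop :=
 measurable_fun (setT : set (RxR R)) (phi \_ UH).

(* [J phi] is the integral of [phi] over the upper half-plane for [y^-2 dx dy]. *)
Definition J phi : \bar R := \int[leb2]_p ((phi \_ UH) p * (hw p.2)%:E).

Lemma patch_UH_ge0 phi p : (forall p, 0 <= phi p) -> 0 <= (phi \_ UH) p.
Proof. by move=> h; rewrite /patch; case: ifP. Qed.
Lemma mhint phi : mj phi ->
 mfT (fun p : RxR R => (phi \_ UH) p * (hw p.2)%:E).
Proof. by move=> m; apply: emeasurable_funM m measurable_hw2. Qed.
Lemma hint_ge0 phi p : (forall p, 0 <= phi p) -> 0 <= (phi \_ UH) p * (hw p.2)%:E.
Proof. by move=> h; rewrite mule_ge0 ?patch_UH_ge0 // lee_fin hw_ge0. Qed.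
Lemma eq_J phi psi : (forall p, UH p -> phi p = psi p) -> J phi = J psi.
Proof.
move=> h; congr (integral _ _ _); ext => p; congr (_ * _).
by rewrite /patch; case: ifPn => // /set_mem /h.
Qed.

Lemma mj_ext phi psi : (forall p, UH p -> phi p = psi p) -> mj phi -> mj psi.
Proof.
move=> h; rewrite /mj (_ : phi \_ UH = psi \_ UH) //; ext => p.
by rewrite /patch; case: ifPn => // /set_mem /h.
Qed.

Lemma J_ge0 phi : (forall p, 0 <= phi p) -> 0 <= J phi.
Proof. by move=> h; apply: integral_ge0 => p _; exact: hint_ge0. Qed.
Lemma le_J phi psi : mj phi -> mj psi -> (forall p, 0 <= phi p) -> (forall p, 0 <= psi p) ->
 (forall p, UH p -> phi p <= psi p) -> J phi <= J psi.
Proof.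
move=> m1 m2 h1 h2 h; apply: ge0_le_integral => //.
- by move=> p _; exact: hint_ge0.
- exact: mhint.
- exact: mhint.
- move=> p _; apply: lee_wpmul2r; first by rewrite lee_fin hw_ge0.
 by rewrite /patch; case: ifPn => // /set_mem /h.
Qed.

Lemma JZ phi (c : \bar R) : mj phi -> (forall p, 0 <= phi p) -> 0 <= c ->
 J (fun p => c * phi p) = c * J phi.
Proof.
move=> m h c0; rewrite /J -ge0_integralZl //.
- apply: eq_integral => p _; rewrite muleA; congr (_ * _).
 by rewrite /patch; case: ifP => //; rewrite mule0.
- exact: mhint.
- by move=> p _; exact: hint_ge0.
Qed.

Lemma J_nneseries (phi : nat -> R * R -> \bar R) : (forall n, mj (phi n)) ->
 (forall n p, 0 <= phi n p) ->
 J (fun p => \sum_(0 <= n <oo) phi n p) = \sum_(0 <= n <oo) J (phi n).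
Proof.
move=> m h; rewrite /J -integral_nneseries //.
- apply: eq_integral => p _; rewrite /patch; case: ifP => _.
  by rewrite muleC -nneseriesZl // ; apply: eq_eseriesr => n _; rewrite muleC.
 by rewrite mul0e eseries0 // => n _ _; rewrite mul0e.
- by move=> n; exact: mhint.
- by move=> n p _; exact: hint_ge0.
Qed.

Lemma J_iter phi : mj phi -> (forall p, 0 <= phi p) ->
 J phi = \int[mu]_y \int[mu]_x ((phi \_ UH) (x, y) * (hw y)%:E).
Proof.
move=> m h; rewrite /J.
have h0 p : 0 <= (fun p => (phi \_ UH) p * (hw p.2)%:E) p by exact: hint_ge0.
apply: (etrans (@fubini_tonelli1 _ _ _ _ R mu mu _ (mhint m) h0)).
exact: (@fubini_tonelli _ _ _ _ R mu mu _ (mhint m) h0).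
Qed.

Let affT (a b : R) (p : R * R) : R * R := (a * p.1 + b, a * p.2)%R.

Let measurable_affT a b : mfT
 (affT a b : RxR R -> RxR R).
Proof.
by apply/measurable_fun_pairP; split; rewrite /comp /affT /=; last exact: measurable_funM;
 apply: measurable_funD => //; exact: measurable_funM.
Qed.

Let affT_UH a b phi : (0 < a)%R -> (phi \o affT a b) \_ UH = (phi \_ UH) \o affT a b.
Proof.
move=> a0; ext => p; rewrite /patch /=.
by congr (if _ then _ else _); apply/idP/idP; rewrite !inE /UH /= pmulr_rgt0.
Qed.

Lemma mj_aff a b phi : (0 < a)%R -> mj phi -> mj (phi \o affT a b).
Proof. by move=> a0 m; rewrite /mj affT_UH //; exact: (mcomp m (measurable_affT a b)). Qed.
Lemma J_aff a b phi : (0 < a)%R -> mj phi -> (forall p, 0 <= phi p) ->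
 J (phi \o affT a b) = J phi.
Proof.
move=> a0 m h; rewrite (J_iter (mj_aff b a0 m) (fun p => h _)) (J_iter m h).
have h0 p : 0 <= (fun p => (phi \_ UH) p * (hw p.2)%:E) p by exact: hint_ge0.
have mG := @measurable_fun_fubini_tonelli_G _ _ _ _ R mu _ (mhint m) h0.
have G0 y : 0 <= \int[mu]_x ((phi \_ UH) (x, y) * (hw y)%:E).
 by apply: integral_ge0 => x _; exact: (h0 (x, y)).
apply: (etrans _ (@integral_affine _ a 0 _ a0 mG G0)).
apply: eq_integral => y _; rewrite addr0 /fubini_G /=.
have mx : mfT (fun x => (phi \_ UH) (x, a * y)%R * (hw (a * y)%R)%:E).
 exact: (@measurable_fun_pair1 _ _ _ _ _ _ _ (a * y)%R (mhint m)).
rewrite -(@integral_affine _ a b (fun x => (phi \_ UH) (x, a * y)%R * (hw (a * y)%R)%:E) a0 mx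
 (fun x => h0 (x, a * y)%R)).
rewrite -ge0_integralZr //.
- apply: eq_integral => x _; rewrite affT_UH //= /affT /= -!muleA; congr (_ * _).
 rewrite /hw /wt pmulr_rgt0 //; case: ifP => y0; last by rewrite !mul0r mul0e.
 rewrite -!EFinM !powR_inv1 ?mulr_ge0 ?(ltW a0) ?(ltW y0) //; congr (_%:E); field.
 by rewrite !gt_eqF.
- apply: emeasurable_funM => //.
 exact: (mcomp mx (measurable_affine a b)).
- by move=> x _; rewrite mule_ge0 ?(h0 (a * x + b, a * y)%R) // lee_fin ltW.
- by rewrite lee_fin ltW.
Qed.

Lemma mj_cone phi : mj phi -> mfT
 (fun q : RxR R => (phi \_ UH) (q.1 * q.2, q.2)%R).
Proof.
move=> m; apply: (mcomp m (g := fun q : RxR R =>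
 ((q.1 * q.2, q.2)%R : RxR R))).
apply/measurable_fun_pairP; split; rewrite /comp /=; last exact: measurable_snd.
by apply: measurable_funM; [exact: measurable_fst|exact: measurable_snd].
Qed.

(* In the coordinates [t = x / y] and [y] the hyperbolic measure is [dt dy / y]. *)
Lemma J_cone phi : mj phi -> (forall p, 0 <= phi p) ->
 J phi = \int[mu]_t mint (fun y => (phi \_ UH) (t * y, y)%R).
Proof.
move=> m h; rewrite (J_iter m h).
pose f (q : RxR R) := (phi \_ UH) (q.1 * q.2, q.2)%R * (wt q.2)%:E.
have mf : mfT f.
 apply: emeasurable_funM; first exact: mj_cone.
 apply/measurable_EFinP; apply: (mcomp measurable_wt); exact: measurable_snd.
have f0 q : 0 <= f q by rewrite mule_ge0 ?patch_UH_ge0 // lee_fin wt_ge0.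
apply: (etrans _ (esym (@fubini_tonelli _ _ _ _ R mu mu f mf f0))).
apply: eq_integral => y _; rewrite /f /=.
have [y0|y0] := ltP 0%R y; last first.
 rewrite !integral0_eq // => x _; first by rewrite /wt ltNge y0 mule0.
 by rewrite /hw /wt ltNge y0 mul0r mule0.
have h0 p : 0 <= (fun p => (phi \_ UH) p * (hw p.2)%:E) p by exact: hint_ge0.
rewrite -(@integral_affine _ y 0 (fun x => (phi \_ UH) (x, y) * (hw y)%:E) y0
 (@measurable_fun_pair1 _ _ _ _ _ _ _ y (mhint m)) (fun x => h0 (x, y))).
apply: eq_integral => x _; rewrite addr0 -muleA (mulrC y); congr (_ * _).
rewrite -EFinM /hw !wtE //; congr (_%:E); field; by rewrite gt_eqF.
Qed.

(** The map z -> -1/z in real coordinates. The inverse of the squared modulus is a real power, which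
    makes the map measurable on the whole plane. *)
Let invT (p : R * R) : R * R :=
 (- (p.1 * (p.1 * p.1 + p.2 * p.2) `^ (-1)), p.2 * (p.1 * p.1 + p.2 * p.2) `^ (-1))%R.

Let measurable_invT : mfT
 (invT : RxR R -> RxR R).
Proof.
have mr : mfT (fun p : RxR R =>
  ((p.1 * p.1 + p.2 * p.2) `^ (-1))%R).
 apply: (mcomp (measurable_powR (-1))).
 by apply: measurable_funD; apply: measurable_funM.
apply/measurable_fun_pairP; split; rewrite /comp /invT /=; last exact: measurable_funM.
by apply: mcomp => //; exact: measurable_funM.
Qed.

Let nrm_gt0 (p : R * R) : UH p -> (0 < p.1 * p.1 + p.2 * p.2)%R.
Proof. by move=> p0; rewrite ltr_wpDl ?mulr_gt0 // -expr2 sqr_ge0. Qed.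

Let invT_UH phi : (phi \o invT) \_ UH = (phi \_ UH) \o invT.
Proof.
ext => p; rewrite /patch /=.
congr (if _ then _ else _); apply/idP/idP; rewrite !inE => h.
 by rewrite /UH /= mulr_gt0 // powR_gt0 // nrm_gt0.
move: h; rewrite /UH /= => h; rewrite -(@pmulr_lgt0 _ ((p.1 * p.1 + p.2 * p.2) `^ (-1))) //.
rewrite lt_neqAle powR_ge0 andbT; apply: contraTneq h => <-.
by rewrite mulr0 ltxx.
Qed.

Lemma mj_invT phi : mj phi -> mj (phi \o invT).
Proof. by move=> m; rewrite /mj invT_UH; exact: (mcomp m measurable_invT). Qed.
(** In the coordinates t = x / y and y, the inversion reads t -> -t and y -> (1 + t^2)^-1 / y. The
    reflection preserves dt, and for fixed t the second map preserves dy / y. *)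
Lemma J_invT phi : mj phi -> (forall p, 0 <= phi p) -> J (phi \o invT) = J phi.
Proof.
move=> m h; rewrite (J_cone (mj_invT m) (fun p => h _)) (J_cone m h).
pose H t := mint (fun y => (phi \_ UH) (t * y, y)%R).
have mH : mfT H.
 have mf : mfT (fun q : RxR R =>
   (phi \_ UH) (q.1 * q.2, q.2)%R * (wt q.2)%:E).
  apply: emeasurable_funM; first exact: mj_cone.
  apply/measurable_EFinP; apply: (mcomp measurable_wt); exact: measurable_snd.
 apply: (@measurable_fun_fubini_tonelli_F _ _ _ _ R mu _ mf) => q.
 by rewrite mule_ge0 ?patch_UH_ge0 // lee_fin wt_ge0.
have H0 t : 0 <= H t.
 by apply: integral_ge0 => y _; rewrite mule_ge0 ?patch_UH_ge0 // lee_fin wt_ge0.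
rewrite -[RHS](integral_reflect mH H0); apply: eq_integral => t _.
have k0 : (0 < (1 + t * t)^-1)%R by rewrite invr_gt0 ltr_pwDl // -expr2 sqr_ge0.
rewrite /H -(@mint_inv _ _ (fun y => (phi \_ UH) (- t * y, y)%R) k0).
- apply: eq_mint => y y0; rewrite invT_UH /=; congr ((phi \_ UH) _); rewrite /invT /=.
 have d0 : (0 < t * y * (t * y) + y * y)%R by exact: (nrm_gt0 (p := (t * y, y)%R)).
 have t0 : (0 < 1 + t * t)%R by rewrite -invr_gt0.
 rewrite powR_inv1 ?(ltW d0) //; congr (_, _); field; rewrite ?(gt_eqF y0) ?(gt_eqF t0) ?(gt_eqF d0) //.
- apply: (mcomp (mj_cone m) (g := fun y : measurableTypeR R => ((- t)%R : measurableTypeR R, y))).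
 exact: pair1_measurable.
- by move=> y; exact: patch_UH_ge0.
Qed.

Local Open Scope ring_scope.

Definition mobR (g : 'M[R]_2) (p : R * R) : R * R := co (mob g (pt p)).

Let pt_invT (p : R * R) : UH p -> pt (invT p) = (- (pt p)^-1)%R.
Proof.
move=> p0; have d0 := nrm_gt0 p0.
have z0 : (pt p != 0)%R.
 by apply: contraTneq p0 => /(congr1 (@complex.Im R)) /= h; rewrite /UH /= h ltxx.
apply: (mulfI z0); rewrite mulrN divff //; apply: cx_eq.
 by rewrite ReM /= powR_inv1 ?(ltW d0) //; field; rewrite gt_eqF.
by rewrite ImM /= powR_inv1 ?(ltW d0) //; field; rewrite gt_eqF.
Qed.

Let mobR_c0 (g : 'M[R]_2) (p : R * R) : \det g = 1%R -> g 1 0 = 0%R ->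
 mobR g p = affT (g 0 0 * g 0 0)%R (g 0 1 * g 0 0)%R p.
Proof.
rewrite det22 => dg c0; move: dg; rewrite c0 mulr0 subr0 => ad.
have a0 : g 0 0 != 0%R by apply: contra_eq_neq ad => ->; rewrite mul0r eq_sym oner_eq0.
have dE : g 1 1 = (g 0 0)^-1%R by apply: (mulfI a0); rewrite ad divff.
rewrite /mobR /mob /mob_den /mob_num c0 dE rmorph0 mul0r add0r fmorphV /= invrK.
by rewrite /co !(ReM, ImM, ReD, ImD) /= /affT; congr (_, _); ring.
Qed.

(** Bruhat decomposition: g z = a / c - 1 / (c^2 z + c d). *)
Let mobR_c (g : 'M[R]_2) (p : R * R) : \det g = 1%R -> g 1 0 != 0%R -> UH p ->
 mobR g p = affT 1 (g 0 0 / g 1 0)%R (invT (affT (g 1 0 * g 1 0)%R (g 1 0 * g 1 1)%R p)).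
Proof.
move=> dg c0 p0; have cc : (0 < g 1 0 * g 1 0)%R by rewrite -expr2 exprn_even_gt0.
set q := affT _ _ p; have q0 : UH q by rewrite /UH /= pmulr_rgt0.
have m0 := mob_den_neq0 dg (p0 : (0 < Im (pt p))%R).
have c0' : toC (g 1 0) != 0%R by rewrite -(rmorph0 (@toC R)) (inj_eq (@toC_inj R)).
have qE : pt q = (toC (g 1 0) * mob_den g (pt p))%R.
 by apply: cx_eq; rewrite /mob_den !(ReM, ImM, ReD, ImD) /=; ring.
have : mob g (pt p) = (toC (g 0 0 / g 1 0) + pt (invT q))%R.
 rewrite pt_invT // qE /mob; apply: (mulIf m0); rewrite divfK // mulrDl.
 have : toC (\det g) = 1%R by rewrite dg rmorph1.
 rewrite det22 rmorphB !rmorphM fmorphV /= => dE.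
 have -> : - (toC (g 1 0) * mob_den g (pt p))^-1 * mob_den g (pt p) = - (toC (g 1 0))^-1.
  by field; rewrite c0' m0.
 apply: (mulIf c0'); rewrite /mob_num /mob_den.
 set z := pt p; set A := toC (g 0 0) in dE *; set B := toC (g 0 1) in dE *.
 set c := toC (g 1 0) in dE c0' *; set D := toC (g 1 1) in dE *.
 have -> : (A / c * (c * z + D) + - c^-1) * c = A * (c * z + D) - 1 by field.
 by rewrite -dE; ring.
rewrite /mobR => ->; rewrite /co ReD ImD /= /affT /=; congr (_, _); ring.
Qed.

Lemma J_mob (g : 'M[R]_2) phi : \det g = 1 -> mj phi -> (forall p, (0 <= phi p)%E) ->
 mj (phi \o mobR g) /\ J (phi \o mobR g) = J phi.
Proof.
move=> dg m h; have [c0|c0] := eqVneq (g 1 0) 0%R.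
 have -> : phi \o mobR g = phi \o affT (g 0 0 * g 0 0)%R (g 0 1 * g 0 0)%R.
  by ext => p /=; rewrite mobR_c0.
 have a0 : (0 < g 0 0 * g 0 0)%R.
  rewrite -expr2 exprn_even_gt0 //=; move: dg; rewrite det22 c0 mulr0 subr0 => ad.
  by apply: contra_eq_neq ad => ->; rewrite mul0r eq_sym oner_eq0.
 by split; [exact: mj_aff|exact: J_aff].
have cc : (0 < g 1 0 * g 1 0)%R by rewrite -expr2 exprn_even_gt0.
pose psi := ((phi \o affT 1 (g 0 0 / g 1 0)%R) \o invT) \o
  affT (g 1 0 * g 1 0)%R (g 1 0 * g 1 1)%R.
have E p : UH p -> psi p = (phi \o mobR g) p by move=> p0; rewrite /psi /= mobR_c.
have m1 := mj_aff (g 0 0 / g 1 0)%R (@ltr01 R) m.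
have m2 := mj_invT m1.
split; first by apply: (mj_ext E); exact: (mj_aff _ cc m2).
apply: (etrans (esym (eq_J E))); apply: (etrans (J_aff _ cc m2 (fun p => h _))).
by apply: (etrans (J_invT m1 (fun p => h _))); exact: J_aff.
Qed.
End HyperbolicIntegral.

(** * The displacement of a matrix and the commutator estimate *)

Section MatrixDisplacement.
Context {R : realType}.
Local Notation C := (Cx R).
Implicit Types (A B g : 'M[R]_2).

Lemma mx22P (A B : 'M[R]_2) : A 0 0 = B 0 0 -> A 0 1 = B 0 1 -> A 1 0 = B 1 0 ->
 A 1 1 = B 1 1 -> A = B.
Proof.
move=> h1 h2 h3 h4; apply/matrixP => i j.
have ord2 (k : 'I_2) : k = 0 \/ k = 1.
 by case: k => -[|[|//]] hk; [left|right]; exact/val_inj.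
by case: (ord2 i) => ->; case: (ord2 j) => ->.
Qed.

(** Twice the squared Frobenius norm of the trace-free part of A. It ignores scalars, so on SL_2 it
    measures the distance from both 1 and -1. *)
Definition nn A : R := (A 0 0 - A 1 1) ^+ 2 + 2 * A 0 1 ^+ 2 + 2 * A 1 0 ^+ 2.
Definition fro A : R := A 0 0 ^+ 2 + A 0 1 ^+ 2 + A 1 0 ^+ 2 + A 1 1 ^+ 2.
Definition adj2 A : 'M[R]_2 := mx22 (A 1 1) (- A 0 1) (- A 1 0) (A 0 0).

Definition central A : Prop := A = 1%:M \/ A = - 1%:M.

Lemma mx22E (a b c d : R) : (mx22 a b c d 0 0 = a) * (mx22 a b c d 0 1 = b) *
 (mx22 a b c d 1 0 = c) * (mx22 a b c d 1 1 = d).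
Proof. by rewrite !mxE. Qed.
Lemma mx1E : ((1%:M : 'M[R]_2) 0 0 = 1) * ((1%:M : 'M[R]_2) 0 1 = 0) *
 ((1%:M : 'M[R]_2) 1 0 = 0) * ((1%:M : 'M[R]_2) 1 1 = 1).
Proof. by rewrite !mxE. Qed.
Lemma mulmx_adj2 A : \det A = 1 -> A *m adj2 A = 1%:M.
Proof.
by rewrite det22 => dA; apply: mx22P; rewrite mulmx22 !mx22E mx1E -?dA; ring.
Qed.

Lemma invmx_adj2 A : \det A = 1 -> invmx A = adj2 A.
Proof.
move=> dA; have uA : A \in unitmx by rewrite unitmxE dA unitr1.
by rewrite -[RHS]mul1mx -(mulVmx uA) -mulmxA mulmx_adj2 // mulmx1.
Qed.

Lemma det_adj2 A : \det (adj2 A) = \det A.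
Proof. rewrite !det22 !mx22E; ring. Qed.
Lemma fro_adj2 A : fro (adj2 A) = fro A.
Proof. rewrite /fro !mx22E; ring. Qed.
Lemma fro_ge0 A : 0 <= fro A.
Proof. by rewrite !addr_ge0 ?sqr_ge0. Qed.
Lemma nn_ge0 A : 0 <= nn A.
Proof.
rewrite /nn; have := sqr_ge0 (A 0 0 - A 1 1); have := sqr_ge0 (A 0 1).
by have := sqr_ge0 (A 1 0); lra.
Qed.

Let cs2 (a b x y : R) : (a * x + b * y) ^+ 2 <= (a ^+ 2 + b ^+ 2) * (x ^+ 2 + y ^+ 2).
Proof. by have := sqr_ge0 (a * y - b * x); nra. Qed.

Lemma froM A B : fro (A *m B) <= fro A * fro B.
Proof.
rewrite /fro !mulmx22.
have h1 := cs2 (A 0 0) (A 0 1) (B 0 0) (B 1 0).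
have h2 := cs2 (A 0 0) (A 0 1) (B 0 1) (B 1 1).
have h3 := cs2 (A 1 0) (A 1 1) (B 0 0) (B 1 0).
have h4 := cs2 (A 1 0) (A 1 1) (B 0 1) (B 1 1).
rewrite [leRHS](_ : _ = (A 0 0 ^+ 2 + A 0 1 ^+ 2) * (B 0 0 ^+ 2 + B 1 0 ^+ 2)
 + (A 0 0 ^+ 2 + A 0 1 ^+ 2) * (B 0 1 ^+ 2 + B 1 1 ^+ 2)
 + (A 1 0 ^+ 2 + A 1 1 ^+ 2) * (B 0 0 ^+ 2 + B 1 0 ^+ 2)
 + (A 1 0 ^+ 2 + A 1 1 ^+ 2) * (B 0 1 ^+ 2 + B 1 1 ^+ 2)); last ring.
by rewrite !lerD.
Qed.

Lemma fro_le A : \det A = 1 -> fro A <= nn A + 2.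
Proof.
rewrite det22 /fro /nn => dA; have := sqr_ge0 (A 0 1 - A 1 0).
have := sqr_ge0 (A 0 1); have := sqr_ge0 (A 1 0).
have := sqr_ge0 (A 0 0 - A 1 1); nra.
Qed.

Lemma nn_le_fro A : nn A <= 2 * fro A.
Proof. rewrite /nn /fro; have := sqr_ge0 (A 0 0 + A 1 1); nra. Qed.
Lemma nn_sub1 A : nn (A - 1%:M) = nn A.
Proof. by rewrite /nn !mxE /=; ring. Qed.
Lemma trace_sqr_ge A : \det A = 1 -> 4 - nn A <= (A 0 0 + A 1 1) ^+ 2.
Proof.
rewrite det22 /nn => dA; have := sqr_ge0 (A 0 1 + A 1 0).
have := sqr_ge0 (A 0 0 - A 1 1); nra.
Qed.

(** The trace is unchanged by conjugation, so an element whose squared trace differs from 4 has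
    displacement at least |tr^2 - 4| at every point of the half-plane. *)
Lemma trace_sqr_sub4_le A : \det A = 1 -> `|(A 0 0 + A 1 1) ^+ 2 - 4| <= nn A.
Proof.
rewrite det22 /nn => dA; rewrite ler_norml.
have := sqr_ge0 (A 0 1 + A 1 0); have := sqr_ge0 (A 0 1 - A 1 0).
have := sqr_ge0 (A 0 0 - A 1 1) => h1 h2 h3; apply/andP; split; nra.
Qed.

Lemma nn_eq0 A : \det A = 1 -> nn A = 0 -> central A.
Proof.
rewrite det22 /nn => dA h.
have h1 := sqr_ge0 (A 0 0 - A 1 1); have h2 := sqr_ge0 (A 0 1); have h3 := sqr_ge0 (A 1 0).
have /eqP : (A 0 0 - A 1 1) ^+ 2 = 0 by lra.
have /eqP : A 0 1 ^+ 2 = 0 by lra.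
have /eqP : A 1 0 ^+ 2 = 0 by lra.
rewrite !sqrf_eq0 subr_eq0 => /eqP c0 /eqP b0 /eqP ad.
move: dA; rewrite b0 mul0r subr0 ad -expr2 => /eqP; rewrite sqrf_eq1 => /orP[] /eqP d1.
 by left; apply: mx22P; rewrite mx1E ?ad.
by right; apply: mx22P; rewrite ?b0 ?c0 ?ad ?d1 !mxE /= ?oppr0.
Qed.

Lemma central_nn A : central A -> nn A = 0.
Proof. by case=> ->; rewrite /nn !mxE /=; ring. Qed.

(** The cross product of the trace-free parts vanishes; its three components are the entries of the
    commutator A B - B A. *)
Definition parallel A B : Prop := [/\ A 0 1 * B 1 0 = B 0 1 * A 1 0,
 (A 0 0 - A 1 1) * B 0 1 = (B 0 0 - B 1 1) * A 0 1 &
 A 1 0 * (B 0 0 - B 1 1) = B 1 0 * (A 0 0 - A 1 1)].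

(** Scalars cancel in A B - B A, so only the trace-free parts enter; the bound then compares squares
    of 2 x 2 minors with products of sums of squares. *)
Lemma fro_comm_le A B : fro (A *m B - B *m A) <= nn A * nn B.
Proof.
have subE (X Y : 'M[R]_2) i j : (X - Y) i j = X i j - Y i j by rewrite !mxE.
rewrite /fro /nn !subE !mulmx22.
set a := A 0 0; set b := A 0 1; set c := A 1 0; set d := A 1 1.
set a' := B 0 0; set b' := B 0 1; set c' := B 1 0; set d' := B 1 1.
pose p := a - d; pose p' := a' - d'.
have -> : (a * a' + b * c' - (a' * a + b' * c)) ^+ 2 +
  (a * b' + b * d' - (a' * b + b' * d)) ^+ 2 +
  (c * a' + d * c' - (c' * a + d' * c)) ^+ 2 +
  (c * b' + d * d' - (c' * b + d' * d)) ^+ 2 =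
  2 * (b * c' - b' * c) ^+ 2 + (p * b' - p' * b) ^+ 2 + (p' * c - p * c') ^+ 2.
 by rewrite /p /p'; ring.
rewrite -/p -/p'.
have := sqr_ge0 (b * c' + b' * c); have := sqr_ge0 (p * b' + p' * b).
have := sqr_ge0 (p' * c + p * c').
have h1 : 0 <= (p * p') ^+ 2 by exact: sqr_ge0.
have h2 : 0 <= (b * b') ^+ 2 by exact: sqr_ge0.
have h3 : 0 <= (c * c') ^+ 2 by exact: sqr_ge0.
have h4 : 0 <= (b * c') ^+ 2 by exact: sqr_ge0.
have h5 : 0 <= (c * b') ^+ 2 by exact: sqr_ge0.
nra.
Qed.

(** Since K - 1 = (A B - B A) A^-1 B^-1, the displacement of the commutator K is of second order: at
    most 2 nn A nn B (21 / 10)^2, which is below nn A when nn B < 1 / 10. A central K is 1, and then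
    A and B commute, or -1, which is excluded because K - 1 would have squared norm 8. *)
Lemma nn_commutator A B : \det A = 1 -> \det B = 1 -> nn A < 1 / 10 -> nn B < 1 / 10 ->
 nn (A *m B *m adj2 A *m adj2 B) <= 99 / 100 * nn A /\
 (central (A *m B *m adj2 A *m adj2 B) -> parallel A B).
Proof.
move=> dA dB nA nB; set K := A *m B *m adj2 A *m adj2 B.
have E : K - 1%:M = (A *m B - B *m A) *m (adj2 A *m adj2 B).
 rewrite mulmxBl /K !mulmxA; congr (_ - _).
 by rewrite -(mulmxA B A) mulmx_adj2 // mulmx1 mulmx_adj2.
have A0 := nn_ge0 A; have B0 := nn_ge0 B.
have f1 : fro (K - 1%:M) <= nn A * nn B * ((nn A + 2) * (nn B + 2)).
 rewrite E; apply: le_trans (froM _ _) _; apply: ler_pM; rewrite ?fro_ge0 ?fro_comm_le //.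
 apply: le_trans (froM _ _) _; rewrite !fro_adj2.
 by apply: ler_pM; rewrite ?fro_ge0 ?fro_le.
have f2 : nn A * nn B * ((nn A + 2) * (nn B + 2)) <= 495 / 1000 * nn A.
 rewrite -mulrA mulrC ler_wpM2r //.
 have : (nn A + 2) * (nn B + 2) <= (21 / 10) * (21 / 10) by apply: ler_pM; lra.
 have h : 0 <= (nn A + 2) * (nn B + 2) by rewrite mulr_ge0; lra.
 have : nn B * ((nn A + 2) * (nn B + 2)) <= 1 / 10 * ((21 / 10) * (21 / 10)).
  by apply: ler_pM => //; [lra|apply: ler_pM; lra].
 lra.
split.
 rewrite -nn_sub1; apply: le_trans (nn_le_fro _) _; lra.
case=> KE.
 have /eqP : (A *m B - B *m A) *m (adj2 A *m adj2 B) = 0 by rewrite -E KE subrr.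
 move=> /eqP h; have : A *m B - B *m A = 0.
  have dM : \det (adj2 A *m adj2 B) = 1 by rewrite det_mulmx !det_adj2 dA dB mulr1.
  by have := congr1 (mulmx^~ (adj2 (adj2 A *m adj2 B))) h;
   rewrite /= -mulmxA mulmx_adj2 // mulmx1 mul0mx.
 move=> /eqP; rewrite subr_eq0 => /eqP/matrixP AB.
 have := AB 0 0; have := AB 0 1; have := AB 1 0; rewrite !mulmx22 => h1 h2 h3.
 by split; lra.
suff : 8 <= fro (K - 1%:M) by lra.
by rewrite KE /fro !mxE /=; lra.
Qed.

(* Conjugation by the affine map sending [i] to [x + i y]. *)
Definition cjm (x y : R) A : 'M[R]_2 :=
 mx22 (A 0 0 - A 1 0 * x) ((A 0 1 + (A 0 0 - A 1 1) * x - A 1 0 * x ^+ 2) / y)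
    (A 1 0 * y) (A 1 1 + A 1 0 * x).

Lemma cjmM x y A B : y != 0 -> cjm x y (A *m B) = cjm x y A *m cjm x y B.
Proof. by move=> y0; apply: mx22P; rewrite !(mulmx22, mx22E); field. Qed.
Lemma cjm1 x y : cjm x y 1%:M = 1%:M.
Proof. by apply: mx22P; rewrite !(mx1E, mx22E); ring. Qed.
Lemma cjm_adj2 x y A : cjm x y (adj2 A) = adj2 (cjm x y A).
Proof. by apply: mx22P; rewrite !mx22E; ring. Qed.
Lemma det_cjm x y A : y != 0 -> \det (cjm x y A) = \det A.
Proof. by move=> y0; rewrite !det22 !mx22E; field. Qed.
Lemma cjm_central x y A : y != 0 -> central (cjm x y A) <-> central A.
Proof.
move=> y0; split=> -[] h.
- left; move/matrixP : h => h; have := h 0 0; have := h 0 1; have := h 1 0; have := h 1 1.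
 rewrite !mx22E !mx1E => h11 /eqP + + h00.
 rewrite mulf_eq0 (negbTE y0) orbF => /eqP c0; rewrite c0 in h11 h00 *.
 rewrite !mul0r subr0 addr0 in h11 h00 *; rewrite h11 h00 subrr mul0r subr0 addr0.
 move=> /eqP; rewrite mulf_eq0 invr_eq0 (negbTE y0) orbF => /eqP b0.
 by apply: mx22P; rewrite mx1E.
- right; move/matrixP : h => h; have := h 0 0; have := h 0 1; have := h 1 0; have := h 1 1.
 rewrite !mx22E !mxE /= oppr0 => h11 /eqP + + h00.
 rewrite mulf_eq0 (negbTE y0) orbF => /eqP c0; rewrite c0 in h11 h00 *.
 rewrite !mul0r subr0 addr0 in h11 h00 *; rewrite h11 h00 subrr mul0r subr0 addr0.
 move=> /eqP; rewrite mulf_eq0 invr_eq0 (negbTE y0) orbF => /eqP b0.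
 by apply: mx22P; rewrite ?h11 ?h00 ?b0 ?c0 !mxE /= ?oppr0.
- by left; rewrite h cjm1.
- by right; rewrite h; apply: mx22P; rewrite !mx22E !mxE /=; ring.
Qed.

Definition nz (z : C) A : R := nn (cjm (Re z) (Im z) A).

Lemma nz_ge0 z A : 0 <= nz z A. Proof. exact: nn_ge0. Qed.

(* The displacement [4 cosh d(z, A z) - (\tr A)^2]. *)
Lemma nzE (z : C) A : Im z != 0 -> \det A = 1 ->
 nz z A = 4 - (A 0 0 + A 1 1) ^+ 2 +
  2 * cabs (toC (A 1 0) * z ^+ 2 + toC (A 1 1 - A 0 0) * z - toC (A 0 1)) ^+ 2
   / Im z ^+ 2.
Proof.
have ReC (r : R) : Re (toC r) = r by [].
have ImC (r : R) : Im (toC r) = 0 by [].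
rewrite det22 /nz /nn !mx22E cabs_sqr (expr2 z) => y0 dA.
rewrite !(ReD, ReN, ImD, ImN, ReM, ImM) !(ReC, ImC).
have -> : 4 = 4 * (A 0 0 * A 1 1 - A 0 1 * A 1 0) by rewrite dA mulr1.
by field.
Qed.

Lemma Im_mob (z : C) g : 0 < Im z -> \det g = 1 ->
 Im (mob g z) = Im z / cabs (mob_den g z) ^+ 2.
Proof.
move=> z0 dg; have d0 := mob_den_neq0 dg z0; move: dg; rewrite det22 => dg.
rewrite /mob (_ : mob_num g z / mob_den g z =
  toC (cabs (mob_den g z) ^+ 2)^-1 * (mob_num g z * (mob_den g z)^*)); last first.
 rewrite fmorphV rmorphXn /= toC_cabs normCK.
 have dc0 : (mob_den g z)^* != 0 by rewrite conjC_eq0.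
 by field; rewrite ?d0 ?dc0.
rewrite ImM /= mul0r addr0 mulrC; congr (_ * _).
rewrite ImM Re_conj Im_conj /mob_num /mob_den !(ReD, ImD, ReM, ImM) /=.
transitivity ((g 0 0 * g 1 1 - g 0 1 * g 1 0) * Im z); first by ring.
by rewrite dg mul1r.
Qed.

(** By [nzE] the displacement is the trace term plus the modulus of the quadratic form c z^2 + (d -
    a) z - b over Im z. The form of g^-1 A g at z is the form of A at g z times the square of the
    denominator of g at z, which is compensated by the change of Im z. *)
Lemma nz_conj (z : C) g A : 0 < Im z -> \det g = 1 -> \det A = 1 ->
 nz (mob g z) A = nz z (adj2 g *m A *m g).
Proof.
move=> z0 dg dA; have d0 := mob_den_neq0 dg z0.
have w0 := mob_Im dg z0.
have dB : \det (adj2 g *m A *m g) = 1 by rewrite !det_mulmx det_adj2 dg dA !mulr1.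
rewrite !nzE ?gt_eqF //; congr (4 - _ + _).
 move: dg; rewrite det22 => dg; congr (_ ^+ 2); rewrite !(mulmx22, mx22E).
 transitivity ((A 0 0 + A 1 1) * (g 0 0 * g 1 1 - g 0 1 * g 1 0)); last ring.
 by rewrite dg mulr1.
set q := toC ((adj2 g *m A *m g) 1 0) * _ + _ - _.
set q1 := toC (A 1 0) * _ + _ - _.
have qE : q1 * mob_den g z ^+ 2 = q.
 rewrite /q /q1 /mob; set n := mob_num g z; set D := mob_den g z in d0 *.
 rewrite (_ : _ * D ^+ 2 = toC (A 1 0) * n ^+ 2 + toC (A 1 1 - A 0 0) * (n * D) -
   toC (A 0 1) * D ^+ 2); last by field.
 rewrite /n /D /mob_num /mob_den !(mulmx22, mx22E) !(rmorphD, rmorphB, rmorphM, rmorphN) /=; ring.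
have ImE := Im_mob z0 dg.
rewrite ImE -qE cabsM cabsX; field.
by rewrite gt_eqF // gt_eqF // cabs_gt0.
Qed.
End MatrixDisplacement.

(** * In a discrete group, elements close to the center in matrix norm are central *)

Section Discreteness.
Context {R : realType}.
Local Notation C := (Cx R).
Implicit Types (G P : set (metap R)) (s t g : metap R) (z w : uhp R).

Lemma cder_unique (f : C -> C) (z l k : C) : cder f z l -> cder f z k -> l = k.
Proof.
move=> hl hk; apply/eqP; rewrite -subr_eq0 -cabs_eq0 eq_le cabs_ge0 andbT.
apply/ler_addgt0Pr => e e0; rewrite add0r; have e2 : 0 < e / 2 by rewrite divr_gt0.
have [d d0 hd] := hl _ e2; have [d' d0' hd'] := hk _ e2.
pose r := Num.min d d' / 2; have r0 : 0 < r by rewrite divr_gt0 // lt_min d0.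
have rl : r < Num.min d d' by rewrite gtr_pMr ?lt_min ?d0 // invf_lt1 // ltr1n.
move: rl; rewrite lt_min => /andP[r1 r2].
have cr : cabs (id (toC r)) = r by rewrite /= cabs_toC ger0_norm // ltW.
have := hd (toC r); have := hd' (toC r); rewrite cr => /(_ r2) h1 /(_ r1) h2.
rewrite -(@ler_pM2r _ r) // -{1}cr -cabsM /=.
rewrite (_ : (l - k) * toC r = (f (z + toC r) - f z - k * toC r) - (f (z + toC r) - f z - l * toC r)); last ring.
by rewrite (le_trans (cabsB _ _)) // (splitr e) mulrDl lerD.
Qed.

Lemma holo_cder (f : uhp R -> C) (hf : holomorphic f) z : exists l, cder (uext f) (uval z) l.
Proof. exact: derivable_cder (hf z). Qed.
Lemma uext_val (f : uhp R -> C) (v : C) (v0 : 0 < Im v) : uext f v = f (UHP v0).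
Proof. by rewrite -[v]/(uval (UHP v0)) uextE. Qed.
Lemma uhp_segment z w (t : R) : 0 <= t <= 1 ->
 0 < Im (uval z + toC t * (uval w - uval z)).
Proof.
move=> /andP[t0 t1]; rewrite ImD ImM /= mul0r addr0 ImD ImN.
have := uval_gt0 z; have := uval_gt0 w.
set a := Im (uval z); set b := Im (uval w) => b0 a0.
have [->|tn1] := eqVneq t 1; first by rewrite mul1r addrCA subrr addr0.
have : 0 < (1 - t) * a by rewrite mulr_gt0 // subr_gt0 lt_neqAle tn1.
have : 0 <= t * b by rewrite mulr_ge0 // ltW.
lra.
Qed.

Lemma cmean_value_seg (f f' : C -> C) (a b : C) (M : R) :
 (forall t : R, 0 <= t <= 1 -> cder f (a + toC t * (b - a)) (f' (a + toC t * (b - a)))) ->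
 (forall t : R, 0 <= t <= 1 -> cabs (f' (a + toC t * (b - a))) <= M) ->
 cabs (f b - f a) <= M * cabs (b - a).
Proof. by move=> h1 h2; have := cmean_value_ineq h1 h2; rewrite (addrC a) subrK. Qed.

(** Obtained by differentiating eta^2 = c z + d; only the existence of the derivative of eta is
    used. *)
Lemma eta_cder s z : cder (uext (eta s)) (uval z) (toC (mat s 1 0) / (2 * eta s z)).
Proof.
have [l hl] := holo_cder (@eta_holo R s) z.
have h1 := gderM hl hl.
have h2 : cder (fun v => mob_den (mat s) v) (uval z) (toC (mat s 1 0)).
 have := gderD (gderZ (toC (mat s 1 0)) (cder_id (uval z))) (gder_cst id (toC (mat s 1 1)) (uval z)).
 by rewrite mulr1 addr0.
have z0 := uval_gt0 z.
have h3 : cder (fun v => uext (eta s) v * uext (eta s) v) (uval z) (toC (mat s 1 0)).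
 apply: (gder_near z0 _ _ h2).
  move=> v hv; have v0 : 0 < Im (uval z + v).
   have := le_lt_trans (Im_le_cabs v) hv; rewrite ltr_norml ImD => /andP[]; lra.
  by rewrite (uext_val _ v0) -expr2 eta_sqr.
 by rewrite uextE -expr2 eta_sqr.
have := cder_unique h3 h1; rewrite uextE => E.
by rewrite E (_ : _ / _ = l) //; field; exact: eta_neq0.
Qed.

Lemma eta_const s z w : mat s 1 0 = 0 -> eta s z = eta s w.
Proof.
move=> c0; have := @cmean_value_seg (uext (eta s)) (fun=> 0) (uval z) (uval w) 0.
rewrite !uextE mul0r => h; apply/esym/eqP; rewrite -subr_eq0 -cabs_eq0 eq_le cabs_ge0 andbT.
apply: h => t ht; last by rewrite cabs0.
have v0 := uhp_segment z w ht.
by have := eta_cder s (UHP v0); rewrite c0 rmorph0 mul0r.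
Qed.

Lemma act_sub_i s : \det (mat s) = 1 -> uval (act s uhp_i) - uval uhp_i =
 (toC (mat s 0 1 + mat s 1 0) + toC (mat s 0 0 - mat s 1 1) * uval uhp_i) / mob_den (mat s) (uval uhp_i).
Proof.
move=> _; have d0 := mob_den_uneq0 s uhp_i.
rewrite /= /mob; apply: (mulIf d0); rewrite mulrBl !divfK // /mob_num /mob_den.
rewrite rmorphD rmorphB /=; apply: cx_eq; rewrite !(ReD, ReN, ReM, ImD, ImN, ImM) /=; ring.
Qed.

(* A matrix close to the identity lifts to two elements [s] of the cover; the
  square of either is close to the identity of the cover. *)
Lemma eta_square_near1 (e : R) : 0 < e -> exists2 d : R, 0 < d & forall s,
 `|mat s 0 0 - 1| < d -> `|mat s 0 1| < d -> `|mat s 1 0| < d -> `|mat s 1 1 - 1| < d ->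
 cabs (eta (s * s)%g uhp_i - 1) < e.
Proof.
move=> e0; pose d := Num.min (1 / 16) (e / 4).
have d16 : d <= 1 / 16 by rewrite ge_min lexx.
have d4 : d <= e / 4 by rewrite ge_min lexx orbT.
have d0 : 0 < d by rewrite lt_min !divr_gt0.
exists d => // s h00 h01 h10 h11.
have n00 := h00; have n01 := h01; have n10 := h10; have n11 := h11.
rewrite ltr_norml in n00; case/andP: n00 => a1 a2.
rewrite ltr_norml in n01; case/andP: n01 => b1 b2.
rewrite ltr_norml in n10; case/andP: n10 => c1 c2.
rewrite ltr_norml in n11; case/andP: n11 => e1 e2.
have ci : cabs (uval (@uhp_i R)) = 1 by rewrite cabsE /= expr0n expr1n add0r sqrtr1.
set q := mob_den (mat s) (uval uhp_i).
have q1 : cabs (q - 1) <= 2 * d.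
 apply: le_trans (cabs_le_ReIm _) _; rewrite /q /mob_den !(ReD, ImD, ReN, ImN, ReM, ImM) /=.
 rewrite !mul0r !mulr0 subr0 !add0r oppr0 !addr0 mulr1.
 by rewrite (_ : 2 * d = d + d) ?lerD ?ltW //; lra.
have qlo : 7 / 8 <= cabs q.
 have := cabsB q (q - 1); rewrite opprB addrCA subrr addr0 cabs1; lra.
have qhi : cabs q <= 9 / 8.
 by have := cabsD (q - 1) 1; rewrite subrK cabs1; lra.
have sm : cabs (uval (act s uhp_i) - uval uhp_i) <= 1 / 2.
 rewrite act_sub_i ?mat_det // cabsf ler_pdivrMr; last by lra.
 apply: le_trans (cabsD _ _) _; rewrite cabsM ci mulr1 !cabs_toC.
 have := ler_normD (mat s 0 1) (mat s 1 0).
 have := ler_normB (mat s 0 0 - 1) (mat s 1 1 - 1); rewrite opprB addrA subrK.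
 lra.
have [l0 hl0] : cabs (eta s uhp_i) <= 9 / 8 /\ 0 <= cabs (eta s uhp_i).
 split; last exact: cabs_ge0.
 rewrite -(@ler_pXn2r _ 2) ?nnegrE // -cabsX eta_sqr -/q; lra.
have ed : cabs (eta s (act s uhp_i) - eta s uhp_i) <= d * (1 / 2).
 pose df v : C := toC (mat s 1 0) / (2 * uext (eta s) v).
 have := @cmean_value_seg (uext (eta s)) df (uval uhp_i) (uval (act s uhp_i)) d.
 rewrite !uextE => h; apply: le_trans (h _ _) _.
 - move=> t ht; have v0 := uhp_segment uhp_i (act s uhp_i) ht; rewrite /df.
  by rewrite (uext_val _ v0); exact: (eta_cder s (UHP v0)).
 - move=> t ht; have v0 := uhp_segment uhp_i (act s uhp_i) ht; rewrite /df.
  rewrite (uext_val _ v0) cabsf cabsM cabs_toC ler_pdivrMr; last first.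
   by rewrite mulr_gt0 ?cabs_gt0 ?eta_neq0 // -(rmorph_nat (@toC R)) -(rmorph0 (@toC R)) (inj_eq (@toC_inj R)) pnatr_eq0.
  have c2E : cabs (2 : C) = 2 by rewrite -(rmorph_nat (@toC R)) cabs_toC ger0_norm.
  rewrite c2E; apply: (@le_trans _ _ (d * 1)); first by rewrite mulr1 ltW.
  rewrite ler_wpM2l ?(ltW d0) // mulrC -ler_pdivrMr // mul1r.
  rewrite -(@ler_pXn2r _ 2) ?nnegrE ?invr_ge0 // -cabsX eta_sqr.
  set v := _ + _ in v0 *.
  have : cabs (mob_den (mat s) v - q) <= d * (1 / 2).
   rewrite /mob_den /q /mob_den (_ : _ - _ = toC (mat s 1 0) * (v - uval uhp_i)); last ring.
   rewrite cabsM cabs_toC; apply: ler_pM; [exact: normr_ge0|exact: cabs_ge0|exact: ltW|].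
   rewrite /v addrAC subrr add0r cabsM cabs_toC; case/andP: ht => t0 t1.
   rewrite ger0_norm //; apply: le_trans sm; rewrite ler_piMl //.
  have := cabsD (mob_den (mat s) v) (q - mob_den (mat s) v); rewrite (addrC (mob_den _ v)) subrK (cabsBC q).
  have -> : (2^-1 : R) ^+ 2 = 1 / 4 by field.
  lra.
 by rewrite ler_wpM2l // ltW.
(* The value at i of the factor of s^2 is eta (s i) eta (i). It is close to eta (i)^2 = c i + d, in
   which the sign of eta has disappeared. *)
rewrite /= (_ : eta s (act s uhp_i) * eta s uhp_i - 1 = (q - 1) + (eta s (act s uhp_i) - eta s uhp_i) * eta s uhp_i); last first.
 by rewrite /q -eta_sqr; ring.
apply: le_lt_trans (cabsD _ _) _; rewrite cabsM.
have : cabs (eta s (act s uhp_i) - eta s uhp_i) * cabs (eta s uhp_i) <= d * (1 / 2) * (9 / 8).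
 by apply: ler_pM; rewrite ?cabs_ge0.
lra.
Qed.

(** Isolation of the identity, made explicit in the topology induced by the matrix and the value of
    eta at i. *)
Lemma discrete_near1 G : is_subgroup G -> discrete_set G -> exists2 d : R, 0 < d & forall s, G s ->
 (forall i j, `|mat s i j - (1%:M : 'M[R]_2) i j| < d) -> cabs (eta s uhp_i - 1) < d -> s = 1%g.
Proof.
move=> [G1 _ _] /(_ _ G1)[_ [V]]; rewrite nbhsE => -[B [[A oA <-] BA1] BV] VG.
have : nbhs (metap_emb (1%g : metap R)) A by apply: open_nbhs_nbhs; split.
move=> [[P Q] [/= nP nQ] PQ].
move: nP => /nbhs_ballP[d1 /= d10 hP].
move: nQ => /nbhs_ballP[x /= x0 hQ].
have [d2 d20 xE] : exists2 r : R, 0 < r & x = toC r.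
 exists (Re x); first by move: x0; rewrite ltcE /= => /andP[].
 by move: x0; case: (x) => a0 b0; rewrite ltcE /= => /andP[/eqP -> _].
exists (Num.min d1 d2) => [|s Gs ms es]; first by rewrite lt_min d10.
have : (V `&` G) s.
 split => //; apply: BV; apply: PQ; split => /=.
  apply: hP; split => // i j; rewrite /ball /= distrC.
  by have := ms i j; rewrite lt_min => /andP[].
 apply: hQ; rewrite /ball /= -toC_cabs xE toC_ltE cabsBC.
 by move: es; rewrite lt_min => /andP[].
by rewrite VG.
Qed.

Lemma mat_mul s t : mat (s * t)%g = mat s *m mat t. Proof. by []. Qed.
Lemma mat_inv s : mat (s^-1)%g = adj2 (mat s).
Proof. by rewrite -invmx_adj2 ?mat_det. Qed.
(** A small [nn] leaves open the sign of the matrix and the sheet of the cover. The square of s has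
    its matrix near 1, the fourth power is near the identity of the cover, and so s^4 = 1 by
    discreteness. A matrix of determinant 1 and squared trace near 4 with this property is 1 or
    -1. *)
Lemma discrete_nn G : is_subgroup G -> discrete_set G -> exists2 d : R, 0 < d & forall s, G s ->
 nn (mat s) < d -> Zmp s.
Proof.
move=> sG dG; have [d d0 hd] := discrete_near1 sG dG; case: (sG) => _ GM _.
have [d1 d10 hd1] := eta_square_near1 d0.
(* The entries of s^2 - 1 are at most 6 r and those of s^4 - 1 stay below 16 r, which explains the
   denominator. *)
pose r := Num.min (Num.min 1 d) d1 / 16.
have m0 : 0 < Num.min (Num.min 1 d) d1 by rewrite !lt_min ltr01 d0.
have r0 : 0 < r by rewrite divr_gt0.
have r1 : r <= 1 / 16 by rewrite ler_pM2r // !ge_min lexx.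
have rd : r <= d / 16 by rewrite ler_pM2r // !ge_min lexx orbT.
have rd1 : r <= d1 / 16 by rewrite ler_pM2r // !ge_min lexx orbT.
exists (r ^+ 2) => [|s Gs ns]; first by rewrite exprn_gt0.
have ds := mat_det s; rewrite det22 in ds.
set a := mat s 0 0 in ds *; set b := mat s 0 1 in ds *; set c := mat s 1 0 in ds *.
set e := mat s 1 1 in ds *.
have ns' : (a - e) ^+ 2 + 2 * b ^+ 2 + 2 * c ^+ 2 < r ^+ 2 by exact: ns.
have [p2 b2 c2] : [/\ 0 <= (a - e) ^+ 2, 0 <= b ^+ 2 & 0 <= c ^+ 2] by split; exact: sqr_ge0.
have sq (u : R) : u ^+ 2 <= r ^+ 2 -> `|u| <= r.
 by move=> h; rewrite -(@ler_pXn2r _ 2) ?nnegrE ?(ltW r0) // real_normK ?num_real.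
have pr : `|a - e| <= r by apply: sq; lra.
have br : `|b| <= r by apply: sq; lra.
have cr : `|c| <= r by apply: sq; lra.
have frs := fro_le (mat_det s); rewrite /fro -/a -/b -/c -/e in frs.
have r2 : r ^+ 2 <= 1 by rewrite expr_le1 //; lra.
have nsr : nn (mat s) <= 1 by lra.
have a2 : `|a| <= 2.
 rewrite -(@ler_pXn2r _ 2) ?nnegrE // real_normK ?num_real //.
 have := sqr_ge0 e; have : (2 : R) ^+ 2 = 4 by rewrite expr2 -natrM.
 lra.
have tr4 : `|a + e| <= 4 + r.
 rewrite (_ : a + e = 2 * a - (a - e)); last ring.
 by apply: le_trans (ler_normB _ _) _; rewrite normrM ger0_norm //; lra.
have mulb (u v x y : R) : `|u| <= x -> `|v| <= y -> `|u * v| <= x * y.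
 by move=> h1 h2; rewrite normrM ler_pM.
have S00 : `|a * a + b * c - 1| <= 4 * r.
 have -> : a * a + b * c - 1 = a * (a - e) + 2 * (b * c) by rewrite -[X in _ - X = _]ds; ring.
 apply: le_trans (ler_normD _ _) _; have := mulb _ _ _ _ a2 pr.
 have := mulb _ _ _ _ br cr; rewrite (normrM 2) (ger0_norm (ler0n _ 2)).
 have : r * r <= r * 1 by rewrite ler_wpM2l ?(ltW r0) //; lra.
 lra.
have S01 : `|a * b + b * e| <= 5 * r.
 rewrite (_ : _ + _ = (a + e) * b); last ring.
 by apply: le_trans (mulb _ _ _ _ tr4 br) _; rewrite ler_wpM2r ?(ltW r0) //; lra.
have S10 : `|c * a + e * c| <= 5 * r.
 rewrite (_ : _ + _ = (a + e) * c); last ring.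
 by apply: le_trans (mulb _ _ _ _ tr4 cr) _; rewrite ler_wpM2r ?(ltW r0) //; lra.
have e3 : `|e| <= 3.
 rewrite (_ : e = a - (a - e)); last ring.
 by apply: le_trans (ler_normB _ _) _; lra.
have S11 : `|c * b + e * e - 1| <= 6 * r.
 have -> : c * b + e * e - 1 = e * (- (a - e)) + 2 * (b * c) by rewrite -[X in _ - X = _]ds; ring.
 apply: le_trans (ler_normD _ _) _.
 have pr' : `|- (a - e)| <= r by rewrite normrN.
 have := mulb _ _ _ _ e3 pr'.
 have := mulb _ _ _ _ br cr; rewrite (normrM 2) (ger0_norm (ler0n _ 2)).
 have : r * r <= r * 1 by rewrite ler_wpM2l ?(ltW r0) //; lra.
 lra.
pose s2 := (s * s)%g; have Gs2 : G s2 by exact: GM.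
have m00 : mat s2 0 0 = a * a + b * c by rewrite /s2 mat_mul mulmx22.
have m01 : mat s2 0 1 = a * b + b * e by rewrite /s2 mat_mul mulmx22.
have m10 : mat s2 1 0 = c * a + e * c by rewrite /s2 mat_mul mulmx22.
have m11 : mat s2 1 1 = c * b + e * e by rewrite /s2 mat_mul mulmx22.
pose s4 := (s2 * s2)%g; have Gs4 : G s4 by exact: GM.
have s4m i j : mat s4 i j = mat s2 i 0 * mat s2 0 j + mat s2 i 1 * mat s2 1 j by exact: mulmx22.
have se : cabs (eta s4 uhp_i - 1) < d.
 by apply: hd1; rewrite ?m00 ?m01 ?m10 ?m11; lra.
have r44 : 6 * r <= 6 / 16 by lra.
have s4E : s4 = 1%g.
 apply: hd => //.
 have T (x y x' y' : R) : `|x - 1| <= 6 * r -> `|y| <= 5 * r -> `|x'| <= 5 * r ->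
   `|x * x + y * x' - 1| < d.
  move=> h1 h2 h3; rewrite (_ : _ - _ = (x - 1) * (x - 1) + 2 * (x - 1) + y * x'); last ring.
  apply: le_lt_trans (ler_normD _ _) _.
  have := ler_normD ((x - 1) * (x - 1)) (2 * (x - 1)); rewrite (normrM 2) (ger0_norm (ler0n _ 2)).
  have := mulb _ _ _ _ h1 h1; have := mulb _ _ _ _ h2 h3.
  have : r * r <= 1 / 16 * r by rewrite ler_wpM2r ?(ltW r0).
  lra.
 have U (x y u : R) : `|x - 1| <= 6 * r -> `|y - 1| <= 6 * r -> `|u| <= 5 * r -> `|(x + y) * u| < d.
  move=> h1 h2 h3; rewrite (_ : _ * _ = (x - 1) * u + (y - 1) * u + 2 * u); last ring.
  apply: le_lt_trans (ler_normD _ _) _.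
  have := ler_normD ((x - 1) * u) ((y - 1) * u); rewrite (normrM 2) (ger0_norm (ler0n _ 2)).
  have := mulb _ _ _ _ h1 h3; have := mulb _ _ _ _ h2 h3.
  have : r * r <= 1 / 16 * r by rewrite ler_wpM2r ?(ltW r0).
  lra.
 have s00 : `|a * a + b * c - 1| <= 6 * r by lra.
 have S4 : [/\ `|mat s4 0 0 - 1| < d, `|mat s4 0 1| < d, `|mat s4 1 0| < d & `|mat s4 1 1 - 1| < d].
  rewrite !s4m m00 m01 m10 m11; split.
  - by apply: T.
  - by rewrite (_ : _ + _ = (a * a + b * c + (c * b + e * e)) * (a * b + b * e)); [exact: U|ring].
  - by rewrite (_ : _ + _ = (a * a + b * c + (c * b + e * e)) * (c * a + e * c)); [exact: U|ring].
  - by rewrite (addrC ((c * a + e * c) * _)); apply: T.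
 case: S4 => k1 k2 k3 k4 i j.
 have ord2 (n : 'I_2) : n = 0 \/ n = 1.
  by case: n => -[|[|//]] hk; [left|right]; exact/val_inj.
 by case: (ord2 i) => ->; case: (ord2 j) => ->; rewrite mx1E ?subr0.
have tr1 := trace_sqr_ge (mat_det s); rewrite -/a -/e in tr1.
have trs : a + e != 0.
 by apply/eqP => h; move: tr1; rewrite h expr0n /=; lra.
have trs2 : a * a + b * c + (c * b + e * e) != 0.
 rewrite (_ : _ + _ = (a + e) ^+ 2 - 2); last by rewrite -ds; ring.
 by apply/eqP; lra.
have := congr1 (@mat R) s4E; move/matrixP => E.
have := E 0 1; have := E 1 0; have := E 0 0; have := E 1 1.
rewrite !s4m m00 m01 m10 m11 !mx1E => E11 E00 E10 E01.
(* The entries of s^4 off the diagonal, and the difference of those on it, are tr (s) tr (s^2) times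
   the corresponding quantities of s; both traces are nonzero. *)
have b0 : b = 0.
 apply/eqP; have : (a + e) * ((a * a + b * c + (c * b + e * e)) * b) == 0 by apply/eqP; rewrite -[RHS]E01; ring.
 by rewrite !mulf_eq0 (negbTE trs) (negbTE trs2).
have c0 : c = 0.
 apply/eqP; have : (a + e) * ((a * a + b * c + (c * b + e * e)) * c) == 0 by apply/eqP; rewrite -[RHS]E10; ring.
 by rewrite !mulf_eq0 (negbTE trs) (negbTE trs2).
have ae : a - e = 0.
 apply/eqP; have : (a + e) * ((a * a + b * c + (c * b + e * e)) * (a - e)) == 0.
  apply/eqP; have := congr1 (fun x => x.1 - x.2) (congr2 pair E00 E11); rewrite /= subrr => <-; ring.
 by rewrite !mulf_eq0 (negbTE trs) (negbTE trs2).
have := nn_eq0 (mat_det s); apply; rewrite /nn -/a -/b -/c -/e ae b0 c0; ring.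
Qed.
End Discreteness.

(** * Counting elements of possibly infinite sets *)

Section Counting.

(** A cardinality bound tested on duplicate-free sequences: it makes sense before P is known to be
    finite, implies finiteness, and passes through injections and fibrations. *)
Definition seqbound (T : eqType) (P : set T) (t : nat) : Prop :=
 forall s : seq T, uniq s -> (forall x, x \in s -> P x) -> (size s <= t)%N.

Lemma seqbound_finite (T : choiceType) (P : set T) t : seqbound P t -> finite_set P.
Proof.
move=> h; apply: contrapT => /(infinite_set_fset t.+1)[B BP].
apply/negP; rewrite -ltnNge ltnS; apply: h; first exact: fset_uniq.
by move=> x xB; exact: BP.
Qed.

Lemma finite_seqbound (T : choiceType) (P : set T) :
 finite_set P -> seqbound P #|` fset_set P|.
Proof.
move=> fP s us sP; apply: uniq_leq_size => // x /sP Px.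
by rewrite in_fset_set // inE.
Qed.

Lemma seqbound_le (T : eqType) (P Q : set T) t u : P `<=` Q -> (t <= u)%N ->
 seqbound Q t -> seqbound P u.
Proof.
by move=> PQ tu h s us sP; apply: leq_trans tu; apply: h => // x /sP /PQ.
Qed.

Lemma seqbound_inj (T U : eqType) (f : T -> U) (P : set T) (Q : set U) t :
 (forall x y, P x -> P y -> f x = f y -> x = y) -> (forall x, P x -> Q (f x)) ->
 seqbound Q t -> seqbound P t.
Proof.
move=> fi PQ h s us sP; rewrite -(size_map f); apply: h.
 by rewrite map_inj_in_uniq // => x y /sP Px /sP Py; exact: fi.
by move=> _ /mapP[x /sP Px ->]; exact: PQ.
Qed.

Lemma seqbound_fibre (T : eqType) (K : finType) (f : T -> K) (P : set T) t :
 (forall x0, P x0 -> seqbound [set x | P x /\ f x = f x0] t) -> seqbound P (#|K| * t).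
Proof.
move=> h s us sP.
have -> : size s = (\sum_(c : K) size [seq x <- s | f x == c])%N.
 elim: s {us sP} => [|x s IH]; first by rewrite big1.
 rewrite /= IH (bigD1 (f x)) //= [in RHS](bigD1 (f x)) //= eqxx /= addSn; congr (_ + _).+1.
 by apply: eq_bigr => c cx; rewrite eq_sym (negbTE cx).
rewrite -sum_nat_const; apply: leq_sum => c _.
case E : [seq x <- s | f x == c] => [//|x0 s']; rewrite -E.
have : x0 \in [seq x <- s | f x == c] by rewrite E mem_head.
rewrite mem_filter => /andP[/eqP fx0 /sP Px0].
apply: (h _ Px0); first exact: filter_uniq.
by move=> x; rewrite mem_filter => /andP[/eqP fx /sP Px]; split; rewrite ?fx0.
Qed.
End Counting.

(** * Elements of small displacement at a point are finite in number and proportional *)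

Section CommutingElements.
Context {R : realType}.
Local Notation C := (Cx R).
Implicit Types (G P : set (metap R)) (s t g : metap R) (z w : uhp R).

(** For a matrix 1 or -1 the function eta is constant with square 1 or -1, so the sign of the matrix
    and a fourth root of unity determine the element. *)
Lemma finite_center : finite_set (@Zmp R).
Proof.
pose f s : bool * C := (`[< mat s = 1%:M >], eta s uhp_i).
pose r4 : seq C := [:: 1; -1; 'i; - 'i].
apply: (@seqbound_finite _ _ #|` fset_set ([set: bool] `*` [set` r4])|).
apply: (@seqbound_inj _ _ f) (finite_seqbound _) => [s t hs ht [e1 e2]|s hs|].
- have ci (u : metap R) : Zmp u -> mat u 1 0 = 0.
  by case=> ->; rewrite !mxE /= ?oppr0.
 apply: metap_ext => [|z]; last by rewrite (eta_const z uhp_i (ci _ hs)) e2 (eta_const z uhp_i (ci _ ht)).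
 case: hs e1 => hs; case: ht => ht; rewrite ?hs ?ht //.
  by move=> e1; apply/esym/asboolP; rewrite -e1; exact/asboolP.
 by move=> e1; apply/asboolP; rewrite e1; exact/asboolP.
- split => //=; have := eta_sqr s uhp_i.
 rewrite !inE; case: hs => ->.
  rewrite mob_den1 => /eqP; rewrite sqrf_eq1 => /orP[] -> //; by rewrite orbT.
 rewrite /mob_den !mxE /= oppr0 rmorph0 mul0r add0r rmorphN rmorph1.
 rewrite -sqrCi => /eqP; rewrite eqf_sqr => /orP[] ->; by rewrite ?orbT.
- by apply: finite_setX; [exact: finite_finset|exact: finite_seq].
Qed.

Definition Tset G (z : uhp R) (d : R) : set (metap R) := [set g | G g /\ nz (uval z) (mat g) < d].

Let y0 z : Im (uval z) != 0.
Proof. by rewrite gt_eqF // uval_gt0. Qed.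

Definition cj z g := cjm (Re (uval z)) (Im (uval z)) (mat g).

Lemma cj_mul z g s : cj z (g * s)%g = cj z g *m cj z s.
Proof. by rewrite /cj mat_mul cjmM. Qed.
Lemma cj_inv z g : cj z (g^-1)%g = adj2 (cj z g).
Proof. by rewrite /cj mat_inv cjm_adj2. Qed.
Lemma det_cj z g : \det (cj z g) = 1.
Proof. by rewrite /cj det_cjm ?mat_det. Qed.
Lemma center_nz z g : Zmp g <-> nz (uval z) (mat g) = 0.
Proof.
split=> h; first by apply: central_nn; apply/cjm_central.
by have := nn_eq0 (det_cj z g) h => /(cjm_central _ _ (y0 z)).
Qed.

Lemma entry_fro (A : 'M[R]_2) (B : R) i j : 0 <= B -> fro A <= B ^+ 2 -> `|A i j| <= B.
Proof.
move=> B0 fA; rewrite -(@ler_pXn2r _ 2) ?nnegrE // real_normK ?num_real //; move: fA; rewrite /fro.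
have ord2 (n : 'I_2) : n = 0 \/ n = 1.
 by case: n => -[|[|//]] hk; [left|right]; exact/val_inj.
have := sqr_ge0 (A 0 0); have := sqr_ge0 (A 0 1); have := sqr_ge0 (A 1 0); have := sqr_ge0 (A 1 1).
by case: (ord2 i) => ->; case: (ord2 j) => ->; lra.
Qed.

(** The entries, taken in the frame of z, are sorted into cells of side 1 / K. If g and g0 share
    their cells, then g0^-1 g has displacement below d at z, so each class embeds into [Tset G z d].
    The number N of classes does not depend on the group or on the point. *)
Lemma pigeonhole (B d : R) : 0 < B -> 0 < d -> exists N : nat, forall G P z (t : nat), is_subgroup G ->
 P `<=` G -> (forall g, P g -> forall i j, `|cj z g i j| <= B) ->
 seqbound (Tset G z d) t -> seqbound P (N * t).
Proof.
move=> B0 d0.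
(* The displacement of g0^-1 g is at most 2 |g0|^2 |g - g0|^2 <= 2 * 4 B^2 * 4 / K^2. *)
have [K K0 hK] : exists2 K : R, 0 < K & 32 * B ^+ 2 < d * K ^+ 2.
 pose X := 32 * B ^+ 2 / d + 1; have X1 : 1 <= X.
  by rewrite lerDr divr_ge0 ?mulr_ge0 ?exprn_ge0 // ltW.
 exists X; first by apply: lt_le_trans X1.
 apply: (@lt_le_trans _ _ (d * X)); last first.
  rewrite ler_pM2l // expr2 ler_peMl // ltW //; exact: lt_le_trans X1.
 rewrite /X (_ : d * _ = 32 * B ^+ 2 + d) ?ltrDl //; by field; rewrite gt_eqF.
pose n := (Num.truncn (2 * B * K)).+1.
pose cell (x : R) : 'I_n := inord (Num.truncn ((x + B) * K)).
pose f z g := (cell (cj z g 0 0), cell (cj z g 0 1), cell (cj z g 1 0), cell (cj z g 1 1)).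
exists #|[the finType of ('I_n * 'I_n * 'I_n * 'I_n)%type]| => G P z t [G1 GM GV] PG PB hT.
have cellE (x y : R) : `|x| <= B -> `|y| <= B -> cell x = cell y -> `|x - y| * K <= 1.
 have bd (u : R) : `|u| <= B -> (Num.truncn ((u + B) * K) < n)%N /\ 0 <= (u + B) * K.
  rewrite ler_norml => /andP[u1 u2]; have u0 : 0 <= u + B by lra.
  split; last by rewrite mulr_ge0 // ltW.
  rewrite ltnS; apply: le_truncn; rewrite ler_pM2r //; lra.
 move=> /bd[x1 x2] /bd[y1 y2] /(congr1 val); rewrite /cell /= !inordK // => E.
 have /andP[a1 a2] := truncn_itv x2; have /andP[b1 b2] := truncn_itv y2; rewrite E in a1 a2.
 rewrite -[X in _ * X](ger0_norm (ltW K0)) -normrM ler_norml.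
 rewrite (_ : (x - y) * K = (x + B) * K - (y + B) * K); last ring.
 rewrite -natr1 in a2 b2; apply/andP; split; lra.
apply: (@seqbound_fibre _ _ (f z)) => g0 Pg0.
apply: (@seqbound_inj _ _ (fun g => g0^-1 * g)%g) hT => [x y _ _ /(congr1 (fun u => g0 * u)%g)|g [Pg]].
 by rewrite !mulgA !mulgV !mul1g.
case=> e00 e01 e10 e11; split; first by apply: GM; [apply: GV|]; exact: PG.
have E (i j : 'I_2) : `|cj z g i j - cj z g0 i j| * K <= 1.
 have ord2 (k : 'I_2) : k = 0 \/ k = 1.
  by case: k => -[|[|//]] hk; [left|right]; exact/val_inj.
 by case: (ord2 i) => ->; case: (ord2 j) => ->; apply: cellE => //; exact: PB.
rewrite /nz -/(cj z (g0^-1 * g)%g) cj_mul cj_inv -nn_sub1.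
have -> : adj2 (cj z g0) *m cj z g - 1%:M = adj2 (cj z g0) *m (cj z g - cj z g0).
 rewrite mulmxBr; congr (_ - _); have uA : cj z g0 \in unitmx by rewrite unitmxE det_cj unitr1.
 by rewrite -invmx_adj2 ?det_cj // mulVmx.
apply: le_lt_trans (nn_le_fro _) _.
apply: (@le_lt_trans _ _ (2 * (4 * B ^+ 2 * (4 / K ^+ 2)))); last first.
 rewrite (_ : 2 * _ = 32 * B ^+ 2 / K ^+ 2); last by field; rewrite gt_eqF.
 by rewrite ltr_pdivrMr ?exprn_gt0.
rewrite ler_pM2l //; apply: le_trans (froM _ _) _; rewrite fro_adj2.
have sq (u v : R) : `|u| <= v -> u ^+ 2 <= v ^+ 2.
 by move=> h; rewrite -(real_normK (num_real u)) lerXn2r ?nnegrE // (le_trans _ h).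
apply: ler_pM; rewrite ?fro_ge0 //.
 by rewrite /fro; have := fun i j => sq _ _ (PB g0 Pg0 i j) => h;
  have := h 0 0; have := h 0 1; have := h 1 0; have := h 1 1; lra.
have h (i j : 'I_2) : (cj z g - cj z g0) i j ^+ 2 <= 1 / K ^+ 2.
 rewrite ler_pdivlMr ?exprn_gt0 // -exprMn (_ : (cj z g - cj z g0) i j = cj z g i j - cj z g0 i j); last by rewrite [LHS]mxE [X in _ + X]mxE.
 rewrite -[leRHS](expr1n _ 2); apply: sq; by rewrite normrM (ger0_norm (ltW K0)).
rewrite /fro; have := h 0 0; have := h 0 1; have := h 1 0; have := h 1 1.
by rewrite (_ : 4 / K ^+ 2 = 4 * (1 / K ^+ 2)) ?mul1r //; lra.
Qed.

Section Group.
Variable G : set (metap R).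
Hypotheses (sG : is_subgroup G) (dG : discrete_set G).

(** Passing from the frame of z to the standard one is a linear change of the three trace-free
    coordinates, which multiplies [nn] at most by the constant K below; [discrete_nn] then
    applies. *)
Lemma Tset_center z : exists2 d : R, 0 < d & Tset G z d `<=` Zmp.
Proof.
have [d d0 hd] := discrete_nn sG dG.
set x := Re (uval z); set y := Im (uval z).
have yp : 0 < y by exact: uval_gt0.
have yn : y != 0 by exact: y0.
pose K := 2 + 8 * (x / y) ^+ 2 + 6 * (y ^+ 2 + x ^+ 2 + (x ^+ 2 / y) ^+ 2) + 2 * y^-1 ^+ 2.
have sq := @sqr_ge0 R.
have K0 : 0 < K.
 by rewrite /K; have := sq (x / y); have := sq y; have := sq x; have := sq (x ^+ 2 / y); have := sq y^-1; lra.
exists (d / K) => [|g [Gg]]; first by rewrite divr_gt0.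
rewrite ltr_pdivlMr // => hg; apply: hd => //; apply: le_lt_trans hg.
set N := nz _ _; pose p := cj z g 0 0 - cj z g 1 1; pose b := cj z g 0 1; pose c := cj z g 1 0.
have NE : N = p ^+ 2 + 2 * b ^+ 2 + 2 * c ^+ 2 by [].
have pE : mat g 0 0 - mat g 1 1 = p + 2 * (x / y) * c.
 by rewrite /p /c /cj !mx22E -/x -/y; field.
have cE : mat g 1 0 = y^-1 * c by rewrite /c /cj !mx22E -/y; field.
have bE : mat g 0 1 = y * b - x * p - (x ^+ 2 / y) * c.
 by rewrite /b /p /c /cj !mx22E -/x -/y; field.
have p0 := sq p; have b0 := sq b; have c0 := sq c.
have [pN bN cN] : [/\ p ^+ 2 <= N, b ^+ 2 <= N & c ^+ 2 <= N] by split; lra.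
have mN (u v w : R) : 0 <= u ^+ 2 -> v ^+ 2 <= w -> (u * v) ^+ 2 <= u ^+ 2 * w.
 by move=> h1 h2; rewrite exprMn ler_wpM2l.
have q1 := mN (2 * (x / y)) c N (sq _) cN; have q2 := mN y^-1 c N (sq _) cN.
have q3 := mN y b N (sq _) bN; have q4 := mN x p N (sq _) pN.
have q5 := mN (x ^+ 2 / y) c N (sq _) cN.
rewrite /nn pE cE bE /K.
have r1 := sq (p - 2 * (x / y) * c).
have r2 := sq (y * b + x * p); have r3 := sq (y * b + (x ^+ 2 / y) * c); have r4 := sq (x * p - (x ^+ 2 / y) * c).
have e1 : (2 * (x / y)) ^+ 2 = 4 * (x / y) ^+ 2 by rewrite exprMn (expr2 2) -natrM.
rewrite e1 in q1.
set u1 := 2 * (x / y) * c in q1 r1 *; set u3 := y * b in q3 r2 r3 *; set u4 := x * p in q4 r2 r4 *.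
set u5 := x ^+ 2 / y * c in q5 r3 r4 *; set u2 := y^-1 * c in q2 *.
set k1 := (x / y) ^+ 2 in q1 *; set k2 := (x ^+ 2 / y) ^+ 2 in q5 *; set k3 := y^-1 ^+ 2 in q2 *.
have t1 : (p + u1) ^+ 2 <= 2 * N + 8 * k1 * N by nra.
have t2 : (u3 - u4 - u5) ^+ 2 <= 3 * (y ^+ 2 * N + x ^+ 2 * N + k2 * N) by nra.
lra.
Qed.

Lemma Tset_finite z : finite_set (Tset G z (1 / 10)).
Proof.
have [d d0 hd] := Tset_center z.
have [N hN] := pigeonhole (ltr0n R 2) d0.
apply: (@seqbound_finite _ _ (N * #|` fset_set (@Zmp R)|)).
apply: (hN G _ z) => //; first by move=> g [].
 move=> g [Gg hg] i j; apply: entry_fro => //.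
 have := fro_le (det_cj z g); rewrite -/(nz (uval z) (mat g)).
 have : (2 : R) ^+ 2 = 4 by rewrite expr2 -natrM.
 lra.
exact: (seqbound_le hd (leqnn _) (finite_seqbound finite_center)).
Qed.

(** The trace-free part of B is k times that of A. This relation is preserved by conjugation, hence
    the displacements of B and A have the same ratio k^2 at every point. *)
Definition scal (A B : 'M[R]_2) (k : R) : Prop :=
 [/\ B 0 1 = k * A 0 1, B 1 0 = k * A 1 0 & B 0 0 - B 1 1 = k * (A 0 0 - A 1 1)].

Lemma parallel_scal (A B : 'M[R]_2) : nn A != 0 -> parallel A B -> exists k, scal A B k.
Proof.
move=> nA [h1 h2 h3].
have [b0|b0] := eqVneq (A 0 1) 0; last first.
 exists (B 0 1 / A 0 1); split; first by rewrite divfK.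
  by apply: (mulIf b0); rewrite mulrAC divfK // -h1 mulrC.
 by apply: (mulIf b0); rewrite mulrAC divfK // -h2 mulrC.
have [c0|c0] := eqVneq (A 1 0) 0; last first.
 exists (B 1 0 / A 1 0); split; last 1 first.
 - by apply: (mulIf c0); rewrite mulrAC divfK // mulrC h3.
 - by apply: (mulIf c0); rewrite mulrAC divfK // -h1 mulrC.
 - by rewrite divfK.
have p0 : A 0 0 - A 1 1 != 0.
 by apply: contra nA => /eqP h; rewrite /nn h b0 c0 expr0n !mulr0 !addr0.
exists ((B 0 0 - B 1 1) / (A 0 0 - A 1 1)); split; last by rewrite divfK.
 by apply: (mulIf p0); rewrite mulrAC divfK // mulrC h2.
by apply: (mulIf p0); rewrite mulrAC divfK // -h3 mulrC.
Qed.

Lemma nn_scal (A B : 'M[R]_2) k : scal A B k -> nn B = k ^+ 2 * nn A.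
Proof. by case=> h1 h2 h3; rewrite /nn h1 h2 h3; ring. Qed.
Lemma scal_cjm (A B : 'M[R]_2) k x y : y != 0 -> scal (cjm x y A) (cjm x y B) k <-> scal A B k.
Proof.
move=> yn; rewrite /scal !mx22E; split=> -[h1 h2 h3].
 have e2 : B 1 0 = k * A 1 0 by apply: (mulIf yn); rewrite h2; ring.
 have e3 : B 0 0 - B 1 1 = k * (A 0 0 - A 1 1).
  by rewrite (_ : B 0 0 - B 1 1 = B 0 0 - B 1 0 * x - (B 1 1 + B 1 0 * x) + 2 * B 1 0 * x); [rewrite h3 e2; ring|ring].
 split=> //; have := congr1 (fun u => u * y) h1; rewrite /= divfK // e2 e3 => h.
 have -> : B 0 1 = (B 0 1 + k * (A 0 0 - A 1 1) * x - k * A 1 0 * x ^+ 2)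
   - (k * (A 0 0 - A 1 1) * x - k * A 1 0 * x ^+ 2) by ring.
 by rewrite h; field.
rewrite h1 h2 h3; split; [by field|by ring|].
rewrite (_ : B 0 0 - _ - _ = (B 0 0 - B 1 1) - 2 * (k * A 1 0) * x); last by ring.
by rewrite h3; ring.
Qed.

(* The commutator with an element of minimal displacement is displaced less,
  hence central: all elements of small displacement are proportional. *)
Lemma Tset_scal z g s : Tset G z (1 / 10) g -> Tset G z (1 / 10) s ->
 ~ Zmp g -> exists k, scal (mat g) (mat s) k.
Proof.
move=> Tg Ts ncg.
pose T := fset_set (Tset G z (1 / 10)).
have inT t : (t \in T) = `[< Tset G z (1 / 10) t >].
 by have fT := Tset_finite z; rewrite /T in_fset_set.
have [g0 Tg0 [ncg0 min0]] : exists2 g0, Tset G z (1 / 10) g0 & ~ Zmp g0 /\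
  forall t, Tset G z (1 / 10) t -> ~ Zmp t -> nz (uval z) (mat g0) <= nz (uval z) (mat t).
 pose l := [seq t <- T | `[< ~ Zmp t >]].
 have gl : g \in l by rewrite mem_filter inT; apply/andP; split; apply/asboolP.
 have main (r : seq (metap R)) : r != [::] -> exists2 t, t \in r & forall u, u \in r -> nz (uval z) (mat t) <= nz (uval z) (mat u).
  elim: r => // t r IH _; have [->|rn] := eqVneq r [::].
   by exists t; rewrite ?mem_head // => u; rewrite inE => /eqP ->.
  have [v vr hv] := IH rn; have [tv|vt] := leP (nz (uval z) (mat t)) (nz (uval z) (mat v)).
   exists t; first exact: mem_head.
   by move=> u; rewrite inE => /orP[/eqP -> //|/hv]; exact: le_trans.
  exists v; first by rewrite inE vr orbT.
  by move=> u; rewrite inE => /orP[/eqP ->|/hv //]; exact: ltW.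
 have [|t tl ht] := main l; first by apply: contraTneq gl => ->.
 move: tl; rewrite mem_filter inT => /andP[/asboolP nct /asboolP Tt].
 exists t => //; split => // u Tu ncu; apply: ht; rewrite mem_filter inT.
 by apply/andP; split; apply/asboolP.
have n0 : nn (cj z g0) != 0.
 by apply/eqP => h; apply: ncg0; apply/(center_nz z).
have par t : Tset G z (1 / 10) t -> exists k, scal (cj z g0) (cj z t) k.
 move=> Tt; apply: parallel_scal => //.
 have [GM GV] : (forall s t, G s -> G t -> G (s * t)%g) /\ (forall s, G s -> G (s^-1)%g) by case: sG.
 have [c1 c2] := nn_commutator (det_cj z g0) (det_cj z t) Tg0.2 Tt.2.
 apply: c2; pose K := (g0 * t * g0^-1 * t^-1)%g.
 have KE : cj z K = cj z g0 *m cj z t *m adj2 (cj z g0) *m adj2 (cj z t).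
  by rewrite /K !cj_mul !cj_inv.
 rewrite -KE; apply/cjm_central; first exact: y0.
 apply: contrapT => ncK.
 have nzp : 0 < nz (uval z) (mat g0) by rewrite lt_neqAle nz_ge0 andbT eq_sym.
 have nzK : nz (uval z) (mat K) <= 99 / 100 * nz (uval z) (mat g0) by rewrite /nz -/(cj z K) KE.
 have : nz (uval z) (mat g0) <= nz (uval z) (mat K).
  apply: min0 => //; split.
   exact: (GM _ _ (GM _ _ (GM _ _ Tg0.1 Tt.1) (GV _ Tg0.1)) (GV _ Tt.1)).
  by have := Tg0.2; lra.
 lra.
have [k1 s1] := par _ Tg; have [k2 s2] := par _ Ts.
have k10 : k1 != 0.
 apply/eqP => h; apply: ncg; apply/(center_nz z).
 by rewrite /nz -/(cj z g) (nn_scal s1) h expr0n mul0r.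
exists (k2 / k1); apply/(@scal_cjm (mat g) (mat s) (k2 / k1) (Re (uval z)) _ (y0 z)).
case: s1 s2 => a1 a2 a3 [b1 b2 b3]; rewrite /scal -/(cj z g) -/(cj z s) a1 a2 a3 b1 b2 b3.
by split; field.
Qed.
End Group.
End CommutingElements.

(** * Integrals over a fundamental domain against sums over the group *)

Section Unfolding.
Context {R : realType}.
Local Open Scope ereal_scope.
Implicit Types (phi psi : uhp R -> \bar R) (z w : uhp R).

Definition lft phi (p : R * R) : \bar R := oapp phi 0 (insub (pt p)).

Lemma lft_co phi z : lft phi (co (uval z)) = phi z.
Proof. by rewrite /lft coK valK. Qed.
Lemma UHE p : UH p -> exists2 z : uhp R, pt p = uval z & p = co (uval z).
Proof. by move=> p0; exists (@UHP R (pt p) p0) => //=; rewrite ptK. Qed.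

(** Measurability, and with [JH] the integral for the hyperbolic measure, of functions on the
    half-plane; values in the extended nonnegative reals make all exchanges of sums and integrals
    unconditional. *)
Definition hm phi : Prop := mj (lft phi).
Definition JH phi : \bar R := J (lft phi).

Lemma lft_ge0 phi : (forall z, 0 <= phi z) -> forall p, 0 <= lft phi p.
Proof. by move=> h p; rewrite /lft; case: insub => //= z. Qed.
Lemma JH_ge0 phi : (forall z, 0 <= phi z) -> 0 <= JH phi.
Proof. by move=> h; apply: J_ge0; exact: lft_ge0. Qed.
Lemma le_JH phi psi : hm phi -> hm psi -> (forall z, 0 <= phi z) ->
 (forall z, phi z <= psi z) -> JH phi <= JH psi.
Proof.
move=> m1 m2 h1 h; have h2 z : 0 <= psi z by exact: le_trans (h z).
apply: le_J; [exact: m1|exact: m2|exact: lft_ge0|exact: lft_ge0|].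
by move=> p /UHE[z _ ->]; rewrite !lft_co.
Qed.

Lemma hm_ext phi psi : phi =1 psi -> hm phi -> hm psi.
Proof. by move=> /funext ->. Qed.
Lemma hmM phi psi : hm phi -> hm psi -> hm (fun z => phi z * psi z).
Proof.
move=> m1 m2; rewrite /hm /mj.
rewrite (_ : (lft _ \_ UH) = (fun p => (lft phi \_ UH) p * (lft psi \_ UH) p)).
 exact: emeasurable_funM.
ext => p; rewrite /patch; case: ifPn => pU; last by rewrite mule0.
by have /UHE[z _ ->] := set_mem pU; rewrite !lft_co.
Qed.

Lemma hm_cst (c : \bar R) : hm (fun=> c).
Proof.
rewrite /hm /mj; apply/(measurable_restrictT _ (@measurable_UH R)).
apply: (eq_measurable_fun (fun=> c)) => [p|]; last exact: measurable_cst.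
by move=> /set_mem /UHE[z _ ->]; rewrite lft_co.
Qed.

Lemma JHZ (c : \bar R) phi : hm phi -> (forall z, 0 <= phi z) -> 0 <= c ->
 JH (fun z => c * phi z) = c * JH phi.
Proof.
move=> m h c0; rewrite /JH -JZ //; last exact: lft_ge0.
by apply: eq_J => p /UHE[z _ ->]; rewrite !lft_co.
Qed.

Lemma JH0 : JH (fun=> 0) = 0.
Proof.
by rewrite /JH /J integral0_eq // => p _; rewrite /patch; case: ifP => _;
 rewrite ?mul0e // /lft; case: insub => /=; rewrite ?mul0e.
Qed.

Lemma JHD phi psi : hm phi -> hm psi -> (forall z, 0 <= phi z) -> (forall z, 0 <= psi z) ->
 hm (fun z => phi z + psi z) /\ JH (fun z => phi z + psi z) = JH phi + JH psi.
Proof.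
move=> m1 m2 h1 h2.
have E p : (lft (fun z => phi z + psi z) \_ UH) p = (lft phi \_ UH) p + (lft psi \_ UH) p.
 rewrite /patch; case: ifPn => pU; last by rewrite adde0.
 by have /UHE[z _ ->] := set_mem pU; rewrite !lft_co.
split; first by rewrite /hm /mj (funext E); exact: emeasurable_funD.
rewrite /JH /J -ge0_integralD //.
- apply: eq_integral => p _; rewrite E ge0_muleDl //; apply: patch_UH_ge0; exact: lft_ge0.
- by move=> p _; apply: hint_ge0; exact: lft_ge0.
- exact: mhint.
- by move=> p _; apply: hint_ge0; exact: lft_ge0.
- exact: mhint.
Qed.

Lemma JH_act (g : metap R) phi : hm phi -> (forall z, 0 <= phi z) ->
 hm (phi \o act g) /\ JH (phi \o act g) = JH phi.
Proof.
move=> m h; have [m1 m2] := J_mob (mat_det g) m (lft_ge0 h).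
have E p : UH p -> (lft phi \o mobR (mat g)) p = lft (phi \o act g) p.
 move=> /UHE[z _ ->]; rewrite lft_co /= /mobR coK.
 by rewrite -(lft_co phi (act g z)).
by split; [exact: (mj_ext E)|rewrite /JH -m2; exact/esym/(eq_J E)].
Qed.

Lemma hm_nneseries (f : nat -> uhp R -> \bar R) : (forall n, hm (f n)) ->
 (forall n z, 0 <= f n z) -> hm (fun z => \sum_(0 <= n <oo) f n z).
Proof.
move=> m h; rewrite /hm /mj.
rewrite (_ : (lft _ \_ UH) = (fun p => \sum_(0 <= n <oo) (lft (f n) \_ UH) p)).
 apply: ge0_emeasurable_sum => [n p _ _|n _]; last exact: m.
 by apply: patch_UH_ge0; exact: lft_ge0.
ext => p; rewrite /patch; case: ifPn => pU; last by rewrite eseries0.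
have /UHE[z _ ->] := set_mem pU; rewrite lft_co.
by apply: eq_eseriesr => n _; rewrite lft_co.
Qed.

Lemma JH_nneseries (f : nat -> uhp R -> \bar R) : (forall n, hm (f n)) ->
 (forall n z, 0 <= f n z) -> JH (fun z => \sum_(0 <= n <oo) f n z) = \sum_(0 <= n <oo) JH (f n).
Proof.
move=> m h; rewrite /JH -J_nneseries //; last by move=> n p; exact: lft_ge0.
apply: eq_J => p /UHE[z _ ->]; rewrite lft_co.
by apply: eq_eseriesr => n _; rewrite lft_co.
Qed.

(** One enumeration serves all families a, so a sum depending on a point becomes a series of
    functions to which monotone convergence applies. *)
Lemma esum_countable I (D : set I) : countable D -> D !=set0 ->
 exists (e : nat -> I) (P : pred nat), (forall n, D (e n)) /\
  forall (a : I -> \bar R), (forall i, 0 <= a i) ->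
  \esum_(i in D) a i = \sum_(0 <= n <oo) (if P n then a (e n) else 0).
Proof.
move=> /countable_injP[f fi] [i0 Di0].
pose P n := `[< exists2 i, D i & f i = n >].
pose e n := xget i0 [set i | D i /\ f i = n].
have eD n : D (e n) by rewrite /e; case: xgetP => // i _ [].
have eP n : P n -> f (e n) = n.
 by move=> /asboolP[i Di fin]; rewrite /e; case: xgetP => [j _ []//|/(_ i)[]].
have DE : D = [set e n | n in P].
 apply/seteqP; split=> [i Di|_ [n _ <-]//]; exists (f i).
  by apply/asboolP; exists i.
 apply: fi; rewrite ?inE //; apply: eP; apply/asboolP; by exists i.
exists e, P; split => // a a0; rewrite {1}DE esum_pred_image //.
 by rewrite eseries_mkcond.
by move=> n m /set_mem Pn /set_mem Pm /(congr1 f); rewrite (eP _ Pn) (eP _ Pm).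
Qed.

Lemma JH_esum I (D : set I) (f : I -> uhp R -> \bar R) : countable D ->
 (forall i, hm (f i)) -> (forall i z, 0 <= f i z) ->
 hm (fun z => \esum_(i in D) f i z) /\ JH (fun z => \esum_(i in D) f i z) = \esum_(i in D) JH (f i).
Proof.
move=> cD m h; have [->|/set0P D0] := eqVneq D set0.
 rewrite esum_set0 (_ : (fun z => _) = (fun=> 0)); last by ext => z; rewrite esum_set0.
 split; first exact: hm_cst.
 exact: JH0.
have [e [P [eD hs]]] := esum_countable cD D0.
pose f' n z := if P n then f (e n) z else 0.
have E : (fun z => \esum_(i in D) f i z) = (fun z => \sum_(0 <= n <oo) f' n z).
 by ext => z; rewrite hs.
have m' n : hm (f' n) by rewrite /f'; case: (P n) => //; exact: hm_cst.
have h' n z : 0 <= f' n z by rewrite /f'; case: (P n).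
rewrite E; split; first exact: hm_nneseries.
rewrite JH_nneseries // hs; last by move=> i; exact: JH_ge0.
apply: eq_eseriesr => n _; by rewrite /f'; case: (P n) => //; exact: JH0.
Qed.

Section Group.
Variable G : set (metap R).
Hypotheses (sG : is_subgroup G) (dG : discrete_set G).

(** Only finitely many elements have entries bounded by a given integer, by [pigeonhole] with a
    radius that leaves only central elements. *)
Lemma countable_group : countable G.
Proof.
have [d d0 hd] := Tset_center sG dG (@uhp_i R).
have GE : G = \bigcup_(k in setT) [set g | G g /\ forall i j, (`|cj uhp_i g i j| <= k.+1%:R)%R].
 apply/seteqP; split=> [g Gg|g [k _ []]//].
 exists (Num.truncn (fro (cj uhp_i g) + 1)) => //; split => // i j.
 set u := fro (cj uhp_i g); apply: entry_fro => //; rewrite -/u.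
 have u0 : (0 <= u)%R by exact: fro_ge0.
 have := truncnS_gt (u + 1)%R; set n := _.+1%:R => h.
 have n1 : (1 <= n)%R by rewrite /n ler1n.
 by nra.
rewrite GE; apply: bigcup_countable => // k _; apply: finite_set_countable.
have [N hN] := pigeonhole (ltr0n R k.+1) d0.
apply: (@seqbound_finite _ _ (N * #|` fset_set (@Zmp R)|)).
apply: (hN G _ uhp_i) => //; first by move=> g [].
 by move=> g [].
exact: (seqbound_le hd (leqnn _) (finite_seqbound finite_center)).
Qed.

Definition SG phi z : \bar R := \esum_(g in G) phi (act g z).

Lemma SG_ge0 phi z : (forall z, 0 <= phi z) -> 0 <= SG phi z.
Proof. by move=> h; apply: esum_ge0 => g _. Qed.
Lemma actK (g : metap R) z : act (g^-1)%g (act g z) = z.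
Proof. by rewrite -actM -[metap_mul _ _]/(g^-1 * g)%g mulVg act1. Qed.
Lemma actVK (g : metap R) z : act g (act (g^-1)%g z) = z.
Proof. by rewrite -actM -[metap_mul _ _]/(g * g^-1)%g mulgV act1. Qed.
Lemma SG_inv phi z : (forall z, 0 <= phi z) -> SG phi z = \esum_(g in G) phi (act (g^-1)%g z).
Proof.
move=> h; rewrite /SG (@reindex_esum _ _ _ G G (fun g => g^-1)%g (fun g => phi (act g z))) //.
split=> [g /=|g s _ _|g Gg /=]; first by case: sG => _ _; apply.
 exact: invg_inj.
by exists (g^-1)%g; rewrite ?invgK //; case: sG => _ _; apply.
Qed.

Lemma hm_SG phi : hm phi -> (forall z, 0 <= phi z) -> hm (SG phi).
Proof.
move=> m h; have [] := @JH_esum _ G (fun g => phi \o act g) countable_group => //.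
 by move=> g; have [] := JH_act g m h.
by move=> g z /=.
Qed.

Lemma esum_mulr I (D : set I) (a : I -> \bar R) (c : \bar R) : countable D ->
 (forall i, 0 <= a i) -> 0 <= c -> (c * (\esum_(i in D) a i) = \esum_(i in D) (c * a i))%E.
Proof.
move=> cD a0 c0; have [->|/set0P D0] := eqVneq D set0; first by rewrite !esum_set0 mule0.
case: c c0 => [c||//] c0; last first.
 have [n|a00] := pselect (exists2 i, D i & a i != 0); last first.
  have az i : D i -> a i = 0 by move=> Di; apply/eqP/negPn/negP => ai; apply: a00; exists i.
  by rewrite !esum1 ?mule0 // => i Di; rewrite az ?mule0.
 case: n => i Di ai; have ai0 : 0 < a i by rewrite lt_def ai a0.
 have le1 (b : I -> \bar R) : (forall i, 0 <= b i) -> b i <= \esum_(j in D) b j.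
  move=> b0; apply: esum_ge; exists [set i]; last by rewrite fsbig_set1.
  by split; [exact: finite_set1|move=> _ ->].
 have s0 : 0 < \esum_(j in D) a j by apply: lt_le_trans ai0 _; exact: le1.
 rewrite gt0_mulye //; apply/esym/eqP; rewrite -leye_eq.
 by rewrite -[leLHS](gt0_mulye ai0); apply: (le1 (fun j => +oo * a j)) => j; exact: mule_ge0.
have [e [P [eD hs]]] := esum_countable cD D0.
rewrite !hs // => [|i]; last exact: mule_ge0.
rewrite -nneseriesZl //; last by move=> n _; case: ifP.
by apply: eq_eseriesr => n _; case: ifP => //; rewrite mule0.
Qed.

(* Both sides are the sum over [g] of the integrals of [phi z * psi (g^-1 z)]. *)
Lemma SG_sym phi psi : hm phi -> hm psi -> (forall z, 0 <= phi z) -> (forall z, 0 <= psi z) ->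
 JH (fun z => phi z * SG psi z) = JH (fun z => psi z * SG phi z).
Proof.
move=> m1 m2 h1 h2.
have cG := countable_group.
have -> : (fun z => phi z * SG psi z) = (fun z => \esum_(g in G) (phi z * psi (act (g^-1)%g z))).
 by ext => z; rewrite SG_inv // esum_mulr.
have -> : (fun z => psi z * SG phi z) = (fun z => \esum_(g in G) (psi z * phi (act g z))).
 by ext => z; rewrite esum_mulr.
have mA g : hm (fun z => phi z * psi (act (g^-1)%g z)).
 by apply: hmM => //; have [] := JH_act (g^-1)%g m2 h2.
have mB g : hm (fun z => psi z * phi (act g z)).
 by apply: hmM => //; have [] := JH_act g m1 h1.
rewrite (JH_esum cG mA _).2 => [|g z]; last exact: mule_ge0.
rewrite (JH_esum cG mB _).2 => [|g z]; last exact: mule_ge0.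
apply: eq_esum => g _.
have [_ <-] := JH_act g (mA g) (fun z => mule_ge0 (h1 _) (h2 _)).
congr JH; ext => z /=; by rewrite actK muleC.
Qed.

Definition ind (F : set (uhp R)) z : \bar R := if `[< F z >] then 1 else 0.

Lemma ind_ge0 F z : 0 <= ind F z.
Proof. by rewrite /ind; case: ifP. Qed.
Lemma hm_ind F : measurable (plane F : set (RxR R)) -> hm (ind F).
Proof.
move=> mF; rewrite /hm /mj (_ : _ \_ UH = (fun p => (\1_(plane F) p)%:E)).
 by apply/measurable_EFinP; exact: measurable_indic.
ext => p; rewrite /patch indicE; case: ifPn => pU; last first.
 rewrite memNset // => -[z Fz zE]; move: pU; rewrite notin_setE; apply.
 by rewrite /UH /=; have := uval_gt0 z; rewrite zE.
have /UHE[z zE ->] := set_mem pU; rewrite lft_co /ind.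
case: asboolP => Fz; first by rewrite mem_set //; exists z => //; exact/esym/coK.
rewrite memNset // => -[w Fw wE]; apply: Fz.
by rewrite (_ : z = w) //; apply: uhp_inj; rewrite wE; exact/esym/coK.
Qed.

Variable F : set (uhp R).
Hypothesis fF : fundamental_domain G F.

Let mF : hm (ind F).
Proof. by apply: hm_ind; case: fF. Qed.

(** Every orbit meets F, so the group sum of the indicator of F is at least 1; [SG_sym] moves the
    sum onto [phi]. *)
Lemma fold_le phi : hm phi -> (forall z, 0 <= phi z) ->
 JH phi <= JH (fun z => ind F z * SG phi z).
Proof.
move=> m h; rewrite -SG_sym //; last by move=> z; exact: ind_ge0.
apply: le_JH => // [|z].
 by apply: hmM => //; apply: hm_SG => // z; exact: ind_ge0.
rewrite -[leLHS]mule1; apply: lee_wpmul2l => //.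
have [_ cov _] := fF; have [s Gs Fs] := cov z.
apply: esum_ge; exists [set s]; first by split; [exact: finite_set1|move=> _ ->].
by rewrite fsbig_set1 /ind asboolT.
Qed.

Let eps := eps_card G.

Lemma finite_centerG : finite_set (G `&` Zmp).
Proof. by apply: sub_finite_set (@finite_center R) => g []. Qed.
Lemma eps_gt0 : (0 < eps)%N.
Proof.
rewrite cardfs_gt0; apply/fset0Pn; exists 1%g.
by rewrite in_fset_set ?inE; [split; [case: sG|left]|exact: finite_centerG].
Qed.

Lemma center_act g z : Zmp g -> act g z = z.
Proof.
move=> cg; apply: uhp_inj; rewrite /= /mob /mob_num /mob_den.
case: cg => ->; rewrite !mxE /= ?oppr0 ?rmorphN ?rmorph1 ?rmorph0 ?mul1r ?mul0r ?addr0 ?add0r ?divr1 //.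
by rewrite mulN1r invrN invr1 mulrN1 opprK.
Qed.

Lemma centerG_mul g s : (G `&` Zmp) g -> G s -> G (g * s)%g.
Proof. by move=> [Gg _] Gs; case: sG => _ h _; exact: h. Qed.
Lemma esum_ind_le I (D P : set I) (n : nat) : seqbound (D `&` P) n ->
 \esum_(i in D) (if `[< P i >] then 1 else 0 : \bar R) <= n%:R%:E.
Proof.
move=> sb; apply: ub_ereal_sup => _ [X [fX XD] <-].
rewrite fsbig_finite //=.
have -> : \sum_(x <- fset_set X) (if `[< P x >] then 1 else 0 : \bar R) =
  (size [seq x <- fset_set X | `[< P x >]])%:R%:E.
 elim: (enum_fset _) => [|x s IH]; rewrite ?big_nil ?big_cons //= IH.
 by case: ifP => _ /=; rewrite ?add0e // -EFinD -natr1 addrC.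
rewrite lee_fin ler_nat; apply: sb; first by rewrite filter_uniq.
move=> x; rewrite mem_filter => /andP[/asboolP Px]; rewrite in_fset_set // => /set_mem Xx.
by split => //; exact: XD.
Qed.

Lemma esum_ind_ge I (D P : set I) (s : seq I) : uniq s ->
 (forall x, x \in s -> D x /\ P x) ->
 (size s)%:R%:E <= \esum_(i in D) (if `[< P i >] then 1 else 0 : \bar R).
Proof.
move=> us hs; apply: esum_ge; exists [set` s].
 by split; [exact: finite_seq|move=> x /= /hs[]].
rewrite -fsbig_seq //=.
have -> : \sum_(x <- s) (if `[< P x >] then 1 else 0 : \bar R) = (size s)%:R%:E.
 elim: s us hs => [|x s IH] /=; rewrite ?big_nil ?big_cons // => /andP[_ us] hs.
 rewrite IH // => [|y ys]; last by apply: hs; rewrite inE ys orbT.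
 by have [_ Px] := hs x (mem_head _ _); rewrite asboolT // -EFinD -natr1 addrC.
exact: lexx.
Qed.

Lemma SG_act phi g z : G g -> (forall z, 0 <= phi z) -> SG phi (act g z) = SG phi z.
Proof.
move=> Gg h; have [_ mG iG] := sG.
rewrite /SG (@reindex_esum _ _ _ G G (fun s => s * g)%g (fun s => phi (act s z))).
 by apply: eq_esum => s _; rewrite -actM.
split=> [s Gs|s t _ _ /mulIg //|s Gs]; first exact: mG.
by exists (s * g^-1)%g; [apply: mG => //; exact: iG|rewrite mulgVK].
Qed.

Lemma null_ind (M : set (R * R)) : measurable (M : set (RxR R)) ->
 leb2 M = 0 ->
 let phi := ind [set z | M (co (uval z))] in hm phi /\ JH phi = 0.
Proof.
move=> mM M0 phi.
have E p : (lft phi \_ UH) p = (\1_(M `&` UH) p)%:E.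
 rewrite /patch indicE in_setI; case: (boolP (p \in UH)) => pU; last by rewrite andbF.
 have /UHE[z _ pE] := set_mem pU; rewrite pE lft_co /phi /ind andbT /=.
 by case: asboolP => Mz; [rewrite mem_set|rewrite memNset].
have mphi : hm phi.
 rewrite /hm /mj (funext E); apply/measurable_EFinP; apply: measurable_indic.
 by apply: measurableI => //; exact: measurable_UH.
split=> //; rewrite /JH /J.
transitivity (\int[leb2]_(p in M) ((lft phi \_ UH) p * (hw p.2)%:E)); last first.
 apply: null_set_integral => //; apply: measurable_funTS; exact: mhint.
rewrite [RHS]integral_mkcond; apply: eq_integral => p _.
rewrite [in RHS]/patch; case: (boolP (p \in M)) => // pM.
by rewrite E indicE in_setI (negbTE pM) mul0e.
Qed.

(** The overlap of F with its translate by s need only lie in a null set, so it is replaced by the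
    indicator of a measurable null set. The statement covers every s, with 0 for irrelevant ones, so
    that a choice function applies. *)
Lemma negligible_ind s : exists m : uhp R -> \bar R, [/\ hm m, forall z, 0 <= m z, JH m = 0 &
 G s -> ~ Zmp s -> forall z, F z -> F (act (s^-1)%g z) -> m z = 1].
Proof.
have [[Gs cs]|nGs] := pselect (G s /\ ~ Zmp s); last first.
 exists (fun=> 0); split; [exact: hm_cst|by []|exact: JH0|] => Gs cs.
 by exfalso; apply: nGs.
have [_ _ /(_ _ Gs cs)[M [mM M0 sM]]] := fF.
have [m1 m2] := null_ind mM M0; exists (ind [set z | M (co (uval z))]); split => // [z|_ _ z Fz Fsz].
 exact: ind_ge0.
rewrite /ind asboolT //=; apply: sM; exists z; last exact/esym/coK.
by split=> //; exists (act (s^-1)%g z) => //; rewrite actVK.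
Qed.

Lemma SG_ind_ge z : eps%:R%:E <= SG (ind F) z.
Proof.
have [_ cov _] := fF; have [s Gs Fs] := cov z.
have := @esum_ind_ge _ G [set g | F (act g z)] [seq (c * s)%g | c <- fset_set (G `&` Zmp)].
rewrite size_map; apply; first by rewrite map_inj_uniq ?fset_uniq // => c d /mulIg.
move=> x /mapP[c]; rewrite in_fset_set; last exact: finite_centerG.
move=> /set_mem[Gc cc] ->; split; first exact: centerG_mul.
by rewrite /= actM center_act.
Qed.

(** Almost every point is sent into F by exactly [eps] elements of G: at least [eps] because the
    center acts trivially, and at most [eps] off the translates of the overlaps. *)
Lemma JH_SG_ind phi : hm phi -> (forall z, 0 <= phi z) ->
 JH (fun z => phi z * SG (ind F) z) = eps%:R%:E * JH phi.
Proof.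
move=> mp p0.
have [m hm_] := choice negligible_ind.
have mm s : hm (m s) by have [] := hm_ s.
have m0 s z : 0 <= m s z by have [_ h _ _] := hm_ s.
have mi s : JH (m s) = 0 by have [] := hm_ s.
have [n1 n2] := JH_esum countable_group mm m0.
set nu := (fun z => _) in n1 n2.
have nu0 z : 0 <= nu z by apply: esum_ge0.
have nuJ : JH nu = 0 by rewrite n2 esum1.
have Hm : hm (SG nu) by exact: hm_SG.
have HJ : JH (SG nu) = 0.
 have na g : hm (nu \o act g) by have [] := JH_act g n1 nu0.
 rewrite /SG (JH_esum countable_group na (fun g z => nu0 _)).2.
 by rewrite esum1 // => g _; have [_ ->] := JH_act g n1 nu0.
have e0 : 0 <= eps%:R%:E :> \bar R by rewrite lee_fin ler0n.
have i0 z : 0 <= ind F z by exact: ind_ge0.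
have S0 z : 0 <= SG (ind F) z by exact: SG_ge0.
have mS : hm (SG (ind F)) by exact: hm_SG.
have H0 z : 0 <= SG nu z by exact: SG_ge0.
apply/eqP; rewrite eq_le; apply/andP; split; last first.
 rewrite -JHZ //; apply: le_JH => [|||z].
 - by apply: hmM => //; exact: hm_cst.
 - exact: hmM.
 - by move=> z; exact: mule_ge0.
 - by rewrite muleC; apply: lee_wpmul2l => //; exact: SG_ind_ge.
have m1 : hm (fun z => eps%:R%:E * phi z) by apply: hmM => //; exact: hm_cst.
have m2 : hm (fun z => +oo * SG nu z) by apply: hmM => //; exact: hm_cst.
have p1 z : 0 <= eps%:R%:E * phi z by exact: mule_ge0.
have p2 z : 0 <= +oo * SG nu z by exact: mule_ge0.
have [m3 E3] := JHD m1 m2 p1 p2.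
rewrite -(JHZ mp) // -[leRHS]adde0 -(mule0 +oo) -HJ -(JHZ Hm) // -E3.
apply: le_JH => // [|z|z]; [exact: hmM|exact: mule_ge0|].
(* On the exceptional set the right-hand side is +oo, at no cost since [SG nu] has integral 0.
   Elsewhere any two elements sending z into F differ by a central one, and [eps] bounds their
   number. *)
have [Hz|Hz] := eqVneq (SG nu z) 0; last first.
 by rewrite gt0_mulye ?addey ?leey ?gt_eqF ?(lt_le_trans _ (p1 z)) ?ltNyr // lt_def Hz H0.
rewrite Hz mule0 adde0 muleC; apply: lee_wpmul2r => //.
apply: (@esum_ind_le _ G [set g | F (act g z)]).
have [[g1 [Gg1 Fg1]]|nG] := pselect (exists g, (G `&` [set g | F (act g z)]) g); last first.
 by move=> [//|x s] _ /(_ x (mem_head _ _)) Px; exfalso; apply: nG; exists x.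
apply: (@seqbound_inj _ _ (fun g => g * g1^-1)%g _ (G `&` Zmp)).
- by move=> x y _ _ /mulIg.
- move=> g [Gg Fg]; have [_ mG iG] := sG.
 have Gs : G (g * g1^-1)%g by apply: mG => //; exact: iG.
 split => //; apply: contrapT => cs.
 have [_ _ _ /(_ Gs cs (act g z) Fg)] := hm_ (g * g1^-1)%g.
 rewrite invgM invgK actM actK => /(_ Fg1) m1z.
 have : 1 <= SG nu z.
  apply: esum_ge; exists [set g]; first by split; [exact: finite_set1|move=> _ ->].
  rewrite fsbig_set1 /= /nu; apply: esum_ge; exists [set (g * g1^-1)%g].
   by split; [exact: finite_set1|move=> _ ->].
  by rewrite fsbig_set1 m1z.
 by rewrite Hz leNgt lte01.
- exact: finite_seqbound finite_centerG.
Qed.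
End Group.
End Unfolding.

(** * The stabilizer of infinity, its cosets, and the unfolding identity *)

Section Cosets.
Context {R : realType}.
Local Notation C := (Cx R).
Variables (G : set (metap R)) (h : R).
Hypotheses (sG : is_subgroup G) (h0 : 0 < h).
Hypothesis HS : cusp_width G h.

Lemma stabE s : stab_oo G s <-> G s /\ mat s 1 0 = 0.
Proof.
split=> -[Gs]; rewrite /bact.
 by case: eqP => // c0 _.
by move=> c0; split=> //; rewrite /bact c0 eqxx.
Qed.

Lemma stab_subgroup : is_subgroup (stab_oo G).
Proof.
have [G1 mG iG] := sG; split=> [|s t /stabE[Gs s0] /stabE[Gt t0]|s /stabE[Gs s0]]; apply/stabE.
- by split=> //; rewrite mxE.
- by split; [exact: mG|rewrite mat_mul mulmx22 s0 t0 mul0r mulr0 addr0].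
- by split; [exact: iG|rewrite mat_inv /adj2 !mx22E s0 oppr0].
Qed.

Lemma center_stab c : G c -> Zmp c -> stab_oo G c.
Proof. by move=> Gc cc; apply/stabE; split => //; case: cc => ->; rewrite !mxE ?oppr0. Qed.
Lemma act_nx (x : R) (w : uhp R) : uval (act (nx x) w) = uval w + toC x.
Proof.
by rewrite /= /mob /mob_num /mob_den !mx22E rmorph1 rmorph0 mul1r mul0r add0r divr1.
Qed.

Lemma act_nxX n (w : uhp R) : uval (act (nx h ^+ n)%g w) = uval w + toC (n%:R * h).
Proof.
elim: n => [|n IH]; first by rewrite expg0 act1 mul0r rmorph0 addr0.
by rewrite expgS actM act_nx IH -natr1 mulrDl mul1r rmorphD addrA.
Qed.

Lemma act_nxXV n (w : uhp R) : uval (act (nx h ^- n)%g w) = uval w - toC (n%:R * h).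
Proof. by rewrite -[in RHS](actVK (nx h ^+ n)%g w) act_nxX addrK. Qed.
Lemma stab_shift t : stab_oo G t ->
 exists k : int, forall w, uval (act t w) = uval w + toC (k%:~R * h).
Proof.
move=> St; have : setmul Zmp (stab_oo G) t.
 by exists 1%g; [left|exists t => //; rewrite mul1g].
rewrite HS => -[c cc [u [n]]] [] -> <-.
 by exists n%:Z => w; rewrite actM center_act // act_nxX.
by exists (- n%:Z) => w; rewrite actM center_act // act_nxXV mulrNz mulNr rmorphN.
Qed.

Lemma stab_all (k : int) : exists2 t, stab_oo G t & forall w, uval (act t w) = uval w + toC (k%:~R * h).
Proof.
have key u : cyclic_gen (nx h) u -> exists2 t, stab_oo G t & forall w, act t w = act u w.
 move=> cu; have : setmul Zmp (cyclic_gen (nx h)) u.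
  by exists 1%g; [left|exists u => //; rewrite mul1g].
 rewrite -HS => -[c cc [t St <-]]; exists t => // w.
 by rewrite actM (center_act _ cc).
case: k => n.
 have [|t St tw] := key (nx h ^+ n)%g; first by exists n; left.
 by exists t => // w; rewrite tw act_nxX.
have [|t St tw] := key (nx h ^- n.+1)%g; first by exists n.+1; right.
by exists t => // w; rewrite tw act_nxXV NegzE mulrNz mulNr rmorphN.
Qed.

Lemma fix_center (s : metap R) : (forall w, act s w = w) -> Zmp s.
Proof.
move=> fx; apply: nn_eq0; first exact: mat_det.
have q0 (y : R) : 0 < y -> mat s 0 1 = - (mat s 1 0 * y ^+ 2) /\ mat s 0 0 = mat s 1 1.
 move=> y0; have iy : 0 < Im (0 +i* y : C)%C by [].
 have /(congr1 uval) := fx (UHP iy); have := mob_den_uneq0 s (UHP iy); rewrite /= /mob => d0.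
 move=> /(congr1 (fun x => x * mob_den (mat s) (0 +i* y)%C)); rewrite divfK //.
 rewrite /mob_num /mob_den /toC; simpc => -[e1 e2]; split; first by rewrite e1; ring.
 by apply: (mulIf (lt0r_neq0 y0)); rewrite e2 mulrC.
(* Fixing iy gives b = -c y^2; two heights force b = c = 0. *)
have [b1 a1] := q0 1 ltr01; have [b2 _] := q0 2 (ltr0n _ 2).
have c0 : mat s 1 0 = 0 by move: b1; rewrite b2; lra.
by rewrite /nn b1 c0 a1 subrr mul0r oppr0; ring.
Qed.

Definition strip : set (uhp R) := [set z | 0 <= Re (uval z) < h].
Let eps := eps_card G.

(** Exactly one translation by a multiple of h brings w into the strip; the elements of the
    stabilizer inducing it form one coset of the center of G. *)
Lemma strip_count w : (\esum_(t in stab_oo G) ind strip (act t w) = eps%:R%:E)%E.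
Proof.
pose k0 := - Num.floor (Re (uval w) / h).
have [t0 St0 t0w] := stab_all k0.
have fl := floor_itv (Re (uval w) / h); set f := Num.floor _ in fl k0 t0w.
have hb : f%:~R * h <= Re (uval w) < (f%:~R + 1) * h.
 move: fl; rewrite intrD => /andP[f1 f2].
 by rewrite -ler_pdivlMr // f1 -ltr_pdivrMr.
have [S1 mS iS] := stab_subgroup.
have str t k : (forall w, uval (act t w) = uval w + toC (k%:~R * h)) ->
  strip (act t w) <-> k = k0.
 move=> tw; rewrite /strip /= -[mob _ _]/(uval (act t w)) tw ReD /=; split=> [/andP[a1 a2]|->].
  suff : (k + f == 0)%R by rewrite addr_eq0 => /eqP.
  have : (-1 < (k + f)%:~R :> R) /\ ((k + f)%:~R < 1 :> R).
   by rewrite intrD; case/andP: hb => b1 b2; split; rewrite -(ltr_pM2r h0); nra.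
  rewrite -[1%R]/(1%:~R) -[(-1)%R]/((-1)%:~R) !ltr_int => -[]; lia.
 by rewrite /k0 mulrNz; case/andP: hb => b1 b2; apply/andP; split; lra.
apply/eqP; rewrite eq_le; apply/andP; split.
 apply: (@esum_ind_le _ _ (stab_oo G) [set t | strip (act t w)]).
 apply: (@seqbound_inj _ _ (fun t => t * t0^-1)%g _ (G `&` Zmp)).
 - by move=> x y _ _ /mulIg.
 - move=> t [St /= tw]; have Stt : stab_oo G (t * t0^-1)%g by apply: mS => //; exact: iS.
  split; first by have /stabE[] := Stt.
  have [k kw] := stab_shift St; have kk : k = k0 by apply/(str _ _ kw).
  apply: fix_center => v; apply: uhp_inj; rewrite actM kw kk -t0w actVK.
  by [].
 - exact: finite_seqbound (finite_centerG G).
have := @esum_ind_ge _ _ (stab_oo G) [set t | strip (act t w)]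
 [seq (c * t0)%g | c <- fset_set (G `&` Zmp)].
rewrite size_map; apply; first by rewrite map_inj_uniq ?fset_uniq // => c d /mulIg.
move=> x /mapP[c]; rewrite in_fset_set; last exact: finite_centerG.
move=> /set_mem[Gc cc] ->; split; first by apply: mS => //; exact: center_stab.
by rewrite /= actM center_act //; apply/(str _ _ t0w).
Qed.

Definition rep (c : set (metap R)) : metap R := xget 1%g c.

Lemma coset_mul t g : stab_oo G t -> right_coset (stab_oo G) (t * g)%g = right_coset (stab_oo G) g.
Proof.
move=> St; have [S1 mS iS] := stab_subgroup.
apply/seteqP; split=> _ [u Su <-].
 by exists (u * t)%g; [exact: mS|rewrite mulgA].
by exists (u * t^-1)%g; [by apply: mS => //; exact: iS|rewrite -mulgA mulKg].
Qed.

Lemma repP c : stab_cosets G c -> G (rep c) /\ c = right_coset (stab_oo G) (rep c).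
Proof.
have [S1 mS iS] := stab_subgroup; have [_ mG _] := sG.
move=> [s Gs <-]; rewrite /rep; case: xgetP => [_ -> [t St <-]|/(_ s) []].
 by split; [by apply: mG => //; have /stabE[] := St|rewrite coset_mul].
by exists 1%g => //; rewrite mul1g.
Qed.

(** Every element of G factors uniquely as t * [rep c] with t in the stabilizer, so a sum over G
    becomes a double sum. *)
Lemma coset_bij : set_bij (stab_cosets G `*`` (fun=> stab_oo G)) G (fun k => k.2 * rep k.1)%g.
Proof.
have [S1 mS iS] := stab_subgroup; have [_ mG _] := sG.
split=> [[c t] /= [cc St]|[c t] [c' t'] /set_mem[/= cc St] /set_mem[/= cc' St'] e|g Gg].
- by have [Gr _] := repP cc; apply: mG => //; have /stabE[] := St.
- have cE : c = c'.
  have [_ ->] := repP cc; have [_ ->] := repP cc'.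
  by rewrite -(coset_mul _ St) e coset_mul.
 by subst c'; congr pair; exact: mulIg e.
- have cg : stab_cosets G (right_coset (stab_oo G) g) by exists g.
 have [_ e] := repP cg; have : right_coset (stab_oo G) g g by exists 1%g; rewrite ?mul1g.
 by rewrite {1}e => -[t St tg]; exists (right_coset (stab_oo G) g, t).
Qed.

Section Unfold.
Local Open Scope ereal_scope.
Hypothesis dG : discrete_set G.
Implicit Types phi : uhp R -> \bar R.

Definition Eser phi (z : uhp R) : \bar R := \esum_(c in stab_cosets G) phi (act (rep c) z).

Lemma Eser_ge0 phi z : (forall z, 0 <= phi z) -> 0 <= Eser phi z.
Proof. by move=> p0; apply: esum_ge0. Qed.
Lemma hm_strip : hm (ind strip).
Proof.
apply: hm_ind; rewrite (_ : plane strip = `[0%R, h[%classic `*` `]0%R, +oo[%classic).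
 exact: measurableX.
apply/seteqP; split=> [[x y] [z zs zE]|[x y] [/= xh y0]].
 move: zs (uval_gt0 z); rewrite /strip /= zE /= => xh y0.
 by split; rewrite /= in_itv /= ?andbT.
move: xh y0; rewrite !in_itv /= andbT => xh y0.
by exists (@UHP R (x +i* y)%C y0).
Qed.

Lemma eps_inj (x y : \bar R) : eps%:R%:E * x = eps%:R%:E * y -> x = y.
Proof.
move=> /(congr1 (fun u => (eps%:R^-1)%:E * u)); rewrite !muleA -EFinM mulVf ?mul1e //.
by rewrite pnatr_eq0 -lt0n; exact: (eps_gt0 sG).
Qed.

Lemma stab_cosets_countable : countable (stab_cosets G).
Proof.
have cG := countable_group sG dG.
exact: (sub_countable (card_image_le (right_coset (stab_oo G)) G) cG).
Qed.

(** In the double sum over cosets and stabilizer, [phi] does not see the stabilizer, and the strip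
    is hit [eps] times. *)
Lemma coset_sum phi z : (forall z, 0 <= phi z) ->
 (forall t w, stab_oo G t -> phi (act t w) = phi w) ->
 SG G (fun w => ind strip w * phi w) z = eps%:R%:E * Eser phi z.
Proof.
move=> p0 ps; have i0 w : 0 <= ind strip w by exact: ind_ge0.
rewrite /SG (reindex_esum _ _ _ (fun g => ind strip (act g z) * phi (act g z)) coset_bij).
rewrite -(@esum_esum _ _ _ (stab_cosets G) (fun=> stab_oo G)
 (fun c t => ind strip (act (t * rep c)%g z) * phi (act (t * rep c)%g z))); last first.
 by move=> c t _ _; exact: mule_ge0.
have cC := stab_cosets_countable.
rewrite /Eser esum_mulr //; apply: eq_esum => c cc.
have cT : countable (stab_oo G) by apply: sub_countable (countable_group sG dG); apply: subset_card_le => t /stabE[].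
rewrite -(strip_count (act (rep c) z)) muleC esum_mulr //; apply: eq_esum => t St.
by rewrite actM ps // muleC.
Qed.

Lemma hm_Eser phi : hm phi -> (forall z, 0 <= phi z) -> hm (Eser phi).
Proof.
move=> mp p0; apply: (JH_esum stab_cosets_countable _ _).1 => [c|c z]; last exact: p0.
by have [] := JH_act (rep c) mp p0.
Qed.

(** Read off from the full group sum, whose invariance is a translation in G; this avoids permuting
    the cosets. *)
Lemma Eser_act phi g z : G g -> (forall z, 0 <= phi z) ->
 (forall t w, stab_oo G t -> phi (act t w) = phi w) -> Eser phi (act g z) = Eser phi z.
Proof.
move=> Gg p0 ps; apply: eps_inj; rewrite -!coset_sum //; apply: SG_act => // w.
by apply: mule_ge0 => //; exact: ind_ge0.
Qed.

(** Multiplied by [eps], both sides equal the integral of the strip-truncated [phi] times the group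
    sum of the indicator of F: the left one by [coset_sum] and [SG_sym], the right one by
    [JH_SG_ind]. *)
Lemma unfold (F : set (uhp R)) phi : fundamental_domain G F -> hm phi -> (forall z, 0 <= phi z) ->
 (forall t w, stab_oo G t -> phi (act t w) = phi w) ->
 JH (fun z => ind F z * Eser phi z) = JH (fun z => ind strip z * phi z).
Proof.
move=> fF mp p0 ps; apply: eps_inj.
have mF : hm (ind F) by apply: hm_ind; case: fF.
have i0 A (z : uhp R) : 0 <= ind A z by exact: ind_ge0.
have m1 : hm (fun z => ind strip z * phi z) by apply: hmM => //; exact: hm_strip.
have p1 z : 0 <= ind strip z * phi z by exact: mule_ge0.
have e0 : 0 <= eps%:R%:E :> \bar R by rewrite lee_fin ler0n.
rewrite -(JH_SG_ind sG dG fF m1 p1) -(SG_sym sG dG mF m1 (i0 F) p1).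
rewrite -JHZ //; first by congr JH; ext => z; rewrite coset_sum // muleCA.
- by apply: hmM => //; exact: hm_Eser.
- by move=> z; apply: mule_ge0 => //; exact: Eser_ge0.
Qed.
End Unfold.
End Cosets.

(** * Hyperbolic balls of a fixed radius *)

Section HyperbolicBalls.
Context {R : realType}.
Local Notation C := (Cx R).
Implicit Types (z w : uhp R) (g : metap R).
Local Notation ht z := (Im (uval z)).

(** Invariance of |z - w|^2 / (Im z Im w), which is 4 sinh^2 of half the hyperbolic distance, stated
    without division. *)
Lemma dist_act g z w : cabs (uval (act g z) - uval (act g w)) ^+ 2 * (ht z * ht w) =
 cabs (uval z - uval w) ^+ 2 * (ht (act g z) * ht (act g w)).
Proof.
have dz := mob_den_uneq0 g z; have dw := mob_den_uneq0 g w.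
have E : uval (act g z) - uval (act g w) =
  (uval z - uval w) / (mob_den (mat g) (uval z) * mob_den (mat g) (uval w)).
 rewrite /= /mob; apply: (mulIf (mulf_neq0 dz dw)); rewrite [RHS]divfK ?mulf_neq0 //.
 have D := mat_det g; rewrite det22 in D.
 have D' : toC (mat g 0 0) * toC (mat g 1 1) - toC (mat g 0 1) * toC (mat g 1 0) = 1.
  by rewrite -!rmorphM -rmorphB D rmorph1.
 transitivity (mob_num (mat g) (uval z) * mob_den (mat g) (uval w) -
  mob_num (mat g) (uval w) * mob_den (mat g) (uval z)); first by field; apply/andP.
 rewrite -[RHS]mul1r -D' /mob_num /mob_den; ring.
have cz : cabs (mob_den (mat g) (uval z)) != 0 by rewrite cabs_eq0.
have cw : cabs (mob_den (mat g) (uval w)) != 0 by rewrite cabs_eq0.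
rewrite E /= !Im_mob ?mat_det // cabsf cabsM; field.
by apply/andP.
Qed.

(** A hyperbolic ball whose radius is independent of z. The constant 40 makes heights in a ball
    differ by at most a factor 6 / 5 and puts z within a quarter of the height of w, as
    [Phi_harnack] requires. *)
Definition hball z : set (uhp R) := [set w | cabs (uval z - uval w) ^+ 2 < ht z * ht w / 40].

Lemma hball_sym z w : hball z w -> hball w z.
Proof. by rewrite /hball /= cabsBC (mulrC (ht z)). Qed.
Lemma hball_act g z w : hball z w -> hball (act g z) (act g w).
Proof.
rewrite /hball /= => H; have p1 := mulr_gt0 (uval_gt0 z) (uval_gt0 w).
have p2 := mulr_gt0 (uval_gt0 (act g z)) (uval_gt0 (act g w)).
have := dist_act g z w; rewrite -[mob _ (uval z)]/(uval (act g z)) -[mob _ (uval w)]/(uval (act g w)).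
set a := cabs _ ^+ 2 in H *; set b := cabs _ ^+ 2; set P := ht z * ht w in p1 H *.
set Q := _ * Im (uval (act g w)) in p2 * => E.
by rewrite -(ltr_pM2r p1) E (_ : Q / 40 * P = P / 40 * Q) ?ltr_pM2r //; ring.
Qed.

Lemma hball_Im z w : hball z w -> ht z <= 6 / 5 * ht w.
Proof.
rewrite /hball /= cabs_sqr ReD ImD ReN ImN => H.
have a0 := uval_gt0 z; have b0 := uval_gt0 w; set a := ht z in H a0 *; set b := ht w in H b0 *.
have : (a - b) ^+ 2 < a * b / 40 by apply: le_lt_trans H; rewrite lerDr sqr_ge0.
move=> K; rewrite leNgt; apply/negP => N; have : (b / 5) * (a - b) < (a - b) ^+ 2.
 by rewrite expr2 ltr_pM2r; lra.
nra.
Qed.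

Lemma hball_close z w : hball z w -> cabs (uval w - uval z) <= ht w / 4.
Proof.
move=> H; have I := hball_Im H; have b0 := uval_gt0 w.
rewrite -(@ler_pXn2r _ 2) ?nnegrE ?divr_ge0 ?(ltW b0) // cabsBC.
move: H; rewrite /hball /= => H; apply: ltW; apply: lt_le_trans H _; nra.
Qed.

(** In the frame of z the squared norm of g is 2 cosh d (z, g z). *)
Lemma fro_cj z g : fro (cj z g) * (ht z * ht (act g z)) =
 cabs (uval z - uval (act g z)) ^+ 2 + 2 * (ht z * ht (act g z)).
Proof.
have y0 := uval_gt0 z; have yn : ht z != 0 by rewrite gt_eqF.
have dz := mob_den_uneq0 g z; have cz : cabs (mob_den (mat g) (uval z)) != 0 by rewrite cabs_eq0.
set P := cabs (toC (mat g 1 0) * uval z ^+ 2 + toC (mat g 1 1 - mat g 0 0) * uval z - toC (mat g 0 1)).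
have -> : fro (cj z g) = 2 + P ^+ 2 / ht z ^+ 2.
 have := nzE yn (mat_det g); rewrite -/P /nz -/(cj z g) => e.
 have e2 : 2 * fro (cj z g) = nn (cj z g) + (mat g 0 0 + mat g 1 1) ^+ 2.
  rewrite /fro /nn /cj /cjm !mx22E; ring.
 by apply: (mulfI (_ : 2 != 0 :> R)); rewrite ?pnatr_eq0 // e2 e; field.
have E : uval z - uval (act g z) = (toC (mat g 1 0) * uval z ^+ 2 + toC (mat g 1 1 - mat g 0 0) * uval z - toC (mat g 0 1)) / mob_den (mat g) (uval z).
 rewrite /= /mob; apply: (mulIf dz); rewrite [RHS]divfK // mulrBl divfK // /mob_num /mob_den rmorphB; ring.
rewrite E cabsf -/P /= Im_mob ?mat_det //; field.
by apply/andP.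
Qed.

(** If g returns some point of the ball at z to that ball, the triangle inequality through g w
    bounds the distance from z to g z. *)
Lemma hball_entries z w g : hball z w -> hball z (act g w) -> forall i j, `|cj z g i j| <= 4.
Proof.
move=> H1 H2; have H3 := hball_act g H1.
have I1 := hball_Im (hball_sym H2); have I2 := hball_Im (hball_sym H3).
have F := fro_cj z g; have a0 := uval_gt0 z; have b0 := uval_gt0 (act g z).
have d1 : cabs (uval z - uval (act g z)) ^+ 2 <=
  2 * cabs (uval z - uval (act g w)) ^+ 2 + 2 * cabs (uval (act g z) - uval (act g w)) ^+ 2.
 have : cabs (uval z - uval (act g z)) <= cabs (uval z - uval (act g w)) + cabs (uval (act g z) - uval (act g w)).
  by rewrite (_ : _ - _ = (uval z - uval (act g w)) - (uval (act g z) - uval (act g w))) ?cabsB //; ring.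
 have := cabs_ge0 (uval z - uval (act g z)).
 set p := cabs _; set q := cabs _; set r := cabs _ => p0 pqr.
 have : p ^+ 2 <= (q + r) ^+ 2 by rewrite ler_pXn2r // nnegrE (le_trans p0).
 have := sqr_ge0 (q - r); nra.
move: H2 H3; rewrite /hball [X in X -> _]/= [X in _ -> X -> _]/= => H2 H3.
move=> i j; apply: entry_fro => //.
set a := ht z in H2 I1 a0 F *; set b := ht (act g z) in H3 I2 b0 F *; set c := ht (act g w) in H2 H3 I1 I2 *.
have ab := mulr_gt0 a0 b0; rewrite -(ler_pM2r ab) F; nra.
Qed.

Local Open Scope ereal_scope.

Lemma hm_hball z : hm (ind (hball z)).
Proof.
apply: hm_ind; set x := Re (uval z); set y := ht z.
pose f (p : RxR R) : R :=
 ((x - p.1) ^+ 2 + (y - p.2) ^+ 2 - y * p.2 / 40)%R.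
have mf : mfT f.
 have m1 : mfT (fun p : RxR R => p.1) by exact: measurable_fst.
 have m2 : mfT (fun p : RxR R => p.2) by exact: measurable_snd.
 apply: measurable_funB; first apply: measurable_funD.
 - by apply: measurable_funX; apply: measurable_funB.
 - by apply: measurable_funX; apply: measurable_funB.
 - by apply: measurable_funM => //; apply: measurable_funM.
rewrite (_ : plane (hball z) = UH `&` f @^-1` `]-oo, 0%R[%classic).
 apply: measurableI; first exact: measurable_UH.
 by rewrite -[X in measurable X]setTI; apply: mf => //; exact: measurable_itv.
have fE (w : uhp R) : f (co (uval w)) \in `]-oo, 0%R[ = (cabs (uval z - uval w) ^+ 2 < y * ht w / 40)%R.
 by rewrite in_itv /= /f /= subr_lt0 cabs_sqr ReD ImD ReN ImN.
apply/seteqP; split=> [p [w hw wE]|p [pU pf]].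
 have pE : p = co (uval w) by rewrite wE; case: (p).
 by rewrite pE; split; [exact: uval_gt0|rewrite /= fE].
have [w _ pE] := UHE pU; exists w; last by rewrite pE; case: (uval w).
by move: pf; rewrite pE /= fE.
Qed.

Lemma JH_hball z : JH (ind (hball z)) = JH (ind (hball uhp_i)).
Proof.
have i0 w : 0 <= ind (hball z) w by exact: ind_ge0.
rewrite /JH -(J_aff (Re (uval z)) (uval_gt0 z) (hm_hball z) (lft_ge0 i0)).
apply: eq_J => p pU; have [w _ pE] := UHE pU; rewrite pE lft_co /=.
have v0 : (0 < Im ((ht z * Re (uval w) + Re (uval z)) +i* (ht z * ht w) : C)%C)%R.
 by rewrite /= mulr_gt0.
rewrite -[(_, _)]/(co (uval (UHP v0))) lft_co /ind; congr (if _ then _ else _).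
apply/asboolP/asboolP; rewrite /hball /= !cabs_sqr !(ReD, ImD, ReN, ImN) /= => H.
 have y0 := uval_gt0 z; have y20 : (0 < ht z ^+ 2)%R by rewrite exprn_gt0.
 by rewrite -(ltr_pM2l y20); move: H; congr (_ < _)%R; ring.
have y0 := uval_gt0 z; have y20 : (0 < ht z ^+ 2)%R by rewrite exprn_gt0.
by move: H; rewrite -(ltr_pM2l y20); congr (_ < _)%R; ring.
Qed.

Lemma JH_hball_gt0 : exists2 c : R, (0 < c)%R & forall z, c%:E <= JH (ind (hball z)).
Proof.
have h1 : (-1 / 20 < 1 / 20 :> R)%R by lra.
have h2 : (19 / 20 < 21 / 20 :> R)%R by lra.
(* A box around i contained in the ball at i: it has area 1 / 100, and the weight y^-2 exceeds 1 / 4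
   on it. *)
pose B : set (R * R) := `[(-1/20)%R, (1/20)%R]%classic `*` `[(19/20)%R, (21/20)%R]%classic.
have mB : measurable (B : set (RxR R)) by exact: measurableX.
have B0 : leb2 B = (1/100)%:E.
 rewrite /leb2 product_measure1E //= !lebesgue_measure_itv /= !lte_fin.
 rewrite h1 h2.
 by rewrite -!EFinD -EFinM; congr EFin; field.
exists (1/4 * (1/100))%R; first lra.
move=> z; have B1 : (1 / 100)%:E = \int[leb2]_p (\1_B p)%:E :> \bar R by rewrite integral_indic // setIT.
rewrite JH_hball EFinM B1.
have mB1 : mfT (fun p : RxR R => ((\1_B p : R)%:E : \bar R)).
 by apply/measurable_EFinP; exact: measurable_indic.
have q0 : (0 <= 1 / 4 :> R)%R by lra.
have B10 (p : R * R) : 0 <= (\1_B p)%:E :> \bar R by rewrite lee_fin.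
rewrite -(ge0_integralZl_EFin leb2 measurableT (fun p _ => B10 p) mB1 q0).
have i0 w : 0 <= ind (hball uhp_i) w by exact: ind_ge0.
apply: ge0_le_integral => //.
- exact: measurable_funeM.
- by apply: mhint; exact: hm_hball.
move=> p _; rewrite indicE; case: (boolP (p \in B)) => pB; last first.
 by rewrite mule0; apply: hint_ge0; exact: lft_ge0.
move/set_mem: pB => [] /=; rewrite !in_itv /= => /andP[x1 x2] /andP[y1 y2].
have pU : UH p by rewrite /UH /=; lra.
rewrite mule1 /patch mem_set //; have [w _ pE] := UHE pU.
rewrite {1}pE lft_co /ind asboolT; last first.
 rewrite /hball /= cabs_sqr ReD ImD ReN ImN /=.
 have -> : Re (uval w) = p.1 by rewrite pE.
 have -> : Im (uval w) = p.2 by rewrite pE.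
 nra.
rewrite mul1e lee_fin /hw wtE; last lra.
rewrite -expr2 exprVn -[leLHS]invrK lef_pV2 ?posrE ?exprn_gt0 ?invr_gt0; try lra.
by rewrite mul1r invrK; nra.
Qed.
End HyperbolicBalls.

(** * The pointwise bound for the sum of [Phi] over cosets *)

Section PhiKey.
Context {R : realType}.
Local Notation C := (Cx R).

Lemma hmZ (c : \bar R) (phi : uhp R -> \bar R) : hm phi -> hm (fun z => c * phi z)%E.
Proof. exact: (hmM (hm_cst c)). Qed.
Lemma cexp_period (k : int) : cexp (0 +i* (2 * pi * k%:~R) : C)%C = 1.
Proof.
have P1 : cexp (0 +i* (2 * pi) : C)%C = 1.
 rewrite /cexp /= expR0 rmorph1 mul1r; apply: cx_eq => /=.
  by rewrite mulrC mulr_natr cos2pi.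
 by rewrite mulrC mulr_natr sin2pi.
have Pn (n : nat) : cexp (0 +i* (2 * pi * n%:R) : C)%C = 1.
 elim: n => [|n IH]; first by rewrite mulr0 cexp0.
 rewrite (_ : (0 +i* (2 * pi * n.+1%:R))%C = (0 +i* (2 * pi * n%:R))%C + (0 +i* (2 * pi))%C).
  by rewrite cexpD IH P1 mulr1.
 by apply: cx_eq; rewrite ?ReD ?ImD /= ?addr0 // -natr1; ring.
case: k => n; first exact: Pn.
rewrite NegzE (_ : (0 +i* (2 * pi * (- n.+1%:Z)%:~R))%C = - (0 +i* (2 * pi * n.+1%:R) : C)%C).
 by rewrite cexpN Pn invr1.
by apply: cx_eq; rewrite ?ReN ?ImN /= ?oppr0 // mulrNz; ring.
Qed.

Section Period.
Variable h : R.
Hypothesis h0 : 0 < h.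

Lemma qx_period (k : int) (z : C) : qx h (z + toC (k%:~R * h)) = qx h z.
Proof.
rewrite /qx mulrDr cexpD (_ : (0 +i* qc h)%C * toC (k%:~R * h) = (0 +i* (2 * pi * k%:~R))%C).
 by rewrite cexp_period mulr1.
have hn : h != 0 by rewrite gt_eqF.
by apply: cx_eq; rewrite ?ReM ?ImM /= /qc; field.
Qed.

Lemma Phi_period a tau (k : int) (z : C) : Phi h a tau (z + toC (k%:~R * h)) = Phi h a tau z.
Proof. by rewrite /Phi qx_period ImD /= addr0. Qed.

Let mf2 : mfT (fun p : RxR R => p.2).
Proof. exact: measurable_snd. Qed.

Lemma hm_Phi a tau : hm (fun z : uhp R => (Phi h a tau (uval z))%:E).
Proof.
pose f (p : RxR R) := Phi h a tau (pt p).
have mE : mfT (fun p : RxR R => expR (- (qc h * p.2))).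
 by apply: mcomp => //; apply: measurable_funN; apply: measurable_funM.
have mA : mfT (fun p : RxR R => qc h * p.1).
 by apply: measurable_funM => //; exact: measurable_fst.
have mC : mfT (fun p : RxR R => cos (qc h * p.1)).
 by apply: mcomp => //; apply: continuous_measurable_fun; exact: continuous_cos.
have mD : mfT (fun p : RxR R => cabs (1 - qx h (pt p))).
 rewrite (_ : (fun p => _) = (fun p : RxR R =>
   Num.sqrt (1 - 2 * (expR (- (qc h * p.2)) * cos (qc h * p.1)) + expR (- (qc h * p.2)) ^+ 2))); last first.
  ext => -[x y]; rewrite cabsE; congr Num.sqrt; rewrite /qx /cexp.
  rewrite !(ReD, ImD, ReN, ImN, ReM, ImM) /= !(mul0r, mulr0, subr0, addr0, sub0r, add0r).
  have := cos2Dsin2 (qc h * x); set c := cos _; set s := sin _; set e := expR _ => cs.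
  rewrite (_ : e ^+ 2 = e ^+ 2 * (c ^+ 2 + s ^+ 2)); last by rewrite cs mulr1.
  ring.
 apply: mcomp.
  by apply: continuous_measurable_fun; exact: sqrt_continuous.
 apply: measurable_funD; last by apply: measurable_funX.
 by apply: measurable_funB => //; apply: measurable_funM => //; apply: measurable_funM.
have mF : mfT f.
 rewrite (_ : f = (fun p => Num.min 1 p.2 `^ a * (1 + cabs (1 - qx h (pt p)) `^ (-1)) `^ tau)); last first.
  by ext => p; rewrite /f /Phi powR_inv1 ?cabs_ge0.
 apply: measurable_funM; apply: (mcomp (measurable_powR _)).
  exact: (@measurable_minr _ _ _ _ (cst 1) (fun p : RxR R => p.2)).
 by apply: measurable_funD => //; apply: (mcomp (measurable_powR _)).
rewrite /hm /mj; apply/(measurable_restrictT _ (@measurable_UH R)).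
apply: (eq_measurable_fun (EFin \o f)) => [p|].
 by move=> /set_mem /UHE[z pz ->]; rewrite lft_co /= /f coK.
by apply/measurable_EFinP; exact: measurable_funTS.
Qed.
End Period.

(** Two elements sending w into the ball at z differ by an element returning some point of that ball
    to it, whose entries are bounded by 4; [pigeonhole] counts these in terms of the elements of
    displacement below d at z. *)
Lemma SG_hball_le (G : set (metap R)) (d : R) : is_subgroup G -> discrete_set G -> (0 < d)%R ->
 exists N : nat, forall z t, seqbound (Tset G z d) t ->
  forall w, (SG G (ind (hball z)) w <= (N * t)%:R%:E)%E.
Proof.
move=> sG dG d0; have [N hN] := pigeonhole (ltr0n R 4) d0; exists N => z t st w.
apply: (@esum_ind_le _ _ G [set g | hball z (act g w)]).
have [[g1 [Gg1 g1w]]|nG] := pselect (exists g, (G `&` [set g | hball z (act g w)]) g); last first.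
 by move=> [//|x s] _ /(_ x (mem_head _ _)) Px; exfalso; apply: nG; exists x.
have [_ mG iG] := sG.
apply: (@seqbound_inj _ _ (fun g => g * g1^-1)%g _
 [set k | G k /\ exists2 u, hball z u & hball z (act k u)]).
- by move=> x y _ _ /mulIg.
- move=> g [Gg gw]; split; first by apply: mG => //; exact: iG.
 by exists (act g1 w) => //; rewrite /= actM actK.
- apply: (hN G _ z t) => // [g []//|g [Gg [u zu zgu]]]; exact: hball_entries zu zgu.
Qed.

Section Key.
Local Open Scope ereal_scope.
Variables (G : set (metap R)) (h a tau : R).
Hypotheses (sG : is_subgroup G) (dG : discrete_set G) (h0 : (0 < h)%R).
Hypothesis HS : cusp_width G h.
Variable F : set (uhp R).
Hypothesis fF : fundamental_domain G F.
Hypotheses (a0 : (0 <= a)%R) (t0 : (0 <= tau)%R).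

Definition ePhi (z : uhp R) : \bar R := (Phi h a tau (uval z))%:E.
Hypothesis Iv : JH (fun z => ind (strip h) z * ePhi z) < +oo.

Lemma ePhi_ge0 z : 0 <= ePhi z. Proof. by rewrite lee_fin Phi_ge0. Qed.

Lemma ePhi_stab t w : stab_oo G t -> ePhi (act t w) = ePhi w.
Proof. by move=> /(stab_shift HS)[k tw]; rewrite /ePhi tw Phi_period. Qed.

Definition EPhi := Eser G ePhi.

Lemma EPhi_ge0 z : 0 <= EPhi z. Proof. by apply: Eser_ge0 => w; exact: ePhi_ge0. Qed.

Lemma hm_EPhi : hm EPhi.
Proof. by apply: (hm_Eser sG dG (hm_Phi h a tau)) => w; exact: ePhi_ge0. Qed.
Lemma EPhi_act g z : G g -> EPhi (act g z) = EPhi z.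
Proof.
by move=> Gg; apply: (Eser_act (h := h)) => // [w|t w]; [exact: ePhi_ge0|exact: ePhi_stab].
Qed.

Lemma EPhi_harnack z w : hball z w -> EPhi z <= (2 `^ a * 2 `^ tau)%:E * EPhi w.
Proof.
move=> zw; rewrite /EPhi /Eser esum_mulr.
- apply: le_esum => c _; rewrite /ePhi -EFinM lee_fin; apply: Phi_harnack => //.
 by rewrite cabsBC; exact/hball_close/hball_act.
- exact: stab_cosets_countable.
- by move=> c; exact: ePhi_ge0.
- by rewrite lee_fin mulr_ge0 // powR_ge0.
Qed.

(** By Harnack, the value at z is at most a constant times the mean over the ball B at z. The
    integral over B is at most that over F against the group sum of the indicator of B, which is at
    most N t; and the integral over F unfolds to the strip. The count t stays a parameter since it
    grows towards the cusps. *)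
Lemma Eser_bound : exists2 K : R, (0 <= K)%R & forall z t, seqbound (Tset G z (1 / 10)) t ->
 EPhi z <= (K * t%:R)%:E.
Proof.
have [c c0 hc] := @JH_hball_gt0 R.
have d0 : (0 < 1 / 10 :> R)%R by lra.
have [N hN] := SG_hball_le sG dG d0.
set H := (2 `^ a * 2 `^ tau)%R; have H0 : (0 <= H)%R by rewrite mulr_ge0 // powR_ge0.
set I := JH (fun z => ind (strip h) z * ePhi z).
have I0 : 0 <= I by apply: JH_ge0 => z; apply: mule_ge0; [exact: ind_ge0|exact: ePhi_ge0].
have Ifin : I \is a fin_num by rewrite ge0_fin_numE.
exists (c^-1 * (H * (N%:R * fine I)))%R.
 by rewrite !mulr_ge0 // ?invr_ge0 ?(ltW c0) // fine_ge0.
move=> z t st; have E0 := EPhi_ge0; have mE := hm_EPhi.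
have mB := hm_hball z; have B0 w : 0 <= ind (hball z) w by exact: ind_ge0.
have mF : hm (ind F) by apply: hm_ind; case: fF.
have F0 w : 0 <= ind F w by exact: ind_ge0.
have mBE : hm (fun w => ind (hball z) w * EPhi w) by exact: hmM.
have BE0 w : 0 <= ind (hball z) w * EPhi w by exact: mule_ge0.
have HE : 0 <= H%:E by rewrite lee_fin.
have s1 : EPhi z * JH (ind (hball z)) <= H%:E * JH (fun w => ind (hball z) w * EPhi w).
 rewrite -(JHZ mB B0 (E0 z)) -(JHZ mBE BE0 HE); apply: le_JH => [||w|w].
 - exact: hmZ.
 - exact: hmZ.
 - exact: mule_ge0.
 rewrite /ind; case: asboolP => zw; last by rewrite mul0e !mule0.
 by rewrite mule1 mul1e; exact: EPhi_harnack.
have Nt0 : 0 <= (N * t)%:R%:E :> \bar R by rewrite lee_fin ler0n.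
have s2 : JH (fun w => ind (hball z) w * EPhi w) <= (N * t)%:R%:E * I.
 apply: le_trans (fold_le sG dG fF mBE BE0) _.
 rewrite /I -(unfold sG h0 HS dG fF (hm_Phi h a tau) ePhi_ge0 ePhi_stab) -/EPhi.
 have mFE : hm (fun w => ind F w * EPhi w) by exact: hmM.
 have FE0 w : 0 <= ind F w * EPhi w by exact: mule_ge0.
 rewrite -(JHZ mFE FE0 Nt0); apply: le_JH => [||w|w].
 - by apply: (hmM mF); exact: hm_SG.
 - exact: hmZ.
 - by apply: mule_ge0 => //; exact: SG_ge0.
 rewrite muleCA; apply: lee_wpmul2l => //.
 have -> : SG G (fun w => ind (hball z) w * EPhi w) w = EPhi w * SG G (ind (hball z)) w.
  rewrite /SG esum_mulr //; last exact: (countable_group sG dG).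
  by apply: eq_esum => g Gg; rewrite EPhi_act // muleC.
 rewrite muleC; apply: lee_wpmul2r => //.
 exact: (hN z t st).
have s3 : c%:E * EPhi z <= (H * (N%:R * fine I) * t%:R)%:E.
 rewrite muleC; apply: le_trans (lee_wpmul2l (E0 z) (hc z)) _; apply: le_trans s1 _.
 apply: le_trans (lee_wpmul2l HE s2) _; rewrite -(fineK Ifin) -!EFinM lee_fin natrM.
 by rewrite le_eqVlt; apply/orP; left; apply/eqP; ring.
have ci : 0 <= c^-1%:E by rewrite lee_fin invr_ge0 ltW.
have := lee_wpmul2l ci s3; rewrite muleA -!EFinM mulVf ?gt_eqF // mul1e.
by rewrite !mulrA.
Qed.
End Key.
End PhiKey.

(** * Convergence of the strip integral of [Phi] *)

Section StripIntegral.
Context {R : realType}.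
Local Notation C := (Cx R).
Local Notation mu := (@lebesgue_measure R).

Lemma sin_le (x : R) : 0 <= x -> sin x <= x.
Proof.
rewrite le_eqVlt => /predU1P[<-|x0]; first by rewrite sin0.
have [|c _] := @MVT R sin cos 0 x x0.
 by apply: continuous_subspaceT => y; exact: continuous_sin.
by rewrite sin0 !subr0 => ->; rewrite ler_piMl ?(ltW x0) // cos_le1.
Qed.

Lemma cos_ge_half (v : R) : 0 <= v <= 1 -> 1 / 2 <= cos v.
Proof.
move=> /andP[v0 v1]; have p2 := pi_ge2 R.
have s0 : 0 <= sin (v / 2) by apply: sin_ge0_pi; apply/andP; split; lra.
have sl : sin (v / 2) <= v / 2 by apply: sin_le; lra.
have -> : cos v = 1 - 2 * sin (v / 2) ^+ 2.
 rewrite [in LHS](_ : v = v / 2 + v / 2); last lra.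
 by rewrite cosD; have := cos2Dsin2 (v / 2); set c := cos _; set s := sin _; nra.
nra.
Qed.

Lemma sin_ge_half (v : R) : 0 <= v <= 1 -> v / 2 <= sin v.
Proof.
move=> /andP[]; rewrite le_eqVlt => /predU1P[<-|v0 v1]; first by rewrite sin0 mul0r.
have [|c] := @MVT R sin cos 0 v v0.
 by apply: continuous_subspaceT => y; exact: continuous_sin.
rewrite in_itv /= sin0 !subr0 => /andP[c0 cv] ->.
have := @cos_ge_half c; rewrite (ltW c0) (ltW (lt_le_trans cv v1)) => /(_ isT); nra.
Qed.

Lemma sin_ge_quarter (u : R) : 0 <= u <= pi / 2 -> u / 4 <= sin u.
Proof.
move=> /andP[u0 u1]; have p2 := pihalf_lt2 R.
have uh : 0 <= u / 2 <= 1 by apply/andP; split; lra.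
have := cos_ge_half uh; have := sin_ge_half uh.
rewrite [sin u](_ : _ = 2 * (sin (u / 2) * cos (u / 2))); last first.
 rewrite [in LHS](_ : u = u / 2 + u / 2); last lra.
 by rewrite sinD; ring.
set s := sin _; set c := cos _; nra.
Qed.

Lemma sin_pi_ge (t : R) : 0 <= t <= 1 -> pi / 4 * Num.min t (1 - t) <= sin (pi * t).
Proof.
have p2 := pi_ge2 R; move=> /andP[t0 t1]; case: (leP t (1 - t)) => tt.
 have /sin_ge_quarter : 0 <= pi * t <= pi / 2 by apply/andP; split; nra.
 by lra.
have /sin_ge_quarter : 0 <= pi * (1 - t) <= pi / 2 by apply/andP; split; nra.
rewrite (_ : sin (pi * (1 - t)) = sin (pi * t)); first by lra.
by rewrite mulrBr mulr1 sinB sinpi cospi; ring.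
Qed.

Variable h : R.
Hypothesis h0 : 0 < h.

Lemma one_sub_qx_sqr (z : C) : cabs (1 - qx h z) ^+ 2 =
 (1 - expR (- (qc h * Im z))) ^+ 2 +
 4 * expR (- (qc h * Im z)) * sin (pi * (Re z / h)) ^+ 2.
Proof.
rewrite cabs_sqr /qx /cexp !(ReD, ImD, ReN, ImN, ReM, ImM) /=.
rewrite !(mul0r, mulr0, subr0, addr0, add0r, sub0r).
have -> : qc h * Re z = pi * (Re z / h) + pi * (Re z / h).
 by rewrite /qc; field; rewrite gt_eqF.
set r := expR _; set u := pi * _; rewrite cosD sinD.
have := cos2Dsin2 u; set c := cos u; set s := sin u => cs.
have e1 : c ^+ 2 = 1 - s ^+ 2 by rewrite -cs addrK.
transitivity (1 - 2 * r * (c ^+ 2 - s ^+ 2) + r ^+ 2 * (c ^+ 2 + s ^+ 2) ^+ 2); first by ring.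
by rewrite cs e1; ring.
Qed.

(** From |1 - q|^2 = (1 - r)^2 + 4 r sin^2 (pi x / h) with r = |q|: the sine is bounded below by the
    distance from x to the ends of the strip. *)
Lemma one_sub_qx_dist (z : C) : 0 < Im z <= 1 -> 0 <= Re z <= h ->
 expR (- qc h) * (pi / (2 * h)) * Num.min (Re z) (h - Re z) <= cabs (1 - qx h z).
Proof.
move=> /andP[y0 y1] /andP[x0 xh]; have q0 := qc_gt0 h0; have p2 := pi_ge2 R.
set d := Num.min _ _; have d0 : 0 <= d by rewrite le_min x0 subr_ge0.
have t01 : 0 <= Re z / h <= 1 by rewrite divr_ge0 ?(ltW h0) // ler_pdivrMr // mul1r.
have S := sin_pi_ge t01.
have mE : Num.min (Re z / h) (1 - Re z / h) = d / h.
 rewrite /d -[1](divff (lt0r_neq0 h0)) -mulrBl.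
 by rewrite minr_pMl // invr_ge0 ltW.
rewrite mE in S; set s := sin _ in S.
set r := expR (- (qc h * Im z)).
have r1 : r <= 1 by rewrite /r -expR0 ler_expR oppr_le0 mulr_ge0 // ltW.
have r2 : expR (- qc h) <= r by rewrite /r ler_expR lerN2 ger_pMr.
have r0 : 0 < expR (- qc h) by exact: expR_gt0.
have dh : 0 <= d / h by rewrite divr_ge0 ?(ltW h0).
rewrite -(@ler_pXn2r _ 2) // ?nnegrE //; last first.
 by rewrite !mulr_ge0 ?(ltW r0) ?invr_ge0 ?mulr_ge0 ?(ltW h0) ?pi_ge0.
rewrite one_sub_qx_sqr -/r -/s.
set w := expR _ in r2 r0 *.
have -> : w * (pi / (2 * h)) * d = 2 * w * (pi / 4 * (d / h)) by field; rewrite gt_eqF.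
set v := pi / 4 * (d / h) in S *; have v0 : 0 <= v by apply: mulr_ge0 => //; rewrite divr_ge0 ?pi_ge0.
have s2 : v ^+ 2 <= s ^+ 2 by rewrite ler_pXn2r // ?nnegrE // (le_trans v0).
have w2 : w ^+ 2 <= r by rewrite expr2; apply: le_trans (_ : r * 1 <= r); [apply: ler_pM => //; [exact: ltW|exact: ltW|exact: le_trans r1]|rewrite mulr1].
have := ler_pM (sqr_ge0 w) (sqr_ge0 v) w2 s2; have := sqr_ge0 (1 - r).
by rewrite (_ : (2 * w * v) ^+ 2 = 4 * (w ^+ 2 * v ^+ 2)); [lra|ring].
Qed.

Local Open Scope ereal_scope.

Lemma powR_integral (e : R) : (0 < e)%R ->
 \int[mu]_(y in `[1%R, +oo[) (y `^ (- e - 1))%:E = (e^-1)%:E.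
Proof.
move=> e0; have en : e != 0%R by rewrite gt_eqF.
have dF (x : R) : (0 < x)%R -> is_derive x 1%R (fun y : R => - e^-1 * y `^ (- e))%R (x `^ (- e - 1))%R.
 move=> x0; have := is_derive1_powR (- e) x0 => D.
 have := @is_deriveZ _ _ _ (fun y : R => y `^ (- e))%R (- e^-1)%R x 1%R _ D.
 by rewrite /GRing.scale /= mulrA mulrNN mulVf // mul1r.
rewrite (@ge0_continuous_FTC2y R _ (fun y : R => - e^-1 * y `^ (- e))%R 1 0).
- by rewrite powR1 mulr1 sub0e -EFinN opprK.
- by move=> x _; exact: powR_ge0.
- apply: continuous_in_subspaceT => x; rewrite inE /= in_itv /= andbT => x1.
 have x0 : (0 < x)%R by apply: lt_le_trans x1.
 have [D _] := is_derive1_powR (- e - 1) x0.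
 by apply: differentiable_continuous; exact/derivable1_diffP.
- apply/cvgrPdist_lt => eps eps0; near=> y.
 have y0 : (0 < y)%R by near: y; exact: nbhs_pinfty_gt.
 rewrite sub0r mulNr opprK ger0_norm ?mulr_ge0 ?invr_ge0 ?(ltW e0) //.
 rewrite mulrC ltr_pdivrMr //.
 have yM : ((eps * e) `^ (- e^-1) < y)%R by near: y; apply: nbhs_pinfty_gt; rewrite num_real.
 have ee : (0 < eps * e)%R by rewrite mulr_gt0.
 rewrite powRN -[ltRHS]invrK ltf_pV2 ?posrE ?invr_gt0 ?powR_gt0 //.
 have -> : ((eps * e)^-1 = ((eps * e) `^ (- e^-1)) `^ e)%R.
  by rewrite -powRrM mulNr mulVf // powR_inv1 // ltW.
 by apply: gt0_ltr_powR => //; rewrite nnegrE // ltW.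
- move=> x x1; have [] := dF x => //; exact: lt_trans x1.
- have [D _] := dF 1%R ltr01; apply: cvg_at_right_filter.
 have : {for 1%R, continuous (fun y : R => - e^-1 * y `^ (- e))%R}.
  by apply: differentiable_continuous; exact/derivable1_diffP.
 by [].
- move=> x; rewrite in_itv /= andbT => x1; rewrite derive1E.
 have [|_ ->] // := dF x; exact: lt_trans x1.
Unshelve. all: by end_near. Qed.

Lemma mint_ge1 (e : R) : (0 < e)%R ->
 mint (fun y : R => if (1 <= y)%R then (y `^ (- e))%:E else 0) = (e^-1)%:E.
Proof.
move=> e0; rewrite -(powR_integral e0) [RHS]integral_mkcond /mint.
apply: eq_integral => y _; rewrite /patch mem_setE in_itv /= andbT.
case: ifP => [y1|]; last by rewrite mul0e.
have y0 : (0 < y)%R by apply: lt_le_trans y1.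
by rewrite wtE // -EFinM powRD ?(gt_eqF y0) ?implybT // powR_inv1 ?(ltW y0).
Qed.

Lemma measurable_if_le (b : R) (f : R -> R) : mfT f ->
 mfT (fun y : R => if (y <= b)%R then (f y)%:E else 0).
Proof.
move=> mf; apply: measurable_fun_ifT; last exact: measurable_cst.
 by apply: measurable_fun_ler.
exact/measurable_EFinP.
Qed.

(** The inversion y -> b / y reduces this to the integral over [1, +oo[ in [mint_ge1]. *)
Lemma mint_le (e b : R) : (0 < e)%R -> (0 < b)%R ->
 mint (fun y : R => if (y <= b)%R then (y `^ e)%:E else 0) = (b `^ e / e)%:E.
Proof.
move=> e0 b0; rewrite -(mint_inv b0).
- rewrite EFinM -(mint_ge1 e0) /mint -ge0_integralZl_EFin //.
 + apply: eq_integral => y _; rewrite muleA; case: (ltrP 0 y) => y0; last first.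
   by rewrite /wt ltNge y0 /= !mule0.
  rewrite ler_pdivrMr // ler_pMr //; case: ifP => _; last by rewrite mule0.
  congr (_ * _); rewrite -EFinM; congr EFin; rewrite powRM ?invr_ge0 ?(ltW y0) ?(ltW b0) //.
  by rewrite -powR_inv1 ?(ltW y0) // -powRrM mulN1r.
 + by move=> y _; apply: mule_ge0; [case: ifP => // _; rewrite lee_fin powR_ge0|rewrite lee_fin wt_ge0].
 + apply: emeasurable_funM; last by apply/measurable_EFinP; exact: measurable_wt.
  apply: measurable_fun_ifT; last exact: measurable_cst.
   exact: measurable_fun_ler.
  by apply/measurable_EFinP; exact: measurable_powR.
- by apply: measurable_if_le; exact: measurable_powR.
- by move=> y; case: ifP => // _; rewrite lee_fin powR_ge0.
Qed.

Lemma JH_xy (P Y : R -> \bar R) : mfT P -> mfT Y ->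
 (forall x, 0 <= P x) -> (forall y, 0 <= Y y) ->
 let phi := fun z : uhp R => P (Re (uval z)) * Y (Im (uval z)) in
 hm phi /\ JH phi = (\int[mu]_x P x) * \int[mu]_y (Y y * (hw y)%:E).
Proof.
move=> mP mY P0 Y0 phi.
pose psi (p : R * R) := P p.1 * Y p.2.
have E p : UH p -> psi p = lft phi p by move=> /UHE[z _ ->]; rewrite lft_co.
have mpsi : mj psi.
 rewrite /mj; apply/(measurable_restrictT _ (@measurable_UH R)); apply: measurable_funTS.
 apply: (@emeasurable_funM _ _ _ setT (P \o fst) (Y \o snd)).
  exact: (mcomp mP measurable_fst).
 exact: (mcomp mY measurable_snd).
split; first exact: (mj_ext E).
rewrite /JH -(eq_J E) J_iter //; last by move=> p; exact: mule_ge0.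
have A0 : 0 <= \int[mu]_x P x by exact: integral_ge0.
rewrite -ge0_integralZl //.
- apply: eq_integral => y _; case: (ltrP 0 y) => y0; last first.
  have -> : hw y = 0%R by rewrite /hw /wt ltNge y0 /= mul0r.
  by rewrite !mule0 integral0_eq // => x _; rewrite mule0.
 rewrite -ge0_integralZr //; last by rewrite mule_ge0 // lee_fin hw_ge0.
 by apply: eq_integral => x _; rewrite /patch mem_set // /psi /= muleA.
- apply: emeasurable_funM => //; apply/measurable_EFinP; rewrite /hw.
 by apply: measurable_funM; exact: measurable_wt.
- by move=> y _; rewrite mule_ge0 // lee_fin hw_ge0.
Qed.

(** For y <= 1 the exponent is split as tau = p1 + p2 with p2 = 1 - e. The power p1 of 1/|1 - q| is
    bounded through |1 - q| >= c0 y, the power p2 through the distance of x to the ends of the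
    strip. This leaves x^(e - 1), integrable at 0, and y^(a - tau + 1 - e). For y > 1 the quantity
    |1 - q| is bounded below. *)
Lemma strip_Phi_le (a tau e : R) : (1 <= tau)%R -> (tau < a)%R -> (0 < e)%R -> (e <= 1 / 2)%R ->
 exists2 K : R, (0 <= K)%R & forall z : C, (0 < Im z)%R -> (0 < Re z < h)%R ->
 (Phi h a tau z <= K * ((Re z `^ (e - 1) + (h - Re z) `^ (e - 1)) *
  (if Im z <= 1 then Im z `^ (a - tau + 1 - e) else 1)))%R.
Proof.
move=> t1 ta e0 e1; have q0 := qc_gt0 h0.
set c0 := (qc h / (1 + qc h))%R; have c00 : (0 < c0)%R by rewrite divr_gt0 // addr_gt0.
set c1 := (expR (- qc h) * (pi / (2 * h)))%R.
have c10 : (0 < c1)%R by rewrite mulr_gt0 ?expR_gt0 // divr_gt0 ?pi_gt0 // mulr_gt0.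
set p2 := (1 - e)%R; set p1 := (tau - p2)%R.
have p20 : (0 <= p2)%R by rewrite /p2; lra.
have p10 : (0 <= p1)%R by rewrite /p1 /p2; lra.
set K1 := (3 `^ tau * ((c0^-1) `^ p1 * (c1^-1) `^ p2))%R.
set K2 := ((1 + c0^-1) `^ tau * h `^ p2)%R.
have K10 : (0 <= K1)%R by rewrite !mulr_ge0 // powR_ge0.
have K20 : (0 <= K2)%R by rewrite mulr_ge0 // powR_ge0.
exists (K1 + K2)%R; first exact: addr_ge0.
move=> z y0 /andP[x0 xh]; set x := Re z in x0 xh *; set y := Im z in y0 *.
have hx0 : (0 < h - x)%R by rewrite subr_gt0.
set P := (x `^ (e - 1) + (h - x) `^ (e - 1))%R.
have pE w : (0 < w)%R -> (w `^ (e - 1) = (w^-1) `^ p2)%R.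
 by move=> w0; rewrite -powR_inv1 ?(ltW w0) // -powRrM /p2; congr (_ `^ _)%R; ring.
have P0 : (0 <= P)%R by rewrite addr_ge0 // powR_ge0.
have Q := one_sub_qx_ge h0 y0; rewrite -/y in Q.
set q := cabs _ in Q *; have qc1 : (0 < 1 + qc h * y)%R by rewrite addr_gt0 // mulr_gt0.
rewrite /Phi -/y -/q; case: (boolP (y <= 1)%R) => y1; last first.
 rewrite -ltNge in y1.
 have qge : (c0 <= q)%R.
  have ky : (qc h <= qc h * y)%R by rewrite ler_peMr ?(ltW q0) // ltW.
  by apply: le_trans Q; rewrite ler_pdivrMr ?addr_gt0 // mulrAC ler_pdivlMr //; nra.
 have q00 : (0 < q)%R by apply: lt_le_trans qge.
 rewrite (min_idPl (ltW y1)) powR1 mul1r mulr1.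
 apply: le_trans (_ : K2 * P <= _)%R; last by rewrite ler_wpM2r // lerDr.
 apply: le_trans (_ : (1 + c0^-1) `^ tau <= _)%R.
  by apply: ge0_ler_powR; rewrite ?nnegrE ?addr_ge0 ?invr_ge0 ?(ltW q00) ?(ltW c00) ?lerD2l ?lef_pV2 //; lra.
 rewrite /K2 -mulrA ler_peMr // (le_trans (_ : _ <= h `^ p2 * x `^ (e - 1))%R) //.
  have : (1 <= (h * x^-1) `^ p2)%R.
   by apply: powR_ge1 => //; rewrite ler_pdivlMr // mul1r ltW.
  by rewrite pE // powRM ?invr_ge0 ?(ltW x0) ?(ltW h0).
 by rewrite ler_wpM2l // lerDl powR_ge0.
apply: le_trans (_ : K1 * (P * y `^ (a - tau + 1 - e)) <= _)%R; last first.
 by rewrite ler_wpM2r ?lerDl // mulr_ge0 // powR_ge0.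
rewrite (min_idPr y1).
have qge : (c0 * y <= q)%R.
 have ky : (0 <= qc h * qc h * y * (1 - y))%R.
  by rewrite mulr_ge0 ?subr_ge0 // mulr_ge0 ?(ltW y0) // mulr_ge0 ?(ltW q0).
 by apply: le_trans Q; rewrite /c0 mulrAC ler_pdivrMr ?addr_gt0 // [leRHS]mulrAC ler_pdivlMr //; nra.
have q00 : (0 < q)%R by apply: lt_le_trans qge; rewrite mulr_gt0.
have q2 : (q <= 2)%R.
 by rewrite /q; apply: le_trans (cabsB _ _) _; rewrite cabs1; have := cabs_qx_lt1 h0 y0; lra.
have qd : (c1 * Num.min x (h - x) <= q)%R.
 by apply: one_sub_qx_dist; rewrite -/x -/y ?y0 ?y1 ?(ltW x0) ?(ltW xh).
have d0 : (0 < Num.min x (h - x))%R by rewrite lt_min x0.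
have dP : ((Num.min x (h - x))^-1 `^ p2 <= P)%R.
 by case: (leP x (h - x)%R) => _; rewrite /P !pE // ?lerDl ?lerDr powR_ge0.
have s1 : ((1 + q^-1) `^ tau <= 3 `^ tau * ((q^-1) `^ p1 * (q^-1) `^ p2))%R.
 rewrite -powRD; last by rewrite invr_eq0 (gt_eqF q00) implybT.
 rewrite /p1 subrK -powRM ?invr_ge0 ?(ltW q00) //; apply: ge0_ler_powR.
 - by lra.
 - by rewrite nnegrE addr_ge0 // invr_ge0 ltW.
 - by rewrite nnegrE mulr_ge0 // invr_ge0 ltW.
 - have : (1 <= 2 * q^-1)%R by rewrite ler_pdivlMr // mul1r.
  by lra.
have s2 : ((q^-1) `^ p1 <= (c0^-1) `^ p1 * (y^-1) `^ p1)%R.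
 rewrite -powRM ?invr_ge0 ?(ltW c00) ?(ltW y0) // -invfM.
 have cy : (0 < c0 * y)%R by exact: mulr_gt0.
 apply: ge0_ler_powR; rewrite ?nnegrE ?invr_ge0 ?(ltW q00) ?(ltW cy) //.
 by rewrite lef_pV2 ?posrE.
have s3 : ((q^-1) `^ p2 <= (c1^-1) `^ p2 * P)%R.
 apply: le_trans (_ : (c1^-1) `^ p2 * (Num.min x (h - x))^-1 `^ p2 <= _)%R; last first.
  by rewrite ler_wpM2l.
 rewrite -powRM ?invr_ge0 ?(ltW c10) ?(ltW d0) // -invfM.
 have cd : (0 < c1 * Num.min x (h - x))%R by exact: mulr_gt0.
 apply: ge0_ler_powR; rewrite ?nnegrE ?invr_ge0 ?(ltW q00) ?(ltW cd) //.
 by rewrite lef_pV2 ?posrE.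
have ye : (y `^ a * (y^-1) `^ p1 = y `^ (a - tau + 1 - e))%R.
 rewrite -powR_inv1 ?(ltW y0) // -powRrM -powRD; last by rewrite (gt_eqF y0) implybT.
 by congr (_ `^ _)%R; rewrite /p1 /p2; ring.
apply: le_trans (ler_wpM2l (powR_ge0 _ _) s1) _.
have -> : (K1 * (P * y `^ (a - tau + 1 - e)) = y `^ a * (3 `^ tau * ((c0^-1) `^ p1 * (y^-1) `^ p1 * ((c1^-1) `^ p2 * P))))%R.
 by rewrite -ye /K1; ring.
rewrite ler_wpM2l // ler_wpM2l //.
by apply: ler_pM; rewrite ?powR_ge0.
Qed.

Lemma strip_Phi (a tau : R) : (1 <= tau)%R -> (tau < a)%R ->
 JH (fun z : uhp R => ind (strip h) z * (Phi h a tau (uval z))%:E) < +oo.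
Proof.
(* The choice e < a - tau makes the exponent u = a - tau + 1 - e larger than 1, so y^u is integrable
   near 0 for y^-2 dy. *)
move=> t1 ta; set e := (Num.min ((a - tau) / 2) (1 / 2))%R.
have e0 : (0 < e)%R by rewrite lt_min; apply/andP; split; lra.
have e1 : (e <= 1 / 2)%R by rewrite ge_min lexx orbT.
have e2 : (e <= (a - tau) / 2)%R by rewrite ge_min lexx.
have [K K0 hK] := strip_Phi_le t1 ta e0 e1.
set u := (a - tau + 1 - e)%R in hK; have u1 : (0 < u - 1)%R by rewrite /u; lra.
pose g (x : R) : \bar R := (if (x <= h)%R then (x `^ e)%:E else 0) * (wt x)%:E.
have g0 x : 0 <= g x.
 by apply: mule_ge0; [case: ifP => // _; rewrite lee_fin powR_ge0|rewrite lee_fin wt_ge0].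
have mwt : mfT (fun x : R => (wt x)%:E) by apply/measurable_EFinP; exact: measurable_wt.
have mg : mfT g.
 by apply: emeasurable_funM => //; apply: measurable_if_le; exact: measurable_powR.
have Ig : \int[mu]_x g x = (h `^ e / e)%:E by rewrite -[RHS](mint_le e0 h0).
have mgr : mfT (fun x : R => g (h - x)%R).
 by apply: mcomp => //; apply: measurable_funB.
have Igr : \int[mu]_x g (h - x)%R = (h `^ e / e)%:E.
 transitivity (\int[mu]_x g (- x + h)%R); first by apply: eq_integral => x _; rewrite addrC.
 have mgh : mfT (fun x : R => g (x + h)%R).
  by apply: mcomp => //; apply: measurable_funD.
 apply: (etrans (integral_reflect mgh (fun x => g0 _))).
 rewrite -Ig -(integral_affine h ltr01 mg g0).
 by apply: eq_integral => x _; rewrite mul1r mule1.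
pose P x := g x + g (h - x)%R.
have mP : mfT P by exact: emeasurable_funD.
have P0 x : 0 <= P x by apply: adde_ge0.
have IP : \int[mu]_x P x < +oo by rewrite ge0_integralD // Ig Igr -EFinD ltry.
pose Y (y : R) : \bar R := (if (y <= 1)%R then (y `^ u)%:E else 0) + (if (1 <= y)%R then 1 else 0).
have mif1 (f : R -> R) : mfT f ->
  mfT (fun y : R => if (1 <= y)%R then (f y)%:E else 0).
 move=> mf; apply: measurable_fun_ifT; last exact: measurable_cst.
  by apply: measurable_fun_ler.
 exact/measurable_EFinP.
have mY : mfT Y.
 apply: emeasurable_funD; first by apply: measurable_if_le; exact: measurable_powR.
 exact: (mif1 (cst 1%R)).
have Y0 y : 0 <= Y y by apply: adde_ge0; case: ifP => // _; rewrite lee_fin powR_ge0.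
have IY : \int[mu]_y (Y y * (hw y)%:E) < +oo.
 pose Y1 (y : R) : \bar R := if (y <= 1)%R then (y `^ (u - 1))%:E else 0.
 pose Y2 (y : R) : \bar R := if (1 <= y)%R then (y `^ (- 1))%:E else 0.
 have Y10 y : 0 <= Y1 y by rewrite /Y1; case: ifP => // _; rewrite lee_fin powR_ge0.
 have Y20 y : 0 <= Y2 y by rewrite /Y2; case: ifP => // _; rewrite lee_fin powR_ge0.
 have w0 y : 0 <= (wt y)%:E by rewrite lee_fin wt_ge0.
 have m1 : mfT (fun y => Y1 y * (wt y)%:E).
  by apply: emeasurable_funM => //; apply: measurable_if_le; exact: measurable_powR.
 have m2 : mfT (fun y => Y2 y * (wt y)%:E).
  by apply: emeasurable_funM => //; apply: mif1; exact: measurable_powR.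
 have -> : \int[mu]_y (Y y * (hw y)%:E) = \int[mu]_y (Y1 y * (wt y)%:E + Y2 y * (wt y)%:E).
  apply: eq_integral => y _; case: (ltrP 0 y) => y0; last first.
   by rewrite /hw /wt ltNge y0 /= mul0r !mule0 adde0.
  rewrite -ge0_muleDl // /hw EFinM muleA; congr (_ * _); rewrite wtE // /Y /Y1 /Y2.
  rewrite ge0_muleDl; [|by case: ifP => // _; rewrite lee_fin powR_ge0|by case: ifP].
  congr (_ + _); case: ifP => _; rewrite ?mul0e // -EFinM.
   by rewrite powRD ?(gt_eqF y0) ?implybT // powR_inv1 ?(ltW y0).
  by rewrite mul1r powR_inv1 ?(ltW y0).
 rewrite ge0_integralD //; try by move=> y _; exact: mule_ge0.
 by rewrite -/(mint Y1) -/(mint Y2) (mint_le u1 ltr01) (mint_ge1 ltr01) -EFinD ltry.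
have [mB JB] := JH_xy mP mY P0 Y0; set B := (fun z => _) in mB JB.
have B0 z : 0 <= B z by exact: mule_ge0.
have KE0 : 0 <= K%:E :> \bar R by rewrite lee_fin.
have KB0 z : 0 <= K%:E * B z by exact: mule_ge0.
have mKB : hm (fun z => K%:E * B z) by exact: hmZ.
(* The bound fails on the line x = 0, where the majorant has no useful value; +oo times the
   indicator of this null line is added. *)
pose M : set (R * R) := [set 0%R] `*` setT.
have mM : measurable (M : set (RxR R)) by exact: measurableX.
have M0 : leb2 M = 0.
 by rewrite /leb2 product_measure1E //= lebesgue_measure_set1 mul0e.
have [mN JN] := null_ind mM M0; set N := ind _ in mN JN.
have N0 z : 0 <= N z by exact: ind_ge0.
have N1 z : 0 <= +oo * N z by exact: mule_ge0.
have mN1 : hm (fun z => +oo * N z) by exact: hmZ.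
have [mS JS] := JHD mKB mN1 KB0 N1.
apply: (@le_lt_trans _ _ (JH (fun z => K%:E * B z + +oo * N z))); last first.
 rewrite JS (JHZ mN N0) // JN mule0 adde0 (JHZ mB B0 KE0) JB.
 have IPf : \int[mu]_x P x \is a fin_num by rewrite ge0_fin_numE // integral_ge0.
 have IYf : \int[mu]_y (Y y * (hw y)%:E) \is a fin_num.
  by rewrite ge0_fin_numE // integral_ge0 // => y _; rewrite mule_ge0 // lee_fin hw_ge0.
 by rewrite -(fineK IPf) -(fineK IYf) -!EFinM ltry.
apply: le_JH => [||z|z].
- by apply: hmM; [exact: hm_strip|exact: hm_Phi].
- exact: mS.
- by apply: mule_ge0; [exact: ind_ge0|rewrite lee_fin Phi_ge0].
rewrite {1}/ind; case: asboolP => [/andP[x0 xh]|_]; last by rewrite mul0e adde_ge0.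
rewrite mul1e; have y0 := uval_gt0 z.
move: x0; rewrite le_eqVlt => /predU1P[x0|x0].
 by rewrite /N /ind asboolT /M /= -?x0 // mule1 addey ?leey // gt_eqF // (lt_le_trans _ (KB0 z)) ?ltNyr.
apply: le_trans (_ : K%:E * B z <= _); last by rewrite leeDl.
have := hK (uval z) y0; rewrite x0 xh => /(_ isT); set x := Re _ in x0 xh *; set y := Im _ in y0 *.
move=> H; have {}H : (Phi h a tau (uval z))%:E <= (K * ((x `^ (e - 1) + (h - x) `^ (e - 1)) *
  (if y <= 1 then y `^ u else 1)))%:E by rewrite lee_fin.
apply: le_trans H _; rewrite EFinM; apply: lee_wpmul2l => //; rewrite EFinM.
have gE w : (0 < w)%R -> (w <= h)%R -> g w = (w `^ (e - 1))%:E.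
 move=> w0 wh; rewrite /g wh wtE // -EFinM powRD ?(gt_eqF w0) ?implybT //.
 by rewrite powR_inv1 ?(ltW w0).
have hx : (0 < h - x)%R by rewrite subr_gt0.
rewrite /B -/x -/y /P !gE ?(ltW xh) //; last by rewrite gerBl ltW.
rewrite -EFinD; apply: lee_wpmul2l; first by rewrite lee_fin addr_ge0 // powR_ge0.
rewrite /Y; case: (leP y 1%R) => y1; first by rewrite leeDl // (fun_if (fun v => 0 <= v)); case: ifP.
by rewrite (ltW y1) add0e.
Qed.
End StripIntegral.

(** * Boundedness of invariant functions on quotients of finite area *)

Section ThickThin.
Context {R : realType}.
Local Notation C := (Cx R).
Implicit Types (z w : uhp R) (g s : metap R).
Local Notation ht z := (Im (uval z)).
Local Notation rx z := (Re (uval z)).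

(** A larger concentric ball: two points whose [hball]s meet are [nearb], which turns a maximal
    packing into a cover. *)
Definition nearb z w := cabs (uval z - uval w) ^+ 2 <= ht z * ht w / 8.

Lemma hball_nearb z w u : hball z u -> hball w u -> nearb z w.
Proof.
move=> zu wu; have I1 := hball_Im (hball_sym zu); have I2 := hball_Im (hball_sym wu).
move: zu wu; rewrite /hball /nearb /= => zu wu.
have a0 := uval_gt0 z; have b0 := uval_gt0 w; have c0 := uval_gt0 u.
have d : cabs (uval z - uval w) <= cabs (uval z - uval u) + cabs (uval w - uval u).
 by rewrite (_ : uval z - uval w = (uval z - uval u) - (uval w - uval u)) ?cabsB //; ring.
set p := cabs _ in zu d *; set q := cabs _ in wu d *; set r := cabs _ in d *.
have r0 : 0 <= r by exact: cabs_ge0.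
have r2 : r ^+ 2 <= 2 * p ^+ 2 + 2 * q ^+ 2.
 have : r ^+ 2 <= (p + q) ^+ 2 by rewrite ler_pXn2r // nnegrE (le_trans r0).
 by have := sqr_ge0 (p - q); nra.
have := mulr_gt0 a0 b0; have := mulr_gt0 b0 c0; have := mulr_gt0 a0 c0; nra.
Qed.

Lemma nearb_Im z w : nearb z w -> ht z <= 3 / 2 * ht w /\ ht w <= 3 / 2 * ht z.
Proof.
rewrite /nearb cabs_sqr ReD ImD ReN ImN => H.
have a0 := uval_gt0 z; have b0 := uval_gt0 w; set a := ht z in H a0 *; set b := ht w in H b0 *.
have K : (a - b) ^+ 2 <= a * b / 8 by apply: le_trans H; rewrite lerDr sqr_ge0.
split; rewrite leNgt; apply/negP => N.
 have : (b / 2) * (a - b) < (a - b) ^+ 2 by rewrite expr2 ltr_pM2r; lra.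
 nra.
have : (a / 2) * (b - a) < (b - a) ^+ 2 by rewrite expr2 ltr_pM2r; lra.
nra.
Qed.

Lemma nearb_entries z0 z g : nearb z z0 -> nz (uval z) (mat g) <= 1 ->
 forall i j, `|cj z0 g i j| <= 4.
Proof.
move=> zz0 n1; have F0 := fro_cj z0 g; have F1 := fro_cj z g.
have [I1 I2] := nearb_Im zz0.
have f3 : fro (cj z g) <= 3 by apply: le_trans (fro_le (det_cj z g)) _; rewrite -/(nz _ _); lra.
have D := dist_act g z z0; move: zz0; rewrite /nearb => zz0.
have p0 := uval_gt0 z0; have p1 := uval_gt0 z; have p2 := uval_gt0 (act g z); have p3 := uval_gt0 (act g z0).
have d1 : cabs (uval z0 - uval (act g z0)) <=
  cabs (uval z - uval z0) + cabs (uval z - uval (act g z)) + cabs (uval (act g z) - uval (act g z0)).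
 rewrite (_ : uval z0 - uval (act g z0) = - (uval z - uval z0) + (uval z - uval (act g z)) +
  (uval (act g z) - uval (act g z0))); last by ring.
 by apply: le_trans (cabsD _ _) _; rewrite lerD2r; apply: le_trans (cabsD _ _) _; rewrite cabsN.
set y0 := ht z0 in zz0 I1 I2 F0 D p0 *; set y1 := ht z in zz0 I1 I2 F1 D p1 *.
set y2 := ht (act g z) in F1 D p2 *; set y3 := ht (act g z0) in F0 D p3 *.
set a := cabs (uval z - uval z0) in zz0 d1 D *; set b := cabs (uval z - uval (act g z)) in F1 d1 *.
set c := cabs (uval (act g z) - uval (act g z0)) in D d1 *; set e := cabs _ in F0 d1.
have a0 : 0 <= a by exact: cabs_ge0. have b0 : 0 <= b by exact: cabs_ge0.
have c0 : 0 <= c by exact: cabs_ge0. have e0 : 0 <= e by exact: cabs_ge0.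
have q01 := mulr_gt0 p1 p0; have q23 := mulr_gt0 p2 p3; have q12 := mulr_gt0 p1 p2.
have b2 : b ^+ 2 <= y1 * y2.
 have : fro (cj z g) * (y1 * y2) <= 3 * (y1 * y2) by rewrite ler_pM2r.
 by rewrite F1; lra.
have c2 : c ^+ 2 <= y2 * y3 / 8.
 rewrite -(ler_pM2r q01) D [leRHS](_ : _ = (y1 * y0 / 8) * (y2 * y3)); last by ring.
 by rewrite ler_pM2r.
have Hact : nearb (act g z) (act g z0) by exact: c2.
have [I3 I4] := nearb_Im Hact; rewrite -/y2 -/y3 in I3 I4.
have bb : (y1 - y2) ^+ 2 <= y1 * y2.
 apply: le_trans b2; rewrite /b cabs_sqr ReD ImD ReN ImN -/y1 -/y2.
 by rewrite lerDr sqr_ge0.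
have y12 : y1 <= 3 * y2.
 rewrite leNgt; apply/negP => N; have : (2 * y2) * (y1 - y2) < (y1 - y2) ^+ 2 by rewrite expr2 ltr_pM2r; lra.
 by nra.
have y21 : y2 <= 3 * y1.
 rewrite leNgt; apply/negP => N; have : (2 * y1) * (y2 - y1) < (y2 - y1) ^+ 2 by rewrite expr2 ltr_pM2r; lra.
 by nra.
have e2 : e ^+ 2 <= 3 * (a ^+ 2 + b ^+ 2 + c ^+ 2).
 have : e ^+ 2 <= (a + b + c) ^+ 2 by rewrite ler_pXn2r // nnegrE (le_trans e0).
 by have := sqr_ge0 (a - b); have := sqr_ge0 (b - c); have := sqr_ge0 (a - c); nra.
have q03 := mulr_gt0 p0 p3.
have t1 : y1 * y0 <= 9 / 2 * (y0 * y3) by rewrite mulrC mulrCA ler_pM2l //; lra.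
have t3 : y2 * y3 <= 9 / 2 * (y0 * y3) by rewrite mulrA ler_pM2r //; lra.
have t2 : y1 * y2 <= 9 / 4 * (y0 * y3).
 rewrite (_ : 9 / 4 * (y0 * y3) = (3 / 2 * y0) * (3 / 2 * y3)); last by field.
 by apply: ler_pM => //; exact: ltW.
move=> i j; apply: entry_fro => //; rewrite -(ler_pM2r q03) F0; lra.
Qed.

(** On the vertical line through z the displacement is A^2 + 2 B^2 / t + 2 c^2 t with t = y^2. If B
    is nonzero, a root in t is found between 0 and the height of z by the intermediate value
    theorem. If B = 0 and c is nonzero, the equation is linear in t. If both vanish, g fixes
    infinity and the foot of the line, and moving horizontally raises the displacement. *)
Lemma ex_equidisp z g (v : R) : ~ Zmp g -> nz (uval z) (mat g) < v ->
 exists w, nz (uval w) (mat g) = v.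
Proof.
move=> nc; have y0 := uval_gt0 z; set x := rx z; set y := ht z in y0 *.
pose a := mat g 0 0; pose b := mat g 0 1; pose c := mat g 1 0; pose d := mat g 1 1.
have nE x' y' : nz (x' +i* y')%C (mat g) =
  (a - d - 2 * c * x') ^+ 2 + 2 * ((b + (a - d) * x' - c * x' ^+ 2) / y') ^+ 2 + 2 * (c * y') ^+ 2.
 by rewrite /nz /nn /cjm !mx22E /= -/a -/b -/c -/d; ring.
have zE : uval z = (x +i* y)%C by rewrite /x /y; case: (uval z).
rewrite zE nE; set A := a - d - 2 * c * x; set B := b + (a - d) * x - c * x ^+ 2 => H.
have mk x' y' : 0 < y' -> nz (x' +i* y')%C (mat g) = v -> exists w, nz (uval w) (mat g) = v.
 by move=> y'0 e; exists (@UHP R (x' +i* y')%C y'0).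
have [B0|B0] := eqVneq B 0.
 rewrite B0 mul0r expr0n /= mulr0 addr0 in H.
 have [c0|c0] := eqVneq c 0.
  have [ad|ad] := eqVneq (a - d) 0.
   exfalso; apply: nc; apply: nn_eq0; first exact: mat_det.
   rewrite /nn -/a -/b -/c -/d ad c0.
   have -> : b = 0 by move: B0; rewrite /B ad c0 mul0r mul0r addr0 subr0.
   by ring.
  rewrite /A c0 mulr0 mul0r subr0 mul0r expr0n /= mulr0 addr0 in H.
  set D := a - d in ad H B0 *; have D2 : 0 < 2 * D ^+ 2 by rewrite mulr_gt0 // exprn_even_gt0.
  set t := (v - D ^+ 2) / (2 * D ^+ 2); have t0 : 0 <= t by rewrite divr_ge0 // ?(ltW D2) // subr_ge0 ltW.
  apply: (mk (x + y * Num.sqrt t) y) => //.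
  rewrite nE -/D c0 !(mulr0, mul0r, subr0) expr0n /= mulr0 addr0.
  rewrite (_ : b + D * (x + y * Num.sqrt t) = D * (y * Num.sqrt t)); last first.
   by move: B0; rewrite /B c0 mul0r subr0 -/D => B0; rewrite mulrDr addrA B0 add0r.
  rewrite (_ : D * (y * Num.sqrt t) / y = D * Num.sqrt t); last by field; rewrite gt_eqF.
  by rewrite exprMn sqr_sqrtr // /t; field.
 have c2 : 0 < 2 * c ^+ 2 by rewrite mulr_gt0 // exprn_even_gt0.
 set t := (v - A ^+ 2) / (2 * c ^+ 2).
 have t0 : 0 < t.
  rewrite divr_gt0 // subr_gt0; apply: le_lt_trans H; rewrite lerDl mulr_ge0 // sqr_ge0 //.
 apply: (mk x (Num.sqrt t)); first by rewrite sqrtr_gt0.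
 rewrite nE -/A -/B B0 mul0r expr0n /= mulr0 addr0 exprMn sqr_sqrtr ?(ltW t0) // /t; field.
 by [].
pose p : {poly R} := (2 * c ^+ 2) *: 'X^2 + (A ^+ 2 - v) *: 'X + (2 * B ^+ 2)%:P.
have pE t : p.[t] = 2 * c ^+ 2 * t ^+ 2 + (A ^+ 2 - v) * t + 2 * B ^+ 2.
 by rewrite /p !hornerE.
have y2 : 0 < y ^+ 2 by rewrite exprn_gt0.
have [||t /andP[t0 ty]] := @poly_ivt R (- p) 0 (y ^+ 2).
- exact: ltW.
- rewrite !hornerN !pE expr0n /= !mulr0 !add0r oppr_le0 oppr_ge0 mulr_ge0 ?sqr_ge0 //=.
 have : (A ^+ 2 + 2 * (B / y) ^+ 2 + 2 * (c * y) ^+ 2 - v) * y ^+ 2 <= 0.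
  by rewrite pmulr_lle0 // subr_le0 ltW.
 by congr (_ <= _); field; rewrite gt_eqF.
rewrite rootE hornerN oppr_eq0 pE => /eqP pt.
have tn : t != 0.
 by apply: contra_neq B0 => t00; move: pt; rewrite t00 expr0n /= !mulr0 !add0r => /eqP; rewrite mulf_eq0 pnatr_eq0 /= sqrf_eq0 => /eqP.
have tp : 0 < t by rewrite lt_def tn t0.
apply: (mk x (Num.sqrt t)); first by rewrite sqrtr_gt0.
rewrite nE -/A -/B !exprMn exprVn sqr_sqrtr ?(ltW tp) //.
apply: (mulIf tn); rewrite -[RHS]addr0 -pt; field.
by [].
Qed.

Lemma seq_argmin (T : eqType) (f : T -> R) (s : seq T) : s != [::] ->
 exists2 x, x \in s & forall y, y \in s -> f x <= f y.
Proof.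
elim: s => // a [|b s] IH _; first by exists a; rewrite ?mem_head // => y; rewrite inE => /eqP ->.
have [//|x xs hx] := IH; have [ax|xa] := leP (f a) (f x).
 exists a; rewrite ?mem_head // => y; rewrite inE => /orP[/eqP -> //|ys].
 exact: le_trans ax (hx y ys).
exists x; first by rewrite inE xs orbT.
by move=> y; rewrite inE => /orP[/eqP ->|/hx //]; exact: ltW.
Qed.

Lemma finite_ub (T : choiceType) (A : set T) (Q : T -> R -> Prop) : finite_set A ->
 (forall x M M', Q x M -> M <= M' -> Q x M') -> (forall x, A x -> exists M, Q x M) ->
 exists M, forall x, A x -> Q x M.
Proof.
move=> /finite_seqP[s ->] mQ; elim: s => [|a s IH] hs; first by exists 0.
have [|M hM] := IH; first by move=> x xs; apply: hs; rewrite /= inE (xs : x \in s) orbT.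
have [|Ma hMa] := hs a; first by rewrite /= mem_head.
exists (Num.max M Ma) => x /=; rewrite inE => /orP[/eqP ->|/hM xM].
 by apply: mQ hMa _; rewrite le_max lexx orbT.
by apply: mQ xM _; rewrite le_max lexx.
Qed.

Variable G : set (metap R).
Hypotheses (sG : is_subgroup G) (dG : discrete_set G).
Variable F : set (uhp R).
Hypotheses (fF : fundamental_domain G F) (aF : (JH (ind F) < +oo)%E).

Definition thick (e : R) z := forall g, G g -> ~ Zmp g -> e <= nz (uval z) (mat g).

Definition sepb z w := forall g u, G g -> hball z u -> ~ hball w (act g u).

Local Open Scope ereal_scope.

(** The group sums of the indicators of separated balls have disjoint supports, and each is at most
    N * [eps] because few elements return a ball at a thick point to itself. Each has integral at
    least c over F, so the area of F bounds the number of balls. *)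
Lemma thick_packing (e : R) : (0 < e)%R -> exists n : nat, forall s : seq (uhp R),
 (forall z, z \in s -> thick e z) -> pairwise (fun z w => `[< sepb z w >]) s -> (size s <= n)%N.
Proof.
move=> e0; have [c c0 hc] := @JH_hball_gt0 R; have [N hN] := SG_hball_le sG dG e0.
set B := (N * eps_card G)%:R%:E : \bar R.
have B0 : 0 <= B by rewrite lee_fin ler0n.
have hN' z w : thick e z -> SG G (ind (hball z)) w <= B.
 move=> tz; apply: hN; apply: seqbound_le (finite_seqbound (finite_centerG G)) => //.
 move=> g [Gg ng]; split=> //; apply: contrapT => cg.
 by have := tz g Gg cg; rewrite leNgt ng.
pose S z := SG G (ind (hball z)).
have i0 A w : 0 <= ind A w :> \bar R by exact: ind_ge0.
have S0 z w : 0 <= S z w by exact: SG_ge0.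
have mS z : hm (S z) by apply: hm_SG => //; exact: hm_hball.
have mF : hm (ind F) by apply: hm_ind; case: fF.
have S1 z w : S z w != 0 -> exists2 g, G g & hball z (act g w).
 move=> Sn; apply: contrapT => H; move/eqP: Sn; apply; apply: esum1 => g Gg.
 by rewrite /ind; case: asboolP => // gw; exfalso; apply: H; exists g.
have sum0 (s : seq (uhp R)) w : 0 <= \sum_(z <- s) S z w by apply: sume_ge0.
have ub (s : seq (uhp R)) : (forall z, z \in s -> thick e z) -> pairwise (fun z w => `[< sepb z w >]) s ->
  forall w, \sum_(z <- s) S z w <= B.
 elim: s => [|z s IH] ts; first by move=> _ w; rewrite big_nil.
 rewrite pairwise_cons => /andP[/allP zs ps] w; rewrite big_cons.
 have [Sz|Sz] := eqVneq (S z w) 0.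
  by rewrite Sz add0e; apply: IH => // v vs; apply: ts; rewrite inE vs orbT.
 rewrite big_seq big1 ?adde0; first by apply: hN'; apply: ts; rewrite mem_head.
 move=> v vs; apply/eqP; apply: contrapT => /negP /S1[g Gg gv].
 have [k Gk kz] := S1 _ _ Sz; have /asboolP sp := zs v vs.
 have [_ mG iG] := sG; apply: (sp (g * k^-1)%g _ _ kz); first by apply: mG => //; exact: iG.
 by rewrite /= actM actK.
have lb (s : seq (uhp R)) : hm (fun w => ind F w * \sum_(z <- s) S z w) /\
  (size s)%:R%:E * c%:E <= JH (fun w => ind F w * \sum_(z <- s) S z w).
 elim: s => [|z s [m1 IH]].
  rewrite (_ : (fun w => _) = (fun=> 0)); first by split; [exact: hm_cst|rewrite JH0 mul0e].
  by ext => w; rewrite big_nil mule0.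
 have mz : hm (fun w => ind F w * S z w) by exact: hmM.
 have z0 w : 0 <= ind F w * S z w by exact: mule_ge0.
 have s0 w : 0 <= ind F w * \sum_(z <- s) S z w by exact: mule_ge0.
 have [m2 J2] := JHD mz m1 z0 s0.
 rewrite (_ : (fun w => ind F w * _) = (fun w => ind F w * S z w + ind F w * \sum_(z <- s) S z w)); last first.
  by ext => w; rewrite big_cons ge0_muleDr.
 split=> //; rewrite J2 /= -natr1 addrC EFinD ge0_muleDl ?lee_fin ?ler0n // mul1e.
 apply: leeD => //; apply: le_trans (hc z) _.
 by apply: fold_le => //; exact: hm_hball.
have Af : JH (ind F) \is a fin_num by rewrite ge0_fin_numE // JH_ge0.
exists (Num.truncn (((N * eps_card G)%:R * fine (JH (ind F))) / c)%R).+1 => s ts ps.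
have [m1 L] := lb s.
have U : JH (fun w => ind F w * \sum_(z <- s) S z w) <= B * JH (ind F).
 rewrite -(JHZ mF (i0 F) B0); apply: le_JH => [||w|w] //.
 - exact: hmZ.
 - exact: mule_ge0.
 - by rewrite [B * _]muleC; apply: lee_wpmul2l => //; exact: ub.
have := le_trans L U; rewrite -(fineK Af) -!EFinM lee_fin -ler_pdivlMr // => H.
by rewrite -(ler_nat R); apply: le_trans H (ltW (truncnS_gt _)).
Qed.

Local Close Scope ereal_scope.

(** The centers of a packing of maximal size: a thick point far from all their translates could be
    added. *)
Lemma thick_cover (e : R) : 0 < e -> exists s : seq (uhp R), forall z, thick e z ->
 exists g w, [/\ G g, w \in s & nearb (act g z) w].
Proof.
move=> e0; have [n hn] := thick_packing e0.
pose P k := `[< exists s : seq (uhp R), [/\ size s = k, forall z, z \in s -> thick e z &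
 pairwise (fun z w => `[< sepb z w >]) s] >].
have P0 : exists k, P k by exists 0%N; apply/asboolP; exists [::].
have Pn k : P k -> (k <= n)%N by move=> /asboolP[s [<- ts ps]]; exact: hn.
case: (ex_maxnP P0 Pn) => k /asboolP[s [sk ts ps]] kmax; exists s => z tz.
apply: contrapT => H; have : P k.+1.
 apply/asboolP; exists (z :: s); split; [by rewrite /= sk| |].
  by move=> w; rewrite inE => /orP[/eqP ->|/ts].
 rewrite pairwise_cons ps andbT; apply/allP => w ws; apply/asboolP => g u Gg zu gu.
 by apply: H; exists g, w; split => //; exact: hball_nearb (hball_act g zu) gu.
by move=> /kmax; rewrite ltnn.
Qed.

Variable phi : uhp R -> R.
Hypothesis phi_act : forall g z, G g -> phi (act g z) = phi z.
Hypothesis phi_loc : forall w, exists M, forall z, nearb z w -> phi z <= M.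
Hypothesis phi_par : forall g, G g -> parabolic (mat g) ->
 exists M, forall z, nz (uval z) (mat g) < 1 / 20 -> phi z <= M.

Lemma bounded_thick (e : R) : 0 < e -> exists M, forall z, thick e z -> phi z <= M.
Proof.
move=> e0; have [s hs] := thick_cover e0.
have [|x M M' h MM z zx|x _|M hM] := @finite_ub _ [set` s] (fun w M => forall z, nearb z w -> phi z <= M).
- exact: finite_seq.
- by apply: le_trans MM; exact: h.
- exact: phi_loc.
exists M => z /hs[g [w [Gg ws gw]]]; rewrite -(phi_act z Gg); exact: hM ws _ gw.
Qed.

(** At a thin point z let g have least displacement. Move to a point w where g has displacement
    exactly 1 / 20; there w is thick, hence near one of finitely many centers modulo G, and the
    conjugate of g carried there has bounded entries. So z is equivalent to a point where one of
    finitely many elements is least displaced. If that element is parabolic, [phi_par] applies;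
    otherwise its displacement is bounded below by its trace, and the point is thick after all. *)
Lemma bounded_of_thick : exists M, forall z, phi z <= M.
Proof.
have e0 : 0 < 1 / 20 :> R by lra.
have [s hs] := thick_cover e0; have [M0 hM0] := bounded_thick e0.
have fin w : finite_set [set g | G g /\ forall i j, `|cj w g i j| <= 4].
 have d0 : 0 < 1 / 10 :> R by lra.
 have [N hN] := pigeonhole (ltr0n R 4) d0.
 apply: (@seqbound_finite _ _ (N * #|` fset_set (Tset G w (1 / 10))|)).
 apply: (hN G _ w) => //; [by move=> g []|by move=> g []|].
 exact: finite_seqbound (Tset_finite sG dG w).
(* [Q g M] bounds [phi] by M at the thin points where g is least displaced. It is monotone in M, so
   finitely many g admit a common M. *)
pose Q g M := forall z, nz (uval z) (mat g) < 1 / 20 -> ~ Zmp g ->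
 (forall k, G k -> ~ Zmp k -> nz (uval z) (mat k) < 1 / 10 ->
   nz (uval z) (mat g) <= nz (uval z) (mat k)) -> phi z <= M.
have Qm g M M' : Q g M -> M <= M' -> Q g M'.
 by move=> q MM z n1 cg mn; apply: le_trans MM; exact: q.
have QG g : G g -> exists M, Q g M.
 move=> Gg; have [cg|cg] := pselect (Zmp g); first by exists 0 => z _ /(_ cg).
 set tr := mat g 0 0 + mat g 1 1.
 have [t4|t4] := eqVneq (tr ^+ 2) 4.
  have par : parabolic (mat g).
   have trE : \tr (mat g) = tr.
    rewrite /mxtrace !big_ord_recl big_ord0 addr0 /tr; congr (_ + mat g _ _); exact/val_inj.
   split; [|by move=> h; apply: cg; left|by move=> h; apply: cg; right].
   rewrite trE; apply/eqP; rewrite -(@eqrXn2 _ 2) // real_normK ?num_real // t4.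
   by apply/eqP; ring.
  by have [M hM] := phi_par Gg par; exists M => z nz1 _ _; exact: hM.
 (* The displacement of g is at least |tr^2 - 4| everywhere and g is the least displaced element, so
    points under consideration are d-thick. *)
 set d := Num.min `|tr ^+ 2 - 4| (1 / 10).
 have d0 : 0 < d by rewrite lt_min normr_gt0 subr_eq0 t4 /=; lra.
 have [M hM] := bounded_thick d0; exists M => z n1 _ mn; apply: hM => k Gk ck.
 rewrite /d; have [k1|k1] := ltP (nz (uval z) (mat k)) (1 / 10); last first.
  by rewrite ge_min k1 orbT.
 rewrite ge_min; apply/orP; left; apply: le_trans (mn k Gk ck k1).
 have := trace_sqr_sub4_le (det_cj z g).
 by rewrite -/(nz _ _) /cj /cjm !mx22E /tr; congr (`|_ ^+ 2 - 4| <= _); ring.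
have [M1 hM1] : exists M, forall w, [set` s] w -> forall g, (G g /\ forall i j, `|cj w g i j| <= 4) -> Q g M.
 apply: finite_ub => [|w M M' h MM g gw|w _].
 - exact: finite_seq.
 - by apply: Qm MM; exact: h.
 - have [g M M' q MM|g [Gg _]|M hM] := @finite_ub _ _ Q (fin w); [exact: Qm MM|exact: QG|by exists M].
exists (Num.max M0 M1) => z; have [tz|nt] := pselect (thick (1 / 20) z).
 by rewrite le_max hM0.
rewrite le_max; apply/orP; right.
have [k0 [Gk0 ck0 nk0]] : exists k, [/\ G k, ~ Zmp k & nz (uval z) (mat k) < 1 / 20].
 apply: contrapT => H; apply: nt => g Gg cg; rewrite leNgt; apply/negP => ng.
 by apply: H; exists g.
have /finite_seqP[L LE] := Tset_finite sG dG z.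
have inL k : (k \in L) = `[< Tset G z (1 / 10) k >].
 by apply/idP/asboolP => h; [rewrite LE|move: h; rewrite LE].
pose L' := [seq k <- L | `[< ~ Zmp k >]].
have inL' k : k \in L' <-> [/\ G k, ~ Zmp k & nz (uval z) (mat k) < 1 / 10].
 rewrite mem_filter inL; split=> [/andP[/asboolP c /asboolP[]] //|[Gk ck nk]].
 by apply/andP; split; apply/asboolP.
have k0L : k0 \in L' by apply/inL'; split => //; lra.
have [|g gL gmin] := @seq_argmin _ (fun k => nz (uval z) (mat k)) L'.
 by apply/eqP => L0; move: k0L; rewrite L0.
have [Gg cg ng] := (inL' g).1 gL.
have ng1 : nz (uval z) (mat g) < 1 / 20 by apply: le_lt_trans nk0; exact: gmin.
have mn k : G k -> ~ Zmp k -> nz (uval z) (mat k) < 1 / 10 ->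
  nz (uval z) (mat g) <= nz (uval z) (mat k).
 by move=> Gk ck nk; apply: gmin; apply/inL'.
have [w nw] := ex_equidisp cg ng1.
have npos : 0 < nz (uval z) (mat g).
 by rewrite lt_def nz_ge0 andbT; apply/eqP => /center_nz.
(* An element k less displaced than g at w is proportional to g with ratio of square below 1, hence
   less displaced than g at z too, against minimality. *)
have tw : thick (1 / 20) w.
 move=> k Gk ck; rewrite leNgt; apply/negP => nk.
 have [||r sc] := @Tset_scal R G sG dG w g k _ _ cg.
 - by split=> //; rewrite nw; lra.
 - by split=> //; lra.
 have E v : nz (uval v) (mat k) = r ^+ 2 * nz (uval v) (mat g).
  by rewrite /nz; apply: nn_scal; apply/scal_cjm => //; rewrite gt_eqF ?uval_gt0.
 have r1 : r ^+ 2 < 1 by move: nk; rewrite E nw; lra.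
 have kz : nz (uval z) (mat k) < nz (uval z) (mat g) by rewrite E gtr_pMl.
 have := mn k Gk ck (lt_trans kz ng); by rewrite leNgt kz.
have [k [v [Gk vs kv]]] := hs w tw; have [_ mG iG] := sG.
pose g' := (k * g * k^-1)%g.
have Gg' : G g' by exact: (mG _ _ (mG _ _ Gk Gg) (iG _ Gk)).
have conj u t : nz (uval (act k u)) (mat (k * t * k^-1)%g) = nz (uval u) (mat t).
 rewrite nz_conj ?mat_det //; congr (nz _ _); rewrite -mat_inv -!mat_mul.
 by congr mat; rewrite !mulgA mulVg mul1g -mulgA mulVg mulg1.
have cconj t : ~ Zmp t -> ~ Zmp (k * t * k^-1)%g.
 by move=> ct /(center_nz (act k z)); rewrite conj => /center_nz.
rewrite -(phi_act z Gk); apply: (hM1 v vs g').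
- split=> //; apply: nearb_entries kv _; rewrite conj nw; lra.
- by rewrite conj.
- exact: cconj.
- move=> t Gt ct nt'.
 have tE : t = (k * (k^-1 * t * k) * k^-1)%g by rewrite !mulgA mulgV mul1g -mulgA mulgV mulg1.
 rewrite tE !conj in nt' *; apply: mn => //.
  exact: (mG _ _ (mG _ _ (iG _ Gk) Gt) Gk).
 by move=> /(center_nz z); rewrite -conj -tE => /center_nz.
Qed.
End ThickThin.

(** * The slash action, behaviour at cusps, and the bound for |f| y^(m/2) *)

Section HalfIntegralWeight.
Context {R : realType}.
Local Notation C := (Cx R).
Implicit Types (z w : uhp R) (g s t : metap R) (f : uhp R -> C).
Local Notation ht z := (Im (uval z)).

Section Weight.
Variables (m : R) (M : nat).
Hypothesis mM : 2 * m = M%:R.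

Lemma eta_powE s z : eta_pow m s z = (eta s z ^+ M)^-1.
Proof. by rewrite /eta_pow mM -[M%:R]/(M%:~R) intrKfloor exprnN. Qed.
Lemma eta_pow_mul s t z : eta_pow m (s * t)%g z = eta_pow m s (act t z) * eta_pow m t z.
Proof. by rewrite !eta_powE -invfM -exprMn. Qed.
Lemma slash_mul f s t z : slash m f (s * t)%g z = slash m (slash m f s) t z.
Proof. by rewrite /slash eta_pow_mul actM mulrA. Qed.
Lemma eta_pow1 z : eta_pow m 1%g z = 1.
Proof. by rewrite eta_powE expr1n invr1. Qed.
Lemma slash1 f z : slash m f 1%g z = f z.
Proof. by rewrite /slash eta_pow1 mulr1 act1. Qed.
Lemma cabs_eta_pow s z : cabs (eta_pow m s z) * ht z `^ (m / 2) = ht (act s z) `^ (m / 2).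
Proof.
have y0 := uval_gt0 z; set r := cabs (eta s z); have r0 : 0 < r by rewrite cabs_gt0 eta_neq0.
have -> : ht (act s z) = ht z * (r ^+ 4)^-1.
 rewrite /= Im_mob ?mat_det //; congr (_ * _^-1).
 by rewrite -eta_sqr cabsX -exprM.
rewrite powRM ?invr_ge0 ?exprn_ge0 ?(ltW y0) ?(ltW r0) // mulrC; congr (_ * _).
rewrite eta_powE cabsV cabsX -/r -powR_mulrn ?(ltW r0) // -powR_inv1 // -powRrM.
rewrite -[X in X `^ _ = _]/r -(powR_mulrn 4 (ltW r0)) -powR_inv1 // -!powRrM.
by congr (_ `^ _); rewrite -mM; field.
Qed.

Lemma cabs_slash f s z : cabs (slash m f s z) * ht z `^ (m / 2) =
 cabs (f (act s z)) * ht (act s z) `^ (m / 2).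
Proof. by rewrite /slash cabsM -mulrA cabs_eta_pow. Qed.
End Weight.

Lemma cabs_efun h n z : cabs (efun h n z) = expR (- (2 * pi * n%:~R / h * ht z)).
Proof. by rewrite /efun cabs_cexp ReM /= mul0r sub0r. Qed.
(** Absolute convergence at height y0 is enough: passing to height y multiplies the n-th term by exp
    (-2 pi n (y - y0) / h), and n >= 1. *)
Lemma fourier_decay (h : R) f (a : int -> C) (y0 : R) : 0 < h -> 0 < y0 ->
 fourier_expansion h f a -> (forall n, n <= 0 -> a n = 0) ->
 exists2 K : R, 0 <= K & forall z, y0 <= ht z -> cabs (f z) <= K * expR (- (2 * pi / h * ht z)).
Proof.
move=> h0 y00 fe a0; have c0 : 0 < 2 * pi / h by rewrite divr_gt0 // mulr_gt0 // pi_gt0.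
pose z0 : uhp R := @UHP R (0 +i* y0)%C y00.
pose p n := cabs (a n * efun h n z0).
have ps : summ p by exact: (hcs_summable ((has_csumE _ _).1 (fe z0))).
have p0 n : 0 <= p n by exact: cabs_ge0.
exists (bsum p * expR (2 * pi / h * y0)); first by rewrite mulr_ge0 ?bsum_ge0.
move=> z yz; rewrite -mulrA -expRD; set e := expR _.
have e0 : 0 <= e by exact: expR_ge0.
have p0' n : 0 <= e * p n by exact: mulr_ge0.
have fB (B : {fset int}) : \sum_(n <- B) (e * p n) <= bsum p * e.
 by rewrite -mulr_sumr mulrC ler_wpM2r // fsum_le_bsum.
have [ps' le'] := summ_ub p0' fB.
apply: le_trans le'.
apply: (@cabs_hcs _ _ (fun n => a n * efun h n z)); last exact/has_csumE.
- move=> n; rewrite /p [leLHS]cabsM (cabsM (a n) (efun h n z0)) !cabs_efun /e.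
 have [n0|n0] := leP n 0; first by rewrite a0 // cabs0 !mul0r mulr0.
 rewrite mulrCA ler_wpM2l // -expRD ler_expR /=.
 have n1 : 1 <= n%:~R :> R by rewrite -[1]/(1%:~R) ler_int; lia.
 have -> : 2 * pi * n%:~R / h = 2 * pi / h * n%:~R by rewrite mulrAC.
 set c := 2 * pi / h in c0 *; have : 0 <= c * (n%:~R - 1) * (ht z - y0).
  by rewrite mulr_ge0 ?subr_ge0 // mulr_ge0 ?subr_ge0 // ltW.
 by nra.
- exact: ps'.
Qed.

Lemma powR_expR_bounded (b c : R) : 0 <= b -> 0 < c -> exists2 M : R, 0 <= M &
 forall y, 0 < y -> y `^ b * expR (- (c * y)) <= M.
Proof.
move=> b0 c0; set n := (Num.truncn b).+1.
have bn : b <= n%:R by rewrite ltW // truncnS_gt.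
have [K K0 hK] : exists2 K : R, 0 <= K & forall x, 0 <= x -> x ^+ n <= K * expR x.
 exists (n%:R ^+ n) => // x x0; have n0 : 0 < n%:R :> R by rewrite ltr0n.
 have -> : expR x = expR (x / n%:R) ^+ n by rewrite -expRM_natl mulrC divfK // gt_eqF.
 rewrite -exprMn ler_pXn2r // ?nnegrE ?mulr_ge0 ?ler0n //.
 rewrite mulrC -ler_pdivrMr //; have := expR_ge1Dx (x / n%:R); lra.
exists (1 + (c ^+ n)^-1 * K); first by rewrite addr_ge0 // mulr_ge0 // invr_ge0 exprn_ge0 // ltW.
move=> y y0; have e1 : expR (- (c * y)) <= 1 by rewrite -expR0 ler_expR oppr_le0 mulr_ge0 ?ltW.
have [y1|y1] := leP y 1.
 apply: le_trans (_ : 1 <= _); last by rewrite lerDl mulr_ge0 // invr_ge0 exprn_ge0 // ltW.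
 rewrite -[leRHS]mulr1; apply: ler_pM; rewrite //.
 apply: le_trans (_ : 1 `^ b <= _); last by rewrite powR1.
 by apply: ge0_ler_powR; rewrite ?nnegrE ?(ltW y0).
apply: le_trans (_ : (c ^+ n)^-1 * K <= _); last by rewrite lerDr.
rewrite expRN ler_pdivrMr ?expR_gt0 // -mulrA ler_pdivlMl ?exprn_gt0 //.
apply: le_trans (hK (c * y) _); last by rewrite mulr_ge0 ?ltW.
rewrite exprMn ler_wpM2l ?exprn_ge0 ?(ltW c0) // -powR_mulrn ?(ltW y0) //.
by apply: ler_powR => //; exact: ltW.
Qed.

Lemma fourier_bounded (h b y0 : R) f (a : int -> C) : 0 < h -> 0 < y0 -> 0 <= b ->
 fourier_expansion h f a -> (forall n, n <= 0 -> a n = 0) ->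
 exists B, forall z, y0 <= ht z -> cabs (f z) * ht z `^ b <= B.
Proof.
move=> h0 y00 b0 fe a0; have [K K0 hK] := fourier_decay h0 y00 fe a0.
have c0 : 0 < 2 * pi / h by rewrite divr_gt0 // mulr_gt0 // pi_gt0.
have [L L0 hL] := powR_expR_bounded b0 c0; exists (K * L) => z yz.
apply: le_trans (ler_wpM2r (powR_ge0 _ _) (hK z yz)) _.
rewrite [leLHS](_ : _ = K * (ht z `^ b * expR (- (2 * pi / h * ht z)))); last by ring.
by rewrite ler_wpM2l //; apply: hL; exact: uval_gt0.
Qed.

(** The square root with values in the closed first quadrant. It serves as factor eta for the matrix
    (x, -1; 1, 0), whose denominator is z, and so provides elements of the cover sending infinity to
    x. *)
Definition uroot (z : C) : C :=
 (Num.sqrt ((cabs z + Re z) / 2) +i* Num.sqrt ((cabs z - Re z) / 2))%C.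

Lemma uroot_sqr (z : C) : 0 <= Im z -> uroot z ^+ 2 = z.
Proof.
move=> y0; have /ler_normlP[r1 r2] := Re_le_cabs z.
have s1 : 0 <= (cabs z + Re z) / 2 by rewrite divr_ge0 //; lra.
have s2 : 0 <= (cabs z - Re z) / 2 by rewrite divr_ge0 //; lra.
have uv : Num.sqrt ((cabs z + Re z) / 2) * Num.sqrt ((cabs z - Re z) / 2) = Im z / 2.
 rewrite -sqrtrM // (_ : _ * _ = (Im z / 2) ^+ 2).
  by rewrite sqrtr_sqr ger0_norm ?divr_ge0.
 by have := cabs_sqr z; set a := cabs z; set x := Re z; set y := Im z => E; nra.
rewrite expr2; apply: cx_eq; first by rewrite ReM /= -!expr2 !sqr_sqrtr //; field.
by rewrite ImM /=; move: uv; set u := Num.sqrt _; set v := Num.sqrt _; lra.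
Qed.

(** With s0 and s1 the roots at z and z + k, (s1 - s0) (s1 + s0) = k, and s1 + s0 is bounded away
    from 0 because both imaginary parts are nonnegative. This gives continuity and differentiability
    together. *)
Lemma uroot_holo : holomorphic (fun z : uhp R => uroot (uval z)).
Proof.
move=> z; apply: (@holomorphic_near _ _ uroot) => //.
have y0 := uval_gt0 z; set s0 := uroot (uval z).
have /ler_normlP[r1 r2] := Re_le_cabs (uval z).
have t0 : 0 < Im s0.
 rewrite /= sqrtr_gt0 divr_gt0 // subr_gt0 lt_neqAle.
 rewrite (_ : Re (uval z) <= _); last lra.
 rewrite andbT; apply/eqP => e; have := cabs_sqr (uval z); rewrite -e => /eqP.
 by rewrite -subr_eq0 opprD addNKr oppr_eq0 sqrf_eq0 gt_eqF.
have s0n : s0 != 0 by rewrite -cabs_gt0; apply: lt_le_trans t0 _; apply: le_trans (ler_norm _) (Im_le_cabs _).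
apply: (@cder_derivable _ _ _ (2 * s0)^-1) => eps eps0.
set t := Im s0 in t0.
exists (Num.min (ht z / 2) (2 * t ^+ 3 * eps)); first by rewrite lt_min divr_gt0 // !mulr_gt0 // exprn_gt0.
move=> k; rewrite lt_min => /andP[k1 k2].
have y1 : 0 <= Im (uval z + k).
 by have := @Im_near R (uval z) (uval z + k); rewrite addrAC subrr add0r => /(_ k1); lra.
set s1 := uroot (uval z + k).
have Q : (s1 - s0) * (s1 + s0) = k.
 rewrite -subr_sqr !uroot_sqr // ?(ltW y0) //; ring.
have i1 : 0 <= Im s1 by rewrite /= sqrtr_ge0.
have ge : t <= cabs (s1 + s0).
 by apply: le_trans (Im_le_cabs _); rewrite ImD ger0_norm; rewrite ?addr_ge0 ?lerDr // ltW.
have sn : s1 + s0 != 0 by rewrite -cabs_gt0; exact: lt_le_trans ge.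
have D : cabs (s1 - s0) <= cabs k / t.
 rewrite ler_pdivlMr // -[in leRHS]Q cabsM ler_wpM2l //.
have two : (2 : C) != 0 by rewrite pnatr_eq0.
have -> : s1 - s0 - (2 * s0)^-1 * k = - ((s1 - s0) ^+ 2 / (2 * s0)).
 by rewrite -Q; field.
rewrite cabsN cabsf cabsX cabsM.
have c2 : cabs (2 : C) = 2 by rewrite -[2]/(2%:R : C) -(rmorph_nat (@toC R)) cabs_toC ger0_norm.
have gs : t <= cabs s0 by apply: le_trans (ler_norm _) (Im_le_cabs _).
have p0 : 0 < 2 * cabs s0 by rewrite mulr_gt0 // (lt_le_trans t0).
rewrite c2 ler_pdivrMr //.
have k0 := cabs_ge0 k.
apply: le_trans (_ : (cabs k / t) ^+ 2 <= _).
 by rewrite ler_pXn2r // ?nnegrE // divr_ge0 // ltW.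
have A : cabs k <= 2 * eps * (t ^+ 2 * cabs s0).
 apply: le_trans (ltW k2) _; rewrite [leLHS](_ : _ = 2 * eps * (t ^+ 2 * t)); last by ring.
 by rewrite ler_wpM2l ?mulr_ge0 ?(ltW eps0) // ler_wpM2l ?sqr_ge0.
rewrite expr_div_n ler_pdivrMr ?exprn_gt0 //.
rewrite [leRHS](_ : _ = cabs k * (2 * eps * (t ^+ 2 * cabs s0))); last by ring.
by rewrite expr2 ler_wpM2l.
Qed.

Fact cusp_det (x : R) : \det (mx22 x (-1) 1 0) = 1.
Proof. by rewrite det22 !mx22E; ring. Qed.

Fact cusp_sqr (x : R) (z : uhp R) : uroot (uval z) ^+ 2 = mob_den (mx22 x (-1) 1 0) (uval z).
Proof. by rewrite /mob_den !mx22E rmorph1 rmorph0 mul1r addr0 uroot_sqr // ltW // uval_gt0. Qed.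

Definition to_cusp (x : option R) : metap R :=
 if x is Some x then Metap (cusp_det x) uroot_holo (cusp_sqr x) else 1%g.

Lemma to_cuspE x : bact (mat (to_cusp x)) None = x.
Proof.
case: x => [x|] /=; rewrite ?mx22E; first by rewrite oner_eq0 divr1.
by rewrite mxE /= eqxx.
Qed.

(** Up to sign, the entry in question is the quadratic form of g at the column of s that represents
    x; its zeros are the fixed points of g. *)
Lemma conj_fix g s x : bact (mat g) x = x -> bact (mat s) None = x ->
 mat (s^-1 * g * s)%g 1 0 = 0.
Proof.
set a := mat g; set p := mat s => gx sx.
have -> : mat (s^-1 * g * s)%g 1 0 =
  a 1 0 * p 0 0 ^+ 2 + (a 1 1 - a 0 0) * p 0 0 * p 1 0 - a 0 1 * p 1 0 ^+ 2.
 by rewrite !mat_mul mat_inv !mulmx22 /adj2 !mx22E -/a -/p; ring.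
move: sx; rewrite /bact; case: eqP => [p0 xE|/eqP p0 xE]; subst x.
 by move: gx; rewrite /bact p0; case: eqP => // -> _; ring.
move: gx; rewrite /bact; case: eqP => [//|/eqP d0 [] /eqP].
rewrite eqr_div // => /eqP E; have := mat_det g; rewrite det22 -/a => da.
move: E; set x := p 0 0 / p 1 0.
have -> : p 0 0 = x * p 1 0 by rewrite divfK.
clearbody x => E; have E0 : p 1 0 * (a 1 0 * x ^+ 2 + (a 1 1 - a 0 0) * x - a 0 1) = 0.
 by move/eqP: E; rewrite -subr_eq0 => /eqP E; rewrite -[RHS]oppr0 -[in RHS]E; ring.
rewrite (_ : _ - _ = p 1 0 * (p 1 0 * (a 1 0 * x ^+ 2 + (a 1 1 - a 0 0) * x - a 0 1))); last by ring.
by rewrite E0 mulr0.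
Qed.

Lemma trace22 (a : 'M[R]_2) : \tr a = a 0 0 + a 1 1.
Proof. by rewrite /mxtrace !big_ord_recl big_ord0 addr0; congr (_ + a _ _); exact/val_inj. Qed.
Lemma parabolic_fix g : parabolic (mat g) -> exists x, bact (mat g) x = x.
Proof.
case=> + _ _; rewrite trace22; set a := mat g => tr2.
have [c0|c0] := eqVneq (a 1 0) 0; first by exists None; rewrite /bact c0 eqxx.
have t4 : (a 0 0 + a 1 1) ^+ 2 = 4 by rewrite -real_normK ?num_real // tr2; ring.
have tn : a 0 0 + a 1 1 != 0 by apply: contra_eq_neq t4 => ->; rewrite expr0n eq_sym pnatr_eq0.
have := mat_det g; rewrite det22 -/a => da.
exists (Some ((a 0 0 - a 1 1) / (2 * a 1 0))); rewrite /bact.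
have -> : a 1 0 * ((a 0 0 - a 1 1) / (2 * a 1 0)) + a 1 1 = (a 0 0 + a 1 1) / 2 by field.
rewrite mulf_eq0 (negbTE tn) invr_eq0 pnatr_eq0 /=; congr Some.
apply/eqP; rewrite eqr_div ?mulf_neq0 ?invr_eq0 ?pnatr_eq0 // -subr_eq0; apply/eqP.
transitivity (((a 0 0 + a 1 1) ^+ 2 - 4 * (a 0 0 * a 1 1 - a 0 1 * a 1 0)) / 2).
 by field.
by rewrite t4 da; field.
Qed.

(** A parabolic matrix moved to infinity is triangular with determinant 1 and trace 2 or -2, hence a
    translation up to sign; the translation is nonzero because g is not central. *)
Lemma conj_parabolic g s : parabolic (mat g) -> mat (s^-1 * g * s)%g 1 0 = 0 ->
 let t := mat (s^-1 * g * s)%g in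
 [/\ t 0 0 = t 1 1, t 0 0 ^+ 2 = 1 & t 0 1 != 0].
Proof.
move=> [tr2 g1 g2] t10 t; have dt : \det t = 1 by exact: mat_det.
have trE : \tr t = \tr (mat g).
 rewrite /t !mat_mul mxtrace_mulC mulmxA -mat_mul.
 by rewrite (_ : (s * s^-1)%g = 1%g) ?mulgV //= mul1mx.
have t4 : (t 0 0 + t 1 1) ^+ 2 = 4 by rewrite -trace22 trE -real_normK ?num_real // tr2; ring.
rewrite det22 -/t t10 mulr0 subr0 in dt.
have e : t 0 0 = t 1 1.
 apply/eqP; rewrite -subr_eq0 -sqrf_eq0; apply/eqP.
 by move: t4 dt; set p := t 0 0; set q := t 1 1; lra.
have e1 : t 0 0 ^+ 2 = 1 by rewrite expr2 {2}e.
split=> //; apply/eqP => t01.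
have ct : Zmp (s^-1 * g * s)%g.
 by apply: nn_eq0; [exact: mat_det|rewrite /nn -/t e t01 t10; ring].
have cg : Zmp g.
 apply/(center_nz (act s uhp_i)); rewrite nz_conj ?mat_det // -mat_inv -!mat_mul.
 exact/center_nz.
by case: cg.
Qed.

Lemma hyp_JH (F : set (uhp R)) (phi : uhp R -> \bar R) :
 (\int[leb2]_(p in plane F) (lft phi p * (p.2 ^- 2)%:E) = JH (fun z => ind F z * phi z))%E.
Proof.
rewrite integral_mkcond; apply: eq_integral => p _; rewrite /patch.
case: (boolP (p \in plane F)) => pF.
 have [z Fz zE] := set_mem pF; have pE : p = co (uval z) by rewrite zE; case: (p).
 rewrite pE mem_set ?lft_co; last exact: uval_gt0.
 rewrite /ind asboolT // mul1e /hw wtE; last exact: uval_gt0.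
 by rewrite -expr2 exprVn.
case: ifP => pU; last by rewrite mul0e.
have [z _ pE] := UHE (set_mem pU); rewrite {1}pE lft_co /ind asboolF ?mul0e // => Fz.
by move: pF; rewrite notin_setE; apply; exists z => //; rewrite pE; case: (uval z).
Qed.

Lemma hyp_area_JH (F : set (uhp R)) : hyp_area F = JH (ind F).
Proof.
rewrite /hyp_area; transitivity (JH (fun z => ind F z * 1)%E); last first.
 by congr JH; ext => z; rewrite mule1.
rewrite -hyp_JH; apply: eq_integral => p /set_mem[z _ zE].
have pE : p = co (uval z) by rewrite zE; case: (p).
by rewrite {2}pE lft_co mul1e.
Qed.

Section Bounded.
Variables (G : set (metap R)) (chi : metap R -> C) (m : R) (M : nat) (f : uhp R -> C).
Hypotheses (mM : 2 * m = M%:R) (sG : is_subgroup G) (dG : discrete_set G).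
Hypotheses (cG : finite_covolume G) (iG : is_cusp G None) (oG : finite_order G chi).
Hypothesis cf : cusp_form G chi m f.

Lemma chi_unitary s : G s -> cabs (chi s) = 1.
Proof.
have [N N0 hN] := oG; move=> /hN /(congr1 (@cabs R)); rewrite cabsX cabs1 => /eqP.
by rewrite pexpr_eq1 // => /eqP.
Qed.

Lemma m_ge0 : 0 <= m / 2.
Proof. have : 0 <= 2 * m by rewrite mM. lra. Qed.
(** [bounded_of_thick] applies: the function is invariant because chi is unitary, it is bounded near
    any point by the expansion at the cusp infinity, and where a parabolic element is little
    displaced the expansion at its fixed cusp bounds it. *)
Lemma cusp_form_bounded : exists B, forall z, cabs (f z) * ht z `^ (m / 2) <= B.
Proof.
have [hf ff fc] := cf; have [F fF] := cG; rewrite hyp_area_JH => aF.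
have inv g z : cabs (f (act g z)) * ht (act g z) `^ (m / 2) = cabs (slash m f g z) * ht z `^ (m / 2).
 by rewrite (cabs_slash mM).
apply: (@bounded_of_thick R G sG dG F fF aF (fun z => cabs (f z) * ht z `^ (m / 2))).
- by move=> g z Gg; rewrite inv ff // cabsM chi_unitary // mul1r.
- move=> w; have [||h' [a [h'0 fe a0]]] := fc None 1%g => //.
  by rewrite /bact mxE /= eqxx.
 have w0 : 0 < 2 / 3 * ht w by rewrite mulr_gt0 //; lra.
 have [B hB] := fourier_bounded h'0 w0 m_ge0 fe a0; exists B => z /nearb_Im[_ zw].
 by have := hB z; rewrite (slash1 mM); apply; lra.
- move=> g Gg pg; have [x gx] := parabolic_fix pg; set s := to_cusp x.
 have sx : bact (mat s) None = x by exact: to_cuspE.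
 have t10 := conj_fix gx sx; have [t1 t2 t3] := conj_parabolic pg t10.
 have [||h' [a [h'0 fe a0]]] := fc x s => //; first by exists g.
 set t := mat (s^-1 * g * s)%g in t10 t1 t2 t3.
 have b0 : 0 < `|t 0 1| by rewrite normr_gt0.
 have [B hB] := fourier_bounded h'0 b0 m_ge0 fe a0; exists B => z nzz.
 have := hB (act (s^-1)%g z); rewrite -inv actVK; apply.
 have y0 := uval_gt0 (act (s^-1)%g z); set y := ht _ in y0 *.
 (* In the coordinate at the cusp, t is a translation up to sign and has displacement 2 (t01 / y)^2;
    a value below 1 / 20 forces y >= |t01|, which is in the range of the bound from the
    expansion. *)
 have : nz (uval (act (s^-1)%g z)) t < 1 / 20.
  move: nzz; rewrite -{1}(actVK s z) nz_conj ?mat_det //.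
  by rewrite -mat_inv -!mat_mul.
 rewrite /nz /nn /cjm !mx22E t10 t1 -/y !mul0r !subr0 addr0 subrr expr0n /= add0r mulr0 !addr0.
 rewrite mul0r addr0 => H.
 rewrite -(@ler_pXn2r _ 2) ?nnegrE ?(ltW b0) ?(ltW y0) // real_normK ?num_real //.
 have y2 : 0 < y ^+ 2 by rewrite exprn_gt0.
 by move: H; rewrite expr_div_n mulrA ltr_pdivrMr //; have := sqr_ge0 (t 0 1); lra.
Qed.
End Bounded.
End HalfIntegralWeight.

(** * Fourier expansion of periodic functions on the half-plane, by dyadic averages *)

Section FourierTheorem.
Context {R : realType}.
Local Notation C := (Cx R).
Variable h : R.
Hypothesis h0 : 0 < h.
Implicit Types (z w : C) (G : C -> C).

Definition fexp (n : int) z : C := cexp ((0 +i* (2 * pi * n%:~R / h))%C * z).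

Lemma fexpD n z w : fexp n (z + w) = fexp n z * fexp n w.
Proof. by rewrite /fexp mulrDr cexpD. Qed.
Lemma imD (a b : R) : (0 +i* (a + b) : C)%C = (0 +i* a)%C + (0 +i* b)%C.
Proof. by apply: cx_eq; rewrite ?ReD ?ImD /= ?addr0. Qed.
Lemma fexp_add (n k : int) z : fexp (n + k) z = fexp n z * fexp k z.
Proof. by rewrite /fexp intrD mulrDr mulrDl imD mulrDl cexpD. Qed.
Lemma fexp0 z : fexp 0 z = 1.
Proof. by rewrite /fexp mulr0 mul0r -[RHS]cexp0; congr cexp; apply: cx_eq; rewrite ?ReM ?ImM /= !mul0r ?subr0 ?addr0. Qed.
Lemma fexpN (n : int) z : fexp (- n) z = (fexp n z)^-1.
Proof.
have : fexp (- n) z * fexp n z = 1 by rewrite -fexp_add addNr fexp0.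
by move=> /(congr1 (fun x => x / fexp n z)); rewrite mulfK ?mul1r // cexp_neq0.
Qed.

Lemma fexp_neq0 n z : fexp n z != 0. Proof. exact: cexp_neq0. Qed.

Lemma cabs_fexp n z : cabs (fexp n z) = expR (- (2 * pi * n%:~R / h * Im z)).
Proof. by rewrite /fexp cabs_cexp ReM /= mul0r sub0r. Qed.
Lemma fexp_qx n (t : R) : fexp n (toC t) = qx h (toC (n%:~R * t)).
Proof.
by rewrite /fexp /qx /qc; congr cexp; apply: cx_eq; rewrite ?ReM ?ImM /=; ring.
Qed.

Lemma fexp_h n : fexp n (toC h) = 1.
Proof.
rewrite /fexp (_ : _ * _ = (0 +i* (2 * pi * n%:~R))%C) ?cexp_period //.
by apply: cx_eq; rewrite ?ReM ?ImM /=; field; rewrite gt_eqF.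
Qed.

Definition pw (j : nat) : R := h / 2 ^+ j.

Lemma pw_gt0 j : 0 < pw j. Proof. by rewrite divr_gt0 // exprn_gt0. Qed.

Lemma pwS j : pw j.+1 + pw j.+1 = pw j.
Proof. by rewrite /pw exprS; field; rewrite expf_neq0 // pnatr_eq0. Qed.

(** The average of G over the 2^j points z + k h / 2^j of a horizontal period, in place of the
    integral over the period. *)
Fixpoint dmean (j : nat) G z : C :=
 if j is j.+1 then (dmean j G z + dmean j G (z + toC (pw j.+1))) / 2 else G z.

Lemma cabs2 : cabs (2 : C) = 2.
Proof. by rewrite -[2]/(2%:R : C) -(rmorph_nat (@toC R)) cabs_toC ger0_norm. Qed.
Lemma dmean_shift j G z : (forall w, Im w = Im z -> G (w + toC h) = G w) ->
 dmean j G (z + toC (pw j)) = dmean j G z.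
Proof.
elim: j z => [|j IH] z per; first by rewrite /= /pw expr0 divr1 per.
have per' w : Im w = Im (z + toC (pw j.+1)) -> G (w + toC h) = G w.
 by rewrite ImD /= addr0; exact: per.
rewrite /= -[z + _ + _]addrA -rmorphD pwS IH // addrC.
by [].
Qed.

Lemma dmean_le j G z B : (forall w, Im w = Im z -> cabs (G w) <= B) ->
 cabs (dmean j G z) <= B.
Proof.
elim: j z => [|j IH] z hB; first exact: hB.
rewrite /= cabsf cabs2 ler_pdivrMr //; apply: le_trans (cabsD _ _) _.
have := IH z hB; have := IH (z + toC (pw j.+1)); rewrite ImD /= addr0 => /(_ hB); lra.
Qed.

Lemma dmean_cder j G G' z : (forall w, Im w = Im z -> cder G w (G' w)) ->
 cder (dmean j G) z (dmean j G' z).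
Proof.
elim: j z => [|j IH] z hG; first exact: hG.
have D1 := IH z hG.
have D2 : cder (dmean j G) (z + toC (pw j.+1)) (dmean j G' (z + toC (pw j.+1))).
 by apply: IH => w; rewrite ImD /= addr0; exact: hG.
have D3 : cder (fun w => dmean j G (w + toC (pw j.+1))) z (dmean j G' (z + toC (pw j.+1)) * 1).
 apply: (@gder_comp R C id (dmean j G) (fun w => w + toC (pw j.+1)) z _ 1 D2); rewrite -[1]addr0; apply: gderD; [exact: cder_id|exact: gder_cst].
have := gderZ (2^-1) (gderD D1 D3); rewrite mulr1 mulrC.
by apply: gder_ext => w; rewrite mulrC.
Qed.

(** A periodic function with two derivatives, all bounded on horizontal bands; G2 need not be
    continuous. *)
Definition nice G G1 G2 : Prop :=
 [/\ forall z, 0 < Im z -> [/\ G (z + toC h) = G z, G1 (z + toC h) = G1 z,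
    cder G z (G1 z) & cder G1 z (G2 z)] &
   forall y0 y1, 0 < y0 -> exists2 B, 0 <= B & forall z, y0 <= Im z <= y1 ->
    [/\ cabs (G z) <= B, cabs (G1 z) <= B & cabs (G2 z) <= B]].

(** The average of G takes the same value at z and at z + [pw j]. Its derivative is Lipschitz with
    constant B along the step, so the derivative at z is at most B times the step: averages of
    derivatives tend to 0. *)
Lemma nice_dmean1 G G1 G2 z j B : nice G G1 G2 -> 0 < Im z ->
 (forall w, Im w = Im z -> cabs (G2 w) <= B) ->
 cabs (dmean j G1 z) <= pw j * B.
Proof.
move=> [D _] z0 hB; set p := pw j; have p0 : 0 < p by exact: pw_gt0.
have Dz w : Im w = Im z -> 0 < Im w by move=> ->.
have seg t : Im (z + toC t * toC p) = Im z.
 by rewrite ImD -rmorphM /= addr0.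
have d1 w : Im w = Im z -> cder (dmean j G) w (dmean j G1 w).
 by move=> wz; apply: dmean_cder => v vw; have [] := D v; rewrite ?vw ?wz.
have d2 w : Im w = Im z -> cder (dmean j G1) w (dmean j G2 w).
 by move=> wz; apply: dmean_cder => v vw; have [] := D v; rewrite ?vw ?wz.
have B2 w : Im w = Im z -> cabs (dmean j G2 w) <= B.
 by move=> wz; apply: dmean_le => v; rewrite wz; exact: hB.
have B0 : 0 <= B by apply: le_trans (hB z erefl); exact: cabs_ge0.
have L w : (exists2 t : R, 0 <= t <= 1 & w = z + toC t * toC p) ->
  cabs (dmean j G1 w - dmean j G1 z) <= B * p.
 move=> [t /andP[t0 t1] ->].
 have H := @cmean_value_ineq R (dmean j G1) (dmean j G2) z (toC t * toC p) B.
 apply: le_trans (H _ _) _.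
 - by move=> s _; apply: d2; rewrite ImD -!rmorphM /= addr0.
 - by move=> s _; apply: B2; rewrite ImD -!rmorphM /= addr0.
 by rewrite cabsM !cabs_toC (ger0_norm t0) (ger0_norm (ltW p0)) ler_wpM2l // ger_pMl.
have H := @cmean_value_ineq R (fun w => dmean j G w - dmean j G1 z * w)
 (fun w => dmean j G1 w - dmean j G1 z) z (toC p) (B * p).
have : cabs (dmean j G (z + toC p) - dmean j G1 z * (z + toC p) - (dmean j G z - dmean j G1 z * z)) <= B * p * cabs (toC p).
 apply: H => t tt; last by apply: L; exists t.
 rewrite -[X in _ - X]mulr1; apply: gderB; first by apply: d1; rewrite seg.
 by apply: gderZ; exact: cder_id.
rewrite dmean_shift; last by move=> w wz; have [] := D w (Dz w wz).
rewrite (_ : _ - _ - _ = - (dmean j G1 z * toC p)); last by ring.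
by rewrite cabsN cabsM cabs_toC ger0_norm ?(ltW p0) // ler_pM2r // mulrC.
Qed.

Lemma nice_dmean_lip G G1 G2 z w j B : nice G G1 G2 -> 0 < Im z -> 0 < Im w ->
 (forall v, Num.min (Im z) (Im w) <= Im v <= Num.max (Im z) (Im w) ->
  cabs (G2 v) <= B) ->
 cabs (dmean j G w - dmean j G z) <= pw j * B * cabs (w - z).
Proof.
move=> N z0 w0 hB; have [D _] := N.
have seg (t : R) : 0 <= t <= 1 -> Num.min (Im z) (Im w) <=
  Im (z + toC t * (w - z)) <= Num.max (Im z) (Im w).
 move=> /andP[t0 t1]; rewrite ImD ImM ImD ImN /= mul0r addr0; set a := Im z; set b := Im w.
 by case: (leP a b) => ab; apply/andP; split; nra.
have seg0 t : 0 <= t <= 1 -> 0 < Im (z + toC t * (w - z)).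
 by move=> tt; have /andP[+ _] := seg _ tt; apply: lt_le_trans; rewrite lt_min z0.
apply: (@cmean_value_seg R (dmean j G) (dmean j G1)) => t tt.
 by apply: dmean_cder => v vE; have [] := D v; rewrite ?vE ?seg0.
apply: (@nice_dmean1 G G1 G2 _ j B N) => [|v vE]; first exact: seg0.
by apply: hB; rewrite vE seg.
Qed.

(** Successive averages differ by O(2^-j). The limit is the same for all z since the j-th average
    has Lipschitz constant O(2^-j); this replaces the independence of the period integral from the
    height. *)
Lemma dmean_cvg G G1 G2 : nice G G1 G2 -> exists a : C, forall z, 0 < Im z ->
 forall e, 0 < e -> exists J, forall j, (J <= j)%N -> cabs (dmean j G z - a) < e.
Proof.
move=> N; have [D Bd] := N; pose z1 : C := 'i%C; have i0 : 0 < Im z1 by exact: ltr01.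
have [B B0 hB] := Bd 1 1 ltr01.
pose d j : C := dmean j.+1 G z1 - dmean j G z1.
have dle j : cabs (d j) <= h ^+ 2 * B * (1 / 2) ^+ j.
 have L := @nice_dmean_lip G G1 G2 z1 (z1 + toC (pw j.+1)) j B N i0.
 rewrite ImD /= addr0 in L; have {}L := L i0; rewrite minxx maxxx in L.
 have {}L : cabs (dmean j G (z1 + toC (pw j.+1)) - dmean j G z1) <= pw j * B * pw j.+1.
  rewrite addrAC subrr add0r cabs_toC (ger0_norm (ltW (pw_gt0 _))) in L.
  by apply: L => v vE; have [] := hB v vE.
 rewrite /d (_ : dmean j.+1 G z1 - _ = (dmean j G (z1 + toC (pw j.+1)) - dmean j G z1) / 2); last first.
  by rewrite /=; field.
 rewrite cabsf cabs2 ler_pdivrMr //; apply: le_trans L _.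
 have w0 : 0 < (1 / 2 : R) ^+ j by rewrite exprn_gt0.
 have w1 : (1 / 2 : R) ^+ j <= 1 by rewrite exprn_ile1 //; lra.
 have -> : pw j = h * (1 / 2) ^+ j by rewrite /pw expr_div_n expr1n mul1r.
 have -> : pw j.+1 = h * ((1 / 2) ^+ j / 2) by rewrite /pw exprSr expr_div_n expr1n; field; rewrite expf_neq0 // pnatr_eq0.
 set w := _ ^+ j in w0 w1 *; have hB0 : 0 <= h ^+ 2 * B by rewrite mulr_ge0 ?sqr_ge0.
 rewrite [leLHS](_ : _ = h ^+ 2 * B * (w * w / 2)); last by ring.
 by rewrite [leRHS](_ : _ = h ^+ 2 * B * (w * 2)) ?ler_wpM2l //; [nra|ring].
have ps : summ (fun j => h ^+ 2 * B * (1 / 2) ^+ j).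
 apply: summZ; [by rewrite mulr_ge0 ?sqr_ge0|by move=> n; rewrite exprn_ge0|apply: summ_geo; lra].
have [l hl] := hcsP (summ_le dle ps).
have part j : \sum_(i < j) d i = dmean j G z1 - dmean 0 G z1.
 elim: j => [|j IH]; first by rewrite big_ord0 subrr.
 by rewrite big_ord_recr /= IH /d addrC addrA subrK.
exists (l + dmean 0 G z1) => z z0 e e0.
pose y0 := Num.min (Im z1) (Im z); pose y1 := Num.max (Im z1) (Im z).
have y00 : 0 < y0 by rewrite lt_min i0.
have [B' B'0 hB'] := Bd y0 y1 y00.
have [A hA] := hl (e / 2) (divr_gt0 e0 (ltr0n _ 2)).
have c0 : 0 <= h * B' * cabs (z - z1) by rewrite !mulr_ge0 // ltW.
set c := h * B' * _ in c0.
pose J1 := (\max_(i <- A) i).+1; pose J2 := (Num.truncn (2 * c / e)).+1.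
exists (maxn J1 J2) => j; rewrite geq_max => /andP[j1 j2].
have s1 : cabs (dmean j G z1 - (l + dmean 0 G z1)) < e / 2.
 have := hA [fset i | i in iota 0 j]%fset; rewrite fsum_iota part => H.
 rewrite cabsBC (_ : _ - _ = l - (dmean j G z1 - dmean 0 G z1)); last by ring.
 apply: H; apply/fsubsetP => i iA; rewrite in_fset /= mem_iota add0n.
 by apply: leq_trans j1; rewrite ltnS; apply: (leq_bigmax_seq (F := id)).
have s2 : cabs (dmean j G z - dmean j G z1) <= e / 2.
 apply: le_trans (nice_dmean_lip (B := B') _ N i0 z0 _) _.
  by move=> v vE; have [] := hB' v vE.
 rewrite (_ : _ * _ * _ = c / 2 ^+ j); last by rewrite /pw /c; ring.
 rewrite ler_pdivrMr ?exprn_gt0 //.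
 have jj : j%:R <= 2 ^+ j :> R by rewrite -natrX ler_nat ltnW // ltn_expl.
 have : 2 * c / e < j%:R by apply: lt_le_trans (truncnS_gt _) _; rewrite ler_nat.
 rewrite ltr_pdivrMr // => H; have := ler_wpM2r (ltW e0) jj.
 by move: H; set u := 2 ^+ j; set v := j%:R; clear -e0; clearbody c; lra.
rewrite (_ : _ - _ = (dmean j G z - dmean j G z1) + (dmean j G z1 - (l + dmean 0 G z1))); last by ring.
by apply: le_lt_trans (cabsD _ _) _; lra.
Qed.

Lemma cder_fexp n z : cder (fexp n) z ((0 +i* (2 * pi * n%:~R / h))%C * fexp n z).
Proof. exact: cder_cexpZ. Qed.
Lemma nice_fexp G G1 G2 n : nice G G1 G2 ->
 let c := (0 +i* (2 * pi * n%:~R / h) : C)%C in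
 nice (fun z => G z * fexp n z) (fun z => (G1 z + c * G z) * fexp n z)
  (fun z => (G2 z + c * G1 z + c * (G1 z + c * G z)) * fexp n z).
Proof.
move=> [D Bd] c; split=> [z z0|y0 y1 y00].
 have [p0 p1 d0 d1] := D z z0; split.
 - by rewrite p0 fexpD fexp_h mulr1.
 - by rewrite p0 p1 fexpD fexp_h mulr1.
 - have := gderM d0 (cder_fexp n z); rewrite -/c; congr gder; ring.
 - have := gderM (gderD d1 (gderZ c d0)) (cder_fexp n z); rewrite -/c; congr gder; ring.
have [B B0 hB] := Bd y0 y1 y00.
set k := `|2 * pi * n%:~R / h|; have k0 : 0 <= k by exact: normr_ge0.
have ck : cabs c = k.
 have -> : c = 'i%C * toC (2 * pi * n%:~R / h) by apply: cx_eq; rewrite ?ReM ?ImM /=; ring.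
 by rewrite cabsM cabs_toC (_ : cabs 'i%C = 1) ?mul1r // cabsE /= expr0n add0r expr1n sqrtr1.
set L := expR (k * `|y1|); have L0 : 0 <= L by exact: expR_ge0.
exists ((1 + k) ^+ 2 * B * L); first by rewrite mulr_ge0 // mulr_ge0 // sqr_ge0.
move=> z zy; have [b0 b1 b2] := hB z zy; case/andP: zy => zy0 zy1.
have fL : cabs (fexp n z) <= L.
 rewrite cabs_fexp ler_expR; have z0 : 0 < Im z by exact: lt_le_trans zy0.
 apply: le_trans (_ : k * Im z <= _); last first.
  by rewrite ler_wpM2l // (le_trans zy1) // ler_norm.
 by rewrite -mulNr ler_wpM2r ?(ltW z0) // /k -normrN ler_norm.
have F0 := cabs_ge0 (fexp n z).
have e1 : cabs (G1 z + c * G z) <= B + k * B.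
 by apply: le_trans (cabsD _ _) _; rewrite cabsM ck lerD // ler_wpM2l.
have kB : 0 <= k * B by exact: mulr_ge0.
have kkB : 0 <= k * (k * B) by exact: mulr_ge0.
split; rewrite [leLHS]cabsM; apply: ler_pM; rewrite //.
- nra.
- by apply: le_trans e1 _; nra.
- apply: le_trans (cabsD _ _) _; rewrite [in X in _ + X]cabsM ck.
 have s1 : cabs (G2 z + c * G1 z) <= B + k * B.
  by apply: le_trans (cabsD _ _) _; rewrite cabsM ck lerD // ler_wpM2l.
 by have := ler_wpM2l k0 e1; nra.
Qed.

Section Expansion.
Variables (g g1 g2 : C -> C).
Hypothesis N : nice g g1 g2.

(** The n-th term of the discrete Fourier expansion of g on 2^j points. It depends on n only modulo
    2^j, and tends to the n-th Fourier term as j grows. *)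
Definition dterm j n z : C := dmean j (fun w => g w * fexp (- n) w) z * fexp n z.

Lemma dtermS j n z : dterm j.+1 n z =
 (dterm j n z + dterm j n (z + toC (pw j.+1)) * (fexp n (toC (pw j.+1)))^-1) / 2.
Proof. by rewrite /dterm /= fexpD; field; rewrite fexp_neq0. Qed.
Lemma fexp_half j : fexp (2 ^ j)%N%:Z (toC (pw j.+1)) = -1.
Proof.
rewrite /fexp (_ : _ * _ = (0 +i* pi)%C).
 rewrite /cexp /= expR0 cospi sinpi rmorph1 mul1r; apply: cx_eq => //=; by rewrite oppr0.
apply: cx_eq; rewrite ?ReM ?ImM /=; first by ring.
have -> : ((2 ^ j)%N%:Z)%:~R = 2 ^+ j :> R by rewrite -pmulrn natrX.
by rewrite /pw exprS; field; rewrite expf_neq0 ?pnatr_eq0 // gt_eqF.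
Qed.

Lemma dterm_period j n z : dterm j (n + (2 ^ j)%N%:Z) z = dterm j n z.
Proof.
elim: j n z => [|j IH] n z.
 have E k : dterm 0 k z = g z by rewrite /dterm /= fexpN divfK ?fexp_neq0.
 by rewrite !E.
rewrite !dtermS (_ : n + (2 ^ j.+1)%N%:Z = n + (2 ^ j)%N%:Z + (2 ^ j)%N%:Z); last first.
 by rewrite expnS; lia.
by rewrite !IH !fexp_add fexp_half !mulrN1 opprK.
Qed.

Lemma dterm_half j n z : dterm j.+1 n z + dterm j.+1 (n + (2 ^ j)%N%:Z) z = dterm j n z.
Proof.
rewrite !dtermS !dterm_period fexp_add fexp_half mulrN1 invrN; field.
by rewrite fexp_neq0.
Qed.

(** Exact discrete inversion: by [dterm_half] the frequencies n and n + 2^j at level j + 1 merge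
    into n at level j. The window may start anywhere. *)
Lemma dterm_sum j c z : \sum_(i < 2 ^ j) dterm j (c + i%:Z) z = g z.
Proof.
elim: j c => [|j IH] c.
 rewrite big_ord_recl big_ord0 addr0 /dterm /= -mulrA fexpN mulVf ?mulr1 //.
 exact: fexp_neq0.
rewrite expnS mul2n -addnn big_split_ord /= -(IH c) -big_split /=.
apply: eq_bigr => i _; rewrite -(dterm_half j (c + i%:Z)); congr (_ + dterm _ _ _).
by rewrite PoszD; ring.
Qed.

Lemma sin_pi_sqr_ge (t : R) : -1 <= 2 * t <= 1 -> (pi / 4) ^+ 2 * t ^+ 2 <= sin (pi * t) ^+ 2.
Proof.
wlog t0 : t / 0 <= t => [W H|].
 have [/W/(_ H) //|/ltW t0] := leP 0 t.
 have := W (- t); rewrite oppr_ge0 (mulrN pi) sinN (mulrN 2) !sqrrN => /(_ t0); apply.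
 by case/andP: H => H1 H2; apply/andP; split; lra.
move=> /andP[_ t1]; have := @sin_pi_ge R t; rewrite t0 /= (_ : t <= 1) => [/(_ isT)|]; last by lra.
rewrite (min_idPl _); last by lra.
move=> S; have p0 : 0 <= pi / 4 * t by rewrite mulr_ge0 // divr_ge0 // pi_ge0.
by rewrite -exprMn ler_pXn2r // nnegrE // (le_trans p0).
Qed.

Lemma dterm_step (G : C -> C) j n z : (forall w, Im w = Im z -> G (w + toC h) = G w) ->
 dmean j (fun w => (G (w + toC (pw j)) - G w) * fexp (- n) w) z =
 (fexp n (toC (pw j)) - 1) * dmean j (fun w => G w * fexp (- n) w) z.
Proof.
move=> per.
have lin (A B : C -> C) (c : C) i w : dmean i (fun v => A v + c * B v) w = dmean i A w + c * dmean i B w.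
 by elim: i w => //= i IH w; rewrite !IH; field.
have sh (A : C -> C) (p : R) i w : dmean i (fun v => A (v + toC p)) w = dmean i A (w + toC p).
 by elim: i w => //= i IH w; rewrite !IH addrAC.
have per' w : Im w = Im z -> G (w + toC h) * fexp (- n) (w + toC h) = G w * fexp (- n) w.
 by move=> wz; rewrite per // fexpD fexp_h mulr1.
have E : (fun w => (G (w + toC (pw j)) - G w) * fexp (- n) w) =
  (fun w => (fexp n (toC (pw j)) * (G (w + toC (pw j)) * fexp (- n) (w + toC (pw j)))) + (-1) * (G w * fexp (- n) w)).
 ext => w; rewrite fexpD !fexpN; field.
 by rewrite !fexp_neq0.
rewrite E lin.
have -> : dmean j (fun w => fexp n (toC (pw j)) * (G (w + toC (pw j)) * fexp (- n) (w + toC (pw j)))) z =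
  fexp n (toC (pw j)) * dmean j (fun w => G w * fexp (- n) w) z.
 have := lin (fun=> 0) (fun w => G (w + toC (pw j)) * fexp (- n) (w + toC (pw j))) (fexp n (toC (pw j))) j z.
 rewrite (sh (fun w => G w * fexp (- n) w)) (@dmean_shift j (fun w => G w * fexp (- n) w) z per').
 have -> : dmean j (fun=> 0) z = 0 by elim: (j) (z) => //= i IH w; rewrite !IH addr0 mul0r.
 by rewrite add0r => <-; congr dmean; ext => w; rewrite add0r.
by rewrite mulN1r mulrBl mul1r.
Qed.

(** Summation by parts twice: the second difference of g with step p = [pw j] is O(p^2), and by
    [dterm_step] it multiplies the coefficient by ([fexp n p] - 1)^2. The bound does not depend on
    j. *)
Lemma dterm_le j n z B : 0 < Im z -> 0 <= B ->
 (forall w, Im w = Im z -> cabs (g w) <= B /\ cabs (g2 w) <= B) ->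
 - (2 ^ j)%N%:Z <= 2 * n <= (2 ^ j)%N%:Z ->
 cabs (dterm j n z) <= (4 * h ^+ 2 + 4) * B * (1 + `|n%:~R|) ^- 2.
Proof.
move=> z0 B0 hB nj; have [D Bd] := N; have F0 := cabs_fexp n z.
have cF : 0 < cabs (fexp n z) by rewrite cabs_gt0 fexp_neq0.
have cN w : Im w = Im z -> cabs (fexp (- n) w) = (cabs (fexp n z))^-1.
 by move=> wz; rewrite fexpN cabsV !cabs_fexp wz.
have Dz w : Im w = Im z -> [/\ g (w + toC h) = g w, g1 (w + toC h) = g1 w,
    cder g w (g1 w) & cder g1 w (g2 w)] by move=> wz; apply: D; rewrite wz.
have b0 : cabs (dterm j n z) <= B.
 rewrite /dterm cabsM -ler_pdivlMr //; apply: dmean_le => w wz.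
 by rewrite cabsM cN // ler_wpM2r ?invr_ge0 ?(ltW cF) //; have [] := hB w wz.
have [n0|n0] := eqVneq n 0.
 apply: le_trans b0 _; rewrite n0 normr0 addr0 expr1n invr1 mulr1.
 by rewrite ler_peMl //; have := sqr_ge0 h; lra.
set p := pw j; have p0 : 0 < p := pw_gt0 j.
pose G1 w := g (w + toC p) - g w; pose G2 w := G1 (w + toC p) - G1 w.
have perG w : Im w = Im z -> G1 (w + toC h) = G1 w.
 move=> wz; rewrite /G1 addrAC; have [-> _ _ _] := Dz w wz.
 by have [|-> _ _ _] := Dz (w + toC p); rewrite ?ImD /= ?addr0.
have ImT w (t : R) : Im (w + toC t) = Im w by rewrite ImD /= addr0.
have ImT2 w (t u : R) : Im (w + toC t * toC u) = Im w.
 by rewrite ImD ImM /= mulr0 mul0r !addr0.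
have g1L w : Im w = Im z -> cabs (g1 (w + toC p) - g1 w) <= B * p.
 move=> wz; apply: le_trans (_ : B * cabs (toC p) <= _); last by rewrite cabs_toC ger0_norm // ltW.
 apply: (@cmean_value_ineq R g1 g2) => t _; first by have [|] := Dz (w + toC t * toC p); rewrite ?ImT2.
 by have [|] := hB (w + toC t * toC p); rewrite ?ImT2.
have G2L w : Im w = Im z -> cabs (G2 w) <= B * p * p.
 move=> wz; apply: le_trans (_ : B * p * cabs (toC p) <= _); last by rewrite cabs_toC ger0_norm // ltW.
 apply: (@cmean_value_ineq R G1 (fun w => g1 (w + toC p) - g1 w)) => t _; last by apply: g1L; rewrite ImT2.
 set v := w + toC t * toC p; have vz : Im v = Im z by rewrite ImT2.
 apply: gderB; last by have [] := Dz v vz.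
 rewrite -[g1 _]mulr1.
 have Dv : cder g (v + toC p) (g1 (v + toC p)) by have [|] := Dz (v + toC p); rewrite ?ImT.
 apply: (@gder_comp R C id g (fun w => w + toC p) v _ 1 Dv); rewrite -[1]addr0.
 by apply: gderD; [exact: cder_id|exact: gder_cst].
have perg w : Im w = Im z -> g (w + toC h) = g w by move=> wz; have [] := Dz w wz.
have E : dmean j (fun w => G2 w * fexp (- n) w) z = (fexp n (toC p) - 1) ^+ 2 * dmean j (fun w => g w * fexp (- n) w) z.
 apply: (etrans (@dterm_step G1 j n z perG)); rewrite expr2 -mulrA; congr (_ * _).
 exact: (@dterm_step g j n z perg).
have U : cabs (dmean j (fun w => G2 w * fexp (- n) w) z) <= B * p * p / cabs (fexp n z).
 by apply: dmean_le => w wz; rewrite cabsM cN // ler_wpM2r ?invr_ge0 ?(ltW cF) // G2L.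
rewrite E cabsM cabsX ler_pdivlMr // in U.
have {}U : cabs (fexp n (toC p) - 1) ^+ 2 * cabs (dterm j n z) <= B * p * p.
 by rewrite /dterm (cabsM (dmean _ _ _)) mulrA.
have nr : n%:~R != 0 :> R by rewrite intr_eq0.
(* The right side is 4 sin^2 (pi n p / h). The restriction |2 n| <= 2^j keeps |n p / h| at most 1 /
   2, where the sine is bounded below linearly. *)
have S : (n%:~R * p / h) ^+ 2 <= cabs (fexp n (toC p) - 1) ^+ 2.
 rewrite fexp_qx cabsBC one_sub_qx_sqr //= mulr0 oppr0 expR0 subrr expr0n /= add0r mulr1.
 set t := n%:~R * p / h; have := @sin_pi_sqr_ge t; have p2 := pi_ge2 R.
 have -> : 2 * t = (2 * n)%:~R / (2 ^ j)%N%:R.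
  by rewrite /t /p /pw natrX intrM; field; rewrite expf_neq0 ?pnatr_eq0 // gt_eqF.
 have j0 : 0 < (2 ^ j)%N%:R :> R by rewrite ltr0n expn_gt0.
 rewrite ler_pdivrMr // ler_pdivlMr // mul1r mulN1r.
 have -> : (- (2 ^ j)%N%:R : R) = (- (2 ^ j)%N%:Z)%:~R by rewrite mulrNz.
 rewrite -[(2 ^ j)%N%:R]/((2 ^ j)%N%:Z%:~R) !ler_int nj => /(_ isT) H.
 have t2 := sqr_ge0 t; have pp : 2 * 2 <= pi * pi :> R by apply: ler_pM.
 have : 1 <= 4 * (pi / 4) ^+ 2 :> R by rewrite (_ : 4 * (pi / 4) ^+ 2 = pi * pi / 4); [lra|field].
 nra.
have n1 : 1 <= `|n%:~R| :> R by rewrite -intr_norm -[1]/(1%:~R) ler_int; lia.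
have a0 : 0 < (1 + `|n%:~R|) ^+ 2 :> R by rewrite exprn_gt0 //; lra.
rewrite ler_pdivlMr //.
have c0 := cabs_ge0 (dterm j n z); set c := cabs (dterm j n z) in U c0 *.
have p2 : 0 < p * p by rewrite mulr_gt0.
have V : n%:~R ^+ 2 * c <= h ^+ 2 * B.
 have : (n%:~R * p / h) ^+ 2 * c <= B * p * p by apply: le_trans U; rewrite ler_wpM2r.
 rewrite -(ler_pM2l (_ : 0 < h ^+ 2)) ?exprn_gt0 //.
 rewrite [leLHS](_ : _ = n%:~R ^+ 2 * c * (p * p)); last by field; rewrite gt_eqF.
 by rewrite [leRHS](_ : _ = h ^+ 2 * B * (p * p)) ?ler_pM2r //; ring.
have q : (1 + `|n%:~R|) ^+ 2 <= 4 * n%:~R ^+ 2 :> R.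
 by rewrite -[n%:~R ^+ 2]real_normK ?num_real //; nra.
have := ler_wpM2l c0 q; have h2 := sqr_ge0 h; nra.
Qed.

Lemma fset_seq_sum (T : choiceType) (V : nmodType) (s : seq T) (p : T -> V) : uniq s ->
 \sum_(i <- [fset x in s]%fset) p i = \sum_(i <- s) p i.
Proof.
move=> us; apply: perm_big; apply: uniq_perm => // x.
by rewrite in_fset.
Qed.

Lemma summ_int (p : nat -> R) : (forall n, 0 <= p n) -> summ p ->
 summ (fun n : int => p `|n|%N).
Proof.
move=> p0 ps; apply: (proj1 (@summ_ub _ _ (fun n : int => p `|n|%N) (bsum p + bsum p) _ _)) => // B.
have ub (s : seq nat) : uniq s -> \sum_(k <- s) p k <= bsum p.
 by move=> us; rewrite -(fset_seq_sum p us); exact: fsum_le_bsum.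
rewrite (bigID (fun n : int => 0 <= n)) /=; apply: lerD.
 rewrite -big_filter -(big_map (fun n : int => `|n|%N) predT p); apply: ub.
 rewrite map_inj_in_uniq ?filter_uniq ?fset_uniq // => x y.
 by rewrite !mem_filter => /andP[x0 _] /andP[y0 _]; lia.
rewrite -big_filter -(big_map (fun n : int => `|n|%N) predT p); apply: ub.
rewrite map_inj_in_uniq ?filter_uniq ?fset_uniq // => x y.
by rewrite !mem_filter => /andP[x0 _] /andP[y0 _]; lia.
Qed.

Lemma lim_cabs_le (u : nat -> C) l B J0 :
 (forall e, 0 < e -> exists J, forall j, (J <= j)%N -> cabs (u j - l) < e) ->
 (forall j, (J0 <= j)%N -> cabs (u j) <= B) -> cabs l <= B.
Proof.
move=> hu hB; rewrite leNgt; apply/negP => lB; have [|J hJ] := hu (cabs l - B); first by rewrite subr_gt0.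
have j1 := leq_maxl J J0; have j2 := leq_maxr J J0; set j := maxn J J0 in j1 j2.
have := hJ j j1; have := hB j j2; have : cabs l <= cabs (u j) + cabs (u j - l).
 by rewrite {1}(_ : l = u j - (u j - l)) ?cabsB //; ring.
lra.
Qed.

(** Dominated convergence: the discrete expansion at level j is exact, its terms converge to the
    Fourier terms, and in the centered window they are bounded by a summable family independent of
    j. *)
Theorem fourier_theorem : exists a : int -> C, forall z, 0 < Im z ->
 hcs (fun n => a n * fexp n z) (g z).
Proof.
have [a ha] := choice (fun n : int => dmean_cvg (nice_fexp (- n) N)).
have tc n z : 0 < Im z -> forall e, 0 < e -> exists J, forall j, (J <= j)%N ->
  cabs (dterm j n z - a n * fexp n z) < e.
 move=> z0 e e0; have F0 : 0 < cabs (fexp n z) by rewrite cabs_gt0 fexp_neq0.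
 have [J hJ] := ha n z z0 (e / cabs (fexp n z)) (divr_gt0 e0 F0).
 by exists J => j Jj; rewrite /dterm -mulrBl cabsM -ltr_pdivlMr //; exact: hJ.
exists a => z z0.
have [D Bd] := N; have [B B0 hB] := Bd (Im z) (Im z) z0.
have hB' w : Im w = Im z -> cabs (g w) <= B /\ cabs (g2 w) <= B.
 by move=> wz; have [|] := hB w; rewrite ?wz ?lexx.
set K := (4 * h ^+ 2 + 4) * B; have K0 : 0 <= K by rewrite mulr_ge0 // addr_ge0 // mulr_ge0 // sqr_ge0.
pose q (n : int) : R := K * (1 + `|n|%N%:R) ^- 2.
have q0 n : 0 <= q n by rewrite mulr_ge0 // invr_ge0 exprn_ge0 // addr_ge0.
have qs : summ q.
 apply: (@summ_int (fun k => K * (1 + k%:R) ^- 2)).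
  by move=> k; rewrite mulr_ge0 // invr_ge0 exprn_ge0 // addr_ge0.
 apply: summZ => //.
 apply: (proj1 (@summ_nat _ _ (2 / 1) _ _)) => [k|k]; first by rewrite invr_ge0 exprn_ge0 // addr_ge0.
 exact: sum_inv_sqr_le.
have dq j n : - (2 ^ j)%N%:Z <= 2 * n <= (2 ^ j)%N%:Z -> cabs (dterm j n z) <= q n.
 move=> nj; apply: le_trans (dterm_le z0 B0 hB' nj) _.
 by rewrite /q -intr_norm -abszE -pmulrn.
have aq n : cabs (a n * fexp n z) <= q n.
 apply: (lim_cabs_le (J0 := (2 * `|n|)%N) (tc n z z0)) => j nj; apply: dq.
 have : (2 * `|n| <= 2 ^ j)%N by apply: leq_trans nj _; exact: ltnW (ltn_expl j (ltnSn 1)).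
 by move=> H; apply/andP; split; lia.
have [l hl] := hcsP (summ_le aq qs).
suff <- : l = g z by [].
apply/eqP; rewrite -subr_eq0 -cabs_eq0; apply/negPn/negP => ln.
set e := cabs (l - g z) in ln; have e0 : 0 < e by rewrite lt_def ln cabs_ge0.
have e4 : 0 < e / 4 by rewrite divr_gt0.
have [A hA] := hcr_bsum q0 qs e4; have {}hA := hA A (fsubset_refl A).
have tA : bsum q - \sum_(n <- A) q n < e / 4 by apply: le_lt_trans hA; exact: ler_norm.
have [J hJ] : exists J, forall j, (J <= j)%N -> forall n, n \in A ->
  cabs (dterm j n z - a n * fexp n z) < e / 4 / (1 + #|` A|%:R).
 have d0 : 0 < e / 4 / (1 + #|` A|%:R) by rewrite divr_gt0 // addr_gt0 // ltr01.
 have [J hJ] := choice (fun n => tc n z z0 _ d0).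
 exists (\max_(n <- A) J n) => j Jj n nA; apply: hJ; apply: leq_trans Jj.
 exact: (leq_bigmax_seq (F := J)).
pose J2 := (\max_(n <- A) `|n|%N).+1.
(* At level j + 1 the window of the 2^(j + 1) frequencies from -2^j on is centered, as [dterm_le]
   requires; J2 ensures that it contains A. *)
pose j := maxn J J2; pose c := - (2 ^ j)%N%:Z.
pose s := [seq c + i%:Z | i <- iota 0 (2 ^ j.+1)].
have us : uniq s by rewrite map_inj_uniq ?iota_uniq // => x y /addrI [].
have gE : g z = \sum_(n <- [fset x in s]%fset) dterm j.+1 n z.
 rewrite fset_seq_sum // big_map -(dterm_sum j.+1 c z).
 by rewrite -(big_mkord predT (fun i => dterm j.+1 (c + i%:Z) z)) /index_iota subn0.
have AB : (A `<=` [fset x in s])%fset.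
 apply/fsubsetP => n nA; have nJ : (`|n| < J2)%N.
  by rewrite /J2 ltnS; apply: (leq_bigmax_seq (F := fun n : int => `|n|%N)).
 have nj : (`|n| < 2 ^ j)%N := ltn_trans (leq_trans nJ (leq_maxr J J2)) (ltn_expl j (ltnSn 1)).
 rewrite in_fset; apply/mapP; exists `|n - c|%N.
  by rewrite mem_iota add0n expnS; move: nj; rewrite /c; move: (2 ^ j)%N => u; clear; lia.
 by move: nj; rewrite /c; move: (2 ^ j)%N => u; clear; lia.
set Bf := [fset x in s]%fset in gE AB.
have sB n : n \in Bf -> cabs (dterm j.+1 n z) <= q n.
 move=> nB; have ns : n \in s by move: nB; rewrite in_fset.
 case/mapP: ns => i; rewrite mem_iota add0n => /andP[_ ij] ->; apply: dq.
 have e2 : (2 ^ j.+1 = 2 * 2 ^ j)%N by rewrite expnS.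
 by move: ij; rewrite e2 /c; move: (2 ^ j)%N => u; clear; move=> ij; apply/andP; split; lia.
have r1 : cabs (\sum_(n <- (Bf `\` A)%fset) dterm j.+1 n z) <= e / 4.
 apply: le_trans (cabs_sum _ _ _) _; apply: le_trans (_ : \sum_(n <- (Bf `\` A)%fset) q n <= _).
  by rewrite big_seq [leRHS]big_seq; apply: ler_sum => n; rewrite in_fsetD => /andP[_ /sB].
 have := fsum_split q AB; have := fsum_le_bsum q0 qs Bf; lra.
have r2 : cabs (\sum_(n <- A) dterm j.+1 n z - \sum_(n <- A) (a n * fexp n z)) <= e / 4.
 rewrite -sumrB; apply: le_trans (cabs_sum _ _ _) _.
 apply: le_trans (_ : \sum_(n <- A) (e / 4 / (1 + #|` A|%:R)) <= _).
  rewrite big_seq [leRHS]big_seq; apply: ler_sum => n nA; apply: ltW; apply: hJ => //.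
  by apply: leq_trans (leqnSn _); exact: leq_maxl.
 rewrite big_const_seq count_predT iter_addr_0 -[leLHS]mulr_natr mulrAC ler_pdivrMr; last first.
  by apply: ltr_wpDr ltr01; rewrite ler0n.
 by rewrite ler_wpM2l ?(ltW e4) // lerDr.
have r3 : cabs (l - \sum_(n <- A) (a n * fexp n z)) <= e / 4.
 by apply: le_trans (hcs_tail A aq qs hl) _; exact: ltW.
have : e <= e / 4 + e / 4 + e / 4.
 rewrite {1}/e gE (fsum_split (fun n => dterm j.+1 n z) AB).
 set S1 := \sum_(n <- A) dterm _ _ _ in r2 *; set S2 := \sum_(n <- (Bf `\` A)%fset) _ in r1 *.
 set S3 := \sum_(n <- A) _ in r2 r3.
 rewrite (_ : l - (S1 + S2) = (l - S3) - (S1 - S3) - S2); last by ring.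
 by apply: le_trans (cabsB _ _) (lerD _ r1); apply: le_trans (cabsB _ _) (lerD r3 r2).
lra.
Qed.
End Expansion.
End FourierTheorem.

(** * Bounds for the coefficients of an expansion *)

Section FourierCoefficients.
Context {R : realType}.
Local Notation C := (Cx R).
Variable h : R.
Hypothesis h0 : 0 < h.

Lemma dmeanD j (u v : C -> C) (c z : C) :
 dmean h j (fun w => u w + c * v w) z = dmean h j u z + c * dmean h j v z.
Proof. by elim: j z => [//|j IH] z /=; rewrite !IH; field. Qed.
Lemma dmean_sum I (A : {fset I}) j (a : I -> C) (u : I -> C -> C) z :
 dmean h j (fun w => \sum_(i <- A) a i * u i w) z = \sum_(i <- A) a i * dmean h j (u i) z.
Proof.
elim: j z => [//|j IH] z /=; rewrite !IH -big_split /= mulr_suml; apply: eq_bigr => i _.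
by field.
Qed.

Lemma dmean_fexp j l : exists c : C, forall z, dmean h j (fexp h l) z = c * fexp h l z.
Proof.
elim: j => [|j [c hc]]; first by exists 1 => z; rewrite mul1r.
exists (c * (1 + fexp h l (toC (pw h j.+1))) / 2) => z /=.
by rewrite !hc fexpD; field.
Qed.

Lemma dmean_fexp1 j z : dmean h j (fexp h 0) z = 1.
Proof. by elim: j z => [|j IH] z /=; rewrite ?fexp0 // !IH; field. Qed.
Lemma odd_part (l : int) : l != 0 -> exists i (r : int), l = (2 ^ i)%N%:Z * (2 * r + 1).
Proof.
move=> l0; have la : (0 < `|l|)%N by rewrite absz_gt0.
have [k ck e] := pfactor_coprime (isT : prime 2) la.
have ok : odd k by rewrite -coprime2n.
have [q e2] : exists q, k = (2 * q + 1)%N.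
 by exists k./2; rewrite -[LHS]odd_double_half ok addnC mul2n.
move: e; move: (logn 2 `|l|) => i e; exists i.
have [lp|ln] := ltP 0 l.
 by exists q%:Z; rewrite -(gtz0_abs lp) e e2 !PoszM PoszD PoszM; ring.
exists (- q%:Z - 1); have -> : l = - `|l|%N%:Z by clear -ln; lia.
by rewrite e e2 !PoszM PoszD PoszM; ring.
Qed.

(** If 2^i is the exact power of 2 in l, halving the step for the (i + 1)-st time pairs points where
    [fexp] has opposite values. Each nonzero frequency is thus annihilated exactly, not only in the
    limit. *)
Lemma dmean_fexp0 (l : int) : l != 0 -> exists J, forall j z, (J <= j)%N -> dmean h j (fexp h l) z = 0.
Proof.
move=> /odd_part[i [r e]]; exists i.+1 => j z; have [c hc] := dmean_fexp i l.
have pm : fexp h l (toC (pw h i.+1)) = -1.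
 have -> : l = (2 ^ i.+1)%N%:Z * r + (2 ^ i)%N%:Z by rewrite e expnS; move: (2 ^ i)%N => u; clear; lia.
 rewrite fexp_add fexp_half // -[RHS]mul1r; congr (_ * _).
 rewrite -(fexp_h h0 r) /fexp; congr cexp.
 have e3 : ((2 ^ i.+1)%N%:Z * r)%:~R = 2 ^+ i.+1 * r%:~R :> R by rewrite intrM -pmulrn natrX.
 by apply: cx_eq; rewrite ?ReM ?ImM /= e3 /pw; field; rewrite ?gt_eqF ?expf_neq0 ?pnatr_eq0 //.
elim: j z => [//|j IH] z; rewrite leq_eqVlt => /orP[/eqP[<-]|ij].
 by rewrite /= !hc fexpD pm mulrN1 mulrN subrr mul0r.
by rewrite /= !IH // addr0 mul0r.
Qed.

(** After multiplication by [fexp (- k)] a fine enough average retains only the k-th term among a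
    finite set of frequencies carrying all but e of the absolute sum. With B = 0 this gives
    uniqueness of the coefficients. *)
Lemma fourier_coef_le (a : int -> C) (g : C -> C) k (z : C) B : 0 < Im z ->
 (forall z : C, 0 < Im z -> hcs (fun n => a n * fexp h n z) (g z)) ->
 (forall w : C, Im w = Im z -> cabs (g w) <= B) -> cabs (a k * fexp h k z) <= B.
Proof.
move=> z0 hg gB; apply/ler_addgt0Pr => e e0.
pose p n := cabs (a n * fexp h n z).
have p0 n : 0 <= p n by exact: cabs_ge0.
have ps : summ p := hcs_summable (hg z z0).
have [A0 hA0] := hcr_bsum p0 ps e0; pose A := (k |` A0)%fset.
have tail : bsum p - \sum_(n <- A) p n <= e.
 by have := hA0 A (fsubsetU1 _ _); rewrite ltr_norml => /andP[_ /ltW].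
have ap (w : C) n : Im w = Im z -> cabs (a n * fexp h n w) <= p n.
 by move=> wz; rewrite /p !(cabsM (a n)) !cabs_fexp wz.
have /choice[Jf hJf] : forall l, exists J, l != 0 -> forall j w, (J <= j)%N -> dmean h j (fexp h l) w = 0.
 move=> l; case: (eqVneq l 0) => [->|/dmean_fexp0[J hJ]]; first by exists 0%N.
 by exists J.
pose J := (\max_(n <- A) Jf (n - k)%R)%N.
pose E := cabs (fexp h (- k) z).
have E0 : 0 < E by rewrite cabs_gt0 fexp_neq0.
have Ew (w : C) : Im w = Im z -> cabs (fexp h (- k) w) = E.
 by move=> wz; rewrite /E !cabs_fexp wz.
pose rm w := (g w - \sum_(n <- A) a n * fexp h n w) * fexp h (- k) w.
have rm_le (w : C) : Im w = Im z -> cabs (rm w) <= e * E.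
 move=> wz; rewrite /rm cabsM Ew // ler_wpM2r ?(ltW E0) //; apply: le_trans tail.
 by apply: (hcs_tail A (fun n => ap w n wz) ps); apply: hg; rewrite wz.
have SE : dmean h J (fun w => g w * fexp h (- k) w) z = a k + dmean h J rm z.
 have -> : (fun w => g w * fexp h (- k) w) = (fun w => rm w + 1 * \sum_(n <- A) a n * fexp h (n - k) w).
  ext => w; rewrite /rm mulrBl mul1r; under [X in _ + X]eq_bigr => n _ do rewrite fexp_add mulrA.
  by rewrite -mulr_suml subrK.
 rewrite dmeanD mul1r dmean_sum addrC; congr (_ + _).
 have kA : k \in A by rewrite in_fset1U eqxx.
 rewrite (big_fsetD1 k kA) /= subrr dmean_fexp1 mulr1 big_seq big1 ?addr0 // => n.
 rewrite in_fsetD1 => /andP[nk nA]; rewrite hJf ?mulr0 ?subr_eq0 //.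
 exact: (leq_bigmax_seq (F := fun n : int => Jf (n - k))).
have S1 : cabs (dmean h J (fun w => g w * fexp h (- k) w) z) <= B * E.
 apply: dmean_le => w wz; rewrite cabsM Ew // ler_wpM2r ?(ltW E0) //; exact: gB.
have S2 : cabs (dmean h J rm z) <= e * E by apply: dmean_le.
have ak : cabs (a k) <= (B + e) * E.
 have -> : a k = dmean h J (fun w => g w * fexp h (- k) w) z - dmean h J rm z by rewrite SE addrK.
 by apply: le_trans (cabsB _ _) _; rewrite mulrDl; exact: lerD.
rewrite cabsM; have -> : cabs (fexp h k z) = E^-1 by rewrite -cabsV -fexpN opprK.
by rewrite ler_pdivrMr.
Qed.
End FourierCoefficients.

(** * Differentiation of a sum of slashed copies of [Fser] *)

Section PoincareSeries.
Context {R : realType}.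
Local Notation C := (Cx R).
Variables (m h : R) (M : nat) (s : C).
Hypotheses (mM : 2 * m = M%:R) (M0 : (0 < M)%N) (h0 : 0 < h).
Implicit Types (z w : uhp R) (g : metap R).
Local Notation ht z := (Im (uval z)).
Local Notation a := (m / 2).

Definition Fk k (z : C) : C := (0 +i* qc h)%C ^+ k * Dser h 0 (s - 1 + k%:R) z.

Lemma cder_Fk k (z : C) : 0 < Im z -> cder (Fk k) z (Fk k.+1 z).
Proof.
move=> z0; have := gderZ ((0 +i* qc h)%C ^+ k) (cder_Dser_z h0 0 (s - 1 + k%:R) z0).
by rewrite /Fk exprSr -natr1 addrA mulrA.
Qed.

Lemma Fk0 z : Fser h s z = Fk 0 (uval z).
Proof. by rewrite Fser_Dser // /Fk expr0 mul1r addr0. Qed.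

(* The [k]-th derivative of [F], slashed: [k] counts the derivatives of [F],
  [l] those of the automorphy factor; the family is closed under d/dz. *)
Definition EV g k l (z : C) : C :=
 toC (mat g 1 0) ^+ l * (Fk k (mob (mat g) z) *
  ((uext (eta g) z ^+ M)^-1 * (mob_den (mat g) z)^-1 ^+ (2 * k + l))).

Lemma cder_den (g : 'M[R]_2) (z : C) : cder (mob_den g) z (toC (g 1 0)).
Proof.
have := gderD (gderZ (toC (g 1 0)) (cder_id z)) (gder_cst id (toC (g 1 1)) z).
by rewrite mulr1 addr0.
Qed.

Lemma cder_num (g : 'M[R]_2) (z : C) : cder (mob_num g) z (toC (g 0 0)).
Proof.
have := gderD (gderZ (toC (g 0 0)) (cder_id z)) (gder_cst id (toC (g 0 1)) z).
by rewrite mulr1 addr0.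
Qed.

Lemma cder_mob g z : cder (mob (mat g)) (uval z) ((mob_den (mat g) (uval z))^-1 ^+ 2).
Proof.
have d0 := mob_den_uneq0 g z.
have := gderM (cder_num (mat g) (uval z)) (gder_comp (cder_inv d0) (cder_den (mat g) (uval z))).
congr gder; have D := mat_det g; rewrite det22 in D.
have D' : toC (mat g 0 0) * toC (mat g 1 1) - toC (mat g 0 1) * toC (mat g 1 0) = 1.
 by rewrite -!rmorphM -rmorphB D rmorph1.
set d := mob_den _ _ in d0 *; rewrite exprVn -[RHS]mul1r -{1}D'.
rewrite /mob_num; transitivity ((toC (mat g 0 0) * d - (toC (mat g 0 0) * uval z + toC (mat g 0 1)) * toC (mat g 1 0)) / d ^+ 2).
 by field.
by congr (_ / _); rewrite /d /mob_den; ring.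
Qed.

Lemma cder_denVX (g : metap R) z n : cder (fun v : C => (mob_den (mat g) v)^-1 ^+ n) (uval z)
 (- (n%:R * toC (mat g 1 0) * (mob_den (mat g) (uval z))^-1 ^+ n.+1)).
Proof.
have d0 := mob_den_uneq0 g z.
have := gder_comp (cderX n _) (gder_comp (cder_inv d0) (cder_den (mat g) (uval z))).
congr gder; case: n => [|n]; first by rewrite !mul0r oppr0.
by rewrite /= -exprVn !exprS; ring.
Qed.

Lemma cder_etaV g z : cder (fun v : C => (uext (eta g) v ^+ M)^-1) (uval z)
 (- (toC m * toC (mat g 1 0) * ((eta g z ^+ M)^-1 * (mob_den (mat g) (uval z))^-1))).
Proof.
have e0 := eta_neq0 g z; have eM : eta g z ^+ M != 0 by rewrite expf_neq0.
have D := gder_comp (cderX M _) (eta_cder g z); rewrite uextE in D.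
have H : cder (fun v : C => v^-1) (uext (eta g) (uval z) ^+ M) (- ((eta g z ^+ M) ^+ 2)^-1).
 by rewrite uextE; exact: cder_inv.
have := @gder_comp R C id (fun v : C => v^-1) (fun v : C => uext (eta g) v ^+ M) (uval z) _ _ H D.
congr gder; rewrite -eta_sqr.
have -> : toC m = M%:R / 2.
 by rewrite -[M%:R](rmorph_nat (@toC R)) -mM rmorphM rmorph_nat mulrC mulKf // pnatr_eq0.
case: (M) M0 => // n _; rewrite /= (exprS _ n); move: e0; set x := eta g z => e0.
have X0 : x ^+ n != 0 by rewrite expf_neq0.
move: X0; set X := x ^+ n => X0; move: (n.+1%:R) (toC _) => u v; clear - e0 X0.
by field; rewrite e0 X0.
Qed.

Lemma cder_EV g k l z : cder (EV g k l) (uval z)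
 (EV g k.+1 l (uval z) - (toC m + (2 * k + l)%:R) * EV g k l.+1 (uval z)).
Proof.
have w0 : 0 < Im (mob (mat g) (uval z)) by exact: (uval_gt0 (act g z)).
have D1 := gder_comp (cder_Fk k w0) (cder_mob g z).
have := gderZ (toC (mat g 1 0) ^+ l) (gderM D1 (gderM (cder_etaV g z) (cder_denVX g z (2 * k + l)))).
congr gder; rewrite /EV !uextE (_ : (2 * k.+1 + l)%N = (2 + (2 * k + l))%N); last by rewrite mulnS addnA.
rewrite (_ : (2 * k + l.+1)%N = (2 * k + l).+1) ?addnS //; set n := (2 * k + l)%N.
rewrite (exprD _ 2 n) !(exprS _ n) (exprS (toC _) l); ring.
Qed.

Lemma cabs_den g z : cabs (mob_den (mat g) (uval z))^-1 ^+ 2 = ht (act g z) / ht z.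
Proof.
rewrite /= Im_mob ?mat_det // cabsV exprVn.
by rewrite mulrAC divff ?mul1r // gt_eqF.
Qed.

Lemma cden_le g z : cabs (toC (mat g 1 0) * (mob_den (mat g) (uval z))^-1) <= (ht z)^-1.
Proof.
have d0 : 0 < cabs (mob_den (mat g) (uval z)) by rewrite cabs_gt0 mob_den_uneq0.
rewrite cabsf cabs_toC ler_pdivrMr // mulrC ler_pdivlMr //.
apply: le_trans (Im_le_cabs _); rewrite /mob_den ImD ImM /= mul0r addr0 addr0 normrM.
by rewrite (gtr0_norm (uval_gt0 z)).
Qed.

Variables (tau d : R).
Hypotheses (d0 : 0 < d) (sd : Re s + d <= tau) (t1 : 1 <= tau).

(** The k derivatives of F are paid by powers of Im (g z) in [Dser_Phi], which the factors |c z +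
    d|^-2 = Im (g z) / Im z convert into powers of Im z; each derivative of the automorphy factor
    costs |c / (c z + d)| <= 1 / Im z. *)
Lemma EV_bound k l : exists2 K : R, 0 <= K & forall g z,
 cabs (EV g k l (uval z)) <= K * (ht z `^ a * ht z ^+ (k + l))^-1 * Phi h a tau (uval (act g z)).
Proof.
have m2 : 0 < 2 * m by rewrite mM ltr0n.
have a0 : 0 < a by rewrite divr_gt0 //; lra.
have [K K0 hK] := Dser_Phi h0 0 k (cabs_ge0 (s - 1)) d0 a0 t1.
exists (qc h ^+ k * K); first by rewrite mulr_ge0 // exprn_ge0 // ltW // qc_gt0.
move=> g z; have y0 := uval_gt0 z; have w0 := uval_gt0 (act g z).
set y := ht z in y0 *; set w := ht (act g z) in w0.
have le1 : Re (s - 1) + d <= tau - 1.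
  have re1 : Re (1 : C) = 1 by [].
  by rewrite ReD ReN re1 addrAC lerD2r.
have := hK (s - 1) (uval (act g z)) (lexx _) le1 w0.
rewrite -/w; set P := Phi _ _ _ _; set D := cabs (Dser _ _ _ _) => B.
have P0 : 0 <= P by exact: Phi_ge0.
have E := cabs_eta_pow mM g z; rewrite (eta_powE mM) -/y -/w in E.
have ya : 0 < y `^ a by rewrite powR_gt0.
have yk : 0 < y ^+ (k + l) by rewrite exprn_gt0.
rewrite /EV uextE cabsM (cabsM (Fk _ _)) (cabsM ((eta g z ^+ M)^-1)).
set e := cabs (eta g z ^+ M)^-1 in E *.
have FE : cabs (Fk k (mob (mat g) (uval z))) = qc h ^+ k * D.
 rewrite /Fk cabsM cabsX; congr (_ ^+ k * _).
 by rewrite cabsE /= expr0n add0r sqrtr_sqr gtr0_norm // qc_gt0.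
have uE : cabs ((mob_den (mat g) (uval z))^-1 ^+ (2 * k + l)) * cabs (toC (mat g 1 0) ^+ l) <= (w / y) ^+ k * (y^-1) ^+ l.
 rewrite !cabsX exprD exprM cabs_den -/w -/y -mulrA -exprMn mulrC [X in _ <= X]mulrC.
 apply: ler_wpM2r; first by rewrite exprn_ge0 // divr_ge0 // ltW.
 apply: lerXn2r; rewrite ?nnegrE ?mulr_ge0 ?invr_ge0 ?(ltW y0) //.
 by rewrite -cabsM mulrC; exact: cden_le.
rewrite FE [leLHS](_ : _ = qc h ^+ k * (D * e * (cabs ((mob_den (mat g) (uval z))^-1 ^+ (2 * k + l)) * cabs (toC (mat g 1 0) ^+ l)))); last by ring.
rewrite [leRHS](_ : _ = qc h ^+ k * (K * P * (y `^ a * y ^+ (k + l))^-1)); last by ring.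
rewrite ler_wpM2l ?exprn_ge0 ?(ltW (qc_gt0 h0)) //.
have e0 : 0 <= e by exact: cabs_ge0. have D0 : 0 <= D by exact: cabs_ge0.
apply: le_trans (ler_wpM2l (mulr_ge0 D0 e0) uE) _.
rewrite ler_pdivlMr ?mulr_gt0 //; apply: le_trans B.
rewrite -E le_eqVlt; apply/orP; left; apply/eqP.
rewrite exprD expr_div_n exprVn; field.
by rewrite !expf_neq0 // gt_eqF.
Qed.

Section Family.
Variables (I : choiceType) (D : set I) (rho : I -> metap R) (kap : I -> C).
Hypothesis kap1 : forall i, D i -> cabs (kap i) = 1.

Definition PhiSum z : \bar R := \esum_(i in D) (Phi h a tau (uval (act (rho i) z)))%:E.
Hypothesis fin : forall z, (PhiSum z < +oo)%E.

Definition EW k l (z : C) : C := csum D (fun i => kap i * EV (rho i) k l z).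

Let ph z (i : I) : R := if `[< D i >] then Phi h a tau (uval (act (rho i) z)) else 0.

Let ph0 z i : 0 <= ph z i. Proof. by rewrite /ph; case: ifP => // _; exact: Phi_ge0. Qed.

Let phE z : (\esum_(i in setT) (ph z i)%:E = PhiSum z)%E.
Proof.
rewrite /PhiSum [RHS]esum_mkcond; apply: eq_esum => i _; rewrite /ph /patch.
by case: asboolP => Di; [rewrite mem_set|rewrite memNset].
Qed.

Let phs z : summ (ph z). Proof. by rewrite /summ phE; exact: fin. Qed.

Let phb z : (bsum (ph z))%:E = PhiSum z. Proof. by rewrite -bsumE // phE. Qed.

Let term_le k l K : (forall g z, cabs (EV g k l (uval z)) <= K * (ht z `^ a * ht z ^+ (k + l))^-1 * Phi h a tau (uval (act g z))) ->
 forall z i, cabs (((fun i => kap i * EV (rho i) k l (uval z)) \_ D) i) <= K * (ht z `^ a * ht z ^+ (k + l))^-1 * ph z i.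
Proof.
move=> hK z i; rewrite /patch /ph; case: asboolP => Di.
 by rewrite mem_set // cabsM kap1 // mul1r; exact: hK.
by rewrite memNset // cabs0 mulr0.
Qed.

Lemma EW_summable k l z : abs_summable D (fun i => kap i * EV (rho i) k l (uval z)).
Proof.
have [K K0 hK] := EV_bound k l; apply/abs_summableE.
apply: (summ_le (term_le hK z)); apply: summZ; [|exact: ph0|exact: phs].
by rewrite mulr_ge0 // invr_ge0 mulr_ge0 // exprn_ge0 // ltW.
Qed.

Lemma EW_hcs k l z : hcs ((fun i => kap i * EV (rho i) k l (uval z)) \_ D) (EW k l (uval z)).
Proof. exact/hcs_csum/EW_summable. Qed.
Lemma EW_bound k l : exists2 K : R, 0 <= K & forall z (B : R), (PhiSum z <= B%:E)%E ->
 cabs (EW k l (uval z)) <= K * (ht z `^ a * ht z ^+ (k + l))^-1 * B.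
Proof.
have [K K0 hK] := EV_bound k l; exists K => // z B; rewrite -phb lee_fin => hB.
set c := K * _; have c0 : 0 <= c by rewrite mulr_ge0 // invr_ge0 mulr_ge0 // exprn_ge0 // ltW.
have ps := summZ c0 (ph0 z) (phs z).
apply: le_trans (cabs_hcs (term_le hK z) ps (EW_hcs k l z)) _.
have cB (A : {fset I}) : \sum_(i <- A) (c * ph z i) <= c * bsum (ph z).
 by rewrite -mulr_sumr ler_wpM2l // fsum_le_bsum.
have [_] := summ_ub (fun i => mulr_ge0 c0 (ph0 z i)) cB.
by move=> H; apply: le_trans H _; rewrite ler_wpM2l.
Qed.

Lemma cder_EW k l z : cder (EW k l) (uval z)
 (EW k.+1 l (uval z) - (toC m + (2 * k + l)%:R) * EW k l.+1 (uval z)).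
Proof.
set c := toC m + _; have y0 := uval_gt0 z; set y := ht z in y0.
have [K1 K10 hK1] := EV_bound k.+1 l; have [K2 K20 hK2] := EV_bound k l.+1.
pose H := 2 `^ a * 2 `^ tau; have H0 : 0 <= H by rewrite mulr_ge0 // powR_ge0.
pose q n := ((y / 2) `^ a * (y / 2) ^+ n)^-1.
have q0 n : 0 <= q n by rewrite invr_ge0 mulr_ge0 // exprn_ge0 // divr_ge0 // ltW.
pose B := (K1 * q (k.+1 + l)%N + cabs c * (K2 * q (k + l.+1)%N)) * H.
have B0 : 0 <= B by rewrite mulr_ge0 // addr_ge0 // !mulr_ge0 // cabs_ge0.
(* The disc of radius y / 10 lies inside [hball z], where Harnack bounds each [Phi] by a constant
   times its value at z; these values form the summable majorant. *)
have r0 : 0 < y / 10 by rewrite divr_gt0.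
have m2 : 0 <= 2 * m by rewrite mM.
have a0 : 0 <= a by rewrite divr_ge0 //; lra.
have near v : cabs (v - uval z) < y / 10 -> exists2 w : uhp R, v = uval w &
  y / 2 <= ht w /\ hball z w.
 move=> vz; have vy : ht z - y / 10 < Im v.
  have := le_lt_trans (Im_le_cabs _) vz; rewrite ImD ImN -/y => /ltr_normlP[]; lra.
 have v0 : 0 < Im v by rewrite -/y in vy; lra.
 rewrite -/y in vy; exists (UHP v0) => //=; split; first lra.
 rewrite /hball /= -/y cabsBC.
 have : cabs (v - uval z) ^+ 2 < (y / 10) ^+ 2 by rewrite ltr_pXn2r // nnegrE // ltW.
 by nra.
have tD (w : uhp R) i : cder (fun v => ((fun i => kap i * EV (rho i) k l v) \_ D) i) (uval w)
  (((fun i => kap i * EV (rho i) k.+1 l (uval w) - c * (kap i * EV (rho i) k l.+1 (uval w))) \_ D) i).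
 rewrite /patch; case: ifP => _; last exact: gder_cst.
 by have := gderZ (kap i) (cder_EV (rho i) k l w); congr gder; rewrite mulrBr; congr (_ - _); exact: mulrCA.
apply: (@hcs_gder R I (fun i v => ((fun i => kap i * EV (rho i) k l v) \_ D) i)
 (fun i v => ((fun i => kap i * EV (rho i) k.+1 l v - c * (kap i * EV (rho i) k l.+1 v)) \_ D) i)
 (EW k l) _ (uval z) (fun i => B * ph z i) (y / 10) r0).
- by move=> i v /near[w -> _]; exact: tD.
- move=> i v /near[w -> [wy zw]].
 have pH : ph w i <= H * ph z i.
  rewrite /ph; case: ifP => _; last by rewrite mulr0.
  apply: (Phi_harnack h0 a0 (le_trans ler01 t1) (uval_gt0 (act (rho i) z))).
  by rewrite cabsBC; exact/hball_close/hball_act/hball_sym.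
 have ql n : (ht w `^ a * ht w ^+ n)^-1 <= q n.
  have y2 : 0 < y / 2 by rewrite divr_gt0.
  rewrite lef_pV2 ?posrE ?mulr_gt0 ?powR_gt0 ?exprn_gt0 //.
  apply: ler_pM; rewrite ?exprn_ge0 ?(ltW y2) //.
   by apply: ge0_ler_powR => //; rewrite nnegrE ltW ?uval_gt0.
  by apply: lerXn2r; rewrite // nnegrE ltW ?uval_gt0.
 have e1 := term_le hK1 w i; have e2 := term_le hK2 w i.
 apply: le_trans (_ : K1 * q (k.+1 + l)%N * ph w i + cabs c * (K2 * q (k + l.+1)%N * ph w i) <= _).
  have f1 : K1 * (ht w `^ a * ht w ^+ (k.+1 + l))^-1 * ph w i <= K1 * q (k.+1 + l)%N * ph w i.
   by rewrite ler_wpM2r // ler_wpM2l.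
  have f2 : K2 * (ht w `^ a * ht w ^+ (k + l.+1))^-1 * ph w i <= K2 * q (k + l.+1)%N * ph w i.
   by rewrite ler_wpM2r // ler_wpM2l.
  have {}e1 := le_trans e1 f1; have {}e2 := le_trans e2 f2.
  move: e1 e2; rewrite /patch; case: ifP => _ e1 e2.
   apply: le_trans (cabsB _ _) (lerD e1 _).
   by rewrite (cabsM c) ler_wpM2l.
  by rewrite cabs0 in e1 e2 *; rewrite addr_ge0 // mulr_ge0 // cabs_ge0.
 rewrite [leLHS](_ : _ = (K1 * q (k.+1 + l)%N + cabs c * (K2 * q (k + l.+1)%N)) * ph w i); last by ring.
 rewrite /B -mulrA; apply: ler_wpM2l pH.
 by rewrite addr_ge0 // !mulr_ge0 // cabs_ge0.
- by apply: summZ; [|exact: ph0|exact: phs].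
- by move=> v /near[w -> _]; exact: EW_hcs.
- have := hcs_lin (- c) (EW_hcs k.+1 l z) (EW_hcs k l.+1 z); rewrite mulNr.
 congr hcs; ext => i; rewrite /patch; case: ifP => _; last by rewrite mulr0 addr0.
 by rewrite mulNr.
Qed.
End Family.
End PoincareSeries.

(** * The series [Psi] is a cusp form *)

Section CosetSeries.
Context {R : realType}.
Local Notation C := (Cx R).
Implicit Types (z w : uhp R) (g t : metap R).
Local Notation ht z := (Im (uval z)).
Variables (G : set (metap R)) (chi : metap R -> C) (m h : R) (M : nat).
Hypotheses (mM : 2 * m = M%:R) (m2 : 2 < m) (sG : is_subgroup G) (dG : discrete_set G).
Hypotheses (cG : finite_covolume G) (chG : is_character G chi) (oG : finite_order G chi).
Hypothesis stab_chi : stab_char G chi m.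
Hypotheses (h0 : 0 < h) (HS : cusp_width G h).
Local Notation a := (m / 2).
Local Notation D := (stab_cosets G).

Lemma weight_gt0 : (0 < M)%N.
Proof. by rewrite -(ltr0n R) -mM; move: m2; lra. Qed.
Lemma chi_mul s t : G s -> G t -> chi (s * t)%g = chi s * chi t.
Proof. exact: chG.2. Qed.
Lemma chi_conjM g : G g -> (chi g)^* * chi g = 1.
Proof. by move=> Gg; rewrite mulrC -normCK -toC_cabs (chi_unitary oG Gg) rmorph1 expr1n. Qed.
Lemma Fser_shift (s : C) z w (k : int) : uval w = uval z + toC (k%:~R * h) ->
 Fser h s w = Fser h s z.
Proof.
move=> e; rewrite (Fser_Dser h0 s w) (Fser_Dser h0 s z).
have q : qx h (uval w) = qx h (uval z) by rewrite e; exact: qx_period.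
by rewrite /Dser q.
Qed.

Lemma Fser_slash (s : C) t z : stab_oo G t -> slash m (Fser h s) t z = chi t * Fser h s z.
Proof.
move=> st; have [k hk] := stab_shift HS st.
by rewrite /slash stab_chi // mulrC (Fser_shift s (hk z)).
Qed.

(** Slashing F by t in the stabilizer multiplies it by chi t, which the conjugate of the unitary
    number chi t cancels. *)
Lemma Psi_term_stab (s : C) z t g : stab_oo G t -> G g ->
 Psi_term m chi h s z (t * g)%g = Psi_term m chi h s z g.
Proof.
move=> st Gg; have Gt : G t by case: st.
rewrite /Psi_term (slash_mul mM).
have -> : slash m (Fser h s) t = (fun w => chi t * Fser h s w).
 by ext => w; exact: Fser_slash.
rewrite chi_mul // rmorphM /slash -[RHS]mul1r -(chi_conjM Gt) -!mulrA; congr (_ * _).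
by rewrite !mulrA; congr (_ * _); rewrite -!mulrA mulrCA.
Qed.

(** Right translation permutes the cosets, which gives the transformation law of [Psi] under G. *)
Definition tr_coset g (c : set (metap R)) : set (metap R) := [set (x * g)%g | x in c].

Lemma tr_cosetK g : cancel (tr_coset g) (tr_coset g^-1%g).
Proof.
move=> c; rewrite /tr_coset image_comp -[RHS]image_id; congr (_ @` _).
by ext => x /=; rewrite mulgK.
Qed.

Lemma tr_cosetVK g : cancel (tr_coset g^-1%g) (tr_coset g).
Proof. by move=> c; have := tr_cosetK g^-1%g c; rewrite invgK. Qed.
Lemma tr_coset_right g u : tr_coset g (right_coset (stab_oo G) u) = right_coset (stab_oo G) (u * g)%g.
Proof.
rewrite /tr_coset /right_coset image_comp; congr (_ @` _).
by ext => x /=; rewrite mulgA.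
Qed.

Lemma tr_coset_stab g c : G g -> D c -> D (tr_coset g c).
Proof.
move=> Gg Dc; have [Gc ->] := repP sG Dc; rewrite tr_coset_right.
by exists (rep c * g)%g => //; case: sG => _ GM _; exact: GM.
Qed.

Lemma tr_coset_rep (s : C) z g c : G g -> D c ->
 Psi_term m chi h s z (rep (tr_coset g c)) = Psi_term m chi h s z (rep c * g)%g.
Proof.
move=> Gg Dc; have [Gc ec] := repP sG Dc; have Gcg : G (rep c * g)%g by case: sG => _ GM _; exact: GM.
have [_ e] := repP sG (tr_coset_stab Gg Dc).
have : tr_coset g c (rep (tr_coset g c)).
 by rewrite [X in X _]e; exists 1%g; rewrite ?mul1g //; case: (stab_subgroup sG).
by rewrite {1}ec tr_coset_right => -[t st <-]; exact: Psi_term_stab.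
Qed.

Lemma periodic_cder (f : C -> C) (b : R) (z l l' : C) :
 (forall z : C, 0 < Im z -> f (z + toC b) = f z) -> 0 < Im z ->
 cder f z l -> cder f (z + toC b) l' -> l = l'.
Proof.
move=> per z0 D1 D2; apply: cder_unique D1 _ => eps e0; have [d d0 hd] := D2 eps e0.
exists (Num.min d (Im z)); first by rewrite lt_min d0.
move=> k; rewrite lt_min => /andP[kd kz]; have := hd k kd.
have zk : 0 < Im (z + k).
 by have := le_lt_trans (Im_le_cabs k) kz; rewrite ltr_norml ImD => /andP[k1 _]; lra.
by rewrite (addrAC z) !per.
Qed.

Lemma nx_mul (x y : R) : (nx x * nx y)%g = nx (x + y).
Proof.
apply: metap_ext => [|z]; last by rewrite /= mulr1.
by apply: mx22P; rewrite mat_mul mulmx22 /= !mx22E; ring.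
Qed.

Lemma nxX (x : R) n : (nx x ^+ n)%g = nx (x *+ n).
Proof.
elim: n => [|n IH]; last by rewrite expgS IH nx_mul mulrS.
rewrite expg0 mulr0n; apply: metap_ext => [|z] //=.
by apply: mx22P; rewrite !mx1E !mx22E.
Qed.

Lemma nxV (x : R) : (nx x)^-1%g = nx (- x).
Proof.
have e : (nx x * nx (- x))%g = 1%g.
 by rewrite nx_mul subrr -(mulr0n x) -nxX expg0.
by rewrite -[LHS]mulg1 -e mulKg.
Qed.

(** For such t the factor eta is a constant with square 1 or -1, so squaring removes the sign of the
    matrix and a second squaring removes the sheet. *)
Lemma parabolic_fourth t : mat t 1 0 = 0 -> mat t 0 0 = mat t 1 1 -> mat t 0 0 ^+ 2 = 1 ->
 (t ^+ 4)%g = nx (4 * (mat t 0 0 * mat t 0 1)).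
Proof.
move=> c0 ad e2.
have E4 : (t ^+ 4 = (t * t) * (t * t))%g by rewrite !expgS expg0 mulg1 !mulgA.
have sq z : eta (t * t)%g z = toC (mat t 0 0).
 rewrite -[LHS]/(eta t (act t z) * eta t z) (eta_const (act t z) z c0) -expr2 eta_sqr.
 by rewrite /mob_den c0 rmorph0 mul0r add0r ad.
rewrite E4; apply: metap_ext => [|z].
 have mm : forall i j, mat (t * t)%g i j = mat t i 0 * mat t 0 j + mat t i 1 * mat t 1 j.
  by move=> i j; rewrite mat_mul mulmx22.
 apply: mx22P; rewrite mat_mul mulmx22 !mm c0 -ad !mx22E; move: e2.
 - by move: (mat t 0 0) => e e2; transitivity ((e ^+ 2) ^+ 2); [ring|rewrite e2 expr1n].
 - move: (mat t 0 0) (mat t 0 1) => e b e2; transitivity (e ^+ 2 * (4 * (e * b))); first by ring.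
  by rewrite e2 mul1r.
 - by move=> _; ring.
 - by move: (mat t 0 0) => e e2; transitivity ((e ^+ 2) ^+ 2); [ring|rewrite e2 expr1n].
by rewrite -[LHS]/(eta (t * t)%g (act (t * t)%g z) * eta (t * t)%g z) !sq -rmorphM -expr2 e2 rmorph1.
Qed.

Lemma chi1 : chi 1%g = 1.
Proof.
have [G1 _ _] := sG; have := chi_mul G1 G1; rewrite mulg1 => e.
by apply: (mulfI (chG.1 _ G1)); rewrite mulr1 -e.
Qed.

Lemma group_expg g n : G g -> G (g ^+ n)%g /\ chi (g ^+ n)%g = chi g ^+ n.
Proof.
move=> Gg; elim: n => [|n [IH1 IH2]]; first by rewrite expg0 chi1; case: sG.
rewrite expgS chi_mul // IH2 exprS; split => //.
by case: sG => _ GM _; exact: GM.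
Qed.

(** The power 4 N of a parabolic element fixing x is a pure translation at the cusp by
    [parabolic_fourth], and lies in the kernel of chi, which has order dividing N. Its inverse is
    taken if the translation is negative. *)
Lemma cusp_period x u : is_cusp G x -> bact (mat u) None = x ->
 exists g b, [/\ G g, chi g = 1, 0 < b & (u^-1 * g * u)%g = nx b].
Proof.
move=> [g [Gg pg gx]] ux; have c0 := conj_fix gx ux.
have [ad e2 b0] := conj_parabolic pg c0.
have [N N0 hN] := oG.
pose k := (4 * N)%N; have [Gk ck] := group_expg k Gg.
have ck1 : chi (g ^+ k)%g = 1 by rewrite ck /k mulnC exprM hN // expr1n.
have conjX : forall n, (u^-1 * g ^+ n * u = (u^-1 * g * u) ^+ n)%g.
 elim=> [|n IH]; first by rewrite !expg0 mulg1 mulVg.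
 by rewrite !expgS -IH !mulgA mulgK.
have E := conjX k; rewrite /k (expgnA (u^-1 * g * u)%g 4 N) parabolic_fourth // nxX in E.
set b := _ *+ N in E.
have bn0 : b != 0.
 rewrite /b -(mulr_natr _ N); apply: mulf_neq0; last by rewrite pnatr_eq0 -lt0n.
 apply: mulf_neq0; first by rewrite pnatr_eq0.
 by apply: mulf_neq0 => //; rewrite -sqrf_eq0 e2 oner_eq0.
move: bn0; rewrite neq_lt => /orP[bn|bp]; last by exists (g ^+ k)%g, b.
exists (g ^+ k)^-1%g, (- b); split; last 1 first.
- by rewrite -nxV -E /k !invgM invgK mulgA.
- by case: sG => _ _; exact.
- have [_ _ GV] := sG; have := chi_mul Gk (GV _ Gk).
 by rewrite mulgV chi1 ck1 mul1r.
- by rewrite oppr_gt0.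
Qed.

Lemma nz_translation z (A : 'M[R]_2) : A 1 0 = 0 -> A 0 0 = A 1 1 ->
 nz (uval z) A = 2 * (A 0 1 / ht z) ^+ 2.
Proof.
move=> c0 ad; rewrite /nz /nn /cjm !mx22E c0 ad.
have y0 : ht z != 0 by rewrite gt_eqF.
by field.
Qed.

Lemma nz_nx z (b : R) : nz (uval z) (mat (nx b)) = 2 * (b / ht z) ^+ 2.
Proof. by rewrite nz_translation /= !mx22E. Qed.
Lemma nz_act u z g : nz (uval (act u z)) (mat g) = nz (uval z) (mat (u^-1 * g * u)%g).
Proof. by rewrite !mat_mul mat_inv /= nz_conj ?mat_det. Qed.
Lemma scal_conj u g t k : scal (mat g) (mat t) k ->
 scal (mat (u^-1 * g * u)%g) (mat (u^-1 * t * u)%g) k.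
Proof.
case=> s01 s10 sd; have {}sd : mat t 0 0 = mat t 1 1 + k * (mat g 0 0 - mat g 1 1).
 by rewrite -sd addrC subrK.
by split; rewrite !mat_mul mat_inv !mulmx22 /adj2 !mx22E s01 s10 sd; ring.
Qed.

Lemma mul_adj2_tri (A B : 'M[R]_2) : A 1 0 = 0 -> B 1 0 = 0 -> A 0 0 = A 1 1 -> B 0 0 = B 1 1 ->
 [/\ (A *m adj2 B) 1 0 = 0, (A *m adj2 B) 0 0 = (A *m adj2 B) 1 1 &
  (A *m adj2 B) 0 1 = A 0 1 * B 0 0 - A 0 0 * B 0 1].
Proof. by move=> a0 b0 aa bb; split; rewrite !mulmx22 /adj2 !mx22E ?a0 ?b0 ?aa ?bb; ring. Qed.

(* Near the cusp all elements of small displacement fix the cusp, hence are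
  translations up to sign; their number is at most linear in the height. *)
Lemma cusp_count g u b : G g -> 0 < b -> (u^-1 * g * u)%g = nx b ->
 exists Q t : nat, forall z n, 5 * b <= ht z -> ht z <= n%:R ->
  seqbound (Tset G (act u z) (1 / 10)) ((Q * n).+1 * t).
Proof.
move=> Gg b0 E; have [dl dl0 hdl] := Tset_center sG dG (act u uhp_i).
(* If two translations, up to sign, have signed lengths differing by less than [et], their quotient
   has displacement below [dl] at [act u uhp_i] and is central. *)
pose et := Num.min 1 dl / 2.
have et0 : 0 < et by rewrite divr_gt0 // lt_min ltr01.
have et2 : 2 * et ^+ 2 < dl.
 have e1 : et <= 1 / 2 by rewrite ler_pM2r ?invr_gt0 // ge_min lexx.
 have e2 : et <= dl / 2 by rewrite ler_pM2r ?invr_gt0 // ge_min lexx orbT.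
 clearbody et; nra.
pose Q := (Num.truncn (2 / et)).+1.
have QP : 2 / et < Q%:R by exact: truncnS_gt.
exists Q, #|` fset_set (@Zmp R)|%fset => z n zb zn.
have y0 := uval_gt0 z; set y := ht z in zb zn y0.
pose cj1 t := mat (u^-1 * t * u)%g.
(* At height at least 5 b the translation by b has displacement 2 (b / y)^2 <= 2 / 25 < 1 / 10. *)
have gT : Tset G (act u z) (1 / 10) g.
 split=> //; rewrite nz_act E nz_nx -/y.
 have : b / y <= 1 / 5 by rewrite ler_pdivrMr //; lra.
 have : 0 < b / y by rewrite divr_gt0.
 by move: (b / y) => v v0 v1; nra.
have gc : ~ Zmp g.
 move/(center_nz (act u z))/eqP; rewrite nz_act E nz_nx.
 by apply/negP; rewrite mulf_neq0 // sqrf_eq0 mulf_neq0 ?invr_eq0 ?gt_eqF.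
have tr t : Tset G (act u z) (1 / 10) t ->
  [/\ G t, cj1 t 1 0 = 0, cj1 t 0 0 = cj1 t 1 1, cj1 t 0 0 ^+ 2 = 1 & `|cj1 t 0 0 * cj1 t 0 1| <= y].
 move=> tT; have [k /(scal_conj u)] := Tset_scal sG dG gT tT gc.
 rewrite E -/(cj1 t) => -[_]; rewrite /= !mx22E mulr0 subrr mulr0 => c10 /eqP.
 rewrite subr_eq0 => /eqP cad; case: tT => Gt; rewrite nz_act -/(cj1 t) nz_translation // -/y => small.
 have e2 : cj1 t 0 0 ^+ 2 = 1.
  by have := mat_det (u^-1 * t * u)%g; rewrite det22 -/(cj1 t) c10 -cad mulr0 subr0 -expr2.
 split=> //; rewrite normrM; have -> : `|cj1 t 0 0| = 1.
  by apply/eqP; rewrite -sqrp_eq1 // -normrX e2 normr1.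
 rewrite mul1r; have : `|cj1 t 0 1| / y <= 1.
  rewrite -(ler_pXn2r (n := 2)) ?nnegrE ?divr_ge0 ?(ltW y0) // expr1n.
  rewrite -[X in _ / X](gtr0_norm y0) -normf_div -normrX ger0_norm ?sqr_ge0 //.
  by move: ((_ / _) ^+ 2) small => v; lra.
 by rewrite ler_pdivrMr // mul1r.
pose be t := (cj1 t 0 0 * cj1 t 0 1 + n%:R) / et.
have beP t : Tset G (act u z) (1 / 10) t -> 0 <= be t /\ (Num.truncn (be t) <= Q * n)%N.
 move=> /tr[_ _ _ _]; rewrite ler_norml => /andP[l1 l2].
 have n0 : 0 <= cj1 t 0 0 * cj1 t 0 1 + n%:R by move: zn; lra.
 split; first by rewrite divr_ge0 // ltW.
 rewrite -ltnS; apply: leq_ltn_trans (_ : (Num.truncn ((Q * n)%:R : R) < _)%N); last by rewrite natrK.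
 apply: le_truncn; rewrite natrM /be ler_pdivrMr //.
 apply: le_trans (_ : 2 * n%:R <= _); first by move: zn; lra.
 by rewrite mulrAC ler_wpM2r // -ler_pdivrMr // ltW.
have : seqbound (Tset G (act u z) (1 / 10)) (#|'I_(Q * n).+1| * #|` fset_set (@Zmp R)|)%fset.
 apply: (@seqbound_fibre _ _ (fun t => inord (Num.truncn (be t)) : 'I_(Q * n).+1)) => t0 T0.
 have [G0 c0 ad0 e0 _] := tr _ T0; have [b00 b0Q] := beP _ T0.
 apply: (@seqbound_inj _ _ (fun t => t * t0^-1)%g _ (@Zmp R)).
 - by move=> t t' _ _; exact: mulIg.
 - move=> t [Tt /(congr1 val)]; have [b1 b1Q] := beP _ Tt.
  rewrite /= !inordK ?ltnS // => eb.
  have [Gt c1 ad1 e1 _] := tr _ Tt; apply: hdl; split.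
   by case: sG => _ GM GV; apply: GM => //; exact: GV.
  rewrite nz_act; have -> : (u^-1 * (t * t0^-1) * u = (u^-1 * t * u) * (u^-1 * t0 * u)^-1)%g.
   by rewrite !invgM invgK !mulgA mulgK.
  rewrite mat_mul mat_inv -/(cj1 t) -/(cj1 t0).
  have [m1 m2' m3] := mul_adj2_tri c1 c0 ad1 ad0.
  rewrite (nz_translation _ m1 m2') m3 /= divr1.
  have : `|be t - be t0| < 1.
   have /andP[i1 i2] := truncn_itv b1; have /andP[j1 j2] := truncn_itv b00.
   rewrite -eb in j1 j2; move: i1 i2 j1 j2; rewrite -natr1; move: (_%:R) => v i1 i2 j1 j2.
   by rewrite ltr_norml; apply/andP; split; lra.
  have -> : be t - be t0 = (cj1 t 0 0 * cj1 t 0 1 - cj1 t0 0 0 * cj1 t0 0 1) / et.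
   by rewrite /be; field; rewrite gt_eqF.
  rewrite normrM (gtr0_norm (_ : 0 < et^-1)) ?invr_gt0 // ltr_pdivrMr // mul1r => lt1.
  apply: le_lt_trans et2; rewrite ler_pM2l //.
  move: e1 e0 lt1; move: (cj1 t 0 0) (cj1 t 0 1) (cj1 t0 0 0) (cj1 t0 0 1) => p q p' q' e1 e0 lt1.
  rewrite [leLHS](_ : _ = (p * q - p' * q') ^+ 2); last first.
   transitivity (p ^+ 2 * q' ^+ 2 + p' ^+ 2 * q ^+ 2 - 2 * p * p' * q * q'); first by ring.
   transitivity (p ^+ 2 * q ^+ 2 + p' ^+ 2 * q' ^+ 2 - 2 * p * p' * q * q'); last by ring.
   by rewrite e1 e0; ring.
  rewrite -[leLHS]ger0_norm ?sqr_ge0 // normrX.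
  by apply: lerXn2r; rewrite ?nnegrE ?normr_ge0 ?(ltW et0) ?(ltW lt1).
 - exact: finite_seqbound finite_center.
by rewrite card_ord.
Qed.

Section Param.
Variable s : C.
Hypothesis sa : Re s < a.
(** The midpoint of the interval from max (1, Re s) to m / 2, with [pdelta] half the length of that
    interval: one half-length absorbs logarithms, the other keeps the strip integral convergent. *)
Definition ptau := (Num.max 1 (Re s) + a) / 2.
Definition pdelta := (a - Num.max 1 (Re s)) / 2.

Lemma ptauP : [/\ 0 < pdelta, Re s + pdelta <= ptau, 1 <= ptau & ptau < a].
Proof.
rewrite /pdelta /ptau; have : 1 <= Num.max 1 (Re s) by rewrite le_max lexx.
have : Re s <= Num.max 1 (Re s) by rewrite le_max lexx orbT.
have : Num.max 1 (Re s) < a by rewrite gt_max sa; move: m2; lra.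
by move: (Num.max _ _) => x; split; lra.
Qed.

Let d0 : 0 < pdelta. Proof. by case: ptauP. Qed.
Let sd : Re s + pdelta <= ptau. Proof. by case: ptauP. Qed.
Let t1 : 1 <= ptau. Proof. by case: ptauP. Qed.
Let ta : ptau < a. Proof. by case: ptauP. Qed.
Let a0 : 0 <= a. Proof. by move: m2; lra. Qed.
Let tau0 : 0 <= ptau. Proof. exact: le_trans ler01 t1. Qed.

Definition pmaj := EPhi G h a ptau.

Lemma pmaj_le : exists2 K : R, 0 <= K & forall z n, seqbound (Tset G z (1 / 10)) n ->
 (pmaj z <= (K * n%:R)%:E)%E.
Proof.
by have [F fF _] := cG; exact: (Eser_bound sG dG h0 HS fF a0 tau0 (strip_Phi h0 t1 ta)).
Qed.

Lemma pmaj_fin z : (pmaj z < +oo)%E.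
Proof.
have [K _ hK] := pmaj_le; apply: le_lt_trans (hK z _ _) (ltry _).
exact: finite_seqbound (Tset_finite sG dG z).
Qed.

Definition prho (u : metap R) (c : set (metap R)) : metap R := (rep c * u)%g.
Definition pkap (c : set (metap R)) : C := (chi (rep c))^*.

Lemma PhiSumE u z : PhiSum m h ptau D (prho u) z = pmaj (act u z).
Proof. by rewrite /PhiSum /pmaj /EPhi /Eser; apply: eq_esum => c _; rewrite /ePhi /prho actM. Qed.
Lemma pfin u z : (PhiSum m h ptau D (prho u) z < +oo)%E.
Proof. by rewrite PhiSumE; exact: pmaj_fin. Qed.
Lemma pkap1 c : D c -> cabs (pkap c) = 1.
Proof. by move=> Dc; rewrite /pkap cabs_conj (chi_unitary oG) //; case: (repP sG Dc). Qed.
Lemma EVE g z : EV h M s g 0 0 (uval z) = slash m (Fser h s) g z.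
Proof. by rewrite /EV expr0 mul1r expr0 mulr1 uextE /slash (eta_powE mM) Fk0. Qed.

Definition PW u := EW h M s D (prho u) pkap.

Lemma Psi_summable z : abs_summable D (fun c => Psi_term m chi h s z (xget 1%g c)).
Proof.
have := EW_summable mM weight_gt0 h0 d0 sd t1 pkap1 (pfin 1%g) 0 0 z.
by congr abs_summable; ext => c; rewrite EVE /prho mulg1.
Qed.

Lemma Psi_hcs z : hcs ((fun c => Psi_term m chi h s z (rep c)) \_ D) (Psi G m chi h s z).
Proof. exact: hcs_csum (Psi_summable z). Qed.
Lemma PW_slash u z : PW u 0 0 (uval z) = slash m (Psi G m chi h s) u z.
Proof.
apply/csumE; have := hcsZ (eta_pow m u z) (Psi_hcs (act u z)); rewrite mulrC.
congr hcs; ext => c; rewrite /patch; case: ifP => _; last by rewrite mulr0.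
rewrite EVE /prho (slash_mul mM) mulrC.
by rewrite -[RHS]/(pkap c * (slash m (Fser h s) (rep c) (act u z) * eta_pow m u z)) mulrA.
Qed.

Lemma PW_Psi z : PW 1%g 0 0 (uval z) = Psi G m chi h s z.
Proof. by rewrite PW_slash (slash1 mM). Qed.
Lemma cder_PW u k l z : cder (PW u k l) (uval z)
 (PW u k.+1 l (uval z) - (toC m + (2 * k + l)%:R) * PW u k l.+1 (uval z)).
Proof. exact: (cder_EW mM weight_gt0 h0 d0 sd t1 pkap1 (pfin u)). Qed.
Lemma PW_bound u k l : exists2 K : R, 0 <= K & forall z (B : R), (pmaj (act u z) <= B%:E)%E ->
 cabs (PW u k l (uval z)) <= K * (ht z `^ a * ht z ^+ (k + l))^-1 * B.
Proof.
have [K K0 hK] := EW_bound mM weight_gt0 h0 d0 sd t1 pkap1 (pfin u) k l.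
exists K; first exact: K0.
move=> z B hB; have := hK z B; rewrite PhiSumE => H.
exact: (H hB).
Qed.

Lemma Psi_holo : holomorphic (Psi G m chi h s).
Proof.
move=> z; apply: (@holomorphic_near R _ (PW 1%g 0 0)); first by move=> w; rewrite PW_Psi.
exact: cder_derivable (cder_PW 1%g 0 0 z).
Qed.

Lemma Psi_act g z : G g -> slash m (Psi G m chi h s) g z = chi g * Psi G m chi h s z.
Proof.
move=> Gg; rewrite -PW_slash; apply/csumE.
have := hcsZ (chi g) (hcs_reindex (tr_cosetK g) (tr_cosetVK g) (Psi_hcs z)).
congr hcs; ext => c; rewrite /patch /=.
have DE : (tr_coset g c \in D) = (c \in D).
 apply/idP/idP; rewrite !inE => Dc; last exact: tr_coset_stab.
 by rewrite -(tr_cosetK g c); apply: tr_coset_stab => //; case: sG => _ _; exact.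
rewrite DE; case: ifPn => [|_]; last by rewrite mulr0.
rewrite inE => Dc; have [Gc _] := repP sG Dc.
rewrite tr_coset_rep // /Psi_term chi_mul // rmorphM EVE /pkap /prho.
rewrite -[RHS]mul1r -(chi_conjM Gg) -!mulrA [RHS]mulrCA; congr (_ * _).
exact: mulrCA.
Qed.

Lemma PW_period u g b : G g -> chi g = 1 -> (u^-1 * g * u)%g = nx b -> forall z : C,
 0 < Im z -> PW u 0 0 (z + toC b) = PW u 0 0 z.
Proof.
move=> Gg cg E z z0.
suff H Z : PW u 0 0 (uval Z + toC b) = PW u 0 0 (uval Z) by exact: (H (UHP z0)).
rewrite -act_nx !PW_slash.
have -> : slash m (Psi G m chi h s) u (act (nx b) Z) = slash m (slash m (Psi G m chi h s) u) (nx b) Z.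
 by rewrite {2}/slash (eta_powE mM) /= expr1n invr1 mulr1.
have e : (u * (u^-1 * g * u) = g * u)%g by rewrite !mulgA mulgV mul1g.
rewrite -(slash_mul mM) -E e (slash_mul mM); congr (slash m _ u Z).
by ext => w; rewrite Psi_act // cg mul1r.
Qed.

Definition lift_up z : uhp R.
Proof.
refine (@UHP R (Re (uval z) +i* (11 / 10 * ht z))%C _).
by rewrite /= mulr_gt0 // divr_gt0.
Defined.

Lemma hball_lift_up z : hball z (lift_up z).
Proof.
have y0 := uval_gt0 z; rewrite /hball /= cabs_sqr !ReD !ImD !ReN !ImN /= subrr.
by move: (ht z) y0 => y y0; rewrite expr0n add0r; nra.
Qed.

Let H := 2 `^ a * 2 `^ ptau.
Let H0 : 0 <= H. Proof. by rewrite mulr_ge0 // powR_ge0. Qed.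

(** Near a cusp the count in [Eser_bound] grows at most linearly with the height, by
    [cusp_count]. *)
Lemma pmaj_high u g b : G g -> 0 < b -> (u^-1 * g * u)%g = nx b ->
 exists2 K : R, 0 <= K & forall z, 5 * b <= ht z -> (pmaj (act u z) <= (K * (1 + ht z))%:E)%E.
Proof.
move=> Gg b0 E; have [Q [t hQ]] := cusp_count Gg b0 E; have [K K0 hK] := pmaj_le.
exists (K * (Q + 1)%:R * t%:R); first by rewrite !mulr_ge0.
move=> z zb; have y0 := uval_gt0 z.
have [n1 n2] : ht z <= (Num.truncn (ht z)).+1%:R /\ (Num.truncn (ht z)).+1%:R <= ht z + 1.
 by have /andP[] := truncn_itv (ltW y0); rewrite -natr1; split; lra.
apply: le_trans (hK _ _ (hQ z _ zb n1)) _; rewrite lee_fin.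
rewrite [leRHS](_ : _ = K * ((Q + 1)%:R * (1 + ht z) * t%:R)); last by ring.
rewrite ler_wpM2l // natrM ler_wpM2r //.
apply: le_trans (_ : Q%:R * (ht z + 1) + 1 <= _).
 by rewrite -natr1 natrM lerD2r ler_wpM2l.
rewrite natrD mulrDr mulrDl; move: (ler0n R Q); nra.
Qed.

(** [pmaj_high] applies only above height 5 b. Lower points are reached by k Harnack steps, each
    raising the height by the factor 11 / 10 inside one ball. *)
Lemma pmaj_chain u g b : G g -> 0 < b -> (u^-1 * g * u)%g = nx b ->
 exists2 K : R, 0 <= K & forall k z, 5 * b <= (11 / 10) ^+ k * ht z ->
  (pmaj (act u z) <= (H ^+ k * (K * (1 + (11 / 10) ^+ k * ht z)))%:E)%E.
Proof.
move=> Gg b0 E; have [K K0 hK] := pmaj_high Gg b0 E; exists K => //.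
elim=> [|k IH] z; first by rewrite expr0 !mul1r; exact: hK.
have e : (11 / 10) ^+ k * ht (lift_up z) = (11 / 10) ^+ k.+1 * ht z.
 by rewrite exprSr -mulrA.
rewrite -e => hz; have := EPhi_harnack sG dG h0 a0 tau0 (hball_act u (hball_lift_up z)).
move=> /le_trans; apply; rewrite exprS -mulrA [leRHS]EFinM.
by apply: lee_wpmul2l; [rewrite lee_fin|exact: IH].
Qed.

Lemma pmaj_band u g b y0 y1 : G g -> 0 < b -> (u^-1 * g * u)%g = nx b -> 0 < y0 ->
 exists2 B : R, 0 <= B & forall z, y0 <= ht z <= y1 -> (pmaj (act u z) <= B%:E)%E.
Proof.
move=> Gg b0 E y00; have [K K0 hK] := pmaj_chain Gg b0 E.
have bern k : 1 + k%:R / 10 <= (11 / 10 : R) ^+ k.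
 elim: k => [|k IH]; first by rewrite mul0r addr0 expr0.
 rewrite exprS -natr1; have := ler0n R k; move: k%:R ((11 / 10) ^+ k) IH => x y xy x0; nra.
pose k := (Num.truncn (50 * b / y0)).+1.
have kb : 5 * b <= (11 / 10) ^+ k * y0.
 have : 50 * b / y0 < k%:R by exact: truncnS_gt.
 rewrite ltr_pdivrMr // => l1; apply: le_trans (_ : (1 + k%:R / 10) * y0 <= _).
  by move: l1 b0 y00; move: k%:R => v; nra.
 by rewrite ler_wpM2r ?(ltW y00).
exists (H ^+ k * (K * (1 + (11 / 10) ^+ k * `|y1|))).
 by rewrite !mulr_ge0 ?exprn_ge0 // addr_ge0 // mulr_ge0 // exprn_ge0 // divr_ge0.
move=> z /andP[z0 z1]; apply: le_trans (hK k z _) _.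
 by apply: le_trans kb _; rewrite ler_wpM2l // exprn_ge0 // divr_ge0.
rewrite lee_fin ler_wpM2l ?exprn_ge0 // ler_wpM2l // lerD2l ler_wpM2l ?exprn_ge0 ?divr_ge0 //.
exact: le_trans z1 (ler_norm _).
Qed.

Lemma PW_band u g b k l y0 y1 : G g -> 0 < b -> (u^-1 * g * u)%g = nx b -> 0 < y0 ->
 exists2 B : R, 0 <= B & forall z : C, y0 <= Im z <= y1 -> cabs (PW u k l z) <= B.
Proof.
move=> Gg b0 E y00; have [B B0 hB] := pmaj_band y1 Gg b0 E y00; have [K K0 hK] := PW_bound u k l.
exists (K * (y0 `^ a * y0 ^+ (k + l))^-1 * B).
 by rewrite !mulr_ge0 // invr_ge0 mulr_ge0 // exprn_ge0 // ltW.
move=> z zy; have /andP[z0 z1] := zy; have zp : 0 < Im z := lt_le_trans y00 z0.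
have := hK (UHP zp) B (hB (UHP zp) zy); move=> /= /le_trans; apply.
rewrite ler_wpM2r // ler_wpM2l // lef_pV2 ?posrE ?mulr_gt0 ?powR_gt0 ?exprn_gt0 //.
apply: ler_pM; rewrite ?exprn_ge0 ?(ltW y00) //.
 by apply: ge0_ler_powR => //; rewrite nnegrE ltW.
by apply: lerXn2r; rewrite // nnegrE ltW.
Qed.

(** The slashed series is periodic and, by [PW_band], [nice], so it has an expansion. On high
    horizontal lines it is O(y^-a (1 + y)), which tends to 0 since a = m / 2 > 1, whereas |[fexp n]|
    >= 1 for n <= 0: these coefficients vanish. *)
Lemma Psi_cusp x u : is_cusp G x -> bact (mat u) None = x ->
 exists b (c : int -> C), [/\ 0 < b, fourier_expansion b (slash m (Psi G m chi h s) u) c &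
  forall n, n <= 0 -> c n = 0].
Proof.
move=> cx ux; have [g [b [Gg cg b0 E]]] := cusp_period cx ux.
pose g0 := PW u 0 0.
pose g1 (z : C) := PW u 1 0 z - (toC m + 0%:R) * PW u 0 1 z.
pose g2 (z : C) := PW u 2 0 z - (toC m + 2%:R) * PW u 1 1 z -
 (toC m + 0%:R) * (PW u 1 1 z - (toC m + 1%:R) * PW u 0 2 z).
have D0 (z : C) : 0 < Im z -> cder g0 z (g1 z).
 by move=> z0; have := cder_PW u 0 0 (UHP z0).
have D1 (z : C) : 0 < Im z -> cder g1 z (g2 z).
 move=> z0; have := gderB (cder_PW u 1 0 (UHP z0)) (gderZ (toC m + 0%:R) (cder_PW u 0 1 (UHP z0))).
 by [].
have per := PW_period Gg cg E.
have N : nice b g0 g1 g2.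
 split=> [z z0|y0 y1 y00].
  have zb0 : 0 < Im (z + toC b) by rewrite ImD /= addr0.
  split; [exact: per| |exact: D0|exact: D1].
  apply/esym/(periodic_cder per z0 (D0 _ z0)); exact: D0.
 have [B1 p1 h1] := PW_band 0 0 y1 Gg b0 E y00.
 have [B2 p2 h2] := PW_band 1 0 y1 Gg b0 E y00.
 have [B3 p3 h3] := PW_band 0 1 y1 Gg b0 E y00.
 have [B4 p4 h4] := PW_band 2 0 y1 Gg b0 E y00.
 have [B5 p5 h5] := PW_band 1 1 y1 Gg b0 E y00.
 have [B6 p6 h6] := PW_band 0 2 y1 Gg b0 E y00.
 pose k n := cabs (toC m + n%:R); have k0 n : 0 <= k n by exact: cabs_ge0.
 pose T1 := B2 + k 0 * B3; pose T2 := B4 + k 2 * B5 + k 0 * (B5 + k 1 * B6).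
 have q1 : 0 <= T1 by rewrite addr_ge0 // mulr_ge0.
 have q2 : 0 <= T2 by rewrite !addr_ge0 // mulr_ge0 // addr_ge0 // mulr_ge0.
 have BM (c x0 y : C) A B : cabs x0 <= A -> cabs y <= B -> cabs (x0 - c * y) <= A + cabs c * B.
  by move=> xA yB; apply: le_trans (cabsB _ _) (lerD xA _); rewrite cabsM ler_wpM2l ?cabs_ge0.
 exists (B1 + T1 + T2); first by apply: addr_ge0 => //; apply: addr_ge0.
 move=> z zy; split.
 - by apply: le_trans (h1 z zy) _; lra.
 - apply: le_trans (_ : T1 <= _); last lra.
  exact: BM (h2 z zy) (h3 z zy).
 - apply: le_trans (_ : T2 <= _); last lra.
  exact: BM (BM _ _ _ _ _ (h4 z zy) (h5 z zy)) (BM _ _ _ _ _ (h5 z zy) (h6 z zy)).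
have [c hc] := fourier_theorem b0 N.
exists b, c; split=> // [z|n n0].
 by apply/has_csumE; rewrite -PW_slash; exact: hc (uval_gt0 z).
have [K K0 hK] := PW_bound u 0 0; have [K' K'0 hK'] := pmaj_high Gg b0 E.
have bd (y : R) : 5 * b <= y -> 1 <= y -> cabs (c n) <= 2 * K * K' * (y `^ (a - 1))^-1.
 move=> yb y1; have y0 : 0 < y by exact: lt_le_trans y1.
 have y0' : 0 < Im (0 +i* y : C)%C by [].
 have hw (w : C) : Im w = y -> cabs (g0 w) <= K * (y `^ a * y ^+ 0)^-1 * (K' * (1 + y)).
  move=> wy; have w0 : 0 < Im w by rewrite wy.
  have := hK (UHP w0) (K' * (1 + y)); rewrite /= wy; apply.
  by have := hK' (UHP w0); rewrite /= wy; apply.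
 have := fourier_coef_le b0 n y0' hc hw; rewrite cabsM cabs_fexp /= => l1.
 have l2 : 1 <= expR (- (2 * pi * n%:~R / b * y)).
  apply: le_trans (_ : expR 0 <= _); first by rewrite expR0.
  rewrite ler_expR oppr_ge0 mulr_le0_ge0 ?(ltW y0) // mulr_le0_ge0 ?invr_ge0 ?(ltW b0) //.
  by rewrite mulr_ge0_le0 ?lerz0 // mulr_ge0 // pi_ge0.
 apply: le_trans (_ : cabs (c n) * expR (- (2 * pi * n%:~R / b * y)) <= _).
  by rewrite ler_peMr.
 apply: le_trans l1 _; rewrite expr0 mulr1.
 have -> : y `^ a = y `^ (a - 1) * y by rewrite -{3}(powRr1 (ltW y0)) -powRD ?subrK ?(gt_eqF y0) ?implybT.
 have P0 : 0 < y `^ (a - 1) by rewrite powR_gt0.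
 move: (y `^ (a - 1)) P0 => P P0.
 rewrite [leRHS](_ : _ = K * K' * (2 * P^-1)); last by ring.
 rewrite [leLHS](_ : _ = K * K' * ((1 + y) / y * P^-1)); last by field; rewrite !gt_eqF.
 rewrite ler_wpM2l ?mulr_ge0 // ler_wpM2r ?invr_ge0 ?(ltW P0) // ler_pdivrMr //; lra.
apply/eqP; rewrite -cabs_eq0; apply/negPn/negP => cn.
have c0 : 0 < cabs (c n) by rewrite lt_neqAle eq_sym cn cabs_ge0.
(* Chosen so that the bound [bd] at a height y with y^(a - 1) >= X contradicts a nonzero [c n]. *)
pose X := 2 * K * K' / cabs (c n) + 1.
have X0 : 0 < X by apply: ltr_wpDl => //; rewrite divr_ge0 ?(ltW c0) // ?mulr_ge0.
pose y := X `^ (a - 1)^-1 + 5 * b + 1.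
have a1 : 0 < a - 1 by move: m2; lra.
have P0 := powR_ge0 X (a - 1)^-1.
have := bd y; have -> : 5 * b <= y by rewrite /y; move: b0; lra.
have -> : 1 <= y by rewrite /y; move: b0; lra.
move=> /(_ isT isT); apply/negP; rewrite -ltNge.
have Xy : X <= y `^ (a - 1).
 have {1}-> : X = (X `^ (a - 1)^-1) `^ (a - 1).
  by rewrite -powRrM mulVf ?gt_eqF // powRr1 // ltW.
 apply: ge0_ler_powR; rewrite ?nnegrE //; first exact: ltW.
 - by rewrite /y; move: b0; lra.
 - by rewrite /y; move: b0; lra.
rewrite ltr_pdivrMr; last exact: lt_le_trans X0 Xy.
rewrite [ltRHS]mulrC -ltr_pdivrMr //; apply: lt_le_trans Xy; rewrite /X ltrDl.
exact: ltr01.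
Qed.

Lemma Psi_cusp_form : cusp_form G chi m (Psi G m chi h s).
Proof.
split; [exact: Psi_holo|by move=> g Gg z; exact: Psi_act|].
by move=> x u cx ux; exact: Psi_cusp cx ux.
Qed.
End Param.
End CosetSeries.

(** * Termwise derivatives of the expansion of a cusp form *)

Section CuspFormCoefficients.
Context {R : realType}.
Local Notation C := (Cx R).
Implicit Types (y c : R).

Lemma hcs_csumT I (t : I -> C) : summ (fun i => cabs (t i)) -> hcs t (csum setT t).
Proof.
by move=> ts; have := @hcs_csum R I setT t; rewrite patch_setT; apply; apply/abs_summableE; rewrite patch_setT.
Qed.

Section Expansion.
Variables (b : R) (co : int -> C) (g : C -> C).
Hypotheses (b0 : 0 < b) (co0 : forall n, n <= 0 -> co n = 0).
Hypothesis hg : forall z : C, 0 < Im z -> hcs (fun n => co n * fexp b n z) (g z).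

Let fr (n : int) : C := (0 +i* (2 * pi * n%:~R / b))%C.
Definition eterm k (n : int) (z : C) : C := fr n ^+ k * (co n * fexp b n z).
Definition eser k (z : C) : C := csum setT (fun n => eterm k n z).

Let maj y (n : int) := cabs (co n * fexp b n (0 +i* (y / 2))%C).

Let maj_sum y : 0 < y -> summ (maj y).
Proof.
by move=> y0; apply: hcs_summable (hg _); rewrite /= divr_gt0.
Qed.

(** Half of the exponential decay pays for the k powers of the frequency, the other half is the
    convergent expansion at height y / 2. *)
Lemma eterm_le k y : 0 < y -> exists2 K : R, 0 <= K & forall z n, y <= Im z ->
 cabs (eterm k n z) <= K * maj y n.
Proof.
move=> y0; have [K K0 hK] := @powR_expR_bounded R k%:R (y / 2) (ler0n _ _) (divr_gt0 y0 (ltr0n _ 2)).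
exists K => // z n yz; case: (lerP n 0) => n0.
 by rewrite /eterm co0 // mul0r mulr0 cabs0 mulr_ge0 // cabs_ge0.
have x0 : 0 < 2 * pi * n%:~R / b :> R by rewrite divr_gt0 // mulr_gt0 ?ltr0z // mulr_gt0 // pi_gt0.
rewrite /eterm /maj cabsM cabsX (cabsM (co n)) (cabsM (co n)) !cabs_fexp mulrCA [leRHS]mulrCA.
rewrite ler_wpM2l //.
have -> : cabs (fr n) = 2 * pi * n%:~R / b.
 by rewrite cabsE /= expr0n add0r sqrtr_sqr gtr0_norm.
move: (2 * pi * n%:~R / b) x0 => x x0 /=.
have := hK x x0; rewrite powR_mulrn ?(ltW x0) // => h1.
apply: le_trans (_ : x ^+ k * (expR (- (y / 2 * x)) * expR (- (x * (y / 2)))) <= _).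
 rewrite ler_wpM2l ?exprn_ge0 ?(ltW x0) // -expRD ler_expR.
 by move: x0 yz; move: (Im z) => v x0 yz; nra.
by rewrite mulrA ler_wpM2r // expR_ge0.
Qed.

Lemma eser_hcs k (z : C) : 0 < Im z -> hcs (fun n => eterm k n z) (eser k z).
Proof.
move=> z0; have [K K0 hK] := eterm_le k z0; apply: hcs_csumT.
apply: (summ_le (q := fun n => K * maj (Im z) n)) => [n|]; first exact: hK.
by apply: summZ => // [n|]; [exact: cabs_ge0|exact: maj_sum].
Qed.

Lemma eser0 (z : C) : 0 < Im z -> eser 0 z = g z.
Proof.
move=> z0; apply: hcs_unique (eser_hcs 0 z0) _; have := hg z0; congr hcs.
by ext => n; rewrite /eterm expr0 mul1r.
Qed.

Lemma cder_eser k (z : C) : 0 < Im z -> cder (eser k) z (eser k.+1 z).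
Proof.
move=> z0; have r0 : 0 < Im z / 2 by rewrite divr_gt0.
have [K K0 hK] := eterm_le k.+1 r0.
have near (v : C) : cabs (v - z) < Im z / 2 -> Im z / 2 <= Im v.
 move=> vz; have := le_lt_trans (Im_le_cabs _) vz.
 by rewrite ImD ImN ltr_norml => /andP[]; lra.
apply: (@hcs_gder R _ (eterm k) (eterm k.+1) (eser k) _ z (fun n => K * maj (Im z / 2) n) _ r0).
- move=> n v vz; have := gderZ (fr n ^+ k * co n) (cder_fexp b n v).
 rewrite /eterm -/(fr n) => D; apply: gder_ext (_ : gder id _ v _) => [w|]; last first.
  by move: D; congr gder; rewrite exprSr; ring.
 by rewrite mulrA.
- by move=> n v /near; exact: hK.
- by apply: summZ => // [n|]; [exact: cabs_ge0|exact: maj_sum].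
- by move=> v /near vz; apply: eser_hcs; exact: lt_le_trans vz.
- exact: eser_hcs.
Qed.

Lemma eser_bounded k y : 0 < y -> exists2 B : R, 0 <= B & forall z, y <= Im z -> cabs (eser k z) <= B.
Proof.
move=> y0; have [K K0 hK] := eterm_le k y0.
have m0 n : 0 <= K * maj y n by rewrite mulr_ge0 // cabs_ge0.
exists (bsum (fun n => K * maj y n)); first exact: bsum_ge0.
move=> z yz; apply: cabs_hcs (eser_hcs k (lt_le_trans y0 yz)) => [n|]; first exact: hK.
by apply: summZ => // [n|]; [exact: cabs_ge0|exact: maj_sum].
Qed.

(** The definition of cusp form supplies an expansion of unknown width b. Its derivatives show that
    the function is [nice] for its actual period h, so [fourier_theorem] yields the expansion of
    width h. *)
Lemma eser_nice h : (forall z : C, 0 < Im z -> g (z + toC h) = g z) ->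
 nice h (eser 0) (eser 1) (eser 2).
Proof.
move=> per; have per0 (z : C) : 0 < Im z -> eser 0 (z + toC h) = eser 0 z.
 by move=> z0; rewrite !eser0 ?per // ImD /= addr0.
split=> [z z0|y0 y1 y00].
 have zh : 0 < Im (z + toC h) by rewrite ImD /= addr0.
 split; [exact: per0| |exact: cder_eser|exact: cder_eser].
 by apply/esym/(periodic_cder per0 z0); exact: cder_eser.
have [B0 p0 q0] := eser_bounded 0 y00; have [B1 p1 q1] := eser_bounded 1 y00.
have [B2 p2 q2] := eser_bounded 2 y00.
exists (B0 + B1 + B2); first by rewrite !addr_ge0.
by move=> z /andP[yz _]; split; [have := q0 z yz|have := q1 z yz|have := q2 z yz]; lra.
Qed.
End Expansion.
End CuspFormCoefficients.

(** * Complex-valued hyperbolic integrals, exchange with sums, unfolding of signed functions *)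

Section ComplexIntegrals.
Context {R : realType}.
Local Notation C := (Cx R).
Implicit Types (u v b : uhp R -> R) (phi psi : uhp R -> C) (z w : uhp R).

Definition rl u (p : R * R) : R := oapp u 0 (insub (pt p)).

Lemma rl_co u z : rl u (co (uval z)) = u z.
Proof. by rewrite /rl coK valK. Qed.
Lemma rl_out u p : ~ UH p -> rl u p = 0.
Proof. by move=> np; rewrite /rl insubN //; apply/negP. Qed.
Lemma lft_EFin u : lft (fun z => (u z)%:E) \_ UH = EFin \o rl u.
Proof.
ext => p; rewrite /patch; case: ifPn => [/set_mem/UHE[z _ ->]|]; first by rewrite lft_co /= rl_co.
by rewrite notin_setE => np; rewrite /= rl_out.
Qed.

Definition mR u := measurable_fun (setT : set (RxR R)) (rl u).

Lemma mRE u : mR u <-> hm (fun z => (u z)%:E).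
Proof. by rewrite /hm /mj lft_EFin; split=> /measurable_EFinP. Qed.
Lemma mR_comp (g : R -> R) u : mfT g -> mR u -> mR (fun z => g (u z)).
Proof.
move=> mg mu; rewrite /mR (_ : rl _ = (g \o rl u) \_ UH).
 by apply/(measurable_restrictT _ measurable_UH); apply: measurable_funTS; exact: mcomp.
ext => p; rewrite /patch; case: ifPn => [/set_mem/UHE[z _ ->]|]; first by rewrite /= !rl_co.
by rewrite notin_setE => np; rewrite rl_out.
Qed.

Lemma mRD u v : mR u -> mR v -> mR (fun z => u z + v z).
Proof.
move=> mu mv; rewrite /mR (_ : rl _ = rl u \+ rl v); first exact: measurable_funD.
by ext => p; rewrite /rl /=; case: insub => //=; rewrite addr0.
Qed.

Lemma mRM u v : mR u -> mR v -> mR (fun z => u z * v z).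
Proof.
move=> mu mv; rewrite /mR (_ : rl _ = rl u \* rl v); first exact: measurable_funM.
by ext => p; rewrite /rl /=; case: insub => //=; rewrite mulr0.
Qed.

Lemma mR_cst c : mR (fun=> c).
Proof. by apply/mRE; exact: hm_cst. Qed.
Lemma mRZ c u : mR u -> mR (fun z => c * u z).
Proof. by apply: mRM; exact: mR_cst. Qed.
Lemma mR_norm u : mR u -> mR (fun z => `|u z|).
Proof. by apply: mR_comp; apply: continuous_measurable_fun; exact: norm_continuous. Qed.
Lemma mR_Im (g : R -> R) : mfT g -> mR (fun z => g (Im (uval z))).
Proof.
move=> mg; rewrite /mR (_ : rl _ = (fun p => g p.2) \_ UH).
 apply/(measurable_restrictT _ measurable_UH); apply: measurable_funTS.
 by apply: mcomp => //; exact: measurable_snd.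
ext => p; rewrite /patch; case: ifPn => [/set_mem/UHE[z _ ->]|]; first by rewrite rl_co.
by rewrite notin_setE => np; rewrite rl_out.
Qed.

Lemma mR_if (F : set (uhp R)) u : hm (ind F) -> mR u -> mR (fun z => if `[< F z >] then u z else 0).
Proof.
move=> mF /mRE mu; apply/mRE; apply: hm_ext (hmM mF mu) => z.
by rewrite /ind; case: asboolP => _; rewrite ?mul1e ?mul0e.
Qed.

Local Notation hf phi := (fun p : R * R => ((lft phi \_ UH) p * (hw p.2)%:E)%E).

Lemma hf_norm u p : (`|hf (fun z => (u z)%:E) p| = hf (fun z => `|u z|%:E) p)%E.
Proof.
rewrite /patch; case: ifPn => [/set_mem/UHE[z _ ->]|_]; last by rewrite !mul0e abse0.
by rewrite !lft_co -!EFinM /= normrM (ger0_norm (hw_ge0 _)).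
Qed.

Definition integ u := leb2.-integrable setT (hf (fun z => (u z)%:E)).
Definition RJ u : R := fine (JH (fun z => (u z)%:E)).

Lemma integE u : mR u -> integ u <-> (JH (fun z => `|u z|%:E) < +oo)%E.
Proof.
move=> /mRE mu; have E : (\int[leb2]_p `|hf (fun z => (u z)%:E) p| = JH (fun z => `|u z|%:E))%E.
 by apply: eq_integral => p _; exact: hf_norm.
split; first by move=> /integrableP[_]; rewrite E.
by move=> fin; apply/integrableP; split; [exact: mhint|rewrite E].
Qed.

Lemma JH_RJ u : integ u -> JH (fun z => (u z)%:E) = (RJ u)%:E.
Proof. by move=> iu; rewrite /RJ fineK //; exact: integrable_fin_num. Qed.
Lemma RJ_lin c u v : integ u -> integ v ->
 integ (fun z => u z + c * v z) /\ RJ (fun z => u z + c * v z) = RJ u + c * RJ v.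
Proof.
move=> iu iv; have icv := integrableZl measurableT c iv.
have E : (hf (fun z => (u z + c * v z)%:E) =
  (fun p => hf (fun z => (u z)%:E) p + c%:E * hf (fun z => (v z)%:E) p))%E.
 ext => p /=; rewrite !lft_EFin /= -!EFinM -EFinD; congr EFin.
 by rewrite /rl; case: insub => [w|] /=; ring.
split; first by rewrite /integ E; exact: integrableD.
rewrite /RJ /JH /J E integralD // integralZl // fineD ?fineM //.
- exact: integrable_fin_num.
- exact: integrable_fin_num.
- by rewrite fin_numM //; exact: integrable_fin_num.
Qed.

Lemma RJ_norm u : mR u -> integ u -> `|RJ u| <= RJ (fun z => `|u z|).
Proof.
move=> mu iu; have /mRE m1 := mu; have m2 := mhint m1.
have := le_abse_integral leb2 measurableT m2.
have E : (\int[leb2]_p `|hf (fun z => (u z)%:E) p| = JH (fun z => `|u z|%:E))%E.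
 by apply: eq_integral => p _; exact: hf_norm.
rewrite E -[X in (`|X| <= _)%E]/(JH (fun z => (u z)%:E)) JH_RJ //.
have ia : integ (fun z => `|u z|).
 apply/integE; first exact: mR_norm.
 by under [X in JH X]funext => z do rewrite normr_id; exact/integE.
by rewrite JH_RJ // lee_fin.
Qed.

Definition mC phi := mR (fun z => Re (phi z)) /\ mR (fun z => Im (phi z)).

Lemma mC_cabs phi : mC phi -> mR (fun z => cabs (phi z)).
Proof.
move=> [m1 m2]; rewrite (_ : (fun z => _) = (fun z => Num.sqrt (Re (phi z) * Re (phi z) +
  Im (phi z) * Im (phi z)))); last by ext => z; rewrite cabsE !expr2.
apply: (mR_comp (g := Num.sqrt)); last by apply: mRD; exact: mRM.
by apply: continuous_measurable_fun; exact: sqrt_continuous.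
Qed.

Lemma mCD phi psi : mC phi -> mC psi -> mC (fun z => phi z + psi z).
Proof.
by move=> [a1 a2] [b1 b2]; split; under eq_fun do rewrite ?ReD ?ImD; exact: mRD.
Qed.

Lemma mCM phi psi : mC phi -> mC psi -> mC (fun z => phi z * psi z).
Proof.
move=> [a1 a2] [b1 b2]; split; under eq_fun do rewrite ?ReM ?ImM.
 under eq_fun do rewrite -mulN1r.
 by apply: mRD; [|apply: mRZ]; exact: mRM.
by apply: mRD; exact: mRM.
Qed.

Lemma mC_conj phi : mC phi -> mC (fun z => (phi z)^*).
Proof.
move=> [a1 a2]; split.
 by rewrite (_ : (fun z => _) = (fun z => Re (phi z))) //; ext => z; rewrite Re_conj.
rewrite (_ : (fun z => _) = (fun z => -1 * Im (phi z))); first exact: mRZ.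
by ext => z; rewrite Im_conj mulN1r.
Qed.

Lemma mC_cst (c : C) : mC (fun=> c).
Proof. by split; exact: mR_cst. Qed.
Lemma mCZ (c : C) phi : mC phi -> mC (fun z => c * phi z).
Proof. by apply: mCM; exact: mC_cst. Qed.
Lemma mC_real u : mR u -> mC (fun z => toC (u z)).
Proof. by move=> mu; split => //; exact: mR_cst. Qed.
Lemma mC_if (F : set (uhp R)) phi : hm (ind F) -> mC phi -> mC (fun z => if `[< F z >] then phi z else 0).
Proof.
move=> mF [a1 a2]; split.
 rewrite (_ : (fun z => _) = (fun z => if `[< F z >] then Re (phi z) else 0)); first exact: mR_if.
 by ext => z; case: ifP.
rewrite (_ : (fun z => _) = (fun z => if `[< F z >] then Im (phi z) else 0)); first exact: mR_if.
by ext => z; case: ifP.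
Qed.

Lemma mC_cder (g : C -> C) : (forall z : C, 0 < Im z -> exists l, cder g z l) ->
 mC (fun z => g (uval z)).
Proof.
move=> dg.
have cont (P : C -> R) : (forall z w : C, `|P z - P w| <= cabs (z - w)) -> mR (fun z => P (g (uval z))).
 move=> PL; rewrite /mR (_ : rl _ = (fun p => P (g (pt p))) \_ UH); last first.
  ext => p; rewrite /patch; case: ifPn => [/set_mem/UHE[z -> ->]|]; first by rewrite rl_co.
  by rewrite notin_setE => np; rewrite rl_out.
 apply/(measurable_restrictT _ measurable_UH); apply: continuous_box_measurable => p pU e e0.
 have [l D] := dg (pt p) pU; have [d d0 hd] := gder_cont D e0.
 exists (d / 2) => [|q q1 q2]; first by rewrite divr_gt0.
 apply: le_lt_trans (PL _ _) _; rewrite (_ : pt q = pt p + (pt q - pt p)); last by rewrite addrC subrK.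
 apply: hd; apply: le_lt_trans (cabs_le_ReIm _) _; rewrite ReD ImD ReN ImN /=.
 by move: q1 q2; move: `|_ - _| => x; move: `|_ - _| => y; lra.
split; apply: cont => z w; [rewrite -ReN -ReD|rewrite -ImN -ImD]; [exact: Re_le_cabs|exact: Im_le_cabs].
Qed.

Lemma mC_holo (f : uhp R -> C) : holomorphic f -> mC f.
Proof.
move=> hf; have := @mC_cder (uext f); rewrite (_ : (fun z => uext f (uval z)) = f).
 by apply=> z z0; exact: (holo_cder hf (UHP z0)).
by ext => z; rewrite uextE.
Qed.

Definition CI phi := mC phi /\ (JH (fun z => (cabs (phi z))%:E) < +oo)%E.
Definition CJ phi : C := (RJ (fun z => Re (phi z)) +i* RJ (fun z => Im (phi z)))%C.

Lemma CI_le phi b : mC phi -> mR b -> (forall z, cabs (phi z) <= b z) ->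
 (JH (fun z => (b z)%:E) < +oo)%E -> CI phi.
Proof.
move=> mp mb pb fin; split=> //; apply: le_lt_trans fin.
by apply: le_JH => [||z|z]; rewrite ?lee_fin //; apply/mRE => //; exact: mC_cabs.
Qed.

Lemma CI_integ phi : CI phi ->
 integ (fun z => Re (phi z)) /\ integ (fun z => Im (phi z)).
Proof.
move=> [mp fin]; have [m1 m2] := mp; have mc := mC_cabs mp.
split; apply/integE => //; apply: le_lt_trans fin.
 by apply: le_JH => [||z|z]; rewrite ?lee_fin ?Re_le_cabs //; apply/mRE => //; exact: mR_norm.
by apply: le_JH => [||z|z]; rewrite ?lee_fin ?Im_le_cabs //; apply/mRE => //; exact: mR_norm.
Qed.

Lemma CJ_lin (c : C) phi psi : CI phi -> CI psi ->
 CI (fun z => phi z + c * psi z) /\ CJ (fun z => phi z + c * psi z) = CJ phi + c * CJ psi.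
Proof.
move=> hp hq; have [mp fp] := hp; have [mq fq] := hq.
have [p1 p2] := CI_integ hp; have [q1 q2] := CI_integ hq; split.
 have m1 := mC_cabs mp; have m2 := mC_cabs mq.
 have m3 : mR (fun z => cabs c * cabs (psi z)) by exact: mRZ.
 apply: (@CI_le _ (fun z => cabs (phi z) + cabs c * cabs (psi z))).
 - by apply: mCD => //; exact: mCZ.
 - exact: mRD.
 - by move=> z; rewrite -cabsM; exact: cabsD.
 have [_] := JHD (iffLR (mRE _) m1) (iffLR (mRE _) m3) (fun z => cabs_ge0 _) (fun z => mulr_ge0 (cabs_ge0 _) (cabs_ge0 _)).
 under [X in JH X]funext => z do rewrite -EFinD.
 move=> ->; apply: lte_add_pinfty => //.
 under [X in JH X]funext => z do rewrite EFinM.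
 rewrite JHZ ?lee_fin //; [|exact/mRE|by move=> z; rewrite lee_fin cabs_ge0].
 by apply: lte_mul_pinfty; rewrite ?lee_fin ?cabs_ge0.
rewrite /CJ.
have [i1 e1] := RJ_lin (Re c) p1 q1; have [i2 e2] := RJ_lin (- Im c) i1 q2.
have [i3 e3] := RJ_lin (Re c) p2 q2; have [i4 e4] := RJ_lin (Im c) i3 q1.
apply: cx_eq; rewrite ?ReD ?ImD ?ReM ?ImM /=.
 rewrite (_ : (fun z => Re (phi z + c * psi z)) = (fun z => Re (phi z) + Re c * Re (psi z) + - Im c * Im (psi z))).
  by rewrite e2 e1; ring.
 by ext => z; rewrite ReD ReM; ring.
rewrite (_ : (fun z => Im (phi z + c * psi z)) = (fun z => Im (phi z) + Re c * Im (psi z) + Im c * Re (psi z))).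
 by rewrite e4 e3; ring.
by ext => z; rewrite ImD ImM; ring.
Qed.

Lemma RJ_le u v : mR u -> mR v -> (forall z, 0 <= u z <= v z) -> (JH (fun z => (v z)%:E) < +oo)%E ->
 RJ u <= RJ v.
Proof.
move=> mu mv uv fin.
have le : (JH (fun z => (u z)%:E) <= JH (fun z => (v z)%:E))%E.
 by apply: le_JH => [||z|z]; rewrite ?lee_fin; try (by apply/mRE); by case/andP: (uv z).
have u0 : (0 <= JH (fun z => (u z)%:E))%E by apply: JH_ge0 => z; rewrite lee_fin; case/andP: (uv z).
by rewrite /RJ fine_le // ge0_fin_numE //; [exact: le_lt_trans fin|exact: le_trans le].
Qed.

Lemma CJ_le phi : CI phi -> cabs (CJ phi) <= 2 * RJ (fun z => cabs (phi z)).
Proof.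
move=> hp; have [i1 i2] := CI_integ hp; have [mp fp] := hp; have [m1 m2] := mp.
have mc := mC_cabs mp.
apply: le_trans (cabs_le_ReIm _) _; rewrite /CJ /= mulr2n mulrDl mul1r.
apply: lerD; (apply: le_trans (RJ_norm _ _) _ => //; apply: RJ_le => //; [exact: mR_norm|move=> z]).
 by rewrite normr_ge0 Re_le_cabs.
by rewrite normr_ge0 Im_le_cabs.
Qed.

Lemma bsum_off I (B : {fset I}) (p : I -> R) : (forall i, 0 <= p i) -> summ p ->
 let q i := if i \in B then 0 else p i in summ q /\ bsum q = bsum p - \sum_(i <- B) p i.
Proof.
move=> p0 ps q; have q0 i : 0 <= q i by rewrite /q; case: ifP.
have BU (A : {fset I}) : (B `<=` B `|` A)%fset by exact: fsubsetUl.
have AU (A : {fset I}) : (A `<=` B `|` A)%fset by exact: fsubsetUr.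
have qB : \sum_(i <- B) q i = 0 by rewrite big_seq big1 // => i iB; rewrite /q iB.
have qp (A : {fset I}) : \sum_(i <- ((B `|` A) `\` B)%fset) q i = \sum_(i <- ((B `|` A) `\` B)%fset) p i.
 by rewrite big_seq [RHS]big_seq; apply: eq_bigr => i; rewrite in_fsetD /q => /andP[/negbTE -> _].
have ub (A : {fset I}) : \sum_(i <- A) q i <= bsum p - \sum_(i <- B) p i.
 apply: le_trans (fsum_mono q0 (AU A)) _; rewrite (fsum_split q (BU A)) qB add0r qp.
 by rewrite lerBrDl -(fsum_split p (BU A)); exact: fsum_le_bsum.
have [qs le1] := summ_ub q0 ub; split=> //; apply/eqP; rewrite eq_le le1 /= lerBlDl.
have ub2 (A : {fset I}) : \sum_(i <- A) p i <= \sum_(i <- B) p i + bsum q.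
 apply: le_trans (fsum_mono p0 (AU A)) _; rewrite (fsum_split p (BU A)) lerD2l -qp.
 exact: fsum_le_bsum.
by have [] := summ_ub p0 ub2.
Qed.

Lemma CI0 : CI (fun=> 0).
Proof.
split; first exact: mC_cst.
by under [X in JH X]funext => z do rewrite cabs0; rewrite JH0.
Qed.

Lemma CJ0 : CJ (fun=> 0) = 0.
Proof. by rewrite /CJ /RJ JH0. Qed.
Lemma CJ_sum (I : Type) (s : seq I) (Ph : I -> uhp R -> C) : (forall i, CI (Ph i)) ->
 CI (fun z => \sum_(i <- s) Ph i z) /\ CJ (fun z => \sum_(i <- s) Ph i z) = \sum_(i <- s) CJ (Ph i).
Proof.
move=> hP; elim: s => [|i s [IH1 IH2]].
 rewrite big_nil; have -> : (fun z => \sum_(i <- [::]) Ph i z) = (fun=> 0) by ext => z; rewrite big_nil.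
 by split; [exact: CI0|exact: CJ0].
have -> : (fun z => \sum_(j <- i :: s) Ph j z) = (fun z => Ph i z + 1 * \sum_(j <- s) Ph j z).
 by ext => z; rewrite big_cons mul1r.
by have [c1 c2] := CJ_lin 1 (hP i) IH1; rewrite c2 IH2 mul1r big_cons.
Qed.

(** The difference between [phi] and a partial sum is pointwise at most the sum of the moduli of the
    omitted terms. Monotone convergence integrates this to the tail of the summable family of L1
    norms. *)
Lemma CJ_swap (I : countType) (Ph : I -> uhp R -> C) phi : (forall i, CI (Ph i)) -> CI phi ->
 summ (fun i => RJ (fun z => cabs (Ph i z))) -> (forall z, hcs (Ph^~ z) (phi z)) ->
 hcs (fun i => CJ (Ph i)) (CJ phi).
Proof.
move=> hP hp; set p := fun i => _ => ps hz e e0.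
have JE i : JH (fun z => (cabs (Ph i z))%:E) = (p i)%:E.
 have [_ fin] := hP i; rewrite /p /RJ fineK // ge0_fin_numE //.
 by apply: JH_ge0 => z; rewrite lee_fin cabs_ge0.
have p0 i : 0 <= p i by rewrite /p /RJ fine_ge0 //; apply: JH_ge0 => z; rewrite lee_fin cabs_ge0.
have e20 : 0 < e / 2 by rewrite divr_gt0.
have [A hA] := hcr_bsum p0 ps e20; exists A => B AB.
have [S1 S2] := CJ_sum B hP; have [D1 D2] := CJ_lin (-1) hp S1.
rewrite -S2 -mulN1r -D2; apply: le_lt_trans (CJ_le D1) _.
suff le : RJ (fun z => cabs (phi z + -1 * \sum_(i <- B) Ph i z)) <= bsum p - \sum_(i <- B) p i.
 by have := hA B AB; rewrite ltr_norml => /andP[_]; lra.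
have [qs qE] := bsum_off B p0 ps; rewrite -qE.
pose Q i z := ((if i \in B then 0 else cabs (Ph i z)) : R)%:E.
have Q0 i z : (0 <= Q i z)%E by rewrite /Q lee_fin; case: ifP => // _; exact: cabs_ge0.
have mQ i : hm (Q i).
 have [iB|iB] := boolP (i \in B); first by apply: hm_ext (hm_cst 0%:E) => z; rewrite /Q iB.
 apply: hm_ext (_ : hm (fun z => (cabs (Ph i z))%:E)) => [z|]; first by rewrite /Q (negbTE iB).
 by apply/mRE; apply: mC_cabs; case: (hP i).
have [mS SE] := JH_esum (D := [set: I]) (countableP _) mQ Q0.
have JS : JH (fun z => \esum_(i in [set: I]) Q i z)%E = (bsum (fun i => if i \in B then 0 else p i))%:E.
 rewrite SE -bsumE //; last by move=> i; case: ifP.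
 apply: eq_esum => i _; case: ifPn => iB; last rewrite -JE.
  by rewrite -[RHS](@JH0 R); congr JH; ext => z; rewrite /Q iB.
 by congr JH; ext => z; rewrite /Q (negbTE iB).
rewrite -[leRHS]/(fine (_%:E)) -JS /RJ fine_le //.
- rewrite ge0_fin_numE; first by case: D1.
 by apply: JH_ge0 => z; rewrite lee_fin cabs_ge0.
- by rewrite JS.
apply: le_JH => //; first by apply/mRE; apply: mC_cabs; case: D1.
 by move=> z; rewrite lee_fin cabs_ge0.
move=> z; rewrite mulN1r.
have s0 i : 0 <= cabs (Ph i z) by exact: cabs_ge0.
have ss := hcs_summable (hz z); have [ts tE] := bsum_off B s0 ss.
rewrite /Q bsumE //; last by move=> i; case: ifP.
by rewrite lee_fin tE; exact: hcs_tail (hz z).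
Qed.


Implicit Types (g t : metap R).
Local Notation ht z := (Im (uval z)).

Lemma hcs_part (P : C -> R) I (c : I -> C) l : P 0 = 0 ->
 (forall z w : C, P (z + w) = P z + P w) -> (forall z : C, `|P z| <= cabs z) ->
 hcs c l -> hcs (fun i => toC (P (c i))) (toC (P l)).
Proof.
move=> P0 PD Pn hc e e0; have [A hA] := hc e e0; exists A => B AB.
apply: le_lt_trans (hA B AB).
rewrite -(big_morph _ (@rmorphD _ _ (@toC R)) (rmorph0 (@toC R))) -(big_morph P PD P0).
have PN (z : C) : P (- z) = - P z by apply: (addrI (P z)); rewrite -PD !subrr.
by rewrite -rmorphB -PN -PD cabs_toC.
Qed.

Lemma hcs_Re I (c : I -> C) l : hcs c l ->
 hcs (fun i => toC (Re (c i))) (toC (Re l)).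
Proof. by apply: hcs_part => //; [exact: ReD|exact: Re_le_cabs]. Qed.
Lemma hcs_Im I (c : I -> C) l : hcs c l ->
 hcs (fun i => toC (Im (c i))) (toC (Im l)).
Proof. by apply: hcs_part => //; [exact: ImD|exact: Im_le_cabs]. Qed.
Lemma hcs_bsum I (p : I -> R) : (forall i, 0 <= p i) -> summ p ->
 hcs (fun i => toC (p i)) (toC (bsum p)).
Proof.
move=> p0 ps e e0; have [A hA] := hcr_bsum p0 ps e0; exists A => B AB; apply: le_lt_trans (hA B AB).
by rewrite -(big_morph _ (@rmorphD _ _ (@toC R)) (rmorph0 (@toC R))) -rmorphB cabs_toC.
Qed.

Lemma hyp_integral_CJ (F : set (uhp R)) psi : measurable (plane F : set (RxR R)) ->
 integ (fun z => if `[< F z >] then Re (psi z) else 0) ->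
 integ (fun z => if `[< F z >] then Im (psi z) else 0) ->
 hyp_integrable F psi /\ hyp_integral F psi = CJ (fun z => if `[< F z >] then psi z else 0).
Proof.
move=> mF iR iI.
have E (P : C -> R) : ((EFin \o (fun p : R * R => P (uext psi (p.1 +i* p.2)%C) * p.2 ^- 2)%R) \_ (plane F) =
  (fun p => (lft (fun z => (if `[< F z >] then P (psi z) else 0)%:E) \_ UH) p * (hw p.2)%:E))%E.
 ext => p; rewrite /patch; case: ifPn => pF.
  have [z Fz zE] := set_mem pF; have pE : p = co (uval z) by rewrite zE; case: (p).
  rewrite {2}pE mem_set; last exact: uval_gt0.
  rewrite {2}pE lft_co asboolT // /= -zE uextE -EFinM; congr (_ * _)%:E.
  rewrite pE /= /hw wtE; last exact: uval_gt0.
  by rewrite -expr2 exprVn.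
 case: ifP => pU; last by rewrite mul0e.
 have [z _ pE] := UHE (set_mem pU); rewrite pE lft_co asboolF ?mul0e // => Fz.
 by move: pF; rewrite notin_setE; apply; exists z => //; rewrite pE; case: (uval z).
split.
 by split; apply/(integrable_mkcond _ mF); rewrite E.
have FE (P : C -> R) : P 0 = 0 ->
  \int[leb2]_(p in plane F) (P (uext psi (p.1 +i* p.2)%C) * p.2 ^- 2) =
  RJ (fun z => P (if `[< F z >] then psi z else 0)).
 move=> P0; rewrite /Rintegral integral_mkcond /RJ /JH /J.
 have -> : (fun z => (P (if `[< F z >] then psi z else 0))%:E) = (fun z => (if `[< F z >] then P (psi z) else 0)%:E).
  by ext => z; case: ifP => // _; rewrite P0.
 by rewrite -(E P).
have ER := FE (@complex.Re R) erefl; have EI := FE (@complex.Im R) erefl.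
by rewrite /CJ -ER -EI.
Qed.

Section Unfold.
Variables (G : set (metap R)) (h : R).
Hypotheses (sG : is_subgroup G) (dG : discrete_set G) (h0 : 0 < h).
Hypothesis HS : cusp_width G h.
Variable F : set (uhp R).
Hypothesis fF : fundamental_domain G F.
Variable b : uhp R -> R.
Hypotheses (mb : mR b) (bstab : forall t w, stab_oo G t -> b (act t w) = b w).
Hypothesis bI : (JH (fun z => ind (strip h) z * (b z)%:E) < +oo)%E.
Hypothesis bfin : forall z, (Eser G (fun z => (b z)%:E) z < +oo)%E.
Local Notation D := (stab_cosets G).

Let mF : hm (ind F). Proof. by case: fF => mF _ _; exact: hm_ind. Qed.

Let ind_if (E : set (uhp R)) v z : ((if `[< E z >] then v z else 0)%:E = ind E z * (v z)%:E)%E.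
Proof. by rewrite /ind; case: asboolP => _; rewrite ?mul1e ?mul0e. Qed.

(** The sum of u over cosets converges as an extended sum, so U is [Eser] and [unfold] applies. The
    factor 2 makes room for u + b in the signed case. *)
Lemma unfold_nonneg u U : mR u -> (forall z, 0 <= u z <= 2 * b z) ->
 (forall t w, stab_oo G t -> u (act t w) = u w) ->
 (forall z, hcs ((fun c => toC (u (act (rep c) z))) \_ D) (toC (U z))) ->
 [/\ integ (fun z => if `[< F z >] then U z else 0), integ (fun z => if `[< strip h z >] then u z else 0) &
  RJ (fun z => if `[< F z >] then U z else 0) = RJ (fun z => if `[< strip h z >] then u z else 0)].
Proof.
move=> mu ub us hU.
have u0 z : 0 <= u z by case/andP: (ub z).
have u0e z : (0 <= (u z)%:E)%E by rewrite lee_fin.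
have mue := iffLR (mRE _) mu; have mbe := iffLR (mRE _) mb.
have b0 z : 0 <= b z by have := ub z; have := u0 z; move=> ? /andP[_]; lra.
have EU z : Eser G (fun z => (u z)%:E) z = (U z)%:E.
 pose p c := if c \in D then u (act (rep c) z) else 0.
 have p0 c : 0 <= p c by rewrite /p; case: ifP.
 have pE : Eser G (fun z => (u z)%:E) z = (\esum_(c in setT) (p c)%:E)%E.
  by rewrite /Eser esum_mkcond; apply: eq_esum => c _; rewrite /p; case: ifP.
 have ps : summ p.
  rewrite /summ -pE; apply: le_lt_trans (_ : 2%:E * Eser G (fun z => (b z)%:E) z < +oo)%E; last first.
   by apply: lte_mul_pinfty => //; rewrite lee_fin.
  rewrite /Eser (esum_mulr (stab_cosets_countable sG dG)); last 2 first.
  - by move=> c; rewrite lee_fin.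
  - by rewrite lee_fin.
  by apply: le_esum => c _; rewrite -EFinM lee_fin; case/andP: (ub (act (rep c) z)).
 rewrite pE bsumE //; congr EFin; apply: toC_inj; apply: hcs_unique (hcs_bsum p0 ps) _.
 by have := hU z; congr hcs; ext => c; rewrite /patch /p; case: ifP => _; rewrite ?rmorph0.
have JE := unfold sG h0 HS dG fF mue u0e (fun t w st => congr1 EFin (us t w st)).
have mS : hm (ind (strip h)) by exact: hm_strip.
have sfin : (JH (fun z => ind (strip h) z * (u z)%:E) < +oo)%E.
 apply: le_lt_trans (_ : JH (fun z => 2%:E * (ind (strip h) z * (b z)%:E)) < +oo)%E; last first.
  rewrite JHZ //; first by apply: lte_mul_pinfty => //; rewrite lee_fin.
   exact: hmM.
  by move=> z; rewrite mule_ge0 ?ind_ge0 ?lee_fin.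
 apply: le_JH => [||z|z].
 - exact: hmM.
 - by apply: hmZ; exact: hmM.
 - by rewrite mule_ge0 ?ind_ge0.
 - rewrite muleCA; apply: lee_wpmul2l; first exact: ind_ge0.
  by rewrite -EFinM lee_fin; case/andP: (ub z).
have U0 z : 0 <= U z by rewrite -lee_fin -EU; exact: Eser_ge0.
have mU : mR U.
 apply/mRE; apply: hm_ext (hm_Eser sG dG mue u0e) => z; exact: EU.
have nn v (v0 : forall z, 0 <= v z) (E : set (uhp R)) : (fun z => `|if `[< E z >] then v z else 0|%:E) =
  (fun z => ind E z * (v z)%:E)%E.
 by ext => z; rewrite -ind_if ger0_norm //; case: ifP.
have JU : JH (fun z => ind F z * (U z)%:E)%E = JH (fun z => ind (strip h) z * (u z)%:E)%E.
 by rewrite -JE; congr JH; ext => z; rewrite EU.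
split.
- by apply/integE; [exact: mR_if|rewrite nn // JU].
- by apply/integE; [exact: mR_if|rewrite nn].
- rewrite /RJ; under [X in JH X]funext => z do rewrite ind_if.
 by under [X in _ = fine (JH X)]funext => z do rewrite ind_if; rewrite JU.
Qed.

(** Both u + b and b are nonnegative and unfold; the results are subtracted. *)
Lemma unfold_real u U : mR u -> (forall z, `|u z| <= b z) ->
 (forall t w, stab_oo G t -> u (act t w) = u w) ->
 (forall z, hcs ((fun c => toC (u (act (rep c) z))) \_ D) (toC (U z))) ->
 integ (fun z => if `[< F z >] then U z else 0) /\
 RJ (fun z => if `[< F z >] then U z else 0) = RJ (fun z => if `[< strip h z >] then u z else 0).
Proof.
move=> mu ub us hU.
have b0 z : 0 <= b z by exact: le_trans (normr_ge0 _) (ub z).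
have b0e z : (0 <= (b z)%:E)%E by rewrite lee_fin.
pose S z := fine (Eser G (fun z => (b z)%:E) z).
have hS z : hcs ((fun c => toC (b (act (rep c) z))) \_ D) (toC (S z)).
 pose p c := if c \in D then b (act (rep c) z) else 0.
 have p0 c : 0 <= p c by rewrite /p; case: ifP.
 have pE : Eser G (fun z => (b z)%:E) z = (\esum_(c in setT) (p c)%:E)%E.
  by rewrite /Eser esum_mkcond; apply: eq_esum => c _; rewrite /p; case: ifP.
 have ps : summ p by rewrite /summ -pE.
 rewrite /S pE; have := hcs_bsum p0 ps; congr hcs.
 by ext => c; rewrite /patch /p; case: ifP => _; rewrite ?rmorph0.
have bb z : 0 <= b z <= 2 * b z by have := b0 z; move=> x; apply/andP; split; lra.
have [i1 i2 e1] := unfold_nonneg mb bb bstab hS.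
have uu z : 0 <= u z + b z <= 2 * b z.
 by have := ub z; rewrite ler_norml => /andP[l1 l2]; apply/andP; split; lra.
have hUS z : hcs ((fun c => toC (u (act (rep c) z) + b (act (rep c) z))) \_ D) (toC (U z + S z)).
 have := hcs_lin 1 (hU z) (hS z); rewrite mul1r -rmorphD; congr hcs.
 ext => c; rewrite /patch; case: ifP => _; last by rewrite mulr0 addr0.
 by rewrite mul1r -rmorphD.
have us2 t w : stab_oo G t -> u (act t w) + b (act t w) = u w + b w by move=> st; rewrite us // bstab.
have [i3 i4 e2] := unfold_nonneg (mRD mu mb) uu us2 hUS.
have [j1 f1] := RJ_lin (-1) i3 i1; have [j2 f2] := RJ_lin (-1) i4 i2.
have sub (E : set (uhp R)) v v' : (fun z => (if `[< E z >] then v z + v' z else 0) + -1 * (if `[< E z >] then v' z else 0)) =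
  (fun z => if `[< E z >] then v z else 0).
 by ext => z; case: ifP => _; rewrite mulN1r ?addrK ?subr0.
rewrite !sub in j1 f1 f2; split=> //.
by rewrite f1 f2 e1 e2.
Qed.

Lemma unfold_complex phi psi : mC phi -> (forall z, cabs (phi z) <= b z) ->
 (forall t w, stab_oo G t -> phi (act t w) = phi w) ->
 (forall z, hcs ((fun c => phi (act (rep c) z)) \_ D) (psi z)) ->
 hyp_integrable F psi /\ hyp_integral F psi = CJ (fun z => if `[< strip h z >] then phi z else 0).
Proof.
move=> [m1 m2] pb ps hp.
have patchP (P : C -> R) z : P 0 = 0 -> (fun c => toC (P (((fun c => phi (act (rep c) z)) \_ D) c))) =
  (fun c => toC (P (phi (act (rep c) z)))) \_ D.
 by move=> P0; ext => c; rewrite /patch; case: ifP => // _; rewrite P0 rmorph0.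
have [||z|i1 e1] := unfold_real (U := fun z => Re (psi z)) m1.
- by move=> z; apply: le_trans (Re_le_cabs _) (pb z).
- by move=> t w st; rewrite ps.
- by rewrite -(@patchP (@complex.Re R)) //; exact: hcs_Re.
have [||z|i2 e2] := unfold_real (U := fun z => Im (psi z)) m2.
- by move=> z; apply: le_trans (Im_le_cabs _) (pb z).
- by move=> t w st; rewrite ps.
- by rewrite -(@patchP (@complex.Im R)) //; exact: hcs_Im.
have mFp : measurable (plane F : set (RxR R)) by case: fF.
have [I1 E1] := hyp_integral_CJ mFp i1 i2; split=> //; rewrite E1.
have ifP' (E : set (uhp R)) (P : C -> R) ph : P 0 = 0 -> (fun z => P (if `[< E z >] then ph z else 0)) =
  (fun z => if `[< E z >] then P (ph z) else 0).
 by move=> P0; ext => z; case: ifP.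
rewrite /CJ !(ifP' _ (@complex.Re R)) // !(ifP' _ (@complex.Im R)) //.
by rewrite e1 e2.
Qed.
End Unfold.
Definition on_strip (h : R) phi z : C := if `[< strip h z >] then phi z else 0.
End ComplexIntegrals.

(** * Gamma integrals and orthogonality of exponentials on the strip *)

Section StripMellin.
Context {R : realType}.
Local Notation C := (Cx R).
Local Notation mu := (@lebesgue_measure R).
Implicit Types (z : uhp R).

(** With r = (n + 1) / (n + 2), ln r <= r - 1 gives r^(1 - e) >= 1 + (e - 1) / (n + 2). The right
    side telescopes, whence [summ_powR]. *)
Lemma inv_powR_le (e : R) n : 1 < e ->
 n.+2%:R `^ (- e) <= (n.+1%:R `^ (1 - e) - n.+2%:R `^ (1 - e)) / (e - 1).
Proof.
move=> e1; set y := n.+2%:R; pose r : R := n.+1%:R / y.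
have y0 : 0 < y by rewrite ltr0n.
have r0 : 0 < r by rewrite divr_gt0 ?ltr0n.
have xE : n.+1%:R = y * r :> R by rewrite /r mulrC divfK // gt_eqF.
have rE : r = 1 - y^-1.
 by rewrite /r (_ : n.+1%:R = y - 1) ?mulrBl ?mul1r ?divff ?gt_eqF // /y -[in RHS]natr1 addrK.
have lnr : 1 + ln r <= r by have := expR_ge1Dx (ln r); rewrite lnK.
have re : 1 + (e - 1) / y <= r `^ (1 - e).
 rewrite /powR gt_eqF //; apply: le_trans (expR_ge1Dx _); rewrite lerD2l.
 have : (e - 1) * (1 - r) <= (e - 1) * - ln r by rewrite ler_wpM2l //; lra.
 by rewrite rE; move: y^-1 => u; lra.
have yE : y `^ (1 - e) = y * y `^ (- e).
 by rewrite powRD ?powRr1 ?(ltW y0) // (gt_eqF y0) implybT.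
rewrite xE powRM ?(ltW r0) ?(ltW y0) // ler_pdivlMr; last lra.
rewrite yE; have P0 : 0 < y `^ (- e) by rewrite powR_gt0.
rewrite -[X in _ <= _ - X]mulr1 -mulrBr; apply: le_trans (_ : y * y `^ (- e) * ((e - 1) / y) <= _).
 by rewrite le_eqVlt; apply/orP; left; apply/eqP; field; rewrite gt_eqF.
by apply: ler_wpM2l; [rewrite mulr_ge0 ?ltW|rewrite lerBrDl].
Qed.

Lemma summ_powR (e : R) : 1 < e -> summ (fun n : nat => n%:R `^ (- e) : R).
Proof.
move=> e1; have p0 n : 0 <= (n%:R `^ (- e) : R) by exact: powR_ge0.
have e0 : 0 < e - 1 by lra.
have ub N : \sum_(n < N.+2) (n%:R `^ (- e) : R) <= 1 + (1 - N.+1%:R `^ (1 - e)) / (e - 1).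
 elim: N => [|N IH].
  rewrite !big_ord_recr big_ord0 /= powR0 ?oppr_eq0 ?gt_eqF //; last lra.
  by rewrite !powR1 subrr mul0r !add0r addr0.
 rewrite big_ord_recr /=; apply: le_trans (lerD IH (inv_powR_le N e1)) _.
 by rewrite -addrA -mulrDl le_eqVlt; apply/orP; left; apply/eqP; congr (_ + _ / _); ring.
suff H N : \sum_(n < N) (n%:R `^ (- e) : R) <= 1 + (e - 1)^-1 by have [] := summ_nat p0 H.
apply: le_trans (_ : \sum_(n < N.+2) (n%:R `^ (- e) : R) <= _).
 by rewrite 2!big_ord_recr /= -addrA lerDl addr_ge0.
by apply: le_trans (ub N) _; rewrite lerD2l ler_pdivrMr // mulVf ?gt_eqF // gerBl powR_ge0.
Qed.

Local Open Scope ereal_scope.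

(** The gamma integral with respect to dy / y, extended-valued so that the dilation invariance
    [mint_scale] applies before finiteness is known. *)
Definition Gm (b : R) : \bar R := mint (fun y => (y `^ b * expR (- y))%:E).

Let mpe (b c : R) : mfT (fun y : R => (y `^ b * expR (- (c * y)))%R).
Proof.
apply: measurable_funM; first exact: measurable_powR.
by apply: mcomp => //; apply: mcomp.
Qed.

Let mpe1 (b : R) : mfT (fun y : R => (y `^ b * expR (- y))%R).
Proof. by have := mpe b 1; under eq_fun do rewrite mul1r. Qed.

Let mw : mfT (fun y : R => (wt y)%:E).
Proof. by apply/measurable_EFinP; exact: measurable_wt. Qed.

Lemma le_mint (g g' : R -> \bar R) : mfT g -> mfT g' ->
 (forall y, 0 <= g y) -> (forall y, (0 < y)%R -> g y <= g' y) -> mint g <= mint g'.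
Proof.
move=> mg mg' g0 gg'; apply: ge0_le_integral => //.
- by move=> y _; rewrite mule_ge0 // lee_fin wt_ge0.
- exact: emeasurable_funM.
- exact: emeasurable_funM.
- move=> y _; have [y0|y0] := ltP 0%R y; last by rewrite /wt ltNge y0 /= !mule0.
 by apply: lee_wpmul2r; [rewrite lee_fin wt_ge0|exact: gg'].
Qed.

Lemma Gm_bounds b : (0 < b)%R -> 0 < Gm b /\ Gm b < +oo.
Proof.
move=> b0; split.
 apply: lt_le_trans (_ : mint (fun y => (expR (-1))%:E * (if (y <= 1)%R then (y `^ b)%:E else 0)) <= _).
  have m1 : mfT (fun y : R => if (y <= 1)%R then (y `^ b)%:E else 0) by exact: measurable_if_le.
  rewrite /mint; under eq_integral do rewrite -muleA.
  rewrite ge0_integralZl ?lee_fin //; last first.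
  - by move=> y _; rewrite mule_ge0 ?lee_fin ?wt_ge0 //; case: ifP => // _; rewrite lee_fin powR_ge0.
  - exact: emeasurable_funM.
  rewrite -/(mint (fun y : R => if (y <= 1)%R then (y `^ b)%:E else 0)) mint_le // powR1 div1r -EFinM lte_fin.
  by rewrite mulr_gt0 ?expR_gt0 ?invr_gt0.
 apply: le_mint.
 - by apply: emeasurable_funM => //; exact: measurable_if_le.
 - by apply/measurable_EFinP; exact: mpe1.
 - by move=> y; rewrite mule_ge0 ?lee_fin //; case: ifP => // _; rewrite lee_fin powR_ge0.
 - move=> y y0; case: ifP => y1; last by rewrite mule0 lee_fin mulr_ge0.
  by rewrite -EFinM lee_fin mulrC ler_wpM2l // ler_expR lerN2.
have [K K0 hK] := @powR_expR_bounded R (b + 1) 1 (addr_ge0 (ltW b0) ler01) ltr01.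
pose g1 (y : R) : \bar R := if (y <= 1)%R then (y `^ b)%:E else 0.
pose g2 (y : R) : \bar R := if (1 <= y)%R then (y `^ (- 1))%:E else 0.
have m1 : mfT g1 by exact: measurable_if_le.
have m2 : mfT g2.
 apply: measurable_fun_ifT => //; first exact: measurable_fun_ler.
 by apply/measurable_EFinP; exact: measurable_powR.
have g10 y : 0 <= g1 y by rewrite /g1; case: ifP => // _; rewrite lee_fin powR_ge0.
have g20 y : 0 <= g2 y by rewrite /g2; case: ifP => // _; rewrite lee_fin powR_ge0.
apply: le_lt_trans (_ : mint (fun y => g1 y + K%:E * g2 y) < +oo).
 apply: le_mint => [||y|y y0].
 - by apply/measurable_EFinP; exact: mpe1.
 - by apply: emeasurable_funD => //; exact: emeasurable_funM.
 - by rewrite lee_fin mulr_ge0.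
 - rewrite /g1 /g2; have P0 := powR_ge0 y b.
  have [y1|y1] := lerP y 1%R.
   apply: le_trans (_ : (y `^ b)%:E <= _).
    by rewrite lee_fin ler_piMr // -expR0 ler_expR oppr_le0 ltW.
   by rewrite leeDl // mule_ge0 ?lee_fin //; exact: g20.
  rewrite (ltW y1) add0e -EFinM lee_fin.
  have := hK y y0; rewrite mul1r powRD ?powRr1 ?(ltW y0) ?(gt_eqF y0) ?implybT // => l1.
  by rewrite powR_inv1 ?(ltW y0) // ler_pdivlMr // mulrAC.
rewrite /mint; under eq_integral do rewrite ge0_muleDl ?mule_ge0 ?lee_fin // -muleA.
rewrite ge0_integralD //; last 4 first.
- by move=> y _; rewrite mule_ge0 ?lee_fin ?wt_ge0.
- exact: emeasurable_funM.
- by move=> y _; rewrite !mule_ge0 ?lee_fin ?wt_ge0.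
- by apply: emeasurable_funM => //; exact: emeasurable_funM.
rewrite ge0_integralZl //; last 2 first.
- exact: emeasurable_funM.
- by move=> y _; rewrite mule_ge0 ?lee_fin ?wt_ge0.
rewrite -/(mint g1) -/(mint g2) mint_le // mint_ge1 // -EFinM -EFinD ltry //.
Qed.

Lemma hw_powR (b c : R) : (0 < c)%R ->
 \int[mu]_y ((y `^ (b + 1) * expR (- (c * y)))%:E * (hw y)%:E) = (c `^ (- b))%:E * Gm b.
Proof.
move=> c0; transitivity (mint (fun y => (c `^ (- b))%:E * ((c * y) `^ b * expR (- (c * y)))%:E)).
 apply: eq_integral => y _; have [y0|y0] := ltP 0%R y; last by rewrite /hw /wt ltNge y0 /= mulr0 !mule0.
 rewrite -!EFinM; congr EFin; rewrite /hw wtE // powRM ?(ltW c0) ?(ltW y0) //.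
 rewrite powRD ?powRr1 ?(ltW y0) ?(gt_eqF y0) ?implybT // powRN.
 by field; rewrite !gt_eqF ?powR_gt0.
have m1 : mfT (fun y => ((c * y) `^ b * expR (- (c * y)))%:E).
 apply/measurable_EFinP; apply: (mcomp (mpe1 b) (_ : mfT (fun y => c * y)%R)).
 exact: measurable_funM.
rewrite /mint; under eq_integral do rewrite -muleA.
rewrite ge0_integralZl ?lee_fin //; last 2 first.
- exact: emeasurable_funM.
- by move=> y _; rewrite mule_ge0 ?lee_fin ?wt_ge0 // mulr_ge0.
congr (_ * _); rewrite -/(mint (fun y => ((c * y) `^ b * expR (- (c * y)))%:E)).
apply: (mint_scale (g := fun y => (y `^ b * expR (- y))%:E)) => //.
- by apply/measurable_EFinP; exact: mpe1.
- by move=> y; rewrite lee_fin mulr_ge0.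
Qed.

Lemma gamma_Gm b : (0 < b)%R -> (gamma_fun b)%:E = Gm b /\ (0 < gamma_fun b)%R.
Proof.
move=> b0; have [g0 g1] := Gm_bounds b0.
have E : \int[mu]_(t in `]0%R, +oo[) (t `^ (b - 1) * expR (- t))%:E = Gm b.
 rewrite integral_mkcond; apply: eq_integral => y _; rewrite /patch.
 have -> : (y \in [set` `]0%R, +oo[]) = (0 < y)%R by rewrite mem_setE in_itv /= andbT.
 case: ifPn => [y0|]; last by rewrite -leNgt => y0; rewrite /wt ltNge y0 /= mule0.
 rewrite -EFinM; congr EFin; rewrite wtE // powRD ?(gt_eqF y0) ?implybT //.
 by rewrite powR_inv1 ?(ltW y0) // mulrAC.
have gE : (gamma_fun b)%:E = Gm b by rewrite /gamma_fun /Rintegral E fineK // ge0_fin_numE // ltW.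
by split=> //; rewrite -lte_fin gE.
Qed.

Variable h : R.
Hypothesis h0 : (0 < h)%R.

Lemma JH_strip_xy (P Y : R -> R) : mfT P -> mfT Y ->
 (forall x, 0 <= P x)%R -> (forall y, 0 <= Y y)%R ->
 JH (fun z => ind (strip h) z * (P (Re (uval z)) * Y (Im (uval z)))%:E) =
 (\int[mu]_(x in `[0%R, h[) (P x)%:E) * \int[mu]_y ((Y y)%:E * (hw y)%:E).
Proof.
move=> mP mY P0 Y0; pose Q x : \bar R := ((EFin \o P) \_ `[0%R, h[) x.
have mQ : mfT Q.
 apply/(measurable_restrictT (D := `[0%R, h[%classic)) => //.
 by apply: measurable_funTS; exact/measurable_EFinP.
have Q0 x : 0 <= Q x by rewrite /Q /patch; case: ifP => // _; rewrite lee_fin.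
have [_] := JH_xy mQ (iffRL (measurable_EFinP _ _) mY) Q0 (fun y => Y0 y).
have -> : \int[mu]_(x in `[0%R, h[) (P x)%:E = \int[mu]_x Q x by rewrite integral_mkcond.
move=> <-; congr JH; ext => z.
rewrite /ind /Q /patch /strip mem_setE /= in_itv /=.
by case: asboolP => /= [->|/negP/negbTE ->]; rewrite ?mul1e ?mul0e // EFinM.
Qed.

Lemma itv_mass : \int[mu]_(x in `[0%R, h[) (1%R : R)%:E = h%:E.
Proof.
rewrite integral_cst //= mul1e lebesgue_measure_itv /= lte_fin h0.
by rewrite oppr0 adde0.
Qed.

Local Close Scope ereal_scope.

Lemma cexp_i (t : R) : cexp (0 +i* t : C)%C = (cos t +i* sin t)%C.
Proof. by rewrite /cexp /= expR0 rmorph1 mul1r. Qed.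
Lemma sin_period (j : int) (t : R) : sin (2 * pi * j%:~R + t) = sin t.
Proof.
have := @cexp_period R j; rewrite cexp_i => e.
have c1 : cos (2 * pi * j%:~R) = 1 := congr1 (@complex.Re R) e.
have s0 : sin (2 * pi * j%:~R) = 0 := congr1 (@complex.Im R) e.
by rewrite sinD c1 s0 mul0r add0r mul1r.
Qed.

Let affine_cont (c t : R) : continuous (fun x : R => c * x + t).
Proof.
by move=> x; apply: (@continuousD _ R^o); [apply: continuousM; [exact: cvg_cst|exact: cvg_id]|exact: cvg_cst].
Qed.

Let cos_cont (c t : R) : continuous (fun x : R => 1 + cos (c * x + t)).
Proof.
move=> x; apply: (@continuousD _ R^o); first exact: cvg_cst.
by apply: (continuous_comp (f := fun y : R => c * y + t) (g := @cos R)); [exact: affine_cont|exact: continuous_cos].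
Qed.

Lemma is_derive_sin_affine (c t x : R) : c != 0 ->
 is_derive x 1 (fun y : R => y + sin (c * y + t) / c) (1 + cos (c * x + t)).
Proof.
move=> c0; pose k : C := (0 +i* c)%C.
have k0 : k != 0 by apply/negP => /eqP/(congr1 (@complex.Im R)) /= /eqP; exact/negP.
have inn := gderZ k (rder_toC x).
have := rder_Re (gderD (rder_toC x) (gderZ (cexp (0 +i* t : C)%C / k) (@gder_comp R R (@toC R) (@cexp R) (fun y => k * toC y) x _ _ (cder_cexp _) inn))).
have E y : cexp (0 +i* t : C)%C * cexp (k * toC y) = (cos (c * y + t) +i* sin (c * y + t))%C.
 rewrite -cexpD -cexp_i; congr cexp; apply: cx_eq; rewrite ?ReD ?ImD ?ReM ?ImM /=; ring.
have Rk (w : C) : Re (w / k) = Im w / c.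
 have : Im w = Im (w / k * k) by rewrite divfK.
 by rewrite ImM /= mulr0 addr0 => ->; rewrite mulfK.
have -> : (fun y => Re (toC y + cexp (0 +i* t : C)%C / k * cexp (k * toC y))) =
  (fun y => y + sin (c * y + t) / c).
 by ext => y; rewrite ReD mulrAC E Rk.
by rewrite mulr1 mulrA (mulrAC (cexp _)) E divfK // ReD.
Qed.

(** The summand 1 makes the integrand nonnegative, so that Tonelli applies in the strip; it is
    subtracted again in [harmonic_cos]. *)
Lemma cos_mass (j : int) (t : R) : j != 0 ->
 (\int[mu]_(x in `[0%R, h[) (1 + cos (2 * pi * j%:~R / h * x + t))%:E = h%:E)%E.
Proof.
move=> j0; set c := (2 * pi * j%:~R / h).
have c0 : c != 0.
 by rewrite /c !mulf_neq0 ?invr_eq0 ?intr_eq0 ?(gt_eqF h0) ?(gt_eqF (pi_gt0 R)) // pnatr_eq0.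
pose Fp (x : R) : R := x + sin (c * x + t) / c.
have D (x : R) : is_derive x 1 Fp (1 + cos (c * x + t)) by exact: is_derive_sin_affine.
have dF (x : R) : derivable Fp x 1 by exact: ex_derive.
have cF : continuous Fp by move=> x; apply: differentiable_continuous; exact/derivable1_diffP.
have mc : mfT (fun x : R => (1 + cos (c * x + t))%:E).
 by apply/measurable_EFinP; apply: continuous_measurable_fun; exact: cos_cont.
rewrite integral_itv_bndo_bndc; last exact: measurable_funTS.
rewrite (@continuous_FTC2 _ (fun x => 1 + cos (c * x + t)) Fp 0 h h0).
- rewrite -EFinB /Fp mulr0 !add0r (_ : c * h = 2 * pi * j%:~R); last by rewrite /c divfK // gt_eqF.
 by rewrite sin_period; congr EFin; ring.
- by apply: continuous_subspaceT; exact: cos_cont.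
- split; first by move=> x _; exact: dF.
 + by apply: cvg_at_right_filter; exact: cF.
 + by apply: cvg_at_left_filter; exact: cF.
- by move=> x _; rewrite derive1E (@derive_val _ _ _ _ _ _ _ (D x)).
Qed.

Section Harmonics.
Variables (m c : R).
Hypotheses (m1 : 1 < m) (c0 : 0 < c).
Let Y (y : R) : R := y `^ m * expR (- (c * y)).
Let A : R := c `^ (1 - m) * gamma_fun (m - 1).

Let mY : mfT Y. Proof. exact: mpe. Qed.
Let Y0 y : 0 <= Y y. Proof. by rewrite mulr_ge0. Qed.

Let YA : (\int[mu]_y ((Y y)%:E * (hw y)%:E) = A%:E)%E.
Proof.
have m10 : 0 < m - 1 by rewrite subr_gt0.
have := hw_powR (m - 1) c0; rewrite subrK -(gamma_Gm m10).1 -EFinM.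
by rewrite opprB.
Qed.

Let strip_if (u : uhp R -> R) : (fun z => (if `[< strip h z >] then u z else 0)%:E) =
 (fun z => ind (strip h) z * (u z)%:E)%E.
Proof. by ext => z; rewrite /ind; case: asboolP => _; rewrite ?mul1e ?mul0e. Qed.

Let mRxy (P : R -> R) : mfT P ->
 mR (fun z => if `[< strip h z >] then P (Re (uval z)) * Y (Im (uval z)) else 0).
Proof.
move=> mP; apply: mR_if; first exact: hm_strip.
apply: mRM; last exact: mR_Im.
rewrite /mR (_ : rl _ = (fun p => P p.1) \_ UH).
 apply/(measurable_restrictT _ measurable_UH); apply: measurable_funTS.
 by apply: mcomp => //; exact: measurable_fst.
ext => p; rewrite /patch; case: ifPn => [/set_mem/UHE[z _ ->]|]; first by rewrite rl_co.
by rewrite notin_setE => np; rewrite rl_out.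
Qed.

Let nonneg_xy (P : R -> R) : mfT P -> (forall x, 0 <= P x) ->
 (\int[mu]_(x in `[0%R, h[) (P x)%:E = h%:E)%E ->
 let u := fun z => if `[< strip h z >] then P (Re (uval z)) * Y (Im (uval z)) else 0 in
 integ u /\ RJ u = h * A.
Proof.
move=> mP P0 Ph u; have JE : JH (fun z => (u z)%:E) = (h * A)%:E.
 by rewrite /u strip_if (JH_strip_xy mP mY P0 Y0) Ph YA.
split; last by rewrite /RJ JE.
apply/integE; first exact: mRxy.
have -> : (fun z => `|u z|%:E) = (fun z => (u z)%:E).
 by ext => z; rewrite ger0_norm // /u; case: ifP => // _; rewrite mulr_ge0.
by rewrite JE ltry.
Qed.

Lemma harmonic_mass : let u := fun z => if `[< strip h z >] then 1 * Y (Im (uval z)) else 0 in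
 integ u /\ RJ u = h * A.
Proof. by apply: (@nonneg_xy (fun=> 1)) => //; exact: itv_mass. Qed.
Lemma harmonic_cos (j : int) (t : R) : j != 0 ->
 RJ (fun z => if `[< strip h z >] then cos (2 * pi * j%:~R / h * Re (uval z) + t) * Y (Im (uval z)) else 0) = 0.
Proof.
move=> j0; pose P x := 1 + cos (2 * pi * j%:~R / h * x + t).
have mP : mfT P by apply: continuous_measurable_fun; exact: cos_cont.
have P0 x : 0 <= P x by rewrite /P -lerBlDl sub0r; exact: cos_geN1.
have [i1 e1] := nonneg_xy mP P0 (cos_mass t j0); have [i2 e2] := harmonic_mass.
have [_ e3] := RJ_lin (-1) i1 i2; rewrite e1 e2 mulN1r subrr in e3; rewrite -[RHS]e3; congr RJ.
by ext => z; rewrite /P; case: ifP => _; ring.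
Qed.

(** The real and imaginary parts are both cosines, the latter with phase -pi / 2, so [harmonic_cos]
    handles both when j is nonzero. *)
Lemma harmonic (j : int) (phi : uhp R -> C) :
 (forall z, phi z = toC (Y (Im (uval z))) * cexp (0 +i* (2 * pi * j%:~R / h * Re (uval z)) : C)%C) ->
 mC phi ->
 [/\ CI (on_strip h phi), RJ (fun z => cabs (on_strip h phi z)) = h * A &
   CJ (on_strip h phi) = if j == 0 then toC (h * A) else 0].
Proof.
move=> phiE mp; have [i2 e2] := harmonic_mass.
have cE : (fun z => cabs (on_strip h phi z)) = (fun z => if `[< strip h z >] then 1 * Y (Im (uval z)) else 0).
 ext => z; rewrite /on_strip; case: ifP => _; last by rewrite cabs0.
 by rewrite phiE cabsM cabs_toC ger0_norm // cabs_cexp /= expR0 mulr1 mul1r.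
have mS : hm (ind (strip h)) by exact: hm_strip.
have ci : CI (on_strip h phi).
 split; first exact: mC_if.
 have -> : (fun z => (cabs (on_strip h phi z))%:E) =
   (fun z => (if `[< strip h z >] then 1 * Y (Im (uval z)) else 0)%:E).
  by ext => z; have := congr1 (@^~ z) cE => /= ->.
 by rewrite JH_RJ // ltry.
split=> //; first by rewrite cE.
rewrite /CJ.
have -> : (fun z => Re (on_strip h phi z)) =
  (fun z => if `[< strip h z >] then cos (2 * pi * j%:~R / h * Re (uval z) + 0) * Y (Im (uval z)) else 0).
 ext => z; rewrite /on_strip; case: ifP => // _; rewrite phiE cexp_i ReM /= mul0r subr0 addr0.
 exact: mulrC.
have -> : (fun z => Im (on_strip h phi z)) =
  (fun z => if `[< strip h z >] then cos (2 * pi * j%:~R / h * Re (uval z) + - (pi / 2)) * Y (Im (uval z)) else 0).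
 ext => z; rewrite /on_strip; case: ifP => // _; rewrite phiE cexp_i ImM /= mul0r addr0.
 by rewrite cosBpihalf mulrC.
case: ifPn => [/eqP ->|j0]; last by rewrite !harmonic_cos.
rewrite mulr0 mul0r; apply: cx_eq => /=.
 rewrite -e2; congr RJ; ext => z; case: ifP => // _.
 by rewrite mul0r addr0 cos0.
rewrite /RJ (_ : (fun z => _) = (fun=> 0%:E)) ?JH0 //; ext => z; case: ifP => // _.
by rewrite mul0r add0r cosN cos_pihalf mul0r.
Qed.
End Harmonics.
End StripMellin.

(** * The unfolded inner product, its derivative in s, and the L-series *)

Section EllFunction.
Context {R : realType}.
Local Notation C := (Cx R).
Implicit Types (phi psi : uhp R -> C) (z w : uhp R) (g t : metap R).
Local Notation ht z := (Im (uval z)).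
Variables (G : set (metap R)) (chi : metap R -> C) (m h : R) (M : nat) (f : uhp R -> C).
Hypotheses (mM : 2 * m = M%:R) (m2 : 2 < m) (sG : is_subgroup G) (dG : discrete_set G).
Hypotheses (cG : finite_covolume G) (iG : is_cusp G None) (chG : is_character G chi) (oG : finite_order G chi).
Hypothesis stab_chi : stab_char G chi m.
Hypotheses (h0 : 0 < h) (HS : cusp_width G h).
Hypothesis cf : cusp_form G chi m f.
Local Notation a := (m / 2).
Local Notation D := (stab_cosets G).

Lemma cusp_form_stab t z : stab_oo G t -> f (act t z) = f z.
Proof.
move=> st; have Gt : G t by case: st.
have [_ inv _] := cf; have := inv t Gt z; rewrite /slash stab_chi // mulrC.
by apply: mulfI; exact: chG.1.
Qed.

(** The bound on coefficients is Hecke's: at height 1 / n the function is O(n^(m/2)) and |[fexp n]|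
    is the constant exp (-2 pi / h). *)
Lemma cusp_form_fourier : fourier_expansion h f (fcoef h f) /\ exists B : R, 0 <= B /\
 forall n : int, 0 < n -> cabs (fcoef h f n) <= B * n%:~R `^ (m / 2).
Proof.
have [hf inv cusps] := cf.
have [b [c [b0 hc c0]]] := cusps None 1%g iG (to_cuspE None).
have f1 : slash m f 1%g = f by ext => z; rewrite (slash1 mM).
rewrite f1 in hc.
have [t st ht] := stab_all HS 1.
have per (z : C) : 0 < Im z -> uext f (z + toC h) = uext f z.
 move=> z0; have := cusp_form_stab (UHP z0) st; rewrite -[in X in X = _](uextE f) ht /= mul1r.
 by rewrite -(uextE f).
have hg (z : C) : 0 < Im z -> hcs (fun n => c n * fexp b n z) (uext f z).
 by move=> z0; have /has_csumE := hc (UHP z0); rewrite -(uextE f).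
have N := eser_nice b0 c0 hg per.
have [d hd] := fourier_theorem h0 N.
have ex : fourier_expansion h f d.
 move=> z; apply/has_csumE; have := hd _ (uval_gt0 z).
 by rewrite (eser0 b0 c0 hg (uval_gt0 z)) uextE.
(* [fcoef] is an arbitrary choice among expansions; the difference of two expansions represents 0,
   and [fourier_coef_le] with bound 0 shows that the choice is unique. *)
have dE : fcoef h f = d.
 have fx : fourier_expansion h f (fcoef h f) by rewrite /fcoef; case: xgetP => [c' _ //|/(_ d)].
 ext => n; apply/eqP; rewrite -subr_eq0.
 have z0 : 0 < Im (0 +i* 1 : C)%C by exact: ltr01.
 have hd0 (z : C) : 0 < Im z -> hcs (fun n => (fcoef h f n - d n) * fexp h n z) 0.
  move=> zp; have /has_csumE e1 := fx (UHP zp); have /has_csumE e2 := ex (UHP zp).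
  have := hcs_lin (-1) e1 e2; rewrite mulN1r subrr; congr hcs; ext => k.
  by rewrite mulN1r -mulrBl.
 have := fourier_coef_le h0 n z0 hd0 (B := 0); rewrite cabs0 => /(_ (fun _ _ => lexx _)).
 rewrite cabsM pmulr_lle0 ?cabs_gt0 ?fexp_neq0 // => dn.
 by rewrite -cabs_eq0 eq_le dn cabs_ge0.
rewrite dE; split=> //.
have [B hB] := cusp_form_bounded mM sG dG cG iG oG cf.
exists (`|B| * expR (2 * pi / h)); split; first by rewrite mulr_ge0 // expR_ge0.
move=> n n0; have nr : 0 < n%:~R :> R by rewrite ltr0z.
have y0 : 0 < Im (0 +i* n%:~R^-1 : C)%C by rewrite /= invr_gt0.
have bd (w : C) : Im w = Im (0 +i* n%:~R^-1 : C)%C ->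
  cabs (eser b c 0 w) <= `|B| * n%:~R `^ (m / 2).
 move=> wy; have w0 : 0 < Im w by rewrite wy.
 rewrite (eser0 b0 c0 hg w0) -ler_pdivrMr ?powR_gt0 //.
 have := hB (UHP w0); rewrite -(uextE f) /= wy /= => hw.
 have -> : (n%:~R `^ (m / 2))^-1 = (n%:~R^-1) `^ (m / 2) :> R.
  by rewrite -(powR_inv1 (ltW nr)) -powRrM mulN1r powRN.
 exact: le_trans hw (ler_norm _).
have := fourier_coef_le h0 n y0 hd bd; rewrite cabsM cabs_fexp /=.
have -> : 2 * pi * n%:~R / h * n%:~R^-1 = 2 * pi / h :> R by field; rewrite !gt_eqF.
by rewrite expRN ler_pdivrMr ?expR_gt0 // mulrAC.
Qed.

Lemma conjM (x y : C) : (x * y)^* = x^* * y^*. Proof. exact: rmorphM. Qed.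
Lemma conjB (x y : C) : (x - y)^* = x^* - y^*. Proof. exact: rmorphB. Qed.
Lemma conjN (x : C) : (- x)^* = - x^*. Proof. exact: rmorphN. Qed.

(** The integrand of the unfolded inner product, with p counting derivatives of [Dser] in its
    exponent. *)
Definition pterm (p : nat) (v : C) (z : uhp R) : C :=
 f z * (Dser h p v (uval z))^* * toC (ht z `^ m).

Let a0 : 0 < a. Proof. by move: m2; lra. Qed.

Lemma weight_split z : ht z `^ m = ht z `^ a * ht z `^ a.
Proof.
have -> : ht z `^ m = ht z `^ (a + a) by congr powR; lra.
by rewrite powRD // (gt_eqF (uval_gt0 z)) implybT.
Qed.

Lemma f_bounded : exists2 B : R, 0 <= B & forall z, cabs (f z) * ht z `^ a <= B.
Proof.
have [B hB] := cusp_form_bounded mM sG dG cG iG oG cf; exists `|B|; first exact: normr_ge0.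
by move=> z; exact: le_trans (hB z) (ler_norm _).
Qed.

(** The weight y^m is shared equally: y^(m/2) makes f bounded, and y^(m/2) puts the other factor
    under [Phi]. *)
Lemma pterm_weight (c : C) z (B K : R) : cabs (f z) * ht z `^ a <= B -> ht z `^ a * cabs c <= K ->
 cabs (f z * c^* * toC (ht z `^ m)) <= B * K.
Proof.
move=> hB hK; rewrite !cabsM cabs_conj cabs_toC ger0_norm // weight_split.
rewrite [leLHS](_ : _ = (cabs (f z) * ht z `^ a) * (ht z `^ a * cabs c)); last by ring.
by apply: ler_pM; rewrite ?mulr_ge0 ?cabs_ge0 ?powR_ge0.
Qed.

Lemma mC_weight (c : C -> C) : (forall z : C, 0 < Im z -> exists l, cder c z l) ->
 mC (fun z => f z * (c (uval z))^* * toC (ht z `^ m)).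
Proof.
move=> dc; have [hf _ _] := cf.
apply: mCM; last by apply: mC_real; apply: (mR_Im (g := fun y => y `^ m)); exact: measurable_powR.
by apply: mCM; [exact: mC_holo|apply: mC_conj; exact: mC_cder].
Qed.

Lemma mC_pterm p v : mC (pterm p v).
Proof.
by apply: mC_weight => z z0; exists ((0 +i* qc h)%C * Dser h p (v + 1) z); exact: cder_Dser_z.
Qed.

Lemma pterm_le p (W d tau : R) : 0 <= W -> 0 < d -> 1 <= tau -> exists2 K : R, 0 <= K &
 forall v z, cabs v <= W -> Re v + d <= tau - 1 -> cabs (pterm p v z) <= K * Phi h a tau (uval z).
Proof.
move=> W0 d0 t1; have [B B0 hB] := f_bounded; have [K K0 hK] := Dser_Phi h0 p 0 W0 d0 a0 t1.
exists (B * K); first exact: mulr_ge0.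
move=> v z vW vd; rewrite -mulrA; apply: pterm_weight => //.
by have := hK v (uval z) vW vd (uval_gt0 z); rewrite expr0 mulr1 addr0.
Qed.

Section Majorant.
Variables (tau : R).
Hypotheses (t1 : 1 <= tau) (ta : tau < a).
Definition strip_mass : R := fine (JH (fun z => ind (strip h) z * (Phi h a tau (uval z))%:E)%E).

Lemma mR_Phi : mR (fun z => Phi h a tau (uval z)).
Proof. by apply/mRE; exact: hm_Phi. Qed.
Lemma strip_massE : JH (fun z => ind (strip h) z * (Phi h a tau (uval z))%:E)%E = strip_mass%:E.
Proof.
rewrite /strip_mass fineK // ge0_fin_numE; first exact: strip_Phi.
by apply: JH_ge0 => z; rewrite mule_ge0 ?ind_ge0 // lee_fin Phi_ge0.
Qed.

Lemma strip_mass_ge0 : 0 <= strip_mass.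
Proof. by apply: fine_ge0; apply: JH_ge0 => z; rewrite mule_ge0 ?ind_ge0 // lee_fin Phi_ge0. Qed.
Lemma CJ_strip_le phi K : 0 <= K -> mC phi -> (forall z, cabs (phi z) <= K * Phi h a tau (uval z)) ->
 CI (on_strip h phi) /\ cabs (CJ (on_strip h phi)) <= 2 * (K * strip_mass).
Proof.
move=> K0 mp pK; have mS : hm (ind (strip h)) by exact: hm_strip.
pose b z := if `[< strip h z >] then K * Phi h a tau (uval z) else 0.
have mb : mR b by apply: mR_if => //; apply: mRZ; exact: mR_Phi.
have pb z : cabs (on_strip h phi z) <= b z.
 by rewrite /on_strip /b; case: ifP => _; [exact: pK|rewrite cabs0].
have JB : JH (fun z => (b z)%:E) = (K * strip_mass)%:E.
 rewrite EFinM -strip_massE -JHZ //.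
 - by congr JH; ext => z; rewrite /b /ind; case: asboolP => _; rewrite ?mul1e ?mul0e ?mule0 // EFinM.
 - by apply: hmM => //; exact: hm_Phi.
 - by move=> z; rewrite mule_ge0 ?ind_ge0 // lee_fin Phi_ge0.
have mo : mC (on_strip h phi) by exact: mC_if.
have ci : CI (on_strip h phi) by apply: (CI_le mo mb pb); rewrite JB ltry.
split=> //; apply: le_trans (CJ_le ci) _; rewrite ler_wpM2l // -[leRHS]/(fine (_%:E)) -JB.
apply: RJ_le => //; [exact: mC_cabs|move=> z|by rewrite JB ltry].
by rewrite cabs_ge0 pb.
Qed.
End Majorant.

Lemma dual_ReE (s : C) : Re (toC m - s^*) = m - Re s.
Proof. by rewrite ReD ReN Re_conj. Qed.
Lemma re_one : Re (1 : C) = 1. Proof. by []. Qed.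

Lemma cder_strip_integral (s : C) : a < Re s ->
 cder (fun s : C => CJ (on_strip h (pterm 0 (toC m - s^* - 1)))) s
  (- CJ (on_strip h (pterm 1 (toC m - s^* - 1)))).
Proof.
move=> sa; have s'a : Re (toC m - s^*) < a by rewrite dual_ReE; lra.
have [d0 sd t1 ta] := ptauP m2 s'a; set d := pdelta _ _ in d0 sd; set tau := ptau _ _ in sd t1 ta.
set v := toC m - s^* - 1.
have vd : Re v + d <= tau - 1 by rewrite /v ReD ReN re_one; move: (Re _) sd => x; lra.
(* Half of the margin d is left to the increment of s, so that all exponents on the segment admit
   the same tau. *)
have d20 : 0 < d / 2 by rewrite divr_gt0.
have W0 : 0 <= cabs v + d by rewrite addr_ge0 // ltW.
have [B B0 hB] := f_bounded; have [K K0 hK] := Dser_Phi h0 2 0 W0 d20 a0 t1.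
have [K1 K10 hK1] := pterm_le 1 W0 d20 t1; have [K2 K20 hK2] := pterm_le 0 W0 d20 t1.
pose I := strip_mass tau; have I0 : 0 <= I := strip_mass_ge0 tau.
move=> eps e0; pose T := 2 * (B * K * I) + 1.
have T0 : 0 < T by rewrite ltr_wpDl // !mulr_ge0.
exists (Num.min (d / 2) (eps / T)); first by rewrite lt_min d20 divr_gt0.
move=> u; rewrite lt_min => /andP[ud ue].
(* The increment of the exponent when s increases by u; conjugation inside the integral turns its
   factor into -u. *)
pose u' : C := - u^*; have cu : cabs u' = cabs u by rewrite cabsN cabs_conj.
have E1 : toC m - (s + u)^* - 1 = v + u' by rewrite rmorphD /v /u'; ring.
have vt (t : R) : 0 <= t <= 1 -> cabs (v + toC t * u') <= cabs v + d /\
  Re (v + toC t * u') + d / 2 <= tau - 1.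
 move=> /andP[t0 t1']; have tu : cabs (toC t * u') <= d / 2.
  rewrite cabsM cabs_toC ger0_norm // cu; apply: le_trans (_ : 1 * cabs u <= _).
   by rewrite ler_wpM2r.
  by rewrite mul1r ltW.
 split; first by apply: le_trans (cabsD _ _) _; move: d0; lra.
 rewrite ReD; have := Re_le_cabs (toC t * u'); rewrite ler_norml => /andP[_].
 by move: (Re (toC t * u')) (cabs _) tu => x y; move: (Re v) vd => r; lra.
pose phi z := pterm 0 (v + u') z + -1 * pterm 0 v z + u * pterm 1 v z.
have mp : mC phi.
 by rewrite /phi; apply: mCD; [apply: mCD|]; rewrite ?mulN1r; try apply: mCZ; exact: mC_pterm.
have pE z : phi z = f z * (Dser h 0 (v + u') (uval z) - Dser h 0 v (uval z) - u' * Dser h 1 v (uval z))^* * toC (ht z `^ m).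
 have key (x y t : C) : (x - y - u' * t)^* = x^* - y^* + u * t^*.
  by rewrite !conjB conjM /u' conjN conjCK mulNr opprK.
 by rewrite /phi /pterm key; ring.
have pB z : cabs (phi z) <= (B * K * cabs u ^+ 2) * Phi h a tau (uval z).
 rewrite pE (_ : _ * _ * Phi _ _ _ _ = B * (K * Phi h a tau (uval z) * cabs u ^+ 2)); last by ring.
 apply: pterm_weight => //; have y0 : 0 < ht z `^ a by rewrite powR_gt0.
 rewrite mulrC -ler_pdivlMr // mulrAC -cu.
 apply: (Dser_taylor h0 (uval_gt0 z)) => t tt; have [c1 c2] := vt t tt.
 rewrite ler_pdivlMr // mulrC; have := hK _ (uval z) c1 c2 (uval_gt0 z).
 by rewrite expr0 mulr1 addr0.
have v1 : [/\ CI (on_strip h (pterm 0 (v + u'))), CI (on_strip h (pterm 0 v)) & CI (on_strip h (pterm 1 v))].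
 have CIp p k v0 : 0 <= k -> (forall v z, cabs v <= cabs (toC m - s^* - 1) + d -> Re v + d / 2 <= tau - 1 ->
   cabs (pterm p v z) <= k * Phi h a tau (uval z)) -> cabs v0 <= cabs v + d ->
   Re v0 + d / 2 <= tau - 1 -> CI (on_strip h (pterm p v0)).
  move=> k0 hk v0W v0d; have [//] := CJ_strip_le t1 ta k0 (mC_pterm p v0) (fun z => hk v0 z v0W v0d).
 have [q1 q2] := vt 1 (introT andP (conj ler01 (lexx 1))).
 have [r1 r2] := vt 0 (introT andP (conj (lexx 0) ler01)).
 rewrite rmorph1 mul1r in q1 q2; rewrite rmorph0 mul0r addr0 in r1 r2.
 by split; [exact: CIp K20 hK2 q1 q2|exact: CIp K20 hK2 r1 r2|exact: CIp K10 hK1 r1 r2].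
have [c1 c2 c3] := v1.
have BK : 0 <= B * K * cabs u ^+ 2 by rewrite mulr_ge0 ?exprn_ge0 // mulr_ge0.
have [_ le1] := CJ_strip_le t1 ta BK mp pB.
have [k1 f1] := CJ_lin (-1) c1 c2; have [k2 f2] := CJ_lin u k1 c3.
have fE : on_strip h phi = (fun z => on_strip h (pterm 0 (v + u')) z + -1 * on_strip h (pterm 0 v) z + u * on_strip h (pterm 1 v) z).
 by ext => z; rewrite /on_strip /phi; case: ifP => // _; rewrite !mulr0 !addr0.
move: le1; rewrite fE f2 f1 E1 mulN1r mulNr opprK (mulrC _ u) => le1.
apply: le_trans le1 _; rewrite (_ : 2 * _ = (2 * (B * K * I)) * cabs u * cabs u); last by rewrite /I; ring.
rewrite ler_wpM2r //; apply: le_trans (_ : T * cabs u <= _).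
 by rewrite ler_wpM2r // /T lerDl.
by rewrite mulrC -ler_pdivlMr // ltW.
Qed.

Lemma pterm_stab v t z : stab_oo G t -> pterm 0 v (act t z) = pterm 0 v z.
Proof.
move=> st; have [k hk] := stab_shift HS st.
have DE : Dser h 0 v (uval (act t z)) = Dser h 0 v (uval z).
 have := Fser_shift h0 (v + 1) (hk z).
 by rewrite (Fser_Dser h0 _ z) (Fser_Dser h0 _ (act t z)) addrK.
have IE : ht (act t z) = ht z by rewrite hk ImD /= addr0.
by rewrite /pterm (cusp_form_stab z st) DE IE.
Qed.

(** In each term f is replaced by its transform under g: chi g cancels its own conjugate, and
    |eta^(-2m)|^2 (Im z)^m = (Im (g z))^m, so the term is the strip integrand at g z. *)
Lemma petersson_hcs (s : C) z : Re s < a ->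
 hcs ((fun c => pterm 0 (s - 1) (act (rep c) z)) \_ D) (petersson_fun m f (Psi G m chi h s) z).
Proof.
move=> sa; have := Psi_hcs mM m2 sG dG cG oG h0 HS sa z.
move=> /hcs_conj/(hcsZ (f z * toC (ht z `^ m))).
rewrite /petersson_fun (_ : f z * _^* * _ = f z * toC (ht z `^ m) * (Psi G m chi h s z)^*); last by rewrite mulrAC.
congr hcs; ext => c; rewrite /patch; case: ifPn => [|_]; last by rewrite rmorph0 mulr0.
move=> /set_mem Dc; have [Gg _] := repP sG Dc; set g := rep c in Gg *.
have [_ inv _] := cf; have := inv g Gg z; rewrite /slash => e.
rewrite /Psi_term /slash /pterm (Fser_Dser h0) !conjM conjCK.
have E2 : eta_pow m g z * (eta_pow m g z)^* * toC (ht z `^ m) = toC (ht (act g z) `^ m).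
 rewrite -normCK -toC_cabs !weight_split -(cabs_eta_pow mM g z).
 by rewrite -rmorphXn -rmorphM; congr toC; ring.
rewrite -E2; set A := Dser _ _ _ _; move: e; set X := f (act g z); set Y := f z; set et := eta_pow m g z.
move=> e; transitivity ((chi g * Y) * A^* * et^* * toC (ht z `^ m)); first by ring.
by rewrite -e; ring.
Qed.

Lemma petersson_unfold (s : C) (F : set (uhp R)) : Re s < a -> fundamental_domain G F ->
 hyp_integrable F (petersson_fun m f (Psi G m chi h s)) /\
 hyp_integral F (petersson_fun m f (Psi G m chi h s)) = CJ (on_strip h (pterm 0 (s - 1))).
Proof.
move=> sa fF; have [d0 sd t1 ta] := ptauP m2 sa; set d := pdelta _ _ in d0 sd.
have [K K0 hK] := pterm_le 0 (cabs_ge0 (s - 1)) d0 t1.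
pose b z := K * Phi h a (ptau m s) (uval z).
have vd : Re (s - 1) + d <= ptau m s - 1 by rewrite ReD ReN re_one; move: (Re s) sd => x; lra.
have E0 z : Eser G (fun z => (b z)%:E) z = (K%:E * pmaj G m h s z)%E.
 rewrite /pmaj /EPhi /Eser (esum_mulr (stab_cosets_countable sG dG)); last 2 first.
 - by move=> c; exact: ePhi_ge0.
 - by rewrite lee_fin.
 by apply: eq_esum => c _; rewrite /b EFinM.
apply: (unfold_complex sG dG h0 HS fF (b := b)).
- by apply: mRZ; exact: mR_Phi.
- move=> t w st; have [k hk] := stab_shift HS st; rewrite /b hk Phi_period //.
- have mS : hm (ind (strip h)) by exact: hm_strip.
 apply: le_lt_trans (_ : (K%:E * (strip_mass (ptau m s))%:E < +oo)%E); last by rewrite -EFinM ltry.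
 rewrite -strip_massE // -JHZ //.
 + by under [X in (JH X <= _)%E]funext => z do rewrite /b EFinM muleCA.
 + by apply: hmM => //; exact: hm_Phi.
 + by move=> z; rewrite mule_ge0 ?ind_ge0 // lee_fin Phi_ge0.
- move=> z; rewrite E0; apply: lte_mul_pinfty; rewrite ?lee_fin //.
 exact: pmaj_fin.
- exact: mC_pterm.
- by move=> z; apply: hK.
- by move=> t w st; exact: pterm_stab.
- by move=> z; exact: petersson_hcs.
Qed.

Lemma hcs_single I (i0 : I) (X : C) : hcs (fun i => if i == i0 then X else 0) X.
Proof.
move=> e e0; exists [fset i0]%fset => B; rewrite fsub1set => iB.
rewrite (big_fsetD1 i0 iB) /= eqxx big_seq big1 ?addr0 ?subrr ?cabs0 // => i.
by rewrite in_fsetD1 => /andP[/negbTE ->].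
Qed.

Lemma CIZ (c : C) phi : CI phi -> [/\ CI (fun z => c * phi z), CJ (fun z => c * phi z) = c * CJ phi &
 RJ (fun z => cabs (c * phi z)) = cabs c * RJ (fun z => cabs (phi z))].
Proof.
move=> hp; have [c1 c2] := CJ_lin c (@CI0 R) hp.
have e : (fun z => 0 + c * phi z) = (fun z => c * phi z) by ext => z; rewrite add0r.
rewrite e CJ0 add0r in c1 c2; split=> //.
have [mp fin] := hp; have i1 : integ (fun z => cabs (phi z)).
 apply/integE; first exact: mC_cabs.
 by under [X in JH X]funext => z do rewrite ger0_norm //.
have [i0 _] := CI_integ (@CI0 R); have [_] := RJ_lin (cabs c) i0 i1.
rewrite {1}/RJ; under [X in fine (JH X)]funext => z do rewrite add0r -cabsM.
by rewrite -/(RJ _) => ->; rewrite {1}/RJ JH0 add0r.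
Qed.

Hypothesis m4 : 4 < m.

Let a2 : 2 < a. Proof. by move: m4; lra. Qed.
Let fE := cusp_form_fourier.1.

Let fexpE (v : C) : 0 < Im v -> hcs (fun n => fcoef h f n * fexp h n v) (uext f v).
Proof. by move=> v0; have /has_csumE := @fE (UHP v0); rewrite -(uextE f). Qed.

(** On the line where y^a = X = (B + 1) / |coefficient|, f is at most B / X, which is smaller than
    the coefficient, while |[fexp n]| >= 1. *)
Lemma fcoef_nonpos (n : int) : n <= 0 -> fcoef h f n = 0.
Proof.
move=> n0; have [B B0 hB] := f_bounded.
apply/eqP; rewrite -cabs_eq0; apply/negPn/negP => cn.
have c0 : 0 < cabs (fcoef h f n) by rewrite lt_neqAle eq_sym cn cabs_ge0.
pose X := (B + 1) / cabs (fcoef h f n).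
have X0 : 0 < X by rewrite divr_gt0 // ltr_wpDl.
pose y := X `^ a^-1; have y0 : 0 < y by rewrite powR_gt0.
have ya : y `^ a = X by rewrite /y -powRrM mulVf ?powRr1 ?(ltW X0) // gt_eqF //; move: a2; lra.
have bd (w : C) : Im w = Im (0 +i* y : C)%C -> cabs (uext f w) <= B / X.
 move=> /= wy; have w0 : 0 < Im w by rewrite wy.
 rewrite ler_pdivlMr // -ya -wy -[w]/(uval (UHP w0)) uextE; exact: hB.
have := fourier_coef_le h0 n (y0 : 0 < Im (0 +i* y : C)%C) fexpE bd.
rewrite cabsM cabs_fexp /= => le1.
have l2 : 1 <= expR (- (2 * pi * n%:~R / h * y)).
 apply: le_trans (_ : expR 0 <= _); first by rewrite expR0.
 rewrite ler_expR oppr_ge0 mulr_le0_ge0 ?(ltW y0) // mulr_le0_ge0 ?invr_ge0 ?(ltW h0) //.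
 by rewrite mulr_ge0_le0 ?lerz0 // mulr_ge0 // pi_ge0.
have : cabs (fcoef h f n) <= B / X by apply: le_trans le1; rewrite ler_peMr ?cabs_ge0.
rewrite ler_pdivlMr // /X mulrC divfK //; lra.
Qed.

Definition fqterm k z : C := f z * (qx h (uval z) ^+ k.+1)^* * toC (ht z `^ m).

Let qxk k (v : C) : exists l, cder (fun v => qx h v ^+ k.+1) v l.
Proof. by eexists; exact: cder_qxX. Qed.

Let kq0 k : 0 < qc h * k.+1%:R. Proof. by rewrite mulr_gt0 ?qc_gt0. Qed.

(** The bound |f| <= B y^(-m/2) leaves y^(m/2) exp (-qc (k + 1) y), whose strip integral is a gamma
    integral of order m / 2 - 1. *)
Lemma fqterm_CI : exists2 K : R, 0 <= K & forall k, CI (on_strip h (fqterm k)) /\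
 RJ (fun z => cabs (on_strip h (fqterm k) z)) <= K * k.+1%:R `^ (1 - a).
Proof.
have [B B0 hB] := f_bounded.
have a1 : 1 < a by move: a2; lra.
have a10 : 0 < a - 1 by rewrite subr_gt0.
have [_ g0] := gamma_Gm a10.
exists (B * (h * (qc h `^ (1 - a) * gamma_fun (a - 1)))).
 by rewrite !mulr_ge0 ?(ltW h0) ?(ltW g0).
move=> k; have [i1 e1] := harmonic_mass h0 a1 (kq0 k).
pose b0 z := if `[< strip h z >] then 1 * (ht z `^ a * expR (- (qc h * k.+1%:R * ht z))) else 0.
have mS : hm (ind (strip h)) by exact: hm_strip.
have mb : mR b0.
 apply: mR_if => //; apply: mRZ; apply: (mR_Im (g := fun y => y `^ a * expR (- (qc h * k.+1%:R * y)))).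
 apply: measurable_funM; first exact: measurable_powR.
 by apply: mcomp => //; apply: mcomp.
have mb1 : mR (fun z => B * b0 z) by exact: mRZ.
have [i0 _] := CI_integ (@CI0 R); have [i2 e2] := RJ_lin B i0 i1.
have JB : JH (fun z => (B * b0 z)%:E) = (B * RJ b0)%:E.
 have E : (fun z => (B * b0 z)%:E) = (fun z => (0 + B * b0 z)%:E) by ext => z; rewrite add0r.
 rewrite E; rewrite (JH_RJ i2) e2; congr EFin.
 by rewrite {1}/RJ JH0 add0r.
have pb z : cabs (on_strip h (fqterm k) z) <= B * b0 z.
 rewrite /on_strip /b0; case: ifP => _; last by rewrite cabs0 mulr0.
 rewrite mul1r; apply: pterm_weight => //.
 by rewrite cabsX cabs_qx -expRM_natl -mulr_natl mulrN (mulrC k.+1%:R) mulrAC.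
have mp : mC (on_strip h (fqterm k)).
 apply: mC_if => //; apply: (mC_weight (c := fun v => qx h v ^+ k.+1)) => v _; exact: qxk.
have ci : CI (on_strip h (fqterm k)) by apply: (CI_le mp mb1 pb); rewrite JB ltry.
split=> //; apply: le_trans (_ : RJ (fun z => B * b0 z) <= _).
 apply: RJ_le => //; [exact: mC_cabs|move=> z|by rewrite JB ltry].
 by rewrite cabs_ge0 pb.
rewrite {1}/RJ JB /= e1 powRM ?(ltW (qc_gt0 h0)) // -!mulrA ler_wpM2l // ler_wpM2l ?(ltW h0) //.
by rewrite ler_wpM2l // mulrC.
Qed.

Let fqT k (n : int) z : C := fexp h n (uval z) * (qx h (uval z) ^+ k.+1)^* * toC (ht z `^ m).

Let mC_fqT k n : mC (fqT k n).
Proof.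
apply: mCM; last by apply: mC_real; apply: (mR_Im (g := fun y => y `^ m)); exact: measurable_powR.
apply: mCM; first by apply: mC_cder => v _; eexists; exact: cder_fexp.
by apply: mC_conj; apply: (mC_cder (g := fun v => qx h v ^+ k.+1)) => v _; exact: qxk.
Qed.

Let fqTE k (n : int) z : fqT k n z =
 toC (ht z `^ m * expR (- (qc h * (n%:~R + k.+1%:R) * ht z))) *
 cexp (0 +i* (2 * pi * (n - k.+1%:Z)%:~R / h * Re (uval z)) : C)%C.
Proof.
have yE (x y : R) : toC (x * expR y) = toC x * cexp (toC y) by rewrite (rmorphM (@toC R)) cexp_toC.
rewrite yE -mulrA -cexpD /fqT /fexp /qx -cexpMn conj_cexp -cexpD mulrC.
have nE : (n - k.+1%:Z)%:~R = n%:~R - k.+1%:R :> R by rewrite intrB -pmulrn.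
have wE (w : C) : w *+ k.+1 = w * toC k.+1%:R by rewrite rmorph_nat mulr_natr.
congr (_ * cexp _); rewrite wE nE.
move: (uval z) (n%:~R) (k.+1%:R) => v x y; rewrite /qc.
by apply: cx_eq; rewrite !(ReD, ImD, Re_conj, Im_conj, ReM, ImM) /=; ring.
Qed.

(** Expanding f and integrating termwise, orthogonality keeps only the frequency n = k + 1. The
    exchange is legitimate because the n-th norm is O(n^(m/2) (n + k + 1)^(1 - m)), at most a
    multiple of n^(1 - m/2), summable for m > 4. *)
Lemma CJ_fqterm k : CJ (on_strip h (fqterm k)) =
 fcoef h f k.+1%:Z * toC (h * ((qc h * (2 * k.+1%:R)) `^ (1 - m) * gamma_fun (m - 1))).
Proof.
have [K K0 hK] := fqterm_CI; have [ci _] := hK k.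
have m1 : 1 < m by move: m4; lra.
have g0 : 0 < gamma_fun (m - 1) by apply: (gamma_Gm _).2; rewrite subr_gt0.
have [_ [B [B0 hB]]] := cusp_form_fourier.
pose Ph (n : int) z := fcoef h f n * on_strip h (fqT k n) z.
have harm (n : int) : 0 < n -> [/\ CI (on_strip h (fqT k n)),
  RJ (fun z => cabs (on_strip h (fqT k n) z)) = h * ((qc h * (n%:~R + k.+1%:R)) `^ (1 - m) * gamma_fun (m - 1)) &
  CJ (on_strip h (fqT k n)) = if n - k.+1%:Z == 0 then toC (h * ((qc h * (n%:~R + k.+1%:R)) `^ (1 - m) * gamma_fun (m - 1))) else 0].
 move=> n0; have c0 : 0 < qc h * (n%:~R + k.+1%:R) by rewrite mulr_gt0 ?qc_gt0 // addr_gt0 ?ltr0z.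
 exact: (harmonic h0 m1 c0 (fqTE k n) (mC_fqT k n)).
have Ph0 n : n <= 0 -> Ph n = (fun=> 0).
 by move=> n0; ext => z; rewrite /Ph fcoef_nonpos // mul0r.
have PhCI n : CI (Ph n).
 have [n0|n0] := lerP n 0; first by rewrite Ph0 //; exact: CI0.
 by have [c1 _ _] := harm n n0; have [] := CIZ (fcoef h f n) c1.
have PhCJ n : CJ (Ph n) = if n == k.+1%:Z then
  fcoef h f k.+1%:Z * toC (h * ((qc h * (2 * k.+1%:R)) `^ (1 - m) * gamma_fun (m - 1))) else 0.
 have [n0|n0] := lerP n 0.
  by rewrite Ph0 // CJ0; case: eqP n0 => // ->.
 have [c1 _ c3] := harm n n0; have [_ -> _] := CIZ (fcoef h f n) c1.
 rewrite c3 subr_eq0; case: eqP => [->|_]; last by rewrite mulr0.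
 by rewrite -pmulrn mulr2n mulrDl mul1r.
have PhS : summ (fun n => RJ (fun z => cabs (Ph n z))).
 pose C0 := B * (h * (qc h `^ (1 - m) * gamma_fun (m - 1))).
 have C00 : 0 <= C0 by rewrite !mulr_ge0 ?(ltW h0) ?(ltW g0).
 pose p (n : nat) : R := C0 * n%:R `^ (- (a - 1)).
 have p0 n : 0 <= p n by rewrite mulr_ge0.
 have ps : summ p.
  apply: summZ => //.
  by apply: summ_powR; move: a2; lra.
 apply: (summ_le (q := fun n : int => p `|n|%N)); last exact: summ_int.
 move=> n.
 have [n0|n0] := lerP n 0.
  by rewrite Ph0 // (_ : (fun z => _) = (fun=> 0)) ?/RJ ?JH0 //; ext => z; rewrite cabs0.
 have nr : 0 < n%:~R :> R by rewrite ltr0z.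
 have [c1 c2 _] := harm n n0; have [_ _ ->] := CIZ (fcoef h f n) c1; rewrite c2 /p /C0.
 have -> : `|n|%N%:R = n%:~R :> R by rewrite -[in RHS](gtz0_abs n0) -pmulrn.
 have -> : n%:~R `^ (- (a - 1)) = n%:~R `^ a * n%:~R `^ (1 - m) :> R.
  by rewrite -powRD ?(gt_eqF nr) ?implybT //; congr powR; lra.
 rewrite [leRHS](_ : _ = B * n%:~R `^ a * (h * (qc h `^ (1 - m) * n%:~R `^ (1 - m) * gamma_fun (m - 1)))); last by ring.
 apply: ler_pM; rewrite ?mulr_ge0 ?(ltW h0) ?(ltW g0) ?hB //.
 rewrite ler_wpM2l ?(ltW h0) // ler_wpM2r ?(ltW g0) // -powRM ?(ltW nr) ?(ltW (qc_gt0 h0)) //.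
 have -> : 1 - m = - (m - 1) by ring.
 have l1 : qc h * n%:~R <= qc h * (n%:~R + k.+1%:R) by rewrite ler_wpM2l ?(ltW (qc_gt0 h0)) // lerDl.
 have q0 : 0 < qc h * n%:~R by rewrite mulr_gt0 ?qc_gt0.
 rewrite !powRN lef_pV2 ?posrE ?powR_gt0 //; last exact: lt_le_trans l1.
 by apply: ge0_ler_powR => //; rewrite ?nnegrE ?(ltW q0) ?subr_ge0 ?(ltW m1) // (le_trans (ltW q0)).
have hz z : hcs (Ph^~ z) (on_strip h (fqterm k) z).
 rewrite /Ph /on_strip; case: ifP => _; last first.
  have := @hcs0 R int; congr hcs; ext => n; by rewrite mulr0.
 have := hcsZ ((qx h (uval z) ^+ k.+1)^* * toC (ht z `^ m)) (fexpE (uval_gt0 z)).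
 rewrite uextE (_ : _ * f z = fqterm k z); last by rewrite /fqterm; ring.
 by congr hcs; ext => n; rewrite /fqT; ring.
have := CJ_swap PhCI ci PhS hz; under [X in hcs X]funext => n do rewrite PhCJ.
by move=> /hcs_unique; apply; exact: hcs_single.
Unshelve. all: exact: 0%N.
Qed.

(** The norms are O(k^(m - Re s - 1) k^(1 - m/2)) = O(k^(m/2 - Re s)), summable exactly in the
    half-plane of the hypothesis. *)
Lemma CJ_Lseries (s : C) : a + 1 < Re s ->
 hcs (fun k : nat => (symb (toC m - s^* - 1) 0 0 k.+1%:R)^* * CJ (on_strip h (fqterm k)))
  (CJ (on_strip h (pterm 0 (toC m - s^* - 1)))).
Proof.
move=> s1; set v := toC m - s^* - 1; have [K K0 hK] := fqterm_CI.
pose Ph k z := (symb v 0 0 k.+1%:R)^* * on_strip h (fqterm k) z.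
have cE k : cabs (symb v 0 0 k.+1%:R)^* = k.+1%:R `^ (m - Re s - 1).
 rewrite cabs_conj /symb /= ffactn0 subn0 expr0 mulr1 mul1r subr0 cabs_cexp_ln //.
 by congr powR; rewrite /v ReD ReN dual_ReE.
have PhI k := CIZ (symb v 0 0 k.+1%:R)^* (hK k).1.
have PhS : summ (fun k => RJ (fun z => cabs (Ph k z))).
 apply: (summ_le (q := fun k => K * k.+1%:R `^ (- (Re s - a)))) => [k|]; last first.
  apply: summZ => //.
  apply: (summ_inj (g := succn) (p := fun k => k%:R `^ (- (Re s - a)))) => [||].
  - exact: succn_inj.
  - by move=> k; exact: powR_ge0.
  - by apply: summ_powR; move: s1; lra.
 have [_ _ ->] := PhI k; rewrite cE.
 have -> : k.+1%:R `^ (- (Re s - a)) = k.+1%:R `^ (m - Re s - 1) * k.+1%:R `^ (1 - a) :> R.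
  by rewrite -powRD ?pnatr_eq0 ?implybT //; congr powR; lra.
 by rewrite mulrCA ler_wpM2l //; case: (hK k).
have s'a : Re (toC m - s^*) < a by rewrite dual_ReE; move: s1 m4; lra.
have [d0 sd t1 ta] := ptauP m2 s'a; set d := pdelta _ _ in d0 sd; set tau := ptau _ _ in sd t1 ta.
have vd : Re v + d <= tau - 1 by rewrite /v ReD ReN re_one; move: (Re _) sd => x; lra.
have [K2 K20 hK2] := pterm_le 0 (cabs_ge0 v) d0 t1.
have [ci _] := CJ_strip_le t1 ta K20 (mC_pterm 0 v) (fun z => hK2 v z (lexx _) vd).
have hz z : hcs (Ph^~ z) (on_strip h (pterm 0 v) z).
 rewrite /Ph /on_strip; case: ifP => _; last first.
  have := @hcs0 R nat; congr hcs; ext => n; by rewrite mulr0.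
 have := hcsZ (f z * toC (ht z `^ m)) (hcs_conj (hcs_Dser h0 0 v (uval_gt0 z))).
 rewrite mulrAC; congr hcs; ext => k.
 by rewrite conjM /fqterm mulrCA; congr (_ * _); rewrite mulrAC.
have := CJ_swap (fun k => let: And3 H _ _ := PhI k in H) ci PhS hz.
by congr hcs; ext => k; have [_ -> _] := PhI k.
Qed.

Lemma Lseries_strip (s : C) : a + 1 < Re s ->
 Lseries h f s = toC ((4 * pi) `^ (m - 1) / (h `^ m * gamma_fun (m - 1))) *
  CJ (on_strip h (pterm 0 (toC m - s^* - 1))).
Proof.
move=> s1; apply: csumE; set u := _ \_ _.
have u0 : u 0%N = 0 by rewrite /u /patch memNset.
set K := toC _; rewrite -[K * _]addr0 -[in X in _ + X]u0; apply: hcs_unshift.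
have := hcsZ K (CJ_Lseries s1); congr hcs; ext => k.
rewrite /u /patch mem_set // CJ_fqterm /npow.
have m1 : 0 < m - 1 by move: m4; lra.
have [_ g0] := gamma_Gm m1.
set x : R := k.+1%:R; have x0 : 0 < x by rewrite ltr0n.
(* The normalizing constant of [ell] cancels the gamma integral h (4 pi x / h)^(1 - m) Gamma (m - 1)
   up to x^(1 - m). Together with the conjugate of x^(m - conj s - 1) this leaves x^(-s). *)
have r1 : (4 * pi) `^ (m - 1) / (h `^ m * gamma_fun (m - 1)) *
  (h * ((qc h * (2 * x)) `^ (1 - m) * gamma_fun (m - 1))) = expR ((1 - m) * ln x).
 have p4 : 0 < 4 * pi :> R by rewrite mulr_gt0 // pi_gt0.
 have -> : qc h * (2 * x) = 4 * pi * (h^-1 * x) by rewrite /qc; field; rewrite gt_eqF.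
 have -> : 1 - m = - (m - 1) by ring.
 move: (4 * pi) p4 => P p4; have hi : 0 < h^-1 by rewrite invr_gt0.
 rewrite !powRM ?(ltW p4) ?(ltW hi) ?(ltW x0) ?mulr_ge0 ?(ltW hi) ?(ltW x0) //.
 have -> : h^-1 `^ (- (m - 1)) = h `^ (m - 1).
  by rewrite -(powR_inv1 (ltW h0)) -powRrM mulN1r opprK.
 have -> : h `^ m = h `^ (m - 1) * h by rewrite -{3}(powRr1 (ltW h0)) -powRD ?subrK ?(gt_eqF h0) ?implybT.
 have -> : expR (- (m - 1) * ln x) = x `^ (- (m - 1)) by rewrite /powR gt_eqF.
 rewrite (powRN P).
 have P1 : 0 < P `^ (m - 1) by rewrite powR_gt0.
 have P2 : 0 < h `^ (m - 1) by rewrite powR_gt0.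
 move: (P `^ (m - 1)) (h `^ (m - 1)) (x `^ _) (gamma_fun _) P1 P2 g0 => A1 A2 A3 A4 P1 P2 P3.
 by field; rewrite !gt_eqF.
have symE : symb (toC m - s^* - 1) 0 0 x = cexp ((toC m - s^* - 1) * toC (ln x)).
 by rewrite /symb /= ffactn0 subn0 expr0 mulr1 mul1r subr0.
rewrite symE conj_cexp; set c := fcoef _ _ _; set e := cexp _.
rewrite [LHS](_ : _ = c * (e * (K * toC (h * ((qc h * (2 * x)) `^ (1 - m) * gamma_fun (m - 1)))))); last by ring.
have KE : K * toC (h * ((qc h * (2 * x)) `^ (1 - m) * gamma_fun (m - 1))) = cexp (toC ((1 - m) * ln x)).
 by rewrite cexp_toC -r1; apply/esym; exact: (rmorphM (@toC R)).
rewrite KE /e -cexpD; congr (_ * cexp _).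
have c1 : (toC m - s^* - 1)^* = toC m - s - 1.
 by rewrite !conjB conjCK conjC_toC; congr (_ - _); exact: (rmorph1 (@Num.conj C)).
have c2 : toC ((1 - m) * ln x) = (1 - toC m) * toC (ln x) by rewrite (rmorphM (@toC R)) (rmorphB (@toC R)) (rmorph1 (@toC R)).
by rewrite conjM c1 conjC_toC c2; ring.
Qed.
End EllFunction.


Theorem theorem5p19 (R : realType) (m : R) (G : set (metap R))
  (chi : metap R -> Cx R) (h : R) (f : uhp R -> Cx R) :
  (exists k : nat, m = 5 / 2 + k%:R) ->
  is_subgroup G -> discrete_set G -> finite_covolume G ->
  is_cusp G None ->
  is_character G chi -> finite_order G chi ->
  (forall g, stab_oo G g -> forall z, eta_pow m g z = chi g) ->
  0 < h ->
  setmul metap_center (stab_oo G) = setmul metap_center (cyclic_gen (nx h)) ->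
  cusp_form G chi m f ->
  (forall s, ell_dom m s -> ell_well_defined G m chi h f s) /\
  forall F : set (uhp R), fundamental_domain G F ->
    holomorphic_on (ell_dom m) (ell G m chi h F f) /\
    (4 < m ->
     analytic_continuation [set s | m / 2 + 1 < complex.Re s]
       [set s | m / 2 < complex.Re s] (Lseries h f) (ell G m chi h F f)).
Proof.
move=> [k mk] sG dG cG iG chG oG stab_chi h0 HS cf.
have mM : 2 * m = (5 + 2 * k)%:R by rewrite mk natrD natrM; field.
have m2 : 2 < m by rewrite mk; have := ler0n R k; lra.
have dom s : ell_dom m s -> m / 2 < Re s.
 by rewrite /ell_dom /= => -[|/andP[]//]; lra.
have dual (s : Cx R) : m / 2 < Re s -> Re (toC m - s^*) < m / 2 by rewrite dual_ReE; lra.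
pose K : Cx R := toC ((4 * pi) `^ (m - 1) / (h `^ m * gamma_fun (m - 1))).
pose I (s : Cx R) := CJ (on_strip h (pterm m h f 0 (toC m - s^* - 1))).
have pu F s (fF : fundamental_domain G F) (sa : m / 2 < Re s) :=
 petersson_unfold mM m2 sG dG cG iG chG oG stab_chi h0 HS cf (dual s sa) fF.
(* The factor [eps] in [ell] cancels the one in the inner product. The right side does not mention
   F, which gives the independence of the fundamental domain. *)
have ellE F s : fundamental_domain G F -> m / 2 < Re s -> ell G m chi h F f s = K * I s.
 move=> fF sa; have [_ e] := pu F s fF sa.
 rewrite /ell /petersson /ell_form e -/(I s) mulrA; congr (_ * _).
 have e0 : (eps_card G)%:R != 0 :> Cx R by rewrite pnatr_eq0 -lt0n eps_gt0.
 rewrite /K -mulrA (rmorphM (@toC R)) (rmorph_nat (@toC R)) mulrC mulrA mulVf // mul1r.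
 by [].
split=> [s /dom sa|F fF].
 split.
 - by move=> z t g st Gg; exact: (Psi_term_stab mM chG oG stab_chi h0 HS).
 - by move=> z; exact: (Psi_summable mM m2 sG dG cG oG h0 HS (dual s sa)).
 - exact: (Psi_cusp_form mM m2 sG dG cG chG oG stab_chi h0 HS (dual s sa)).
 - by move=> F fF; case: (pu F s fF sa).
 - by move=> F F' fF fF'; rewrite !ellE.
(* The strip formula holds on a whole disc of radius Re s - m / 2 around s, so the derivative
   carries over to [ell]. *)
have holo s : m / 2 < Re s -> derivable (ell G m chi h F f) s 1.
 move=> sa; have := gderZ K (cder_strip_integral mM m2 sG dG cG iG oG h0 cf sa).
 move=> D; apply: cder_derivable; apply: (gder_near (d := Re s - m / 2) _ _ _ D).
 - by rewrite subr_gt0.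
 - move=> u us; rewrite ellE //; have := le_lt_trans (Re_le_cabs u) us.
  by rewrite ReD ltr_norml => /andP[]; lra.
 - by rewrite ellE.
split; first by move=> s /dom; exact: holo.
move=> m4; split.
- by move=> s /=; lra.
- by move=> s; exact: holo.
- move=> s /= s1; rewrite (Lseries_strip mM m2 sG dG cG iG chG oG stab_chi h0 HS cf m4 s1) ellE //.
 lra.
Qed.
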